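(* Let $U\subset J^1(\mathbb{R}^n)$ be compact, let $H\in C^{r+1}(U)$, and let $$\varepsilon_N:=\|H-H^{(N)}\|_{C^{r+1}(U)},\qquad H^{(N)}\in P^{(N)}(J^1(\mathbb{R}^n)).$$ Assume that the flows of $H$ and $H^{(N)}$ exist on $[0,T]$ and remain in a compact subset $U'\subset U$. Choose a representation $$H^{(N)}=s_0+d_0+\sum_{i\in I}[s_i,d_i],\qquad s_i\in\mathfrak{scont}(J^1(\mathbb{R}^n)),\ d_i\in\mathfrak{pdiff}(J^1(\mathbb{R}^n)),$$ with $I$ a finite index set. Assume moreover that, for all sufficiently small positive and negative times required by the composition coefficients, the exact subflows of each generator $s_i$ and $d_i$ are well-defined on a neighborhood of $U'$, and that all finite compositions of them used in constructing the map $\Psi^{(p)}_{N,h}$ below remain in a fixed compact subset of that neighborhood. Then, for any target order $p\in\mathbb{N}$, there exist a contact one-step map $\Psi^{(p)}_{N,h}$, given by a finite composition of exact flows of the strict and prolonged generators $s_i,d_i$, and a constant $C_{\mathrm{split}}(N,p,T,r)>0$ such that $$\big\|\Phi^{nh}_{H^{(N)}}-(\Psi^{(p)}_{N,h})^n\big\|_{C^r(U)}\le C_{\mathrm{split}}(N,p,T,r)\,h^p$$ for all sufficiently small $h>0$ and all $nh\le T$. Consequently, there exists a constant $C_{\mathrm{approx}}(H,U,T,r)>0$ such that $$\big\|\Phi^{nh}_{H}-(\Psi^{(p)}_{N,h})^n\big\|_{C^r(U)}\le C_{\mathrm{approx}}(H,U,T,r)\,\varepsilon_N+C_{\mathrm{split}}(N,p,T,r)\,h^p$$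 for all sufficiently small $h>0$ and all $nh\le T$. In particular, if the approximants $H^{(N)}$ are such that $\varepsilon_N\to0$ as $N\to\infty$, then given any $\varepsilon>0$ one may first choose $N$ so that $C_{\mathrm{approx}}\,\varepsilon_N<\varepsilon/2$ and then choose $h>0$ so that $C_{\mathrm{split}}\,h^p<\varepsilon/2$. Hence, for any $\varepsilon>0$ and any target order $p$, there exist $N<\infty$ and $h>0$ such that $$\big\|\Phi^{nh}_{H}-(\Psi^{(p)}_{N,h})^n\big\|_{C^r(U)}<\varepsilon$$ for all $nh\le T$.
   Context: In the claim, $p\in\mathbb{N}$ denotes the order of the method, not the momentum coordinate, and $n$ in $nh$ is a nonnegative integer step count. $J^1(\mathbb{R}^n)\cong\mathbb{R}^{2n+1}$ has global coordinates $(x^i,u,p_i)$ and contact form $\alpha=du-p_i\,dx^i$ (summation convention). A function $H$ generates the contact Hamiltonian vector field $$X_H=\frac{\partial H}{\partial p_i}\frac{\partial}{\partial x^i}-\Big(\frac{\partial H}{\partial x^i}+p_i\frac{\partial H}{\partial u}\Big)\frac{\partial}{\partial p_i}+\Big(p_i\frac{\partial H}{\partial p_i}-H\Big)\frac{\partial}{\partial u},$$ with flow $\Phi^t_H$. The contact-Jacobi bracket is $$[H,K]=\{H,K\}+\frac{\partial H}{\partial u}\Big(K-p_i\frac{\partial K}{\partial p_i}\Big)-\frac{\partial K}{\partial u}\Big(H-p_i\frac{\partial H}{\partial p_i}\Big),\qquad \{H,K\}=\sum_{i}\Big(\frac{\partial H}{\partial p_i}\frac{\partial K}{\partial x^i}-\frac{\partial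 H}{\partial x^i}\frac{\partial K}{\partial p_i}\Big).$$ $\mathfrak{scont}(J^1(\mathbb{R}^n))$ is the set of smooth $H$ with $\partial H/\partial u=0$ (strict contact Hamiltonians); $\mathfrak{pdiff}(J^1(\mathbb{R}^n))$ is the set of $H=f(x,u)+g^i(x,u)p_i$ with $f,g^i$ smooth (prolonged Hamiltonians); $P^{(N)}(J^1(\mathbb{R}^n))$ is the space of $H=\sum_{|\alpha|\le N}f_\alpha(x,u)p^\alpha$ with $f_\alpha$ smooth (polynomials in the momentum variables of degree at most $N$). Every element of $P^{(N)}(J^1(\mathbb{R}^n))$ admits a representation $s_0+d_0+\sum_{i\in I}[s_i,d_i]$ of the form used in the claim. A contact one-step map is a family, parametrized by the step size $h$, of (local) contactomorphisms, i.e. diffeomorphisms $\psi$ with $\psi^*\alpha=e^{\lambda}\alpha$ for a function $\lambda$. The norm is $\|F\|_{C^r(U)}=\max_{0\le k\le r}\sup_{z\in U}\|D^kF(z)\|$. The constant $C_{\mathrm{approx}}$ depends on the time horizon $T$, $r$, the confinement neighborhood and uniform Lipschitz and derivative bounds for the contact vector fields of $H$ and $H^{(N)}$; the constant $C_{\mathrm{split}}$ depends on $T$, $r$, the confinement neighborhood, the target order, and the chosen representation of $H^{(N)}$ (number and size of generators, uniform bounds on subflows and commutators). *)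

(* Defs.v *)
From Stdlib Require List.
From HB Require Import structures.
From mathcomp Require Import all_boot all_order all_algebra.
From mathcomp Require Import all_classical all_reals all_analysis.
Import Order.TTheory GRing.Theory Num.Theory.
Import numFieldNormedType.Exports.

Set Implicit Arguments.
Unset Strict Implicit.
Unset Printing Implicit Defensive.

Local Open Scope classical_set_scope.
Local Open Scope ring_scope.

Section Calculus.
Context {R : realType} {V W : normedModType R}.
Implicit Types (F : V -> W) (A : set V).

(* D^k F(z)(v_1, ..., v_k), for vs = [:: v_1; ...; v_k], as an iterated
   directional derivative; for F of class C^k near z this is the k-linear
   k-th derivative. *)
Definition iterD (vs : seq V) F : V -> W := foldr (fun v G => 'D_v G) F vs.

(* In finite dimension, continuity of z |-> D F(z) v for every v is continuity
   of D F, so this is the usual class C^k on an open set A. *)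
Fixpoint class_C (k : nat) A F : Prop :=
  if k is k'.+1 then
    (forall z, A z -> differentiable F z) /\ (forall v, class_C k' A ('D_v F))
  else forall z, A z -> {for z, continuous F}.

Definition smooth_on A F : Prop := forall k, class_C k A F.

Definition smooth F : Prop := smooth_on setT F.

(* F belongs to C^k(U) for a compact U: F is C^k on an open neighborhood. *)
Definition class_C_near (k : nat) (U : set V) F : Prop :=
  exists A, [/\ open A, U `<=` A & class_C k A F].

(* Operator norm of the k-linear map D^k F(z). *)
Definition Dnorm (k : nat) F (z : V) : R :=
  sup [set `|iterD vs F z| |
        vs in [set vs : k.-tuple V | forall i, `|tnth vs i| <= 1]].

(* The suprema are suprema of bounded sets when U is compact and
   [class_C_near r U F] holds; statements on the norm must assert or imply this. *)
Definition C_norm (r : nat) (U : set V) F : R :=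
  \big[Num.max/0]_(k < r.+1) sup [set Dnorm k F z | z in U].

End Calculus.

Section Flow.
Context {R : realType} {V : normedModType R}.
Implicit Types (X : V -> V) (z : V).

(* gamma is an integral curve of X starting at z, on the closed interval
   between 0 and t, where t may be negative. *)
Definition integral_curve X (t : R) z (gamma : R -> V) : Prop :=
  [/\ gamma 0 = z,
      {within `[Num.min 0 t, Num.max 0 t], continuous gamma} &
      forall s, s \in `]Num.min 0 t, Num.max 0 t[ ->
        is_derive s 1 gamma (X (gamma s))].

Definition flow_defined X (t : R) z : Prop := exists gamma, integral_curve X t z gamma.

(* Exact flow at time t; it has the dummy value z where it is undefined. *)
Definition flow X (t : R) z : V :=
  xget z [set gamma t | gamma in integral_curve X t z].

Definition flow_confined X (T : R) (U U' : set V) : Prop :=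
  forall z, U z -> exists gamma, integral_curve X T z gamma /\
    forall t, 0 <= t <= T -> U' (gamma t).

(* L bounds the derivatives of X up to order r on U, and their Lipschitz
   constants on U. *)
Definition field_bounds (r : nat) (U : set V) (L : R) X : Prop :=
  C_norm r U X <= L /\
  forall k (vs : k.-tuple V), (k <= r)%N -> (forall i, `|tnth vs i| <= 1) ->
    L.-lipschitz_U (iterD vs X).

End Flow.

(* Points of J^1(R^n) are ((x, u), p). *)
Definition base (R : realType) (n : nat) : normedModType R :=
  ('rV[R]_n * R)%type.
Definition jet (R : realType) (n : nat) : normedModType R :=
  (base R n * 'rV[R]_n)%type.
Definition ham (R : realType) (n : nat) : Type := jet R n -> R.

Section Contact.
Context {R : realType} {n : nat}.
Implicit Types (H K : ham R n) (z v : jet R n).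

Definition mom z (i : 'I_n) : R := z.2 0 i.

Definition e_x (i : 'I_n) : jet R n := ((delta_mx 0 i, 0), 0).
Definition e_u : jet R n := ((0, 1), 0).
Definition e_p (i : 'I_n) : jet R n := ((0, 0), delta_mx 0 i).

Definition d_x (i : 'I_n) H : ham R n := 'D_(e_x i) H.
Definition d_u H : ham R n := 'D_e_u H.
Definition d_p (i : 'I_n) H : ham R n := 'D_(e_p i) H.

(* alpha = du - p_i dx^i, evaluated at z on the tangent vector v. *)
Definition alpha z v : R := v.1.2 - \sum_(i < n) mom z i * v.1.1 0 i.

Definition contact_field H : jet R n -> jet R n := fun z =>
  ((\row_i d_p i H z, \sum_(i < n) mom z i * d_p i H z - H z),
   \row_i (- (d_x i H z + mom z i * d_u H z))).

Definition poisson H K : ham R n := fun z =>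
  \sum_(i < n) (d_p i H z * d_x i K z - d_x i H z * d_p i K z).

Definition jacobi H K : ham R n := fun z =>
  poisson H K z
  + d_u H z * (K z - \sum_(i < n) mom z i * d_p i K z)
  - d_u K z * (H z - \sum_(i < n) mom z i * d_p i H z).

Definition scont H : Prop := smooth H /\ forall z, d_u H z = 0.

Definition pdiff H : Prop :=
  exists (f : base R n -> R) (g : 'I_n -> base R n -> R),
    [/\ smooth f, (forall i, smooth (g i)) &
        forall z, H z = f z.1 + \sum_(i < n) g i z.1 * mom z i].

Definition mom_poly (N : nat) H : Prop :=
  exists f : {ffun 'I_n -> 'I_N.+1} -> base R n -> R,
    (forall a, smooth (f a)) /\
    forall z, H z =
      \sum_(a : {ffun 'I_n -> 'I_N.+1} | (\sum_(i < n) a i <= N)%N)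
        f a z.1 * \prod_(i < n) mom z i ^+ a i.

(* The data of s_0 + d_0 + sum_(i in I) [s_i, d_i]. *)
Record splitting := Splitting {
  spI : finType;
  sp_s0 : ham R n;
  sp_d0 : ham R n;
  sp_s : spI -> ham R n;
  sp_d : spI -> ham R n }.

Definition represents (S : splitting) H : Prop :=
  [/\ scont (sp_s0 S) /\ pdiff (sp_d0 S),
      (forall i, scont (@sp_s S i)),
      (forall i, pdiff (@sp_d S i)) &
      forall z, H z = sp_s0 S z + sp_d0 S z
                      + \sum_(i : spI S) jacobi (sp_s i) (sp_d i) z].

Definition generators (S : splitting) : set (ham R n) :=
  [set sp_s0 S] `|` [set sp_d0 S] `|` range (@sp_s S) `|` range (@sp_d S).

(* One factor of a composition: the exact flow of the generator [fac_ham] for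
   the time c h^e, with c = [fac_coef] of any sign and e = [fac_exp] > 0.
   Commutators are generated by factors with e = 1/2. *)
Record factor := Factor { fac_ham : ham R n; fac_coef : R; fac_exp : R }.

Definition factor_flow (h : R) (a : factor) : jet R n -> jet R n :=
  flow (contact_field (fac_ham a)) (fac_coef a * h `^ fac_exp a).

Definition admissible_word (S : splitting) (w : seq factor) : Prop :=
  forall a, List.In a w -> generators S (fac_ham a) /\ 0 < fac_exp a.

(* The head of w acts first. *)
Definition word_map (w : seq factor) (h : R) : jet R n -> jet R n :=
  foldl (fun z a => factor_flow h a z) ^~ w.

Definition subflows_ok (U' : set (jet R n)) (S : splitting) : Prop :=
  exists V K : set (jet R n),
    [/\ open V /\ U' `<=` V,
        compact K /\ K `<=` V,
        (exists2 delta : R, 0 < delta &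
          forall g, generators S g -> forall z t, V z -> `|t| <= delta ->
            flow_defined (contact_field g) t z) &
        forall w, admissible_word S w ->
          exists2 h1 : R, 0 < h1 & forall h, 0 < h < h1 ->
            forall z j, U' z -> K (word_map (take j w) h z)].

(* Diffeomorphism of the open set A onto its open image, with
   psi^* alpha = e^lambda alpha. *)
Definition contactomorphism_on (A : set (jet R n)) (psi : jet R n -> jet R n) :
    Prop :=
  [/\ open A /\ open (psi @` A),
      smooth_on A psi,
      (exists2 phi, smooth_on (psi @` A) phi & forall z, A z -> phi (psi z) = z) &
      exists lambda : jet R n -> R, forall z, A z -> forall v,
        alpha (psi z) ('d psi z v) = expR (lambda z) * alpha z v].

Definition contact_one_step (U' : set (jet R n)) (Psi : R -> jet R n -> jet R n) :
    Prop :=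
  exists2 A, U' `<=` A &
    exists2 h0 : R, 0 < h0 & forall h, 0 < h < h0 ->
      contactomorphism_on A (Psi h).

Definition flow_composition (S : splitting) (Psi : R -> jet R n -> jet R n) :
    Prop :=
  exists2 w, admissible_word S w & Psi = word_map w.

Definition flow_error H (Psi : R -> jet R n -> jet R n) (m : nat) (h : R) :
    jet R n -> jet R n :=
  fun z => flow (contact_field H) (m%:R * h) z - iter m (Psi h) z.

(* ||Phi_H^{mh} - (Psi_h)^m||_{C^r(U)} <= B h, for all sufficiently small
   h > 0 and all m with m h <= T. *)
Definition error_bound (U : set (jet R n)) (T : R) (r : nat) H
    (Psi : R -> jet R n -> jet R n) (B : R -> R) : Prop :=
  exists2 h0 : R, 0 < h0 & forall h, 0 < h < h0 ->
    forall m : nat, m%:R * h <= T ->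
      class_C_near r U (flow_error H Psi m h) /\
      C_norm r U (flow_error H Psi m h) <= B h.

Definition splitting_method (U U' : set (jet R n)) (T : R) (r p : nat)
    H (S : splitting) (Psi : R -> jet R n -> jet R n) (C : R) : Prop :=
  [/\ contact_one_step U' Psi, flow_composition S Psi, 0 < C &
      error_bound U T r H Psi (fun h => C * h ^+ p)].

Definition admissible_approx (U U' : set (jet R n)) (T : R) (N : nat)
    HN (S : splitting) : Prop :=
  [/\ mom_poly N HN, flow_confined (contact_field HN) T U U',
      represents S HN & subflows_ok U' S].

End Contact.

Arguments splitting : clear implicits.
Arguments factor : clear implicits.

(* Main.v *)
From Pilot Require Import Defs.
(* The map K |-> X_K is a morphism of Lie algebras, [X_H, X_K] = X_[H,K], so the field of
   H^(N) is X_{s_0} + X_{d_0} + sum [X_{s_i}, X_{d_i}].  With step h = e^2, commutators of the flows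
   for times +-e composed with the flows of s_0 and d_0 for time e^2 agree with the flow of H^(N)
   up to O(e^3).  If w(e) agrees with it up to O(e^k), the composition
   w(ae) w(ae) w(be)^-1, where 2a^2 - b^2 = 1 and 2a^k = b^k, does so up to O(e^(k+1)).  All maps
   are smooth in (e, z), so by Hadamard's lemma the defect is e^k times a smooth map, which gives
   local errors O(h^(p+1)) in every C^r.

   Estimates in C^r are estimates in C^0 for iterated tangent maps Tf (z, v) = (f z, D_v f z),
   because the flow of TX is the tangent map of the flow of X.  The global error of the method and
   the distance between the flows of H and H^(N) then follow from Gronwall's inequality.  For the
   latter, T^r X_H is only continuous; but it is linear in the last tangent vector, and the
   derivatives of the approximating fields are equicontinuous, by the uniform bounds or by
   convergence.  Contactomorphy comes from the Lie derivative of alpha along X_H, -H_u alpha. *)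
From HB Require Import structures.
From mathcomp Require Import all_boot all_order all_algebra.
From mathcomp Require Import all_classical all_reals all_analysis.
From mathcomp Require Import ring lra.
Import Order.TTheory GRing.Theory Num.Theory.
Import numFieldNormedType.Exports.
Set Implicit Arguments.
Unset Strict Implicit.
Unset Printing Implicit Defensive.
Local Open Scope classical_set_scope.
Local Open Scope ring_scope.

(** The order can be raised without end because one factor of the triple is an inverse: its
    condition 2a^k = b^k has real solutions for even [k] too, whereas three forward factors would
    need a sum of even powers to vanish. The parameter e = sqrt h runs over both signs, so that all
    maps are smooth through e = 0. An order in e known only at each single point is then enough:
    divisibility with a smooth quotient makes it locally uniform, together with all derivatives. The
    quotient in Hadamard's lemma is read off the time-one flow of an auxiliary field, so its
    smoothness is that of flows and no integral is differentiated under its sign.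

    Iterated tangent maps leave the jet space at once, hence the analysis is done in abstract
    finite-dimensional normed spaces. Three asymptotic regimes occur: O(h^p) uniformly in the number
    of steps, O(eps_N) with one constant for all approximants, and o(1) as N grows. An abstract
    gauge along a filter lets one set of closure lemmas for C^k estimates, and one comparison of
    flows, serve them. *)

(* Reflexive decision of identities between linear combinations of vectors:
   both sides are compared coefficient by coefficient with [ring]. *)
Section LinExpr.
Context {R : realType}.
Inductive lexpr :=
  LVar of nat | LZero | LAdd of lexpr & lexpr | LOpp of lexpr | LScale of R & lexpr
| LMuln of lexpr & nat.

Fixpoint leval (V : lmodType R) (env : seq V) e : V := match e with
  | LVar n => nth 0 env n | LZero => 0
  | LAdd a b => leval env a + leval env b | LOpp a => - leval env a
  | LScale c a => c *: leval env a | LMuln a n => leval env a *+ n end.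

Fixpoint lcoef e (i : nat) : R := match e with
  | LVar n => if n == i then 1 else 0 | LZero => 0
  | LAdd a b => lcoef a i + lcoef b i | LOpp a => - lcoef a i
  | LScale c a => c * lcoef a i | LMuln a n => lcoef a i *+ n end.

Lemma leval_coef (V : lmodType R) (env : seq V) e :
  leval env e = \sum_(i < size env) lcoef e i *: nth 0 env i.
Proof.
elim: e => /= [n||a -> b ->|a ->|c a ->|a -> n].
- case: (ltnP n (size env)) => [lt|ge].
    rewrite (bigD1 (Ordinal lt)) //= eqxx scale1r big1 ?addr0 // => i ne.
    by rewrite eq_sym (_ : (_ == n) = false) ?scale0r //; apply: negbTE.
  rewrite nth_default // big1 // => i _.
  by rewrite gtn_eqF ?scale0r // (leq_trans (ltn_ord i)).
- by rewrite big1 // => i _; rewrite scale0r.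
- by rewrite -big_split; apply: eq_bigr => i _; rewrite scalerDl.
- by rewrite -sumrN; apply: eq_bigr => i _; rewrite scaleNr.
- by rewrite scaler_sumr; apply: eq_bigr => i _; rewrite scalerA.
- by rewrite -sumrMnl; apply: eq_bigr => i _; rewrite scalerMnl.
Qed.

Fixpoint lsame n e1 e2 : Prop :=
  if n is m.+1 then lcoef e1 m = lcoef e2 m /\ lsame m e1 e2 else True.

Lemma leval_same (V : lmodType R) (env : seq V) e1 e2 :
  lsame (size env) e1 e2 -> leval env e1 = leval env e2.
Proof.
rewrite !leval_coef; elim: (size env) => [|n IH] /=; first by rewrite !big_ord0.
by move=> [E /IH]; rewrite !big_ord_recr /= E => ->.
Qed.
End LinExpr.

Ltac lmem x l := lazymatch l with
  | nil => constr:(false)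
  | ?y :: ?t => lazymatch constr:((x, y)) with (?z, ?z) => constr:(true) | _ => lmem x t end end.
Ltac lidx x l := lazymatch l with
  | ?y :: ?t => lazymatch constr:((x, y)) with
     | (?z, ?z) => constr:(O) | _ => let n := lidx x t in constr:(S n) end end.
Ltac latoms l e := lazymatch e with
  | GRing.add ?a ?b => let l1 := latoms l a in latoms l1 b
  | GRing.opp ?a => latoms l a
  | GRing.scale _ ?a => latoms l a
  | GRing.natmul ?a _ => latoms l a
  | GRing.zero => l
  | _ => let b := lmem e l in lazymatch b with true => l | _ => constr:(e :: l) end end.
Ltac lreify K l e := lazymatch e with
  | GRing.add ?a ?b => let x := lreify K l a in let y := lreify K l b in constr:(@LAdd K x y)
  | GRing.opp ?a => let x := lreify K l a in constr:(@LOpp K x)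
  | GRing.scale ?c ?a => let x := lreify K l a in constr:(@LScale K c x)
  | GRing.natmul ?a ?n => let x := lreify K l a in constr:(@LMuln K x n)
  | GRing.zero => constr:(@LZero K)
  | _ => let n := lidx e l in constr:(@LVar K n) end.
Ltac lmod K := lazymatch goal with |- @eq ?T ?a ?b =>
  let l0 := latoms (@nil T) a in let l := latoms l0 b in
  let x := lreify K l a in let y := lreify K l b in
  apply: (@leval_same K _ l x y); cbn [lsame size lcoef eqn]; rewrite /=;
  repeat split; ring end.

Goal forall (R:realType) (W:normedModType R) (a b c d : W) (x y : R), b - a - (x *: (c - y *: a) + (d - a)) = b - d - (x *: c - (x * y) *: a).
Proof. intros. lmod R. Qed.

(** * Linear maps, derivatives and iterated tangent maps *)

Section IsLin.
Context {R : realType}.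
Implicit Types V W Z : normedModType R.

(** A predicate rather than a bundled structure, so that composites and pairs need no new instances.
    Continuity is included because the spaces are abstract; it yields the operator bound
    [islin_bound]. *)
Definition islin V W (f : V -> W) : Prop :=
  (forall a x y, f (a *: x + y) = a *: f x + f y) /\ continuous f.

Lemma islin_pack V W (f : V -> W) : islin f ->
  exists2 F : {linear V -> W}, (F : V -> W) = f & continuous F.
Proof.
move=> [lf cf].
pose m := GRing.isLinear.Build R V W *:%R f lf.
pose F : {linear V -> W} := HB.pack f m.
by exists F.
Qed.

Lemma islin_diff V W (f : V -> W) z : islin f -> differentiable f z.
Proof. by move=> /islin_pack[F <- cF]; exact: linear_differentiable. Qed.

Lemma islin_derive V W (f : V -> W) z v : islin f -> 'D_v f z = f v.
Proof.
move=> lf; rewrite deriveE; last exact: islin_diff.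
by case/islin_pack: lf => F <- cF; rewrite diff_lin.
Qed.

Lemma islin0 V W (f : V -> W) : islin f -> f 0 = 0.
Proof. by move=> /islin_pack[F <- _]; rewrite linear0. Qed.
Lemma islinD V W (f : V -> W) x y : islin f -> f (x + y) = f x + f y.
Proof. by move=> /islin_pack[F <- _]; rewrite linearD. Qed.
Lemma islinB V W (f : V -> W) x y : islin f -> f (x - y) = f x - f y.
Proof. by move=> /islin_pack[F <- _]; rewrite linearB. Qed.
Lemma islinZ V W (f : V -> W) a x : islin f -> f (a *: x) = a *: f x.
Proof. by move=> /islin_pack[F <- _]; rewrite linearZ. Qed.
Lemma islin_sum V W (f : V -> W) (I : Type) (r : seq I) (P : pred I) (F : I -> V) :
  islin f -> f (\sum_(i <- r | P i) F i) = \sum_(i <- r | P i) f (F i).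
Proof. by move=> /islin_pack[G <- _]; rewrite linear_sum. Qed.

Lemma islin_id V : islin (@id V).
Proof. by split => // x; exact: cvg_id. Qed.
Lemma islin_cst0 V W : islin (fun _ : V => 0 : W).
Proof. by split=> [a x y|x]; [rewrite scaler0 addr0 | exact: cvg_cst]. Qed.
Lemma islin_fst V W : islin (@fst V W).
Proof. by split => // x; exact: cvg_fst. Qed.
Lemma islin_snd V W : islin (@snd V W).
Proof. by split => // x; exact: cvg_snd. Qed.
Lemma islin_comp V W Z (f : V -> W) (g : W -> Z) :
  islin f -> islin g -> islin (fun x => g (f x)).
Proof.
move=> [lf cf] [lg cg]; split=> [a x y|x]; first by rewrite lf lg.
by apply: (continuous_comp (cf x)); exact: cg.
Qed.
Lemma islin_pair V W Z (f : V -> W) (g : V -> Z) :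
  islin f -> islin g -> islin (fun x => (f x, g x)).
Proof.
move=> [lf cf] [lg cg]; split=> [a x y|x]; first by rewrite lf lg.
by apply: cvg_pair; [exact: cf | exact: cg].
Qed.
Lemma islin_add V W (f g : V -> W) :
  islin f -> islin g -> islin (fun x => f x + g x).
Proof.
move=> [lf cf] [lg cg]; split=> [a x y|x].
  by rewrite lf lg scalerDr addrACA.
by apply: cvgD; [exact: cf | exact: cg].
Qed.
Lemma islin_scale V W c (f : V -> W) : islin f -> islin (fun x => c *: f x).
Proof.
move=> [lf cf]; split=> [a x y|x].
  by rewrite lf scalerDr !scalerA mulrC.
by apply: cvgZl_tmp; exact: cf.
Qed.
Lemma islin_scalev V (x : V) : islin (fun a : R => a *: x).
Proof.
split=> [a b c|a]; first by rewrite scalerDl scalerA.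
by apply: cvgZr_tmp; exact: cvg_id.
Qed.
Lemma islin_bigsum V W (I : Type) (r : seq I) (f : I -> V -> W) :
  (forall i, islin (f i)) -> islin (fun x => \sum_(i <- r) f i x).
Proof.
move=> lf; elim: r => [|i r IH].
  rewrite (_ : (fun _ => _) = fun=> 0); first exact: islin_cst0.
  by apply/funext => x; rewrite big_nil.
rewrite (_ : (fun _ => _) = fun x => f i x + \sum_(j <- r) f j x).
  exact: islin_add.
by apply/funext => x; rewrite big_cons.
Qed.

Lemma islin_bound V W (f : V -> W) : islin f ->
  exists2 c, 0 < c & forall x, `|f x| <= c * `|x|.
Proof.
move=> /islin_pack[F <- cF].
exact: linear_lipschitz.
Qed.
End IsLin.

Section DiffEps.
Context {R : realType}.
Implicit Types V W Z : normedModType R.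

(** Directional derivatives take the place of ['d], and an explicit epsilon that of little-o: this
    is the form in which derivatives are estimated below. [eps_diff] is the converse. *)
Lemma diff_eps V W (f : V -> W) z : differentiable f z ->
  islin (fun v => 'D_v f z) /\ forall e, 0 < e -> \forall x \near z, `|f x - f z - 'D_(x - z) f z| <= e * `|x - z|.
Proof.
move=> df.
have E : (fun v => 'D_v f z) = 'd f z :> (V -> W).
  by apply/funext => v; rewrite deriveE.
split.
  rewrite E; split; last exact: diff_continuous.
  by move=> a x y; rewrite linearP.
move=> e e0.
have /diff_locallyP[_ /eqaddoP /(_ e e0)] := df.
rewrite (near_shift 0 z) subr0; apply: filterS => x /=.
by rewrite addrK !fctE /= deriveE // opprD addrA.
Qed.

Lemma eps_diff V W (f L : V -> W) z : islin L ->
  (forall e, 0 < e -> \forall x \near z, `|f x - f z - L (x - z)| <= e * `|x - z|) ->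
  differentiable f z /\ forall v, 'D_v f z = L v.
Proof.
move=> /islin_pack[F <- cF] H.
have E : f \o shift z = cst (f z) + F +o_ 0 id.
  apply/eqaddoP => e e0; have := H e e0.
  rewrite (near_shift 0 z) subr0; apply: filterS => x /=.
  by rewrite addrK !fctE /= opprD addrA.
have Ed := diff_unique cF E.
have dd : differentiable f z by apply/diff_locallyP; rewrite Ed.
by split=> // v; rewrite deriveE // Ed.
Qed.

Lemma near_eq_diff V W (f g : V -> W) z : (\forall x \near z, f x = g x) ->
  differentiable f z -> differentiable g z /\ forall v, 'D_v g z = 'D_v f z.
Proof.
move=> fg /diff_eps[lf Hf]; apply: eps_diff => // e e0.
have fz := nbhs_singleton fg.
by near=> x; rewrite -(near fg x) // -fz; near: x; exact: Hf.
Unshelve. all: by end_near. Qed.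

Lemma derive_compE V W Z (f : V -> W) (g : W -> Z) z v :
  differentiable f z -> differentiable g (f z) ->
  'D_v (g \o f) z = 'D_('D_v f z) g (f z).
Proof.
move=> df dg; rewrite !deriveE //; last exact: differentiable_comp.
by rewrite diff_comp.
Qed.

Lemma derive_pairE V W Z (f : V -> W) (g : V -> Z) z v :
  differentiable f z -> differentiable g z ->
  'D_v (fun x => (f x, g x)) z = ('D_v f z, 'D_v g z).
Proof.
move=> df dg; rewrite !deriveE //; last exact: differentiable_pair.
by rewrite diff_pair.
Qed.

End DiffEps.

Section Tangent.
Context {R : realType}.
Implicit Types V W Z : normedModType R.

(* The tangent map: it turns derivatives into values and is functorial, so that estimates
   in C^k become uniform estimates on iterated tangent maps. *)
Definition tgt V W (f : V -> W) : (V * V)%type -> (W * W)%type :=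
  fun zv => (f zv.1, 'D_zv.2 f zv.1).

(** Class C^k by recursion on the tangent map instead of on directional derivatives. The chain rule
    of any order is then a plain induction on functoriality, with no formula for higher derivatives
    of a composite. *)
Fixpoint CT (k : nat) V W (A : set V) (f : V -> W) : Prop :=
  if k is k'.+1 then
    (forall z, A z -> differentiable f z) /\
    @CT k' (V * V)%type (W * W)%type (A `*` setT) (tgt f)
  else forall z, A z -> {for z, continuous f}.

Lemma openXT V W (A : set V) : open A -> open (A `*` (setT : set W)).
Proof.
move=> oA; rewrite openE => -[a b] [/= Aa _].
exists (A, setT); last by [].
by split => /=; [exact: open_nbhs_nbhs|exact: filterT].
Qed.

Lemma near_open V (A : set V) (P : V -> Prop) z : open A ->
  (forall x, A x -> P x) -> A z -> \forall x \near z, P x.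
Proof.
move=> oA H Az; apply: filterS (open_nbhs_nbhs _); first exact: H.
by split.
Qed.

Lemma tgt_eq V W (A : set V) (f g : V -> W) : open A ->
  (forall z, A z -> f z = g z) -> (forall z, A z -> differentiable f z) ->
  forall zv, (A `*` setT) zv -> tgt f zv = tgt g zv.
Proof.
move=> oA E df [z v] [/= Az _]; rewrite /tgt /= (E z Az).
by have [_ ->] := near_eq_diff (near_open oA E Az) (df z Az).
Qed.

Lemma CT_loc k V W (A : set V) (f g : V -> W) : open A ->
  (forall z, A z -> f z = g z) -> CT k A f -> CT k A g.
Proof.
elim: k V W A f g => [|k IH] V W A f g oA E.
  move=> /= cf z Az; rewrite /prop_for /continuous_at -(E z Az).
  apply: cvg_trans (cf z Az); apply: near_eq_cvg.
  by apply: (near_open oA) Az => x /E.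
move=> [df ctf]; split.
  by move=> z Az; have [] := near_eq_diff (near_open oA E Az) (df z Az).
apply: IH ctf; first exact: openXT.
exact: tgt_eq.
Qed.

Lemma CT_sub k V W (A B : set V) (f : V -> W) : B `<=` A -> CT k A f -> CT k B f.
Proof.
elim: k V W A B f => [|k IH] V W A B f BA /=; first by move=> H z /BA /H.
move=> [df cf]; split; first by move=> z /BA /df.
by apply: IH cf => -[z v] [/= /BA].
Qed.

Lemma CTS k V W (A : set V) (f : V -> W) : CT k.+1 A f -> CT k A f.
Proof.
elim: k V W A f => [|k IH] V W A f.
  by move=> [df _] z Az; exact/differentiable_continuous/df.
by move=> [df cf]; split => //; exact: IH.
Qed.

Lemma CT_le j k V W (A : set V) (f : V -> W) : (j <= k)%N -> CT k A f -> CT j A f.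
Proof.
move=> /subnK <-; elim: (k - j)%N => [//|i IH]; rewrite addSn => /CTS; exact: IH.
Qed.

Lemma CT_cont k V W (A : set V) (f : V -> W) z : CT k A f -> A z -> {for z, continuous f}.
Proof. by move=> /(CT_le (leq0n k)); apply. Qed.

Lemma CT_diff k V W (A : set V) (f : V -> W) z : CT k.+1 A f -> A z -> differentiable f z.
Proof. by case=> + _; apply. Qed.

Lemma tgt_comp V W Z (f : V -> W) (g : W -> Z) zv :
  differentiable f zv.1 -> differentiable g (f zv.1) ->
  tgt (g \o f) zv = tgt g (tgt f zv).
Proof. by move=> df dg; rewrite /tgt /= derive_compE. Qed.

Lemma CT_comp k V W Z (A : set V) (B : set W) (f : V -> W) (g : W -> Z) :
  open A -> (forall z, A z -> B (f z)) ->
  CT k A f -> CT k B g -> CT k A (g \o f).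
Proof.
elim: k V W Z A B f g => [|k IH] V W Z A B f g oA AB.
  by move=> /= cf cg z Az; apply: continuous_comp; [exact: cf | exact/cg/AB].
move=> [df cf] [dg cg]; split.
  by move=> z Az; apply: differentiable_comp; [exact: df | exact/dg/AB].
apply: (@CT_loc _ _ _ _ (tgt g \o tgt f)); first exact: openXT.
  move=> [z v] [/= Az _]; apply/esym/tgt_comp; first exact: df.
  exact/dg/AB.
apply: (IH _ _ _ _ (B `*` setT)) => //; first exact: openXT.
by move=> [z v] [/= /AB].
Qed.

Lemma CT_lin k V W (A : set V) (f : V -> W) : islin f -> CT k A f.
Proof.
elim: k V W A f => [|k IH] V W A f lf; first by move=> z _; case: lf => _; apply.
split; first by move=> z _; exact: islin_diff.
apply: IH; rewrite (_ : tgt f = fun zv => (f zv.1, f zv.2)).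
  by apply: islin_pair; (apply: islin_comp lf; [exact: islin_fst || exact: islin_snd]).
by apply/funext => -[z v]; rewrite /tgt /= islin_derive.
Qed.

Lemma CT_pair k V W Z (A : set V) (f : V -> W) (g : V -> Z) : open A ->
  CT k A f -> CT k A g -> CT k A (fun x => (f x, g x)).
Proof.
elim: k V W Z A f g => [|k IH] V W Z A f g oA.
  by move=> cf cg z Az; apply: cvg_pair; [exact: cf|exact: cg].
move=> [df cf] [dg cg]; split.
  by move=> z Az; apply: differentiable_pair; [exact: df|exact: dg].
have oA' := @openXT V V A oA.
(* The tangent map of a pair is the pair of the tangent maps up to this exchange of the two middle
   components. *)
pose s (x : ((W * W) * (Z * Z))%type) := ((x.1.1, x.2.1), (x.1.2, x.2.2)).
apply: (@CT_loc _ _ _ _ (s \o (fun x => (tgt f x, tgt g x)))) => //.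
  move=> [z v] [/= Az _]; rewrite /s /tgt /=.
  by rewrite derive_pairE //; [exact: df|exact: dg].
apply: (@CT_comp _ _ _ _ _ setT) => //; first exact: IH.
apply: CT_lin.
have l1 := @islin_fst R (W * W)%type (Z * Z)%type.
have l2 := @islin_snd R (W * W)%type (Z * Z)%type.
apply: islin_pair; apply: islin_pair.
- exact: (islin_comp l1 (islin_fst _ _)).
- exact: (islin_comp l2 (islin_fst _ _)).
- exact: (islin_comp l1 (islin_snd _ _)).
- exact: (islin_comp l2 (islin_snd _ _)).
Qed.

Lemma CT_post k V W Z (A : set V) (f : V -> W) (L : W -> Z) : open A -> islin L ->
  CT k A f -> CT k A (fun x => L (f x)).
Proof. by move=> oA lL cf; apply: (@CT_comp _ _ _ _ _ setT) => //; exact: CT_lin. Qed.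

Lemma CT_pre k V W Z (A : set V) (B : set W) (L : V -> W) (f : W -> Z) : open A -> islin L ->
  (forall x, A x -> B (L x)) -> CT k B f -> CT k A (fun x => f (L x)).
Proof. by move=> oA lL AB cf; apply: (@CT_comp _ _ _ _ _ B) => //; exact: CT_lin. Qed.

Lemma CT_cst k V W (A : set V) (c : W) : CT k A (fun=> c).
Proof.
elim: k V W A c => [|k IH] V W A c; first by move=> z _; exact: cvg_cst.
split; first by move=> z _; exact: differentiable_cst.
rewrite (_ : tgt _ = fun=> (c, 0)); first exact: IH.
by apply/funext => -[z v]; rewrite /tgt /= derive_cst.
Qed.

Lemma CT_add k V W (A : set V) (f g : V -> W) : open A ->
  CT k A f -> CT k A g -> CT k A (fun x => f x + g x).
Proof.
move=> oA cf cg.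
apply: (@CT_post _ _ (W * W)%type _ _ (fun x => (f x, g x)) (fun y => y.1 + y.2)) => //.
  by apply: islin_add; [exact: islin_fst|exact: islin_snd].
exact: CT_pair.
Qed.

Lemma CT_scalec k V W (A : set V) c (f : V -> W) : open A ->
  CT k A f -> CT k A (fun x => c *: f x).
Proof.
move=> oA cf; apply: (@CT_post _ _ _ _ _ f (fun y => c *: y)) => //.
exact/islin_scale/islin_id.
Qed.

Lemma CT_opp k V W (A : set V) (f : V -> W) : open A ->
  CT k A f -> CT k A (fun x => - f x).
Proof.
move=> oA /(CT_scalec (-1) oA); apply: CT_loc => // z _.
by rewrite scaleN1r.
Qed.

Lemma CT_sub2 k V W (A : set V) (f g : V -> W) : open A ->
  CT k A f -> CT k A g -> CT k A (fun x => f x - g x).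
Proof. by move=> oA cf cg; apply: CT_add => //; exact: CT_opp. Qed.

Lemma CT_sum k V W (A : set V) (I : Type) (r : seq I) (f : I -> V -> W) : open A ->
  (forall i, CT k A (f i)) -> CT k A (fun x => \sum_(i <- r) f i x).
Proof.
move=> oA cf; elim: r => [|i r IH].
  by apply: CT_loc (CT_cst _ _ 0) => // z _; rewrite big_nil.
by apply: CT_loc (CT_add oA (cf i) IH) => // z _; rewrite big_cons.
Qed.

(** The remainder of a bilinear map is the product of the two increments, hence quadratic. *)
Lemma diff_scale_pair W (p : (R * W)%type) :
  differentiable (fun p : (R * W)%type => p.1 *: p.2) p /\
  forall v, 'D_v (fun p : (R * W)%type => p.1 *: p.2) p = p.1 *: v.2 + v.1 *: p.2.
Proof.
apply: (@eps_diff _ _ _ _ (fun v : (R * W)%type => p.1 *: v.2 + v.1 *: p.2)).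
  apply: islin_add; first exact/islin_scale/islin_snd.
  exact: (islin_comp (islin_fst _ _) (islin_scalev _)).
move=> e e0; near=> x.
have -> : x.1 *: x.2 - p.1 *: p.2 - (p.1 *: (x - p).2 + (x - p).1 *: p.2)
   = (x - p).1 *: (x - p).2 by rewrite /=; lmod R.
rewrite normrZ; apply: ler_pM => //.
  by apply: (@le_trans _ _ `|x - p|); [rewrite prod_normE /= le_max lexx|].
by rewrite prod_normE /= le_max lexx orbT.
Unshelve. all: by end_near. Qed.

(** The tangent map of a product is again a combination of products of components of the two tangent
    maps, so the induction closes on itself. *)
Lemma CT_scale k V W (A : set V) (a : V -> R) (f : V -> W) : open A ->
  CT k A a -> CT k A f -> CT k A (fun x => a x *: f x).
Proof.
elim: k V W A a f => [|k IH] V W A a f oA ca cf.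
  by move=> z Az; apply: cvgZ; [exact: ca|exact: cf].
pose m (p : (R * W)%type) := p.1 *: p.2.
have dm z : A z -> differentiable (m \o (fun x => (a x, f x))) z /\
  forall v, 'D_v (m \o (fun x => (a x, f x))) z = a z *: 'D_v f z + 'D_v a z *: f z.
  move=> Az; have da := CT_diff ca Az; have df := CT_diff cf Az.
  have [dm Em] := diff_scale_pair (a z, f z).
  have dp : differentiable (fun x => (a x, f x)) z by exact: differentiable_pair.
  split; first exact: differentiable_comp.
  by move=> v; rewrite derive_compE // derive_pairE // Em.
split; first by move=> z /dm[].
have oA' := @openXT V V A oA.
have [_ ca'] := ca; have [_ cf'] := cf.
have c1 := CT_post oA' (islin_fst _ _) ca'.
have c2 := CT_post oA' (islin_snd _ _) ca'.
have c3 := CT_post oA' (islin_fst _ _) cf'.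
have c4 := CT_post oA' (islin_snd _ _) cf'.
apply: (@CT_loc _ _ _ _ (fun zv => ((tgt a zv).1 *: (tgt f zv).1,
   (tgt a zv).1 *: (tgt f zv).2 + (tgt a zv).2 *: (tgt f zv).1))) => //.
  by move=> [z v] [/= Az _]; rewrite /tgt /=; have [_ ->] := dm z Az.
apply: CT_pair => //; first exact: IH.
by apply: CT_add => //; exact: IH.
Qed.

End Tangent.

(** * Finite dimension and the class C^k *)

Section FinDim.
Context {R : realType}.
Implicit Types V W Z : normedModType R.

(** A finite generating family with continuous linear coordinates; independence is not asked for.
    This passes to products, hence to all iterated tangent spaces. *)
Definition findim V : Prop := exists (m : nat) (e : 'I_m -> V) (c : 'I_m -> V -> R),
  (forall i, islin (c i)) /\ forall v, v = \sum_i c i v *: e i.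

Lemma findim_R : findim R.
Proof.
exists 1%N, (fun=> 1), (fun=> id); split=> [i|v]; first exact: islin_id.
by rewrite big_ord1 [_ *: _]mulr1.
Qed.

Lemma islin_coord n (i : 'I_n) : islin (fun v : 'rV[R]_n => v 0 i).
Proof. by split=> [a x y|x]; [rewrite !mxE | exact: coord_continuous]. Qed.

Lemma findim_rV n : findim 'rV[R]_n.
Proof.
exists n, (fun i => delta_mx 0 i), (fun i (v : 'rV[R]_n) => v 0 i); split=> [i|v].
  exact: islin_coord.
exact: row_sum_delta.
Qed.

Lemma findim_prod V W : findim V -> findim W -> findim (V * W)%type.
Proof.
move=> [m [e [c [lc Ec]]]] [n [e' [c' [lc' Ec']]]].
exists (m + n)%N,
  (fun i => match fintype.split i with inl j => (e j, 0) | inr j => (0, e' j) end),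
  (fun i v => match fintype.split i with inl j => c j v.1 | inr j => c' j v.2 end).
split=> [i|[v w]].
  case: (fintype.split i) => j; [exact: islin_comp (islin_fst _ _) _|exact: islin_comp (islin_snd _ _) _].
rewrite big_split_ord /=.
rewrite (eq_bigr (fun i => (c i v *: e i, 0))); last first.
  move=> i _; rewrite (_ : fintype.split _ = inl i) ?scale_pair //=.
    by rewrite -[LHS]/(c i v *: e i, c i v *: 0) scaler0.
  exact: (unsplitK (inl i)).
rewrite [X in _ + X](eq_bigr (fun i => (0, c' i w *: e' i))); last first.
  move=> i _; rewrite (_ : fintype.split _ = inr i) //=.
    by rewrite -[LHS]/(c' i w *: 0, c' i w *: e' i) scaler0.
  exact: (unsplitK (inr i)).
have S1 : \sum_i (c i v *: e i, 0) = (v, 0 : W).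
  rewrite [in RHS](Ec v); elim/big_ind2 : _ => // x1 x2 y1 y2 -> ->.
  by rewrite -[LHS]/(_ + _, 0 + 0) addr0.
have S2 : \sum_i (0, c' i w *: e' i) = (0 : V, w).
  rewrite [in RHS](Ec' w); elim/big_ind2 : _ => // x1 x2 y1 y2 -> ->.
  by rewrite -[LHS]/(0 + 0, _ + _) addr0.
by rewrite S1 S2 -[RHS]/(v + 0, 0 + w) addr0 add0r.
Qed.

Lemma islin_bound_fin V m (c : 'I_m -> V -> R) : (forall i, islin (c i)) ->
  exists2 C, 0 < C & forall i v, `|c i v| <= C * `|v|.
Proof.
move=> lc.
have /choice[k Hk] : forall i, exists k, 0 < k /\ forall v, `|c i v| <= k * `|v|.
  by move=> i; have [k k0 Hk] := islin_bound (lc i); exists k.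
have S0 : 0 <= \sum_i k i by apply: sumr_ge0 => i _; exact/ltW/(Hk i).1.
exists (1 + \sum_i k i); first by rewrite ltr_pwDl.
move=> i v; apply: le_trans ((Hk i).2 v) _; apply: ler_wpM2r => //.
rewrite (bigD1 i) //= addrCA lerDl addr_ge0 // sumr_ge0 // => j _.
exact/ltW/(Hk j).1.
Qed.

(** The ball is the image under [phi] of a bounded closed set of coordinate rows, which is
    compact. *)
Lemma compact_cball V M : findim V -> compact [set v : V | `|v| <= M].
Proof.
move=> [m [e [c [lc Ec]]]].
have [C C0 HC] := islin_bound_fin lc.
pose phi (x : 'rV[R]_m) : V := \sum_i x 0 i *: e i.
have lphi : islin phi.
  by apply: islin_bigsum => i; apply: islin_comp (islin_coord i) (islin_scalev _).
pose S := [set x : 'rV[R]_m | `|x| <= C * M] `&` phi @^-1` [set v | `|v| <= M].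
have cS : compact S.
  apply: bounded_closed_compact.
    exists (C * M); split; first exact: num_real.
    by move=> y yM x [/= H _]; apply: le_trans H (ltW yM).
  apply: closedI.
    apply: (closed_comp _ (@closed_le _ (C * M))) => x _; exact: norm_continuous.
  apply: closed_comp => [x _|]; first exact: lphi.2.
  apply: (closed_comp _ (@closed_le _ M)) => x _; exact: norm_continuous.
have -> : [set v : V | `|v| <= M] = phi @` S.
  apply/seteqP; split=> [v /= vM|_ [x [_ /= H] <-] //].
  have Ev : phi (\row_i c i v) = v.
    by rewrite /phi [RHS]Ec; apply: eq_bigr => i _; rewrite mxE.
  exists (\row_i c i v) => //; split; last by rewrite /= Ev.
  rewrite /= [leLHS]/Num.norm /= mx_normrE; apply: bigmax_le => [|[i j] _ /=].
    by rewrite mulr_ge0 ?(ltW C0) // (le_trans _ vM).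
  by rewrite mxE; apply: le_trans (HC _ _) _; rewrite ler_pM2l.
apply: continuous_compact cS; apply: continuous_subspaceT; exact: lphi.2.
Qed.

Lemma cvg_finsum V (I T : Type) (F : set_system T) (r : seq I) (f : I -> T -> V) (l : I -> V) :
  Filter F -> (forall i, f i @ F --> l i) ->
  (fun x => \sum_(i <- r) f i x) @ F --> \sum_(i <- r) l i.
Proof.
move=> FF H; elim: r => [|i r IH].
  rewrite big_nil (_ : (fun _ => _) = fun=> 0); first exact: cvg_cst.
  by apply/funext => x; rewrite big_nil.
rewrite big_cons (_ : (fun _ => _) = fun x => f i x + \sum_(j <- r) f j x).
  exact: cvgD.
by apply/funext => x; rewrite big_cons.
Qed.

(** The form of completeness that Picard iteration uses: each coordinate sequence is Cauchy in [R],
    and the coordinate limits are reassembled. *)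
Lemma geom_cauchy V (x : nat -> V) M : findim V ->
  (forall n, `|x n.+1 - x n| <= M * 2^-1 ^+ n) ->
  exists l, forall n, `|x n - l| <= 2 * M * 2^-1 ^+ n.
Proof.
move=> [m [e [c [lc Ec]]]] Hx.
have [C C0 HC] := islin_bound_fin lc.
have tel n k : `|x (n + k)%N - x n| <= 2 * M * 2^-1 ^+ n * (1 - 2^-1 ^+ k).
  elim: k => [|k IH]; first by rewrite addn0 subrr normr0 expr0 subrr mulr0.
  rewrite addnS; apply: (le_trans (ler_distD (x (n + k)%N) _ _)).
  apply: le_trans (lerD (Hx _) IH) _.
  by rewrite exprD exprS le_eqVlt; apply/orP; left; apply/eqP; field.
have M0 : 0 <= M by have := Hx 0%N; rewrite expr0 mulr1; exact: le_trans.
have tel' n k : `|x (n + k)%N - x n| <= 2 * M * 2^-1 ^+ n.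
  apply: le_trans (tel n k) _; apply: ler_piMr.
    by rewrite mulr_ge0 ?exprn_ge0 // mulr_ge0.
  by rewrite lerBlDr lerDl exprn_ge0.
have half0 K : (fun n => K * 2^-1 ^+ n) @ \oo --> (0 : R).
  by apply: cvg_geometric; rewrite ger0_norm // invf_lt1 // ltr1n.
have cv i : exists l : R, (fun n => c i (x n)) @ \oo --> l.
  suff /cauchy_cvgP/cvg_ex[l Hl] : cauchy ((fun n => c i (x n)) @ \oo) by exists l.
  apply: cauchy_exP => eps eps0.
  have /cvgrPdist_lt/(_ eps eps0)[N _ /(_ N (leqnn N))] := half0 (C * (2 * M)).
  rewrite /= sub0r normrN ger0_norm ?mulr_ge0 ?exprn_ge0 ?(ltW C0) // => HN.
  exists (c i (x N)); exists N => // n /= Nn.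
  rewrite -ball_normE /= distrC -(islinB _ _ (lc i)) -(subnKC Nn).
  apply: le_lt_trans (HC _ _) _; apply: le_lt_trans HN.
  by rewrite -[in leRHS]mulrA ler_pM2l.
have /choice[l Hl] := cv.
have xl : x @ \oo --> \sum_i l i *: e i.
  rewrite (_ : x = fun n => \sum_i c i (x n) *: e i); last by apply/funext.
  apply: cvg_finsum => i; apply: cvgZr_tmp; exact: Hl.
exists (\sum_i l i *: e i) => n.
rewrite distrC.
have /cvg_norm /= xl' : (fun k => x k - x n) @ \oo --> (\sum_i l i *: e i - x n).
  by apply: cvgB => //; exact: cvg_cst.
apply: (@closed_cvg _ _ _ _ _ [set y | y <= 2 * M * 2^-1 ^+ n] _ _ _ xl').
  exact: closed_le.
by exists n => // k /= nk; rewrite -(subnKC nk).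
Qed.

Lemma class_CS k V W (A : set V) (f : V -> W) : class_C k.+1 A f -> class_C k A f.
Proof.
elim: k f => [|k IH] f [df cf]; first by move=> z /df /differentiable_continuous.
by split => // v; apply: IH; exact: cf.
Qed.

(** With coordinates, the derivative in direction v is a finite sum of derivatives along fixed
    vectors with coefficients linear in v. This turns regularity in z for each v into joint
    regularity in (z, v). *)
Lemma class_C_CT k V W (A : set V) (f : V -> W) : findim V -> open A ->
  class_C k A f -> CT k A f.
Proof.
move=> fV oA; elim: k W f => [//|k IH] W f Hf; have [df cf] := Hf; split => //.
have [m [e [c [lc Ec]]]] := fV.
have oA' := @openXT _ V V A oA.
have sub (x : (V * V)%type) : (A `*` setT) x -> A x.1 by case.
apply: (@CT_loc _ _ _ _ _ (fun zv => (f zv.1, \sum_i c i zv.2 *: 'D_(e i) f zv.1))) => //.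
  move=> [z v] [/= Az _]; rewrite /tgt /=; congr (_, _).
  have lD := (diff_eps (df z Az)).1.
  by rewrite [in RHS](Ec v) (islin_sum _ _ _ lD); apply: eq_bigr => i _; rewrite (islinZ _ _ lD).
apply: CT_pair => //.
  by exact: (CT_pre oA' (islin_fst V V) sub (IH _ _ (class_CS Hf))).
apply: CT_sum => // i; apply: CT_scale => //.
  by apply: CT_lin; exact: (islin_comp (islin_snd _ _)).
by exact: (CT_pre oA' (islin_fst V V) sub (IH _ _ (cf _))).
Qed.

Lemma CT_slice k V W (A : set V) (f : (V * V)%type -> W) v : open A ->
  CT k (A `*` setT) f -> CT k A (fun z => f (z, v)).
Proof.
move=> oA cf; apply: (@CT_comp _ _ _ _ _ _ (A `*` setT) (fun z => (z, v))) => //.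
by apply: CT_pair => //; [apply: CT_lin; exact: islin_id|exact: CT_cst].
Qed.

Lemma CT_derive k V W (A : set V) (f : V -> W) v : open A ->
  CT k.+1 A f -> CT k A ('D_v f).
Proof.
move=> oA [_ cf].
exact: (CT_post oA (islin_snd W W) (CT_slice v oA cf)).
Qed.

Lemma CT_class_C k V W (A : set V) (f : V -> W) : open A ->
  CT k A f -> class_C k A f.
Proof.
move=> oA; elim: k W f => [//|k IH] W f cf; split.
  by move=> z Az; exact: CT_diff cf Az.
by move=> v; apply: IH; exact: CT_derive.
Qed.

(** Continuity of the derivative in operator norm: coordinates reduce uniformity in v to finitely
    many directions. *)
Lemma near_derive_op V W (A : set V) (f : V -> W) z0 eta : findim V -> open A ->
  CT 1 A f -> A z0 -> 0 < eta ->
  \forall z \near z0, forall v, `|'D_v f z - 'D_v f z0| <= eta * `|v|.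
Proof.
move=> [m [e [c [lc Ec]]]] oA cf Az0 eta0.
have [C C0 HC] := islin_bound_fin lc.
(* [m.+1] instead of [m] keeps the tolerance positive when there are no coordinates; the spare
   summand is dropped at the end. *)
have H : \forall z \near z0, forall i : 'I_m, `|'D_(e i) f z - 'D_(e i) f z0| <= eta / (C * m.+1%:R).
  apply: filter_forall => i.
  have cD := CT_cont (CT_derive (e i) oA cf) Az0.
  have e0 : 0 < eta / (C * m.+1%:R) by rewrite divr_gt0 // mulr_gt0.
  have /cvgrPdist_le /(_ _ e0) := cD.
  by apply: filterS => z; rewrite distrC.
near=> z => v.
have Az : A z by near: z; exact: open_nbhs_nbhs.
have Hz : forall i : 'I_m, `|'D_(e i) f z - 'D_(e i) f z0| <= eta / (C * m.+1%:R).
  by near: z; exact: H.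
have lz := (diff_eps (CT_diff cf Az)).1.
have lz0 := (diff_eps (CT_diff cf Az0)).1.
rewrite {1 2}(Ec v) !(islin_sum _ _ _ lz) !(islin_sum _ _ _ lz0) -sumrB.
apply: le_trans (ler_norm_sum _ _ _) _.
have -> : eta * `|v| = \sum_(i < m.+1) (eta / m.+1%:R * `|v|).
  rewrite sumr_const card_ord -[RHS]mulr_natr.
  have : (m.+1%:R : R) != 0 by rewrite pnatr_eq0.
  by move: (m.+1%:R : R) => M M0; field.
rewrite big_ord_recr /= -[leLHS]addr0; apply: lerD; last by rewrite mulr_ge0 // divr_ge0 // ltW.
apply: ler_sum => i _.
rewrite (islinZ _ _ lz) (islinZ _ _ lz0) -scalerBr normrZ.
apply: le_trans (_ : C * `|v| * (eta / (C * m.+1%:R)) <= _).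
  exact: ler_pM.
rewrite le_eqVlt; apply/orP; left; apply/eqP.
have : (m.+1%:R : R) != 0 by rewrite pnatr_eq0.
by move: (m.+1%:R : R) => M M0; field; rewrite M0 gt_eqF.
Unshelve. all: by end_near. Qed.
End FinDim.

(** * Integral curves: comparison, existence and uniqueness *)

Section Curves.
Context {R : realType}.
Implicit Types V W Z : normedModType R.

Lemma is_derive_diff V (u : R -> V) (s : R) (d : V) : is_derive s 1 u d ->
  differentiable u s /\ forall h, 'D_h u s = h *: d.
Proof.
move=> H; have du : derivable u s 1 by [].
have df : differentiable u s by apply/derivable1_diffP.
split=> // h; have l := (diff_eps df).1.
by rewrite -[h in LHS]mulr1 -[h * 1]/(h *: (1 : R)) (islinZ _ _ l) derive_val.
Qed.

Lemma diff_is_derive V (u : R -> V) (s : R) (d : V) : differentiable u s -> 'D_(1 : R) u s = d -> is_derive s 1 u d.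
Proof. by move=> du <-; apply: derivableP; apply/derivable1_diffP. Qed.

Lemma is_derive_comp V W (u : R -> V) (f : V -> W) (s : R) (d : V) : is_derive s 1 u d ->
  differentiable f (u s) -> is_derive s 1 (fun t => f (u t)) ('D_d f (u s)).
Proof.
move=> /is_derive_diff[du Eu] df; apply: diff_is_derive.
  exact: (differentiable_comp du df).
by rewrite (derive_compE (1 : R) du df) Eu scale1r.
Qed.

Lemma is_derive_pair V W (u : R -> V) (w : R -> W) (s : R) (d : V) (e : W) : is_derive s 1 u d ->
  is_derive s 1 w e -> is_derive s 1 (fun t => (u t, w t)) (d, e).
Proof.
move=> /is_derive_diff[du Eu] /is_derive_diff[dw Ew]; apply: diff_is_derive.
  exact: differentiable_pair.
by rewrite derive_pairE // Eu Ew !scale1r.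
Qed.

Lemma is_derive_lin V W (u : R -> V) (f : V -> W) (s : R) (d : V) : is_derive s 1 u d ->
  islin f -> is_derive s 1 (fun t => f (u t)) (f d).
Proof.
move=> du lf; have := is_derive_comp du (islin_diff (u s) lf).
by rewrite islin_derive.
Qed.

Lemma is_derive_eps V (u : R -> V) (s : R) (d : V) (e : R) : is_derive s 1 u d -> 0 < e ->
  \forall x \near s, `|u x - u s - (x - s) *: d| <= e * `|x - s|.
Proof.
move=> /is_derive_diff[du Eu] e0; have := (diff_eps du).2 e e0.
by apply: filterS => x; rewrite Eu.
Qed.

Lemma is_derive_continuous V (u : R -> V) (s : R) (d : V) : is_derive s 1 u d -> {for s, continuous u}.
Proof. by move=> /is_derive_diff[/differentiable_continuous]. Qed.

(** The norm of [u] need not be differentiable, so the comparison is made at the first time where it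
    reaches [b]: just before, the norm is below [b], which contradicts the strict inequality between
    the speeds. *)
Lemma barrier V (u du : R -> V) (b db : R -> R) :
  (forall t : R, 0 <= t <= 1 -> {for t, continuous u}) ->
  (forall t : R, 0 <= t <= 1 -> {for t, continuous b}) ->
  (forall t : R, 0 < t < 1 -> is_derive t 1 u (du t)) ->
  (forall t : R, 0 < t < 1 -> is_derive t 1 b (db t)) ->
  `|u 0| < b 0 ->
  (forall t : R, 0 < t < 1 -> `|u t| = b t -> `|du t| < db t) ->
  forall t : R, 0 <= t <= 1 -> `|u t| <= b t.
Proof.
move=> cu cb Hu Hb u0 H.
have cw (t : R) : 0 <= t <= 1 -> {for t, continuous (fun s => b s - `|u s|)}.
  by move=> tI; apply: cvgB; [exact: cb|apply: cvg_norm; exact: cu].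
have main (t : R) : 0 <= t < 1 -> `|u t| < b t.
  move=> /andP[t0 t1]; apply: contrapT => /negP; rewrite -leNgt => bad.
  (* The infimum of the times of violation is the first touching time; continuity from both sides
     gives equality there. *)
  pose S := [set s | 0 <= s <= t /\ b s <= `|u s|].
  have St : S t by split=> //; rewrite t0 lexx.
  have lS : lbound S 0 by move=> s [/andP[]].
  have hS : has_inf S by split; [exists t|exists 0].
  pose a := inf S.
  have a0 : 0 <= a by apply: lb_le_inf => //; exists t.
  have at_ : a <= t by apply: ge_inf => //; exists 0.
  have aI : 0 <= a <= 1 by rewrite a0 (le_trans at_ (ltW t1)).
  have below (s : R) : 0 <= s -> s < a -> `|u s| < b s.
    move=> s0 sa; rewrite ltNge; apply/negP => Hs.
    have : S s by split=> //; rewrite s0 (le_trans (ltW sa)).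
    move=> Ss.
    have : a <= s by apply: ge_inf => //; exists 0.
    by rewrite leNgt sa.
  have wa : b a <= `|u a|.
    rewrite leNgt; apply/negP => Ha.
    have Ha' : 0 < b a - `|u a| by rewrite subr_gt0.
    have /cvgrPdist_lt/(_ _ Ha') := cw a aI.
    move=> /nbhs_ballP[d /= d0 Hd].
    have [s [sI bs] sd] := inf_adherent d0 hS.
    have as_ : a <= s by apply: ge_inf => //; exists 0.
    have : ball a d s.
      by rewrite -ball_normE /= distrC ger0_norm ?subr_ge0 // ltrBlDl.
    move=> /Hd /=; rewrite ltr_norml => /andP[_]; rewrite ltrBlDr ltrDl subr_gt0.
    by rewrite ltNge bs.
  have a_gt0 : 0 < a.
    rewrite lt_neqAle a0 andbT; apply/eqP => a00.
    by move: wa; rewrite -a00 leNgt u0.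
  have aI' : 0 < a < 1 by rewrite a_gt0 (le_lt_trans at_).
  have wa' : `|u a| = b a.
    apply/eqP; rewrite eq_le wa andbT leNgt; apply/negP => Ha.
    have Ha' : 0 < `|u a| - b a by rewrite subr_gt0.
    have /cvgrPdist_lt/(_ _ Ha') := cw a aI.
    move=> /nbhs_ballP[d /= d0 Hd].
    pose s := Num.max 0 (a - d / 2).
    have s0 : 0 <= s by rewrite le_max lexx.
    have sa : s < a by rewrite gt_max a_gt0 gtrBl divr_gt0.
    have ad : a - s < d.
      rewrite ltrBlDl -ltrBlDr lt_max; apply/orP; right.
      lra.
    have : ball a d s.
      by rewrite -ball_normE /= ger0_norm ?subr_ge0 // ltW.
    move=> /Hd /=; have := below s s0 sa => bs; rewrite ltr_norml => /andP[]; lra.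
  have dd := H a aI' wa'.
  (* A quarter of the gap between the speeds: the two linear approximations cost one [e] each, which
     leaves a positive margin. *)
  pose e := (db a - `|du a|) / 4.
  have e0 : 0 < e by rewrite divr_gt0 // subr_gt0.
  have : \forall s \near a, [/\ `|u s - u a - (s - a) *: du a| <= e * `|s - a|,
     `|b s - b a - (s - a) *: db a| <= e * `|s - a| & 0 < s].
    have l1 := is_derive_eps (Hu a aI') e0; have l2 := is_derive_eps (Hb a aI') e0.
    near=> s; split; near: s => //; exact: lt_nbhsr.
  move=> /nbhs_ballP[d /= d0 Hd].
  have : ball a d (a - d / 2) by rewrite -ball_normE /= opprB addrC subrK gtr0_norm; lra.
  move=> /Hd; set s := a - d / 2 => -[h1 h2 s0].
  have sa : s < a by rewrite /s; lra.
  have bs := below s (ltW s0) sa.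
  move: h1 h2; rewrite [ `|s - a| ]ltr0_norm ?subr_lt0 // => h1 h2.
  have u1 : `|u a| <= `|u s| + (a - s) * (`|du a| + e).
    have -> : u a = u s - (u s - u a - (s - a) *: du a) - (s - a) *: du a by lmod R.
    apply: le_trans (ler_normB _ _) _; rewrite normrZ [ `|s - a| ]ltr0_norm ?subr_lt0 //.
    have := ler_normB (u s) (u s - u a - (s - a) *: du a); nra.
  move: h2; rewrite ler_norml => /andP[h2 h3].
  have h4 : (s - a) *: db a = (s - a) * db a by [].
  have e4 : db a = `|du a| + 4 * e by rewrite /e; field.
  have P : 0 < (a - s) * e by rewrite mulr_gt0 // subr_gt0.
  rewrite h4 in h2 h3.
  have h5 : (s - a) * db a = - ((a - s) * `|du a|) - 4 * ((a - s) * e) by rewrite e4; ring.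
  have h6 : (a - s) * (`|du a| + e) = (a - s) * `|du a| + (a - s) * e by ring.
  lra.
(* Derivatives are available only on the open interval, so the endpoint 1 is reached by continuity,
   with a non-strict inequality. *)
move=> t /andP[t0]; rewrite le_eqVlt => /orP[/eqP->|t1]; last by apply/ltW/main; rewrite t0.
rewrite leNgt; apply/negP => Ha.
have Ha' : 0 < `|u 1| - b 1 by rewrite subr_gt0.
have /cvgrPdist_lt/(_ _ Ha') : {for 1, continuous (fun s => b s - `|u s|)}.
  by apply: cw; rewrite ler01 lexx.
move=> /nbhs_ballP[d /= d0 Hd].
pose s := Num.max 0 (1 - d / 2).
have s0 : 0 <= s by rewrite le_max lexx.
have sa : s < 1 by rewrite gt_max ltr01 gtrBl divr_gt0.
have ad : 1 - s < d.
  rewrite ltrBlDl -ltrBlDr lt_max; apply/orP; right; lra.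
have : ball (1 : R) d s.
  by rewrite -ball_normE /= ger0_norm // subr_ge0 ltW.
move=> /Hd /=; have := main s; rewrite s0 sa => /(_ isT) bs.
rewrite ltr_norml => /andP[]; lra.
Unshelve. all: by end_near. Qed.
End Curves.

Section Gronwall.
Context {R : realType}.
Implicit Types V W Z : normedModType R.

Lemma is_derive_expc (B c t : R) : is_derive t 1 (fun s => B * expR (c * s)) (c * (B * expR (c * t))).
Proof.
have h : is_derive t 1 (fun s : R => c * s) c.
  by have := is_derive_lin (is_derive_id t 1) (@islin_scale R _ _ c _ (@islin_id R R)); rewrite [_ *: 1]mulr1.
have := is_derive1_comp (is_derive_expR (c * t)) h => h2.
have := is_derive_lin h2 (@islin_scale R _ _ B _ (@islin_id R R)).
by rewrite [_ *: _]mulrA mulrC.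
Qed.

Lemma cont_expc (B c t : R) : {for t, continuous (fun s => B * expR (c * s))}.
Proof. exact: is_derive_continuous (is_derive_expc B c t). Qed.

Lemma le_slack (x y C : R) : (forall e, 0 < e -> x <= y + e * C) -> x <= y.
Proof.
move=> H; apply/ler_addgt0Pr => e e0.
have C0 : 0 < `|C| + 1 by rewrite ltr_wpDl.
apply: le_trans (H (e / (`|C| + 1)) _) _; first by rewrite divr_gt0.
rewrite lerD2l mulrAC ler_pdivrMr // ler_pM2l //.
by apply: le_trans (ler_norm C) _; rewrite lerDl.
Qed.

(** The barrier needs strict inequalities for the initial value and for the speed. Adding e (s + 1)
    to the bound provides both, and e then tends to 0. *)
Lemma mvi V (u du : R -> V) (b db : R -> R) :
  (forall t : R, 0 <= t <= 1 -> {for t, continuous u}) ->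
  (forall t : R, 0 <= t <= 1 -> {for t, continuous b}) ->
  (forall t : R, 0 < t < 1 -> is_derive t 1 u (du t)) ->
  (forall t : R, 0 < t < 1 -> is_derive t 1 b (db t)) ->
  (forall t : R, 0 < t < 1 -> `|du t| <= db t) ->
  forall t : R, 0 <= t <= 1 -> `|u t - u 0| <= b t - b 0.
Proof.
move=> cu cb Hu Hb H t tI; apply: (@le_slack _ _ 2) => e e0.
have dl (s : R) : is_derive s 1 (fun x : R => e * (x + 1)) e.
  have h1 : is_derive s 1 (fun x : R => x + 1) 1.
    by have := is_deriveD (is_derive_id s (1 : R)) (is_derive_cst (1 : R) s 1); rewrite addr0.
  by have := is_derive_lin h1 (@islin_scale R _ _ e _ (@islin_id R R)); rewrite [_ *: 1]mulr1.
have := @barrier R V (fun s => u s - u 0) du (fun s => b s - b 0 + e * (s + 1)) (fun s => db s + e).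
move=> /(_ _ _ _ _ _ _ t tI) /= B; apply: le_trans (B _ _ _ _ _ _) _.
- by move=> s sI; apply: cvgB; [exact: cu|exact: cvg_cst].
- move=> s sI; apply: cvgD; last exact: is_derive_continuous (dl s).
  by apply: cvgB; [exact: cb|exact: cvg_cst].
- move=> s sI; have := is_deriveB (Hu s sI) (is_derive_cst (u 0) s 1).
  by rewrite subr0.
- move=> s sI; apply: (is_deriveD _ (dl s)).
  by have := is_deriveB (Hb s sI) (is_derive_cst (b 0) s 1); rewrite subr0.
- by rewrite !subrr normr0 !add0r mulr1.
- by move=> s sI _; apply: le_lt_trans (H s sI) _; rewrite ltrDl.
- by rewrite lerD2l ler_pM2l //; case/andP: tI; lra.
Qed.

(** The exponential itself is the barrier, and the gap between [c] and [c'] absorbs the source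
    [eta]. The differential inequality is required only while [u] is smaller than [rho], so
    constants valid in a tube around a curve suffice: the conclusion keeps [u] inside the tube. *)
Lemma gronwall V (u du : R -> V) (a c c' eta rho : R) :
  (forall t : R, 0 <= t <= 1 -> {for t, continuous u}) ->
  (forall t : R, 0 < t < 1 -> is_derive t 1 u (du t)) ->
  `|u 0| <= a -> 0 <= c -> c < c' -> eta <= (c' - c) * a -> a * expR c' < rho ->
  (forall t : R, 0 < t < 1 -> `|u t| < rho -> `|du t| <= c * `|u t| + eta) ->
  forall t : R, 0 <= t <= 1 -> `|u t| <= a * expR (c' * t).
Proof.
move=> cu Hu u0 c0 cc' etaa arho H t tI.
have a0 : 0 <= a by apply: le_trans u0.
have c'0 : 0 < c' by apply: le_lt_trans cc'.
(* Half of the room left below [rho], so that (a + e0) exp c' is still smaller than [rho]. *)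
pose e0 := (rho - a * expR c') / expR c' / 2.
have e00 : 0 < e0 by rewrite /e0 !divr_gt0 ?subr_gt0 // expR_gt0.
have key e : 0 < e -> e <= e0 -> `|u t| <= (a + e) * expR (c' * t).
  move=> ep ee0.
  apply: (@barrier R V u du (fun s => (a + e) * expR (c' * s))
     (fun s => c' * ((a + e) * expR (c' * s)))) tI => //.
  - by move=> s sI; exact: cont_expc.
  - by move=> s sI; exact: is_derive_expc.
  - by rewrite mulr0 expR0 mulr1; apply: le_lt_trans u0 _; rewrite ltrDl.
  - move=> s /[dup] sI /andP[s0 s1] E.
    have ae0 : 0 < a + e by rewrite ltr_wpDl.
    have b1 : a + e <= `|u s|.
      by rewrite E ler_pMr // -(@expR0 R) ler_expR mulr_ge0 // ltW.
    have b2 : `|u s| < rho.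
      rewrite E; apply: (@le_lt_trans _ _ ((a + e) * expR c')).
        by rewrite ler_pM2l // ler_expR ger_pMr // ltW.
      apply: (@le_lt_trans _ _ ((a + e0) * expR c')).
        by rewrite ler_pM2r ?expR_gt0 // lerD2l.
      rewrite mulrDl /e0 -(@ltrD2l _ (- (a * expR c'))) addKr mulrAC.
      by rewrite mulrVK ?unitfE ?gt_eqF ?expR_gt0 //; lra.
    apply: le_lt_trans (H s sI b2) _; rewrite -E.
    have : (c' - c) * a < (c' - c) * `|u s|.
      by rewrite ltr_pM2l ?subr_gt0 // (lt_le_trans _ b1) // ltrDl.
    lra.
apply: (@le_slack _ _ (expR (c' * t))) => e ep.
have := key (Num.min e e0); rewrite lt_min ep e00 => /(_ isT).
rewrite ge_min lexx orbT => /(_ isT) K; apply: le_trans K _.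
by rewrite mulrDl lerD2l ler_pM2r ?expR_gt0 // ge_min lexx.
Qed.

(** Curves matter on [0, 1] only. Composition with this retraction makes them continuous on the
    whole line, so that no one-sided continuity has to be carried along. *)
Definition clamp (t : R) : R := Num.max 0 (Num.min t 1).
Lemma clampE (t : R) : 0 <= t <= 1 -> clamp t = t.
Proof. by move=> /andP[t0 t1]; rewrite /clamp min_l // max_r. Qed.
Lemma clampP (t : R) : 0 <= clamp t <= 1.
Proof. by rewrite /clamp le_max lexx /= ge_max ler01 /= ge_min lexx orbT. Qed.
Lemma clamp_continuous : continuous clamp.
Proof.
move=> t; have c0 : {for t, continuous (cst 0 : R -> R)} by exact: cvg_cst.
have c1 : {for t, continuous (cst 1 : R -> R)} by exact: cvg_cst.
have c2 : {for t, continuous (id : R -> R)} by exact: cvg_id.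
exact: (continuous_max c0 (continuous_min c2 c1)).
Qed.
Lemma near_clampE (t : R) : 0 < t < 1 -> \forall s \near t, s = clamp s.
Proof.
move=> /andP[t0 t1]; near=> s; rewrite clampE //; apply/andP; split; apply/ltW.
  by near: s; exact: lt_nbhsr.
by near: s; exact: lt_nbhsl.
Unshelve. all: by end_near. Qed.

Lemma primitiveR (f : R -> R) : continuous f -> exists F : R -> R,
  [/\ continuous F, F 0 = 0 & forall t : R, 0 < t < 1 -> is_derive t 1 F (f t)].
Proof.
move=> cf.
(* Integration starts at -1 so that 0 is an interior point and the primitive is continuous there as
   well. *)
pose F0 (x : R) : R := (\int[lebesgue_measure]_(t in `[(-1 : R), x]) f t)%R.
have H (x : R) : -1 < x -> is_derive x 1 F0 (f x).
  move=> x1.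
  have xu : x < x + 1 by rewrite ltrDl.
  have fi : lebesgue_measure.-integrable [set` `[(-1 : R), x + 1]] (EFin \o f).
    apply: continuous_compact_integrable; first exact: segment_compact.
    exact: continuous_subspaceT.
  case: (continuous_FTC1 xu fi _ (cf x)) => [|d e]; first by rewrite /= lte_fin.
  by rewrite -e derive1E; exact: derivableP.
exists (fun t => F0 (clamp t) - F0 (clamp 0)); split.
- move=> t; apply: cvgB; last exact: cvg_cst.
  have ct : -1 < clamp t by have /andP[c0 _] := clampP t; lra.
  apply: (continuous_comp (@clamp_continuous t)).
  exact: is_derive_continuous (H _ ct).
- by rewrite subrr.
- move=> t tI; have t1 : -1 < t by case/andP: tI; lra.
  apply: (near_eq_is_derive (f := fun t => F0 t - F0 (clamp 0))).
    by near do congr (F0 _ - _); exact: near_clampE.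
  by have := is_deriveB (H t t1) (is_derive_cst (F0 (clamp 0)) t 1); rewrite subr0.
Unshelve. all: by end_near. Qed.

Lemma primitive V (f : R -> V) : findim V -> continuous f -> exists F : R -> V,
  [/\ continuous F, F 0 = 0 & forall t : R, 0 < t < 1 -> is_derive t 1 F (f t)].
Proof.
move=> [m [e [c [lc Ec]]]] cf.
have /choice[F HF] : forall i, exists F : R -> R,
  [/\ continuous F, F 0 = 0 & forall t : R, 0 < t < 1 -> is_derive t 1 F (c i (f t))].
  move=> i; apply: primitiveR => t; apply: (continuous_comp (cf t)); exact: (lc i).2.
have l1 i := islin_scalev (e i).
exists (fun t => \sum_i F i t *: e i); split.
- move=> t; apply: cvg_finsum => i.
  have [cF _ _] := HF i.
  exact: (continuous_comp (cF t) ((l1 i).2 (F i t))).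
- by rewrite big1 // => i _; have [_ -> _] := HF i; rewrite scale0r.
- move=> t tI; rewrite [X in is_derive _ _ _ X]Ec.
  have D i : is_derive t 1 (fun s => F i s *: e i) (c i (f t) *: e i).
    by have [_ _ /(_ t tI) d] := HF i; exact: (is_derive_lin d (l1 i)).
  have := is_derive_sum D.
  by congr (is_derive _ _ _ _); apply/funext => s; rewrite fct_sumE.
Qed.

End Gronwall.

Section Picard.
Context {R : realType}.
Implicit Types V W Z : normedModType R.

(** Integration is a contraction on all of [0, 1] once the sup norm carries a suitable exponential
    weight, so no subdivision of the time interval is needed. *)
Lemma picard V (f : R -> V -> V) (L : R) z : findim V -> 0 < L ->
  (forall g : R -> V, continuous g -> continuous (fun s => f s (g s))) ->
  (forall s x y, `|f s x - f s y| <= L * `|x - y|) ->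
  exists g : R -> V, [/\ continuous g, g 0 = z &
    forall t : R, 0 < t < 1 -> is_derive t 1 g (f t (g t))].
Proof.
move=> fV L0 cf lf.
have /choice[P HP] : forall g : R -> V, exists G : R -> V, continuous g ->
  [/\ continuous G, G 0 = 0 & forall t : R, 0 < t < 1 -> is_derive t 1 G (f t (g t))].
  move=> g; have [cg|] := pselect (continuous g); last by exists g.
  by have [G HG] := primitive fV (cf g cg); exists G.
pose g := fix g (n : nat) : R -> V := if n is m.+1 then fun t => z + P (g m) t else fun=> z.
have cg n : continuous (g n).
  elim: n => [|n IH] /= t; first exact: cvg_cst.
  by have [cP _ _] := HP _ IH; apply: cvgD; [exact: cvg_cst|exact: cP].
have g0 n : g n 0 = z.
  by case: n => [//|n] /=; have [_ -> _] := HP _ (cg n); rewrite addr0.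
have dg n (t : R) : 0 < t < 1 -> is_derive t 1 (g n.+1) (f t (g n t)).
  move=> tI; have [_ _ /(_ t tI) d] := HP _ (cg n).
  by have := is_deriveD (is_derive_cst z t 1) d; rewrite add0r.
have [M M0 HM] : exists2 M, 0 <= M & forall t : R, 0 <= t <= 1 -> `|g 1%N t - g 0%N t| <= M.
  have ch : {within `[(0 : R), 1], continuous (fun t => `|g 1%N t - g 0%N t|)}.
    apply: continuous_subspaceT => t; apply: cvg_norm; apply: cvgB; exact: cg.
  have [c _ Hc] := EVT_max ler01 ch.
  by exists `|g 1%N c - g 0%N c| => // t tI; apply: Hc; rewrite in_itv.
(* With the weight exp (2 L t), integrating a bound multiplied by [L] gains the factor 1/2, whatever
   [L] is. *)
have step n (t : R) : 0 <= t <= 1 ->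
    `|g n.+1 t - g n t| <= M * 2^-1 ^+ n * expR (2 * L * t).
  elim: n t => [|n IH] t tI.
    rewrite expr0 mulr1; apply: le_trans (HM t tI) _; rewrite ler_peMr //.
    by case/andP: tI => t0 _; rewrite -(@expR0 R) ler_expR !mulr_ge0 // ltW.
  pose B := M * 2^-1 ^+ n.+1.
  have B0 : 0 <= B by rewrite mulr_ge0 // exprn_ge0.
  have := @mvi R V (fun t => g n.+2 t - g n.+1 t) (fun t => f t (g n.+1 t) - f t (g n t))
    (fun t => B * expR (2 * L * t)) (fun t => 2 * L * (B * expR (2 * L * t))).
  move=> /(_ _ _ _ _ _ t tI); rewrite !g0 subrr subr0 mulr0 expR0 mulr1.
  move=> H; apply: le_trans (H _ _ _ _ _) _.
  - by move=> s _; apply: cvgB; exact: cg.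
  - by move=> s _; exact: cont_expc.
  - by move=> s sI; apply: is_deriveB; exact: dg.
  - by move=> s _; exact: is_derive_expc.
  - move=> s /andP[s0 s1]; apply: le_trans (lf _ _ _) _.
    have sI : 0 <= s <= 1 by rewrite !ltW.
    have := IH s sI; rewrite -(ler_pM2l L0) => IHs.
    apply: le_trans IHs _; rewrite /B exprS le_eqVlt; apply/orP; left; apply/eqP; by field.
  - by rewrite lerBlDr lerDl.
have e2L : 0 < expR (2 * L) by exact: expR_gt0.
have /choice[l Hl] : forall t, exists l, forall n,
    `|g n (clamp t) - l| <= 2 * (M * expR (2 * L)) * 2^-1 ^+ n.
  move=> t; apply: (@geom_cauchy R V (fun n => g n (clamp t))) => // n.
  apply: le_trans (step n (clamp t) (clampP t)) _.
  rewrite mulrAC ler_wpM2r ?exprn_ge0 // ler_wpM2l // ler_expR.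
  by have /andP[_ c1] := clampP t; rewrite ler_piMr // mulr_ge0 // ltW.
pose K := 2 * (M * expR (2 * L)).
have K0 : 0 <= K by rewrite !mulr_ge0 // ltW.
have half0 C : (fun n => C * 2^-1 ^+ n) @ \oo --> (0 : R).
  by apply: cvg_geometric; rewrite ger0_norm // invf_lt1 // ltr1n.
have cl : continuous l.
  move=> t; apply/cvgrPdist_le => e e0.
  have e3 : 0 < e / 3 by rewrite divr_gt0.
  have /cvgrPdist_lt/(_ _ e3)[N _ /(_ N (leqnn N))] := half0 K.
  rewrite /= sub0r normrN ger0_norm ?mulr_ge0 ?exprn_ge0 // => HN.
  have cc : {for t, continuous (fun t => g N (clamp t))}.
    exact: (continuous_comp (@clamp_continuous R t) (cg N _)).
  have /cvgrPdist_lt/(_ _ e3) := cc.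
  apply: filterS => s Hs.
  have -> : l t - l s = (g N (clamp t) - g N (clamp s)) - (g N (clamp t) - l t) + (g N (clamp s) - l s).
    by lmod R.
  apply: le_trans (ler_normD _ _) _.
  have n1 := ler_normB (g N (clamp t) - g N (clamp s)) (g N (clamp t) - l t).
  have n2 := Hl t N; have n3 := Hl s N; rewrite -/K in n2 n3; lra.
have [cP P0 dP] := HP _ cl.
(* The limit [l] comes without a derivative. Its Picard image [G] has one, and it equals [l] on
   [0, 1] since both are limits of the iterates. *)
pose G t := z + P l t.
have cG : continuous G by move=> t; apply: cvgD; [exact: cvg_cst|exact: cP].
have dG (t : R) : 0 < t < 1 -> is_derive t 1 G (f t (l t)).
  by move=> tI; have := is_deriveD (is_derive_cst z t 1) (dP t tI); rewrite add0r.
have G0 : G 0 = z by rewrite /G P0 addr0.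
have near_ n (t : R) : 0 <= t <= 1 -> `|g n.+1 t - G t| <= L * K * 2^-1 ^+ n * t.
  move=> tI.
  pose B := L * K * 2^-1 ^+ n.
  have dB (s : R) : is_derive s 1 (fun s => B * s) B.
    by have := is_derive_lin (is_derive_id s (1 : R)) (@islin_scale R _ _ B _ (@islin_id R R)); rewrite [_ *: 1]mulr1.
  have := @mvi R V (fun t => g n.+1 t - G t) (fun t => f t (g n t) - f t (l t))
    (fun t => B * t) (fun t => B).
  move=> /(_ _ _ _ _ _ t tI); rewrite g0 G0 subrr subr0 mulr0 subr0; apply.
  - by move=> s _; apply: cvgB; [exact: cg|exact: cG].
  - by move=> s _; exact: is_derive_continuous (dB s).
  - by move=> s sI; apply: is_deriveB; [exact: dg|exact: dG].
  - move=> s /andP[s0 s1]; apply: le_trans (lf _ _ _) _.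
    rewrite /B -mulrA ler_pM2l //.
    by have := Hl s n; rewrite clampE // !ltW.
have Gl (t : R) : 0 <= t <= 1 -> l t = G t.
  move=> tI; apply/eqP; rewrite -subr_eq0 -normr_le0.
  have cvK := half0 (K + L * K).
  apply/ler_addgt0Pr => e e0.
  have /cvgrPdist_lt/(_ _ e0)[N _ /(_ N (leqnn N))] := cvK.
  rewrite /= sub0r normrN ger0_norm ?mulr_ge0 ?addr_ge0 ?exprn_ge0 ?mulr_ge0 ?(ltW L0) // => HN.
  rewrite add0r.
  have -> : l t - G t = (g N.+1 t - G t) - (g N.+1 t - l t) by lmod R.
  apply: le_trans (ler_normB _ _) _; apply: le_trans (ltW HN).
  have n1 := near_ N t tI; have n2 := Hl t N.+1; rewrite clampE // -/K in n2.
  rewrite mulrDl addrC; apply: lerD.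
    apply: le_trans n2 _; rewrite ler_wpM2l // exprS ler_piMl ?exprn_ge0 //.
    by rewrite invf_le1 // ler1n.
  apply: le_trans n1 _; rewrite ler_piMr ?mulr_ge0 ?exprn_ge0 ?(ltW L0) //.
  by case/andP: tI.
exists G; split => // t /[dup] tI /andP[t0 t1].
by rewrite -Gl; [exact: dG|rewrite !ltW].
Qed.
End Picard.

(** * Strict differentiability, uniformity on compact sets, symmetry of second derivatives *)

Section Strict.
Context {R : realType}.
Implicit Types V W Z : normedModType R.

Lemma ball_seg V (z x y : V) d (t : R) : ball z d x -> ball z d y -> 0 <= t <= 1 ->
  ball z d (y + t *: (x - y)).
Proof.
rewrite -!ball_normE /= => bx by_ /andP[t0 t1].
have -> : z - (y + t *: (x - y)) = (1 - t) *: (z - y) + t *: (z - x) by lmod R.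
apply: le_lt_trans (ler_normD _ _) _; rewrite !normrZ ger0_norm ?subr_ge0 // ger0_norm //.
have [->|tn0] := eqVneq t 0; first by rewrite subr0 mul1r mul0r addr0.
have tp : 0 < t by rewrite lt_neqAle eq_sym tn0.
have h1 : (1 - t) * `|z - y| <= (1 - t) * d by rewrite ler_wpM2l ?subr_ge0 // ltW.
have h2 : t * `|z - x| < t * d by rewrite ltr_pM2l.
lra.
Qed.

Lemma seg_derive V (x y : V) (t : R) : is_derive t 1 (fun s : R => y + s *: (x - y)) (x - y).
Proof.
have := is_deriveD (is_derive_cst y t 1) (is_derive_lin (is_derive_id t (1 : R)) (islin_scalev (x - y))).
by rewrite add0r scale1r.
Qed.

(** The mean value inequality for s |-> f (y + s (x - y)) - s l. With the value of a fixed
    derivative as [l], it yields two-point estimates. *)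
Lemma seg_mvi V W (f : V -> W) (l : W) (x y : V) C :
  (forall t : R, 0 <= t <= 1 -> differentiable f (y + t *: (x - y)) /\
     `|'D_(x - y) f (y + t *: (x - y)) - l| <= C) ->
  `|f x - f y - l| <= C.
Proof.
move=> H.
have D (t : R) : 0 <= t <= 1 -> is_derive t 1 (fun s => f (y + s *: (x - y)) - s *: l)
    ('D_(x - y) f (y + t *: (x - y)) - l).
  move=> tI; have [df _] := H t tI.
  have d1 := is_derive_comp (seg_derive x y t) df.
  have d2 := is_derive_lin (is_derive_id t (1 : R)) (islin_scalev l).
  by rewrite scale1r in d2; exact: is_deriveB.
have dC (t : R) : is_derive t 1 (fun s : R => C * s) C.
  by have := is_derive_lin (is_derive_id t (1 : R)) (@islin_scale R _ _ C _ (@islin_id R R)); rewrite [_ *: 1]mulr1.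
have wk (t : R) : 0 < t < 1 -> 0 <= t <= 1 by move=> /andP[? ?]; rewrite !ltW.
have I1 : 0 <= (1 : R) <= 1 by rewrite ler01 lexx.
have := @mvi R W (fun s => f (y + s *: (x - y)) - s *: l) (fun s => 'D_(x - y) f (y + s *: (x - y)) - l)
  (fun s => C * s) (fun=> C).
move=> /(_ _ _ _ _ _ 1 I1).
rewrite !scale1r !scale0r addr0 subr0 mulr1 mulr0 subr0 (addrC y) subrK addrAC; apply.
- by move=> t tI; exact: is_derive_continuous (D t tI).
- by move=> t tI; exact: is_derive_continuous (dC t).
- by move=> t /wk tI; exact: D.
- by move=> t /wk tI; case: (H t tI).
Qed.

Lemma strict_diff V W (A : set V) (f : V -> W) z eta : findim V -> open A ->
  CT 1 A f -> A z -> 0 < eta -> exists d : R, [/\ 0 < d,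
    forall x, ball z d x -> A x,
    forall x, ball z d x -> forall v, `|'D_v f x - 'D_v f z| <= eta * `|v| &
    forall x y, ball z d x -> ball z d y ->
       `|f x - f y - 'D_(x - y) f z| <= eta * `|x - y|].
Proof.
move=> fV oA cf Az eta0.
have H : \forall x \near z, A x /\ forall v, `|'D_v f x - 'D_v f z| <= eta * `|v|.
  near=> x; split; near: x; first exact: (open_nbhs_nbhs (conj oA Az)).
  exact: (near_derive_op fV oA cf Az).
have [d /= d0 Hd] := (nbhs_ballP _ _).1 H.
exists d; split=> // [x /Hd[]//|x /Hd[]//|x y bx by_].
apply: seg_mvi => t tI; have [At HD] := Hd _ (ball_seg bx by_ tI).
by split; [exact: CT_diff cf At|exact: HD].
Unshelve. all: by end_near. Qed.

Lemma near0_ball V (z : V) (d : R) (P : R -> V -> Prop) : 0 < d ->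
  (forall e x, 0 < e <= d -> ball z d x -> P e x) ->
  \forall x \near z & e \near 0^'+, P e x.
Proof.
move=> d0 H; exists (ball z d, [set e | 0 < e <= d]).
  split; first exact: nbhsx_ballx.
  near=> e; apply/andP; split => //; near: e; exact: nbhs_right_le.
by move=> [x e] [/= bx ed]; exact: H.
Unshelve. all: by end_near. Qed.

(** The compactness argument used throughout. A single small [e] serves as a radius and, through its
    inverse, as a bound or a Lipschitz constant, so one parameter carries everything that must be
    made uniform. *)
Lemma cpt_unif V (K : set V) (P : R -> V -> Prop) : compact K ->
  (forall z, K z -> exists2 d : R, 0 < d & forall e x, 0 < e <= d -> ball z d x -> P e x) ->
  exists2 d : R, 0 < d & forall e x, 0 < e <= d -> K x -> P e x.
Proof.
move=> /compact_near_coveringP cK H.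
have : \forall e \near 0^'+, K `<=` P e.
  by apply: cK => z /H[d d0 Hd]; exact: (near0_ball d0).
move=> [d /= d0 Hd]; exists (d / 2); first by rewrite divr_gt0.
move=> e x /andP[e0 ed]; apply: Hd => //=.
rewrite sub0r normrN gtr0_norm //; lra.
Qed.

Lemma strict_diff_cpt V W (A K : set V) (f : V -> W) eta : findim V -> open A ->
  CT 1 A f -> compact K -> K `<=` A -> 0 < eta -> exists2 d : R, 0 < d &
    forall z, K z -> forall x y, ball z d x -> ball z d y ->
       [/\ A x, `|f x - f y - 'D_(x - y) f z| <= eta * `|x - y| &
           forall v, `|'D_v f x - 'D_v f z| <= eta * `|v| ].
Proof.
move=> fV oA cf cK KA eta0.
have [d d0 Hd] : exists2 d : R, 0 < d & forall e z, 0 < e <= d -> K z ->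
    forall x y, ball z e x -> ball z e y ->
       [/\ A x, `|f x - f y - 'D_(x - y) f z| <= eta * `|x - y| &
           forall v, `|'D_v f x - 'D_v f z| <= eta * `|v| ].
  apply: cpt_unif => // z0 Kz0.
  have eta2 : 0 < eta / 2 by rewrite divr_gt0.
  have [d [d0 dA dD dS]] := strict_diff fV oA cf (KA _ Kz0) eta2.
  exists (d / 2); first by rewrite divr_gt0.
  move=> e z /andP[e0 ed] bz x y bx by_.
  have bd w : ball z e w -> ball z0 d w.
    move=> bw; rewrite -[d](@subrK _ (d / 2)); apply: ball_triangle (le_ball _ bw).
      by move: bz; apply: le_ball; lra.
    lra.
  have bz' : ball z0 d z by apply: bd; exact: ballxx.
  have := dS x y (bd _ bx) (bd _ by_); have := dD z bz' (x - y) => h1 h2.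
  split; first exact/dA/bd.
    have -> : f x - f y - 'D_(x - y) f z = f x - f y - 'D_(x - y) f z0 - ('D_(x - y) f z - 'D_(x - y) f z0).
      by lmod R.
    apply: le_trans (ler_normB _ _) _; lra.
  move=> v.
  have -> : 'D_v f x - 'D_v f z = 'D_v f x - 'D_v f z0 - ('D_v f z - 'D_v f z0) by lmod R.
  have h3 := dD x (bd _ bx) v; have h4 := dD z bz' v.
  apply: le_trans (ler_normB _ _) _; lra.
exists d => // z Kz; apply: (Hd d z) => //; by rewrite d0 lexx.
Qed.

(** Membership in [A] is part of the estimate, so the radius also keeps points inside the domain. *)
Definition locLip V W (A : set V) (f : V -> W) : Prop := forall z, A z ->
  exists d : R, 0 < d /\ exists L : R, forall x y, ball z d x -> ball z d y ->
    A x /\ `|f x - f y| <= L * `|x - y|.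

Lemma CT1_locLip V W (A : set V) (f : V -> W) : findim V -> open A ->
  CT 1 A f -> locLip A f.
Proof.
move=> fV oA cf z Az.
have [d [d0 dA _ dS]] := strict_diff fV oA cf Az ltr01.
have [c c0 Hc] := islin_bound (diff_eps (CT_diff cf Az)).1.
exists d; split=> //; exists (1 + c) => x y bx by_; split; first exact: dA.
have := dS x y bx by_; have := Hc (x - y); rewrite mulrDl => h1 h2.
rewrite -[f x - f y](@subrK _ ('D_(x - y) f z)).
by apply: le_trans (ler_normD _ _) _; exact: lerD.
Qed.

Lemma locLip_cpt V W (A K : set V) (f : V -> W) : locLip A f -> compact K -> K `<=` A ->
  exists d L : R, [/\ 0 < d, 0 < L & forall z, K z -> forall x y, ball z d x -> ball z d y ->
    A x /\ `|f x - f y| <= L * `|x - y|].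
Proof.
move=> lf cK KA.
have [d d0 Hd] : exists2 d : R, 0 < d & forall e z, 0 < e <= d -> K z ->
    forall x y, ball z e x -> ball z e y -> A x /\ `|f x - f y| <= e^-1 * `|x - y|.
  apply: cpt_unif => // z0 Kz0.
  have [d [d0 [L HL]]] := lf _ (KA _ Kz0).
  (* The second term makes the inverse of any admissible [e] at least the local Lipschitz
     constant. *)
  pose d' := Num.min (d / 2) (`|L| + 1)^-1.
  have L1 : 0 < `|L| + 1 by rewrite ltr_wpDl.
  have d'0 : 0 < d' by rewrite lt_min divr_gt0 //= invr_gt0.
  exists d' => // e z /andP[e0]; rewrite le_min => /andP[ed eL] bz x y bx by_.
  have bd w : ball z e w -> ball z0 d w.
    move=> bw; rewrite -[d](@subrK _ (d / 2)); apply: ball_triangle (le_ball _ bw).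
      by move: bz; apply: le_ball; rewrite /d' ge_min; apply/orP; left; lra.
    lra.
  have [Ax Hxy] := HL x y (bd _ bx) (bd _ by_); split=> //.
  apply: le_trans Hxy _; apply: ler_wpM2r => //.
  rewrite -(invrK L) -[leRHS]invrK.
  apply: (@le_trans _ _ (`|L| + 1)).
    by rewrite invrK (le_trans (ler_norm _)) // lerDl.
  by rewrite invrK -[leLHS]invrK lef_pV2 // posrE invr_gt0.
exists d, d^-1; rewrite invr_gt0; split=> // z Kz; apply: (Hd d z) => //; by rewrite d0 lexx.
Qed.

(* Local Lipschitz constants suffice on a non-convex compact set: far-apart points are
   handled by boundedness. *)
Lemma locLip_on_cpt V W (A K : set V) (f : V -> W) : locLip A f -> compact K -> K `<=` A ->
  exists2 L : R, 0 < L & forall x y, K x -> K y -> `|f x - f y| <= L * `|x - y|.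
Proof.
move=> lf cK KA; have [d [L [d0 L0 HL]]] := locLip_cpt lf cK KA.
have [B B0 HB] : exists2 B : R, 0 < B & forall x, K x -> `|f x| <= B.
  have [e e0 He] : exists2 d : R, 0 < d & forall e z, 0 < e <= d -> K z -> `|f z| <= e^-1.
    apply: cpt_unif => // z0 Kz0.
    have L1 : 0 < `|f z0| + L * d by rewrite ltr_wpDl // mulr_gt0.
    exists (Num.min d (`|f z0| + L * d)^-1); first by rewrite lt_min d0 invr_gt0.
    move=> e x /andP[e0]; rewrite le_min => /andP[ed eL] bx.
    have bx' : ball z0 d x by move: bx; apply: le_ball; rewrite ge_min lexx.
    have [_ h] := HL _ Kz0 x z0 bx' (ballxx _ d0).
    apply: (@le_trans _ _ (`|f z0| + L * d)); last first.
      by rewrite -[leLHS]invrK lef_pV2 // posrE invr_gt0.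
    have : `|f x| <= `|f z0| + `|f x - f z0|.
      by rewrite -{1}(subrK (f z0) (f x)) addrC; exact: ler_normD.
    move=> h1; apply: le_trans h1 _; rewrite lerD2l; apply: le_trans h _.
    by rewrite ler_pM2l //; move: bx'; rewrite -ball_normE /= distrC => /ltW.
  exists e^-1; first by rewrite invr_gt0.
  by move=> x Kx; apply: He => //; rewrite e0 lexx.
exists (L + 2 * B / d); first by rewrite addr_gt0 // divr_gt0 // mulr_gt0.
move=> x y Kx Ky; have [lt|ge] := ltP `|x - y| d.
  have by_ : ball x d y by rewrite -ball_normE.
  have [_ h] := HL x Kx x y (ballxx _ d0) by_; apply: le_trans h _.
  by rewrite ler_wpM2r // lerDl divr_ge0 ?mulr_ge0 ?ltW.
apply: le_trans (ler_normB _ _) _; apply: le_trans (lerD (HB _ Kx) (HB _ Ky)) _.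
have : 2 * B <= 2 * B / d * `|x - y|.
  by rewrite mulrAC ler_pdivlMr // ler_pM2l // mulr_gt0.
have : 0 <= L * `|x - y| by rewrite mulr_ge0 // ltW.
rewrite mulrDl; lra.
Qed.

(** The second difference of [f] along t v and t w is symmetric in v and w; divided by t^2 it tends
    to either of the two mixed derivatives. *)
Lemma schwarz V W (A : set V) (f : V -> W) z v w : findim V -> open A ->
  CT 2 A f -> A z -> 'D_v ('D_w f) z = 'D_w ('D_v f) z.
Proof.
move=> fV oA cf Az.
pose Dl t := f (z + t *: v + t *: w) - f (z + t *: v) - f (z + t *: w) + f z.
have half (a b : V) eta : 0 < eta -> \forall t \near (0 : R)^'+,
   `|(f (z + t *: a + t *: b) - f (z + t *: b) - (f (z + t *: a) - f z))
     - t *: (t *: 'D_a ('D_b f) z)| <= eta * t * t.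
  move=> eta0.
  have cD := CT_derive b oA cf.
  have a1 : 0 < `|a| + 1 by rewrite ltr_wpDl.
  have b1 : 0 < `|b| + 1 by rewrite ltr_wpDl.
  have e1 : 0 < eta / (`|a| + 1) by rewrite divr_gt0.
  have [d [d0 dA _ dS]] := strict_diff fV oA cD Az e1.
  have dp : 0 < d / (`|a| + 1 + (`|b| + 1)) by rewrite divr_gt0 // addr_gt0.
  near=> t.
  have t0 : 0 < t by [].
  have td : t * (`|a| + 1 + (`|b| + 1)) < d.
    rewrite -ltr_pdivlMr; last by rewrite addr_gt0.
    by near: t; exact: (nbhs_right_lt dp).
  have inb c c' : 0 <= c <= 1 -> 0 <= c' <= 1 -> ball z d (z + (c * t) *: a + (c' * t) *: b).
    move=> /andP[c0 c1] /andP[c'0 c'1].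
    rewrite -ball_normE /= -addrA opprD addrA subrr sub0r normrN.
    apply: le_lt_trans (ler_normD _ _) _; apply: le_lt_trans td.
    rewrite !normrZ !ger0_norm ?mulr_ge0 ?(ltW t0) //.
    have h1 : c * t * `|a| <= t * `|a| by rewrite ler_wpM2r // ler_piMl // ltW.
    have h2 : c' * t * `|b| <= t * `|b| by rewrite ler_wpM2r // ler_piMl // ltW.
    lra.
  (* The second difference is the increment of [g] along t b. The mean value inequality for [g]
     leaves a difference of first derivatives of [f], to which strict differentiability applies. *)
  pose g x := f (x + t *: a) - f x.
  have -> : f (z + t *: a + t *: b) - f (z + t *: b) - (f (z + t *: a) - f z)
     = g (z + t *: b) - g z by rewrite /g (addrAC z (t *: a)).
  apply: seg_mvi => s sI.
  have -> : z + t *: b - z = t *: b by lmod R.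
  have E : z + s *: (t *: b) = z + (0 * t) *: a + (s * t) *: b by lmod R.
  have E' : z + s *: (t *: b) + t *: a = z + (1 * t) *: a + (s * t) *: b by lmod R.
  have I0 : 0 <= (0 : R) <= 1 by rewrite ler01 lexx.
  have I1 : 0 <= (1 : R) <= 1 by rewrite ler01 lexx.
  have b0 := inb _ _ I0 sI; have bb1 := inb _ _ I1 sI; rewrite -E in b0; rewrite -E' in bb1.
  set x := z + s *: (t *: b) in E E' b0 bb1 *.
  have df1 := CT_diff cf (dA _ b0); have df2 := CT_diff cf (dA _ bb1).
  have [ds Es] : differentiable (fun y => y + t *: a) x /\ forall h, 'D_h (fun y => y + t *: a) x = h.
    apply: eps_diff; first exact: islin_id.
    move=> e e0; near=> y; have -> : y + t *: a - (x + t *: a) - (y - x) = 0 by lmod R.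
    by rewrite normr0 mulr_ge0 // ltW.
  have df2' : differentiable (fun y => f (y + t *: a)) x by exact: (differentiable_comp ds df2).
  split; first exact: differentiableB.
  have -> : 'D_(t *: b) g x = t *: ('D_b f (x + t *: a) - 'D_b f x).
    rewrite (deriveB (diff_derivable df2') (diff_derivable df1)).
    rewrite (derive_compE (t *: b) ds df2) Es.
    rewrite (islinZ _ _ (diff_eps df1).1) (islinZ _ _ (diff_eps df2).1).
    by rewrite scalerBr.
  rewrite -scalerBr normrZ gtr0_norm // mulrC ler_pM2r //.
  have := dS _ _ bb1 b0.
  have -> : x + t *: a - x = t *: a by lmod R.
  rewrite (islinZ _ _ (diff_eps (CT_diff cD Az)).1) => h; apply: le_trans h _.
  rewrite normrZ gtr0_norm // mulrCA [leRHS]mulrC ler_pM2l //.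
  by rewrite mulrAC ler_pdivrMr // ler_pM2l // lerDl.
apply/eqP; rewrite -subr_eq0 -normr_le0; apply/ler_addgt0Pr => eta eta0; rewrite add0r.
have eta2 : 0 < eta / 2 by rewrite divr_gt0.
have half1 := half v w _ eta2; have half2 := half w v _ eta2.
have : \forall t \near (0 : R)^'+, `|'D_v ('D_w f) z - 'D_w ('D_v f) z| <= eta.
  have t_gt0 : \forall t \near (0 : R)^'+, 0 < t by exact: nbhs_right_gt.
  move: half1 half2 t_gt0; apply: filterS3 => t h1 h2 t0.
  rewrite [z + t *: w + _]addrAC in h2.
  rewrite -(@ler_pM2l _ (t * t)) ?mulr_gt0 // -[X in X * `|_|]gtr0_norm ?mulr_gt0 // -normrZ.
  move: h1 h2; set a1 := f _; set a2 := f _; set a3 := f _; set a4 := f _.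
  set D1 := 'D_v _ _; set D2 := 'D_w _ _ => h1 h2.
  have -> : (t * t) *: (D1 - D2) = (a1 - a3 - (a2 - a4) - t *: (t *: D2)) - (a1 - a2 - (a3 - a4) - t *: (t *: D1)).
    by lmod R.
  apply: le_trans (ler_normB _ _) _.
  rewrite (_ : t * t * eta = eta / 2 * t * t + eta / 2 * t * t); last by field.
  exact: (lerD h2 h1).
by move=> /filter_ex[].
Unshelve. all: by end_near. Qed.
End Strict.

(** * Existence, uniqueness and stability of integral curves *)

Section Flow.
Context {R : realType}.
Implicit Types V W Z : normedModType R.

Lemma near_dist V (x : V) (e : R) : 0 < e -> \forall y \near x, `|x - y| <= e.
Proof.
move=> e0; apply: filterS (nbhsx_ballx x _ e0) => y.
by rewrite -ball_normE /= => /ltW.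
Qed.

Lemma linear_bounded_islin V W (f : V -> W) c :
  (forall a x y, f (a *: x + y) = a *: f x + f y) ->
  (forall x, `|f x| <= c * `|x|) -> islin f.
Proof.
move=> lf H; split => // x; apply/cvgrPdist_le => e e0.
have c1 : 0 < `|c| + 1 by rewrite ltr_wpDl.
near=> y.
have -> : f x - f y = f (x - y).
  by rewrite -scaleN1r addrC -lf scaleN1r addrC.
apply: le_trans (H _) _; apply: (@le_trans _ _ ((`|c| + 1) * `|x - y|)).
  by rewrite ler_wpM2r // (le_trans (ler_norm c)) // lerDl.
rewrite mulrC -ler_pdivlMr //; near: y.
by apply: near_dist; rewrite divr_gt0.
Unshelve. all: by end_near. Qed.

(** Radial retraction onto the ball of radius [rho]. It truncates a field outside a tube to make it
    globally Lipschitz without changing it inside. *)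
Definition retr V (rho : R) (w : V) : V := (rho / Num.max rho `|w|) *: w.

Lemma retr_id V rho (w : V) : 0 < rho -> `|w| <= rho -> retr rho w = w.
Proof. by move=> r0 wr; rewrite /retr max_l // divff ?scale1r // gt_eqF. Qed.

Lemma retr_norm V rho (w : V) : 0 < rho -> `|retr rho w| <= rho.
Proof.
move=> r0; have m0 : 0 < Num.max rho `|w| by rewrite lt_max r0.
rewrite /retr normrZ gtr0_norm ?divr_gt0 // mulrAC ler_pdivrMr // ler_pM2l //.
by rewrite le_max lexx orbT.
Qed.

Lemma retr_lip V rho (x y : V) : 0 < rho -> `|retr rho x - retr rho y| <= 2 * `|x - y|.
Proof.
move=> r0; rewrite /retr; set a := Num.max rho `|x|; set b := Num.max rho `|y|.
have a0 : 0 < a by rewrite lt_max r0.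
have b0 : 0 < b by rewrite lt_max r0.
have ra : rho <= a by rewrite le_max lexx.
have yb : `|y| <= b by rewrite le_max lexx orbT.
have -> : (rho / a) *: x - (rho / b) *: y = (rho / a) *: (x - y) + ((rho / a) * ((b - a) / b)) *: y.
  rewrite (_ : rho / a * ((b - a) / b) = rho / a - rho / b); first by lmod R.
  by field; rewrite !gt_eqF.
have ab : `|b - a| <= `|x - y|.
  have := ler_dist_dist x y; rewrite distrC !ler_norml => /andP[h1 h2].
  rewrite /a /b; apply/andP.
  by case: (leP rho `|x|) => h3; case: (leP rho `|y|) => h4; split; have := normr_ge0 (x - y); lra.
apply: le_trans (ler_normD _ _) _; rewrite !normrZ !normfV.
rewrite !(gtr0_norm r0) !(gtr0_norm a0) !(gtr0_norm b0).
have ra1 : rho / a <= 1 by rewrite ler_pdivrMr // mul1r.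
have yb1 : `|y| / b <= 1 by rewrite ler_pdivrMr // mul1r.
have ra0 : 0 <= rho / a by rewrite divr_ge0 // ltW.
have h1 : rho / a * `|x - y| <= `|x - y| by rewrite ler_piMl.
have h2 : rho / a * (`|b - a| / b) * `|y| <= `|b - a|.
  rewrite (_ : _ * _ = (rho / a) * (`|y| / b) * `|b - a|); last by field; rewrite !gt_eqF.
  by rewrite ler_piMl // mulr_ile1 // divr_ge0 // ltW.
lra.
Qed.

(** Time is normalised to [0, 1]; other times, negative ones included, are obtained by scaling the
    field. Continuity on the whole line is arranged with [clamp]. *)
Definition icurve V (X : V -> V) (z : V) (g : R -> V) : Prop :=
  [/\ g 0 = z, continuous g & forall t : R, 0 < t < 1 -> is_derive t 1 g (X (g t))].

Definition idom V (A : set V) (X : V -> V) : set V :=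
  [set z | exists g, icurve X z g /\ forall t : R, 0 <= t <= 1 -> A (g t)].

Lemma curve_cpt V (g : R -> V) : continuous g -> compact (g @` `[(0 : R), 1]).
Proof.
move=> cg; apply: continuous_compact; last exact: segment_compact.
exact: continuous_subspaceT.
Qed.

Lemma curve_in V (g : R -> V) (t : R) : 0 <= t <= 1 -> (g @` `[(0 : R), 1]) (g t).
Proof. by move=> tI; exists t => //=; rewrite in_itv. Qed.

Lemma curve_sub V (g : R -> V) (A : set V) : (forall t : R, 0 <= t <= 1 -> A (g t)) ->
  (g @` `[(0 : R), 1]) `<=` A.
Proof. by move=> H _ [t /= + <-]; rewrite in_itv /= => /H. Qed.

(** Gronwall with initial error 0: the Lipschitz bound in a tube around the compact image of [g] is
    enough, and nothing is assumed about where [g'] goes. *)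
Lemma icurve_unique V (A : set V) (X : V -> V) z g g' : locLip A X ->
  icurve X z g -> (forall t : R, 0 <= t <= 1 -> A (g t)) -> icurve X z g' ->
  forall t : R, 0 <= t <= 1 -> g' t = g t.
Proof.
move=> lX [g0 cg dg] gA [g'0 cg' dg'] t tI.
have [d [L [d0 L0 HL]]] := locLip_cpt lX (curve_cpt cg) (curve_sub gA).
apply/eqP; rewrite -subr_eq0 -normr_le0 -(mul0r (expR ((L + 1) * t))).
apply: (@gronwall _ _ (fun t => g' t - g t) (fun t => X (g' t) - X (g t)) 0 L (L + 1) 0 d) tI.
- by move=> s _; apply: cvgB; [exact: cg'|exact: cg].
- by move=> s sI; apply: is_deriveB; [exact: dg'|exact: dg].
- by rewrite g0 g'0 subrr normr0.
- exact: ltW.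
- by rewrite ltrDl.
- by rewrite mulr0.
- by rewrite mul0r.
- move=> s /andP[s0 s1] us; rewrite addr0.
  have sI : 0 <= s <= 1 by rewrite !ltW.
  have b1 : ball (g s) d (g' s) by rewrite -ball_normE /= distrC.
  by have [_] := HL _ (curve_in g sI) _ _ b1 (ballxx _ d0).
Qed.

(** The field is truncated outside a tube around [g0], Picard solves the truncated equation, and
    Gronwall shows that for close initial values the solution stays in the tube, where it solves the
    original equation. *)
Lemma idom_nbhs V (A : set V) (X : V -> V) z0 g0 : findim V -> locLip A X ->
  icurve X z0 g0 -> (forall t : R, 0 <= t <= 1 -> A (g0 t)) ->
  exists r C : R, [/\ 0 < r, 0 < C & forall z, `|z - z0| < r -> exists g,
    icurve X z g /\ forall t : R, 0 <= t <= 1 -> A (g t) /\ `|g t - g0 t| <= C * `|z - z0| ].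
Proof.
move=> fV lX [g00 cg0 dg0] gA.
have [d [L [d0 L0 HL]]] := locLip_cpt lX (curve_cpt cg0) (curve_sub gA).
pose rho := d / 2.
have rho0 : 0 < rho by rewrite divr_gt0.
have rd : rho < d by rewrite /rho; lra.
pose gc s := g0 (clamp s).
have cgc : continuous gc by move=> s; exact: (continuous_comp (@clamp_continuous R s) (cg0 _)).
pose f s x := X (gc s + retr rho (x - gc s)).
have inb s x : ball (gc s) d (gc s + retr rho (x - gc s)).
  rewrite -ball_normE /= opprD addrA subrr sub0r normrN.
  by apply: le_lt_trans rd; exact: retr_norm.
have Kgc s : (g0 @` `[(0 : R), 1]) (gc s) by apply: curve_in; exact: clampP.
have retc (w : V) : {for w, continuous (@retr V rho)}.
  apply/cvgrPdist_le => e e0; near=> y.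
  apply: le_trans (retr_lip _ _ rho0) _; rewrite mulrC -ler_pdivlMr //.
  by near: y; apply: near_dist; rewrite divr_gt0.
have cX s x : {for gc s + retr rho (x - gc s), continuous X}.
  set w := gc s + _; have [d' [d'0 [L' HL']]] := lX w (HL _ (Kgc s) _ _ (inb s x) (inb s x)).1.
  have c1 : 0 < `|L'| + 1 by rewrite ltr_wpDl.
  apply/cvgrPdist_le => e e0; near=> y.
  have [|_ h] := HL' w y (ballxx _ d'0); first by near: y; exact: nbhsx_ballx.
  apply: le_trans h _; apply: (@le_trans _ _ ((`|L'| + 1) * `|w - y|)).
    by rewrite ler_wpM2r // (le_trans (ler_norm _)) // lerDl.
  rewrite mulrC -ler_pdivlMr //; near: y.
  by apply: near_dist; rewrite divr_gt0.
have cf (g : R -> V) : continuous g -> continuous (fun s => f s (g s)).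
  move=> cg s; have c1 : {for s, continuous (fun s => g s - gc s)}.
    by apply: cvgB; [exact: cg|exact: cgc].
  have c2 : {for s, continuous (fun s => gc s + retr rho (g s - gc s))}.
    apply: cvgD; first exact: cgc.
    exact: (continuous_comp c1 (retc _)).
  exact: (continuous_comp c2 (cX s (g s))).
have lf s x y : `|f s x - f s y| <= 2 * L * `|x - y|.
  have [_ h] := HL _ (Kgc s) _ _ (inb s x) (inb s y); apply: le_trans h _.
  rewrite opprD addrACA subrr add0r (mulrC 2) -mulrA ler_pM2l //.
  apply: le_trans (retr_lip _ _ rho0) _.
  by rewrite opprB addrA subrK.
have e0 := expR_gt0 (L + 1).
exists (rho / expR (L + 1)), (expR (L + 1)); split => //; first by rewrite divr_gt0.
move=> z; rewrite ltr_pdivlMr // => zr.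
have L20 : 0 < 2 * L by rewrite mulr_gt0.
have [g [cg gz dg]] := picard z fV L20 cf lf.
have main : forall t : R, 0 <= t <= 1 -> `|g t - g0 t| <= `|z - z0| * expR ((L + 1) * t).
  apply: (@gronwall _ _ (fun t => g t - g0 t) (fun t => f t (g t) - X (g0 t)) `|z - z0| L (L + 1) 0 rho) => //.
  - by move=> s _; apply: cvgB; [exact: cg|exact: cg0].
  - by move=> s sI; apply: is_deriveB; [exact: dg|exact: dg0].
  - by rewrite gz g00.
  - exact: ltW.
  - by rewrite ltrDl.
  - by rewrite addrAC subrr add0r mul1r.
  - move=> s /andP[s0 s1] us; rewrite addr0.
    have sI : 0 <= s <= 1 by rewrite !ltW.
    have b1 : ball (g0 s) d (g s) by rewrite -ball_normE /= distrC (lt_trans us).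
    rewrite /f /gc clampE // (retr_id rho0 (ltW us)) [g0 s + _]addrC subrK.
    by have [_] := HL _ (curve_in g0 sI) _ _ b1 (ballxx _ d0).
have main' (t : R) : 0 <= t <= 1 -> `|g t - g0 t| <= expR (L + 1) * `|z - z0|.
  move=> tI; apply: le_trans (main t tI) _; rewrite mulrC ler_wpM2r // ler_expR.
  by case/andP: tI => _ t1; rewrite ler_piMr // addr_ge0 // ltW.
have small (t : R) : 0 <= t <= 1 -> `|g t - g0 t| < rho.
  by move=> /main' h; apply: le_lt_trans h _; rewrite mulrC.
exists g; split.
  split=> // t /[dup] tI /andP[t0 t1]; have tI' : 0 <= t <= 1 by rewrite !ltW.
  have := dg t tI; rewrite /f /gc clampE // (retr_id rho0 (ltW (small t tI'))).
  by rewrite [g0 t + _]addrC subrK.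
move=> t tI; split; last exact: main'.
have b1 : ball (g0 t) d (g t) by rewrite -ball_normE /= distrC (lt_trans (small t tI)).
by have [] := HL _ (curve_in g0 tI) _ _ b1 b1.
Unshelve. all: by end_near. Qed.
End Flow.

(** * Differentiability of flows *)

Section Variational.
Context {R : realType}.
Implicit Types V W Z : normedModType R.

Definition fl V (X : V -> V) (z : V) : V := xget z [set g 1 | g in icurve X z].

Lemma flE V (A : set V) (X : V -> V) z g : locLip A X -> icurve X z g ->
  (forall t : R, 0 <= t <= 1 -> A (g t)) -> fl X z = g 1.
Proof.
move=> lX ig gA; rewrite /fl; case: xgetP => [y -> [g' ig' <-]|/(_ (g 1))[]]; last by exists g.
by apply: (icurve_unique lX ig gA ig'); rewrite ler01 lexx.
Qed.

Lemma open_idom V (A : set V) (X : V -> V) : findim V -> locLip A X -> open (idom A X).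
Proof.
move=> fV lX; rewrite openE => z [g [ig gA]].
have [r [C [r0 C0 H]]] := idom_nbhs fV lX ig gA.
apply/nbhs_ballP; exists r => // y; rewrite -ball_normE /= distrC => /H[g' [ig' H']].
by exists g'; split=> // t /H'[].
Qed.

Lemma fl_continuous V (A : set V) (X : V -> V) : findim V -> locLip A X ->
  CT 0 (idom A X) (fl X).
Proof.
move=> fV lX z [g [ig gA]].
have [r [C [r0 C0 H]]] := idom_nbhs fV lX ig gA.
apply/cvgrPdist_le => e e0; near=> y.
have I1 : 0 <= (1 : R) <= 1 by rewrite ler01 lexx.
have [|g' [ig' H']] := H y.
  by near: y; apply: filterS (nbhsx_ballx z _ r0) => y; rewrite -ball_normE /= distrC.
rewrite (flE lX ig gA) (flE lX ig' (fun t tI => (H' t tI).1)) distrC.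
apply: le_trans (H' 1 I1).2 _; rewrite distrC mulrC -ler_pdivlMr //.
by near: y; apply: near_dist; rewrite divr_gt0.
Unshelve. all: by end_near. Qed.

Variables (V : normedModType R) (A : set V) (X : V -> V).
Hypotheses (fV : findim V) (oA : open A) (cX : CT 1 A X).
Let lX : locLip A X := CT1_locLip fV oA cX.

Lemma op_bound_cpt (K : set V) : compact K -> K `<=` A ->
  exists2 M : R, 0 < M & forall z, K z -> forall v, `|'D_v X z| <= M * `|v|.
Proof.
move=> cK KA.
have [e e0 He] : exists2 d : R, 0 < d & forall e z, 0 < e <= d -> K z ->
    forall v, `|'D_v X z| <= e^-1 * `|v|.
  apply: cpt_unif => // z0 Kz0.
  have [d [d0 dA dD _]] := strict_diff fV oA cX (KA _ Kz0) ltr01.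
  have [c c0 Hc] := islin_bound (diff_eps (CT_diff cX (KA _ Kz0))).1.
  have c1 : 0 < 1 + c by rewrite addr_gt0.
  exists (Num.min d (1 + c)^-1); first by rewrite lt_min d0 invr_gt0.
  move=> e x /andP[e0]; rewrite le_min => /andP[ed ec] bx v.
  have bx' : ball z0 d x by move: bx; apply: le_ball; rewrite ge_min lexx.
  apply: (@le_trans _ _ ((1 + c) * `|v|)).
    rewrite -['D_v X x](@subrK _ ('D_v X z0)) mulrDl.
    apply: le_trans (ler_normD _ _) _; apply: lerD; last exact: Hc.
    exact: dD.
  by rewrite ler_wpM2r // -[leLHS]invrK lef_pV2 // posrE invr_gt0.
exists e^-1; first by rewrite invr_gt0.
by move=> z Kz v; apply: He => //; rewrite e0 lexx.
Qed.

(* [y] solves the variational equation along [g]. *)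
Definition vcurve (g : R -> V) (v : V) (y : R -> V) : Prop :=
  [/\ y 0 = v, continuous y & forall t : R, 0 < t < 1 -> is_derive t 1 y ('D_(y t) X (g t))].

Lemma vcurve_bound g v y M : (forall t : R, 0 <= t <= 1 -> forall w, `|'D_w X (g t)| <= M * `|w|) ->
  0 < M -> vcurve g v y -> forall t : R, 0 <= t <= 1 -> `|y t| <= `|v| * expR ((M + 1) * t).
Proof.
move=> HM M0 [y0 cy dy]; apply: (@gronwall _ _ y (fun t => 'D_(y t) X (g t)) `|v| M (M + 1) 0
   (`|v| * expR (M + 1) + 1)) => //.
- by move=> t _; exact: cy.
- by rewrite y0.
- exact: ltW.
- by rewrite ltrDl.
- by rewrite addrAC subrr add0r mul1r.
- by rewrite ltrDl.
- by move=> t /andP[t0 t1] _; rewrite addr0; apply: HM; rewrite !ltW.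
Qed.

Lemma vcurve_lin g v w a y x : (forall t : R, 0 <= t <= 1 -> A (g t)) ->
  vcurve g v y -> vcurve g w x -> vcurve g (a *: v + w) (fun t => a *: y t + x t).
Proof.
move=> gA [y0 cy dy] [x0 cx dx]; split.
- by rewrite y0 x0.
- by move=> t; apply: cvgD; [apply: cvgZl_tmp; exact: cy|exact: cx].
- move=> t tI; have At : A (g t) by apply: gA; case/andP: tI => ? ?; rewrite !ltW.
  have [lD _] := diff_eps (CT_diff cX At).
  rewrite lD.1; apply: is_deriveD; last exact: dx.
  exact: is_derive_lin (dy t tI) (@islin_scale R V V a _ (@islin_id R V)).
Qed.

Lemma vcurve_ex g v : continuous g -> (forall t : R, 0 <= t <= 1 -> A (g t)) ->
  exists y, vcurve g v y.
Proof.
move=> cg gA.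
have [M M0 HM] := op_bound_cpt (curve_cpt cg) (curve_sub gA).
pose gc s := g (clamp s).
have gcA s : A (gc s) by apply/gA/clampP.
pose f s x := 'D_x X (gc s).
have cf (x : R -> V) : continuous x -> continuous (fun s => f s (x s)).
  move=> cx s.
  have cgc : {for s, continuous gc} by exact: (continuous_comp (@clamp_continuous R s) (cg _)).
  have cp : {for s, continuous (fun s => (gc s, x s))} by apply: cvg_pair => //; exact: cx.
  have [_ /(_ (gc s, x s) (conj (gcA s) I)) ct] := cX.
  have := continuous_comp cp ct => /(@cvg_comp _ _ _ _ snd) h.
  by apply: h; exact: cvg_snd.
have lf s x y : `|f s x - f s y| <= M * `|x - y|.
  have [lD _] := diff_eps (CT_diff cX (gcA s)).
  by rewrite /f -(islinB _ _ lD); apply: HM; apply: curve_in; exact: clampP.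
have [y [cy y0 dy]] := picard v fV M0 cf lf.
exists y; split=> // t /[dup] tI /andP[t0 t1].
by have := dy t tI; rewrite /f /gc clampE // !ltW.
Qed.

Lemma vcurve_unique g v y y' : continuous g -> (forall t : R, 0 <= t <= 1 -> A (g t)) ->
  vcurve g v y -> vcurve g v y' -> forall t : R, 0 <= t <= 1 -> y t = y' t.
Proof.
move=> cg gA vy vy' t tI.
have [M M0 HM] := op_bound_cpt (curve_cpt cg) (curve_sub gA).
have := vcurve_lin (-1) gA vy' vy; rewrite scaleN1r addNr => h.
have := vcurve_bound (fun s sI => HM _ (curve_in g sI)) M0 h tI.
rewrite normr0 mul0r normr_le0 scaleN1r addrC subr_eq0 => /eqP //.
Qed.

(** The difference of two integral curves minus the variational solution satisfies a linear
    inequality whose source, by strict differentiability of [X], is a small multiple of the distance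
    of the initial points. *)
Lemma fl_diff z g v y : icurve X z g -> (forall t : R, 0 <= t <= 1 -> A (g t)) ->
  vcurve g v y -> differentiable (fl X) z /\ 'D_v (fl X) z = y 1.
Proof.
move=> ig gA vy; have [gz cg dg] := ig.
have I1 : 0 <= (1 : R) <= 1 by rewrite ler01 lexx.
have cK := curve_cpt cg; have KA := curve_sub gA.
have [M M0 HM] := op_bound_cpt cK KA.
have HMg t (tI : 0 <= t <= 1) := HM _ (curve_in g tI).
have /choice[Y HY] : forall v, exists y, vcurve g v y by move=> w; exact: vcurve_ex.
pose L w := Y w 1.
have lL : islin L.
  apply: (@linear_bounded_islin _ _ _ _ (expR (M + 1))).
    move=> a w x; exact: (vcurve_unique cg gA (HY _) (vcurve_lin a gA (HY w) (HY x)) I1).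
  by move=> w; have := vcurve_bound HMg M0 (HY w) I1; rewrite mulr1 mulrC.
have [r [C [r0 C0 H]]] := idom_nbhs fV lX ig gA.
have [dd Ed] : differentiable (fl X) z /\ forall w, 'D_w (fl X) z = L w.
  apply: eps_diff => // e e0.
  (* [C] bounds the spreading of the curves and the exponential is Gronwall's factor; their product
     turns [eta] into the prescribed [e]. *)
  pose eta := e / (C * expR (M + 1)).
  have Ce : 0 < C * expR (M + 1) by rewrite mulr_gt0 // expR_gt0.
  have eta0 : 0 < eta by rewrite divr_gt0.
  have [d d0 Hd] := strict_diff_cpt fV oA cX cK KA eta0.
  have dC : 0 < d / (C + 1) by rewrite divr_gt0 // addr_gt0.
  have C1 : 0 < C + 1 by rewrite addr_gt0.
  near=> x.
  have xr : `|x - z| < r by rewrite distrC; near: x; apply: filterS (nbhsx_ballx z _ r0) => x; rewrite -ball_normE.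
  have xd : `|x - z| * (C + 1) <= d.
    by rewrite -ler_pdivlMr // distrC; near: x; exact: near_dist.
  have [g' [ig' H']] := H x xr.
  have [g'x cg' dg'] := ig'.
  rewrite (flE lX ig' (fun t tI => (H' t tI).1)) (flE lX ig gA).
  have [y0 cy dy] := HY (x - z).
  set w := Y (x - z) in y0 cy dy.
  pose a := eta * C * `|x - z|.
  have a0 : 0 <= a by apply: mulr_ge0 => //; apply: mulr_ge0; exact: ltW.
  have -> : e * `|x - z| = a * expR ((M + 1) * 1).
    rewrite /a /eta mulr1; have := expR_gt0 (M + 1).
    by move: (expR (M + 1)) => E E0; field; rewrite !gt_eqF.
  apply: (@gronwall _ _ (fun t => g' t - g t - w t) (fun t => X (g' t) - X (g t) - 'D_(w t) X (g t))
     a M (M + 1) a (a * expR (M + 1) + 1)) I1 => //.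
  - move=> t _; apply: cvgB; last exact: cy.
    by apply: cvgB; [exact: cg'|exact: cg].
  - move=> t tI; apply: is_deriveB; last exact: dy.
    by apply: is_deriveB; [exact: dg'|exact: dg].
  - by rewrite g'x gz y0 subrr normr0.
  - exact: ltW.
  - by rewrite ltrDl.
  - by rewrite addrAC subrr add0r mul1r.
  - by rewrite ltrDl.
  - move=> t /andP[t0 t1] _.
    have tI : 0 <= t <= 1 by rewrite !ltW.
    have Kt := curve_in g tI.
    have [_ gg] := H' t tI.
    have b1 : ball (g t) d (g' t).
      rewrite -ball_normE /= distrC; apply: le_lt_trans gg _.
      have [->|xz] := eqVneq x z; first by rewrite subrr normr0 mulr0.
      have : 0 < `|x - z| by rewrite normr_gt0 subr_eq0.
      lra.
    have [_ h _] := Hd _ Kt _ _ b1 (ballxx _ d0).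
    have [lD _] := diff_eps (CT_diff cX (KA _ Kt)).
    have -> : X (g' t) - X (g t) - 'D_(w t) X (g t) =
      (X (g' t) - X (g t) - 'D_(g' t - g t) X (g t)) + 'D_(g' t - g t - w t) X (g t).
      by rewrite !(islinB _ _ lD); lmod R.
    apply: le_trans (ler_normD _ _) _; rewrite addrC; apply: lerD; first exact: HM.
    by apply: le_trans h _; rewrite /a -mulrA ler_pM2l.
split=> //; rewrite Ed /L.
exact: (vcurve_unique cg gA (HY v) vy I1).
Unshelve. all: by end_near. Qed.

Lemma icurve_tgt z g v y : icurve X z g -> vcurve g v y ->
  icurve (tgt X) (z, v) (fun t => (g t, y t)).
Proof.
move=> [gz cg dg] [y0 cy dy]; split.
- by rewrite gz y0.
- by move=> t; apply: cvg_pair; [exact: cg|exact: cy].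
- by move=> t tI; apply: is_derive_pair; [exact: dg|exact: dy].
Qed.

Lemma icurve_tgt_inv z v w : icurve (tgt X) (z, v) w ->
  icurve X z (fun t => (w t).1) /\ vcurve (fun t => (w t).1) v (fun t => (w t).2).
Proof.
move=> [w0 cw dw]; split; split.
- by rewrite w0.
- by move=> t; apply: (continuous_comp (cw t)); exact: cvg_fst.
- by move=> t tI; exact: is_derive_lin (dw t tI) (islin_fst V V).
- by rewrite w0.
- by move=> t; apply: (continuous_comp (cw t)); exact: cvg_snd.
- by move=> t tI; exact: is_derive_lin (dw t tI) (islin_snd V V).
Qed.

Lemma idom_tgt z v : idom A X z -> idom (A `*` setT) (tgt X) (z, v).
Proof.
move=> [g [ig gA]]; have [_ cg _] := ig; have [y vy] := vcurve_ex v cg gA.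
exists (fun t => (g t, y t)); split; first exact: icurve_tgt.
by move=> t tI; split => //=; exact: gA.
Qed.

(** The field [tgt X] is only continuous here, so its curves are not unique by a Lipschitz argument.
    Uniqueness comes from its triangular shape: the first component is a curve of [X], and the
    second solves a linear equation along it. *)
Lemma fl_tgt z v : idom A X z -> fl (tgt X) (z, v) = tgt (fl X) (z, v).
Proof.
move=> [g [ig gA]]; have [_ cg _] := ig; have [y vy] := vcurve_ex v cg gA.
have I1 : 0 <= (1 : R) <= 1 by rewrite ler01 lexx.
have [_ E] := fl_diff ig gA vy.
rewrite /tgt /= E (flE lX ig gA) /fl; case: xgetP => [_ -> [w iw <-]|].
  have [iw1 vw2] := icurve_tgt_inv iw; have [_ cw _] := iw1.
  have Ew t : 0 <= t <= 1 -> (w t).1 = g t by exact: icurve_unique lX ig gA iw1 t.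
  rewrite [LHS]surjective_pairing Ew //; congr (_, _).
  have vw2' : vcurve g v (fun t => (w t).2).
    have [h1 h2 h3] := vw2; split=> // t /[dup] tI /andP[t0 t1].
    by rewrite -Ew; [exact: h3|rewrite !ltW].
  exact: (vcurve_unique cg gA vw2' vy I1).
move=> /(_ (g 1, y 1)) []; exists (fun t => (g t, y t)) => //.
exact: icurve_tgt.
Qed.

(** For the same reason continuous dependence cannot be quoted for [tgt X]. Two variational
    solutions are compared directly, by linearity in the solution and continuity of the derivative
    of [X] along the base curve. *)
Lemma fl_tgt_continuous : CT 0 (idom A X `*` setT) (tgt (fl X)).
Proof.
move=> [z v] [/= dz _].
have [g [ig gA]] := dz; have [gz cg dg] := ig.
have [y vy] := vcurve_ex v cg gA; have [y0 cy dy] := vy.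
have I1 : 0 <= (1 : R) <= 1 by rewrite ler01 lexx.
have cK := curve_cpt cg; have KA := curve_sub gA.
have [M M0 HM] := op_bound_cpt cK KA.
have HMg t (tI : 0 <= t <= 1) := HM _ (curve_in g tI).
have [r [C [r0 C0 H]]] := idom_nbhs fV lX ig gA.
pose B := `|v| * expR (M + 1).
have HB (t : R) : 0 <= t <= 1 -> `|y t| <= B.
  move=> tI; apply: le_trans (vcurve_bound HMg M0 vy tI) _.
  rewrite ler_wpM2l // ler_expR; case/andP: tI => _ t1.
  by rewrite ler_piMr // addr_ge0 // ltW.
have B0 : 0 <= B by rewrite mulr_ge0 // expR_ge0.
apply/cvgrPdist_le => e e0.
pose E2 := expR (M + 2).
have E20 : 0 < E2 by exact: expR_gt0.
(* The bound 1 turns the variation of the derivative into an increase of the Lipschitz constant from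
   M to M + 1; the other bound keeps the contribution of the source [eta * B] below e / 2. *)
pose eta := Num.min 1 (e / (2 * E2 * (B + 1))).
have B1 : 0 < B + 1 by rewrite ltr_wpDl.
have eta0 : 0 < eta by rewrite lt_min ltr01 divr_gt0 // !mulr_gt0.
have eta1 : eta <= 1 by rewrite ge_min lexx.
have etaB : eta * B * E2 <= e / 2.
  have : eta * (2 * E2 * (B + 1)) <= e.
    by rewrite -ler_pdivlMr ?mulr_gt0 // ge_min lexx orbT.
  have : 0 <= eta * E2 by rewrite mulr_ge0 // ltW.
  nra.
have [d d0 Hd] := strict_diff_cpt fV oA cX cK KA eta0.
have dC : 0 < d / (C + 1) by rewrite divr_gt0 // addr_gt0.
have C1 : 0 < C + 1 by rewrite addr_gt0.
have eE : 0 < e / (2 * E2) by rewrite divr_gt0 // mulr_gt0.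
have eC : 0 < e / C by rewrite divr_gt0.
have Nz (dl : R) : 0 < dl -> \forall p \near (z, v), `|p.1 - z| < dl /\ `|p.2 - v| < dl.
  move=> dl0; apply: filterS (nbhsx_ballx (z, v) _ dl0) => -[p q] [].
  by rewrite -!ball_normE /= => h1 h2; rewrite !(distrC _ z) !(distrC _ v).
near=> p.
have [p1r _] : `|p.1 - z| < r /\ `|p.2 - v| < r by near: p; exact: Nz.
have [p1d _] : `|p.1 - z| < d / (C + 1) /\ `|p.2 - v| < d / (C + 1) by near: p; exact: Nz.
have [p1e _] : `|p.1 - z| < e / C /\ `|p.2 - v| < e / C by near: p; exact: Nz.
have [_ p2e] : `|p.1 - z| < e / (2 * E2) /\ `|p.2 - v| < e / (2 * E2) by near: p; exact: Nz.
have [g' [ig' H']] := H p.1 p1r.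
have g'A t tI := (H' t tI).1.
have [g'x cg' dg'] := ig'.
have [y' vy'] := vcurve_ex p.2 cg' g'A; have [y'0 cy' dy'] := vy'.
have [_ Ep] := fl_diff ig' g'A vy'.
have [_ Ez] := fl_diff ig gA vy.
rewrite /tgt /= Ep Ez (flE lX ig gA) (flE lX ig' g'A) prod_normE /= ge_max; apply/andP; split.
  rewrite distrC; apply: le_trans (H' 1 I1).2 _.
  by rewrite mulrC -ler_pdivlMr // ltW.
pose a := `|p.2 - v| + eta * B.
have a0 : 0 <= a by rewrite addr_ge0 // mulr_ge0 // ltW.
rewrite distrC.
apply: (@le_trans _ _ (a * expR ((M + 2) * 1))); last first.
  rewrite mulr1 mulrDl [e]splitr; apply: lerD => //.
  by move: (ltW p2e); rewrite invfM mulrA ler_pdivlMr.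
apply: (@gronwall _ _ (fun t => y' t - y t) (fun t => 'D_(y' t) X (g' t) - 'D_(y t) X (g t))
   a (M + 1) (M + 2) (eta * B) (a * expR (M + 2) + 1)) I1.
- by move=> t _; apply: cvgB; [exact: cy'|exact: cy].
- by move=> t tI; apply: is_deriveB; [exact: dy'|exact: dy].
- by rewrite y'0 y0 lerDl mulr_ge0 // ltW.
- by rewrite addr_ge0 // ltW.
- by rewrite ltrD2l ltr1n.
- by rewrite (_ : M + 2 - (M + 1) = 1) ?mul1r ?lerDr //; ring.
- by rewrite ltrDl.
- move=> t /andP[t0 t1] _.
  have tI : 0 <= t <= 1 by rewrite !ltW.
  have Kt := curve_in g tI.
  have [_ gg] := H' t tI.
  have b1 : ball (g t) d (g' t).
    rewrite -ball_normE /= distrC; apply: le_lt_trans gg _.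
    have := p1d; rewrite ltr_pdivlMr // => h.
    have [->|xz] := eqVneq p.1 z; first by rewrite subrr normr0 mulr0.
    have : 0 < `|p.1 - z| by rewrite normr_gt0 subr_eq0.
    lra.
  have [_ _ h] := Hd _ Kt _ _ b1 (ballxx _ d0).
  have [lD _] := diff_eps (CT_diff cX (g'A _ tI)).
  have -> : 'D_(y' t) X (g' t) - 'D_(y t) X (g t) =
    ('D_(y' t - y t) X (g' t) - 'D_(y' t - y t) X (g t)) + 'D_(y' t - y t) X (g t)
     + ('D_(y t) X (g' t) - 'D_(y t) X (g t)).
    by rewrite (islinB _ _ lD); lmod R.
  apply: le_trans (ler_normD _ _) _; apply: lerD.
    apply: le_trans (ler_normD _ _) _; rewrite addrC mulrDl; apply: lerD; first exact: HM.
    by apply: le_trans (h _) _; rewrite ler_wpM2r.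
  by apply: le_trans (h _) _; rewrite ler_pM2l //; exact: HB.
Unshelve. all: by end_near. Qed.

End Variational.

Section FlowCT.
Context {R : realType}.

Lemma fl_CT k (V : normedModType R) (A : set V) (X : V -> V) : findim V -> open A ->
  CT k.+1 A X -> CT k.+1 (idom A X) (fl X).
Proof.
elim: k V A X => [|k IH] V A X fV oA cX.
  split; last exact: fl_tgt_continuous.
  move=> z [g [ig gA]]; have [_ cg _] := ig.
  have [y vy] := vcurve_ex fV oA cX 0 cg gA.
  by have [] := fl_diff fV oA cX ig gA vy.
have cX1 : CT 1 A X by exact: CT_le cX.
have oD := open_idom fV (CT1_locLip fV oA cX1).
split.
  move=> z [g [ig gA]]; have [_ cg _] := ig.
  have [y vy] := vcurve_ex fV oA cX1 0 cg gA.
  by have [] := fl_diff fV oA cX1 ig gA vy.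
have [_ cT] := cX.
have h := IH _ _ _ (findim_prod fV fV) (openXT oA) cT.
apply: (@CT_loc _ _ _ _ _ (fl (tgt X))); first exact: openXT.
  by move=> [z v] [/= dz _]; exact: (fl_tgt fV oA cX1).
apply: CT_sub h => -[z v] [/= dz _]; exact: (idom_tgt fV oA cX1).
Qed.
End FlowCT.

(** * Flows for arbitrary times and their joint smoothness in time and point *)

Section TimeFlow.
Context {R : realType}.
Implicit Types V W Z : normedModType R.

Definition sm V W (A : set V) (f : V -> W) : Prop := forall k, CT k A f.

Lemma I01 : 0 <= (1 : R) <= 1. Proof. by rewrite ler01 lexx. Qed.
Lemma oo_cc (t : R) : 0 < t < 1 -> 0 <= t <= 1. Proof. by move=> /andP[? ?]; rewrite !ltW. Qed.

Lemma cont_pair V W Z (f : V -> W) (g : V -> Z) z : {for z, continuous f} ->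
  {for z, continuous g} -> {for z, continuous (fun x => (f x, g x))}.
Proof. by move=> cf cg; apply: cvg_pair. Qed.

Lemma icurve_clamp V (X : V -> V) z (h : R -> V) : h 0 = z ->
  (forall t : R, 0 <= t <= 1 -> {for t, continuous h}) ->
  (forall t : R, 0 < t < 1 -> is_derive t 1 h (X (h t))) ->
  icurve X z (fun t => h (clamp t)).
Proof.
move=> h0 ch dh; split.
- by rewrite clampE // lexx ler01.
- by move=> t; exact: (continuous_comp (@clamp_continuous R t) (ch _ (clampP t))).
- move=> t tI; rewrite clampE ?oo_cc //.
  apply: near_eq_is_derive (dh t tI).
  by have := near_clampE tI; apply: filterS => s <-.
Qed.

Lemma within_clamp V (g : R -> V) (a b : R) (p : R -> R) : continuous p ->
  (forall s, a <= p s <= b) -> {within `[a, b], continuous g} -> continuous (fun s => g (p s)).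
Proof.
move=> cp pI /continuous_within_itvP cg s.
have [ab|ba] := ltP a b; last first.
  have E x : p x = a by have /andP[h1 h2] := pI x; apply/eqP; rewrite eq_le h1 andbT (le_trans h2).
  rewrite (_ : (fun s => g (p s)) = fun=> g a); first exact: cvg_cst.
  by apply/funext => x; rewrite E.
have [ci cl cr] := cg ab.
apply/cvgrPdist_lt => e e0.
have /andP[h1 h2] := pI s.
have : \forall y \near p s, a <= y <= b -> `|g (p s) - g y| < e.
  move: h1; rewrite le_eqVlt => /orP[/eqP <-|h1].
    have /cvgrPdist_lt/(_ _ e0) := cl.
    rewrite near_withinE; apply: filterS => y Hy /andP[]; rewrite le_eqVlt => /orP[/eqP <- _|ay _].
      by rewrite subrr normr0.
    exact: Hy.
  move: h2; rewrite le_eqVlt => /orP[/eqP ->|h2].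
    have /cvgrPdist_lt/(_ _ e0) := cr.
    rewrite near_withinE; apply: filterS => y Hy /andP[_]; rewrite le_eqVlt => /orP[/eqP ->|ay].
      by rewrite subrr normr0.
    exact: Hy.
  have pin : p s \in `]a, b[ by rewrite in_itv /= h1 h2.
  have /cvgrPdist_lt/(_ _ e0) := ci _ pin.
  by apply: filterS => y h _.
move=> /(cp s) h; apply: (@filterS _ (nbhs s) _ _ _ _ h) => y /= hy; exact: (hy (pI y)).
Qed.

Lemma minmax_scale (t s : R) : 0 <= s <= 1 -> Num.min 0 t <= t * s <= Num.max 0 t.
Proof.
move=> /andP[s0 s1]; rewrite ge_min le_max.
have [t0|t0] := leP 0 t.
  have : 0 <= t * s by rewrite mulr_ge0.
  have : t * s <= t by rewrite ler_piMr.
  by move=> h1 h2; rewrite h1 h2 /= orbT.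
have : t * s <= 0 by rewrite mulr_le0_ge0 // ltW.
have : t <= t * s by rewrite ler_niMr // ltW.
by move=> h1 h2; rewrite h1 h2 orbT.
Qed.

Lemma minmax_scale_oo (t s : R) : t != 0 -> 0 < s < 1 -> t * s \in `]Num.min 0 t, Num.max 0 t[.
Proof.
move=> tn /andP[s0 s1]; rewrite in_itv /= gt_min lt_max.
have [t0|t0|E] := ltgtP 0 t; last by rewrite -E eqxx in tn.
  have : 0 < t * s by rewrite mulr_gt0.
  have : t * s < t by rewrite gtr_pMr.
  by move=> h1 h2; rewrite h1 h2 /= orbT.
have : t * s < 0 by rewrite nmulr_rlt0.
have : t < t * s by rewrite ltr_nMr.
by move=> h1 h2; rewrite h1 h2 orbT.
Qed.

Lemma is_derive_affine V (g : R -> V) (a b t : R) (d : V) : is_derive (a + b * t) 1 g d ->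
  is_derive t 1 (fun s => g (a + b * s)) (b *: d).
Proof.
move=> dg.
have da : is_derive t 1 (fun s : R => a + b * s) b.
  have := is_deriveD (is_derive_cst a t 1) (is_derive_lin (is_derive_id t (1 : R)) (@islin_scale R _ _ b _ (@islin_id R R))).
  by rewrite add0r [_ *: _]mulr1.
have [dgd Eg] := is_derive_diff dg.
by have := is_derive_comp da dgd; rewrite Eg.
Qed.

Lemma integral_icurve V (X : V -> V) t z g : integral_curve X t z g ->
  icurve (fun x => t *: X x) z (fun s => g (t * clamp s)).
Proof.
move=> [g0 cg dg]; split.
- by rewrite clampE ?lexx ?ler01 // mulr0.
- apply: (within_clamp _ _ cg).
    by move=> s; apply: cvgM; [exact: cvg_cst|exact: clamp_continuous].
  by move=> s; apply: minmax_scale; exact: clampP.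
- move=> s sI; have [->|tn] := eqVneq t 0.
    rewrite scale0r (_ : (fun _ => _) = cst (g 0)); first exact: is_derive_cst.
    by apply/funext => y; rewrite mul0r.
  rewrite clampE ?oo_cc //.
  apply: (near_eq_is_derive (f := fun s => g (0 + t * s))).
    by have := near_clampE sI; apply: filterS => y {1}->; rewrite add0r.
  by apply: is_derive_affine; rewrite add0r; apply: dg; exact: minmax_scale_oo.
Qed.

Lemma icurve0 V z (g : R -> V) : icurve (fun=> 0) z g -> forall t : R, 0 <= t <= 1 -> g t = z.
Proof.
move=> [g0 cg dg] t tI; apply/eqP; rewrite -subr_eq0 -normr_le0 -g0 -[leRHS](subrr 0).
apply: (@mvi R V g (fun=> 0) (fun=> 0) (fun=> 0)) tI => //.
- by move=> s _; exact: cg.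
- by move=> s _; exact: cvg_cst.
- by move=> s _; rewrite normr0.
Qed.

Lemma icurve_integral V (X : V -> V) t z g : icurve (fun x => t *: X x) z g ->
  exists2 g', integral_curve X t z g' & forall s : R, 0 <= s <= 1 -> g' (t * s) = g s.
Proof.
move=> ig; have [g0 cg dg] := ig; have [t0|tn] := eqVneq t 0.
  exists (cst z); first split=> //.
  - by apply: continuous_subspaceT => x; exact: cvg_cst.
  - by move=> s; rewrite t0 minxx maxxx in_itv /= => /andP[h1 h2]; have := lt_trans h1 h2; rewrite ltxx.
  move=> s sI; rewrite /cst; apply/esym; apply: icurve0 sI.
  have -> // : (fun _ : V => 0 : V) = (fun x => t *: X x).
  by apply/funext => x; rewrite t0 scale0r.
exists (fun s => g (0 + t^-1 * s)); last by move=> s _; rewrite add0r mulrA mulVf // mul1r.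
split.
- by rewrite mulr0 addr0.
- apply: continuous_subspaceT => s; apply: (@continuous_comp _ _ _ (fun s => 0 + t^-1 * s) g); last exact: cg.
  by apply: cvgD; [exact: cvg_cst|apply: cvgM; [exact: cvg_cst|exact: cvg_id]].
- move=> s; rewrite in_itv /= gt_min lt_max => sI.
  have sI' : 0 < t^-1 * s < 1.
    rewrite mulrC; case/andP: sI => /orP h1 /orP h2.
    have [tp|tp|E] := ltgtP 0 t; last by rewrite -E eqxx in tn.
      have h3 : 0 < s by case: h1 => ?; lra.
      have h4 : s < t by case: h2 => ?; lra.
      by rewrite divr_gt0 //= ltr_pdivrMr // mul1r.
    have h3 : s < 0 by case: h2 => ?; lra.
    have h4 : t < s by case: h1 => ?; lra.
    rewrite -[s / t]mulrNN -invrN divr_gt0 ?oppr_gt0 //=.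
    by rewrite ltr_pdivrMr ?oppr_gt0 // mul1r ltrN2.
  rewrite (_ : X _ = t^-1 *: (t *: X (g (0 + t^-1 * s)))); last by rewrite scalerA mulVf // scale1r.
  by apply: is_derive_affine; apply: dg; rewrite add0r.
Qed.

(** The substitution of t s for s covers both signs of t; at t = 0 the interval degenerates and the
    scaled field vanishes. *)
Lemma flow_fl V (X : V -> V) t z : flow X t z = fl (fun x => t *: X x) z.
Proof.
rewrite /flow /fl; congr xget; apply/seteqP; split=> [_ [g ig <-]|_ [g ig <-]].
  exists (fun s => g (t * clamp s)); first exact: integral_icurve.
  by rewrite clampE ?I01 // mulr1.
have [g' ig' E] := icurve_integral ig; exists g' => //.
by rewrite -(E 1 I01) mulr1.
Qed.

(* [clamp] makes the reparametrized curve continuous on the whole line. *)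
Lemma icurve_restrict V (X : V -> V) c z g s s' : icurve (fun x => c *: X x) z g ->
  0 <= s <= 1 -> 0 <= s' <= 1 ->
  icurve (fun x => ((s' - s) * c) *: X x) (g s) (fun t => g (s + (s' - s) * t)).
Proof.
move=> [g0 cg dg] /andP[s0 s1] /andP[s'0 s'1]; split.
- by rewrite mulr0 addr0.
- move=> t; apply: (@continuous_comp _ _ _ (fun t => s + (s' - s) * t) g); last exact: cg.
  by apply: cvgD; [exact: cvg_cst|apply: cvgM; [exact: cvg_cst|exact: cvg_id]].
- move=> t /andP[t0 t1]; have [E|ne] := eqVneq s' s.
    rewrite E subrr mul0r scale0r (_ : (fun _ => _) = cst (g s)); first exact: is_derive_cst.
    by apply/funext => y; rewrite mul0r addr0.
  rewrite -scalerA; apply: is_derive_affine; apply: dg.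
  have -> : s + (s' - s) * t = (1 - t) * s + t * s' by ring.
  have [lt|ge] := ltP s s'.
    have h1 : 0 < t * s' by rewrite mulr_gt0 // (le_lt_trans s0).
    have h2 : (1 - t) * s < (1 - t) * 1 by rewrite ltr_pM2l ?subr_gt0 // (lt_le_trans lt).
    have h3 : t * s' <= t * 1 by rewrite ler_pM2l.
    have h4 : 0 <= (1 - t) * s by rewrite mulr_ge0 // subr_ge0 ltW.
    apply/andP; split; lra.
  have lt : s' < s by rewrite lt_neqAle ne.
  have h1 : 0 < (1 - t) * s by rewrite mulr_gt0 ?subr_gt0 // (le_lt_trans s'0).
  have h2 : (1 - t) * s <= (1 - t) * 1 by rewrite ler_pM2l ?subr_gt0.
  have h3 : t * s' < t * 1 by rewrite ltr_pM2l // (lt_le_trans lt).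
  have h4 : 0 <= t * s' by rewrite mulr_ge0 // ltW.
  apply/andP; split; lra.
Qed.

End TimeFlow.

Section Joint.
Context {R : realType} {V : normedModType R}.
Variable X : V -> V.
Hypotheses (fV : findim V) (sX : sm setT X).
Implicit Types (t s : R) (z : V).

Definition fdom : set (R * V)%type := [set p | exists g, icurve (fun x => p.1 *: X x) p.2 g].
(** The time is adjoined as a constant component of the state, so that smoothness in (t, z) is
    smoothness of a single time-one flow. *)
Definition jfield (p : (R * V)%type) : (R * V)%type := (0, p.1 *: X p.2).

Let sXc c : CT 1 setT (fun x => c *: X x).
Proof. by apply: CT_scalec; [exact: openT|exact: sX]. Qed.

Lemma sm_jfield : sm setT jfield.
Proof.
move=> k; apply: CT_pair; [exact: openT|exact: CT_cst|].
apply: CT_scale; [exact: openT|exact: CT_lin (islin_fst _ _)|].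
exact: (CT_pre (@openT _) (islin_snd R V) (fun _ _ => I) (sX k)).
Qed.

Lemma icurve_jfield t z w : icurve jfield (t, z) w -> forall s, 0 <= s <= 1 -> (w s).1 = t.
Proof.
move=> [w0 cw dw]; apply: (@icurve0 _ _ t (fun s => (w s).1)); split.
- by rewrite w0.
- by move=> s; exact: (continuous_comp (cw s) ((islin_fst R V).2 (w s))).
- by move=> s sI; exact: (is_derive_lin (dw s sI) (islin_fst _ _)).
Qed.

Lemma jfield_icurve t z g : icurve (fun x => t *: X x) z g -> icurve jfield (t, z) (fun s => (t, g s)).
Proof.
move=> [g0 cg dg]; split.
- by rewrite g0.
- by move=> s; apply: cont_pair; [exact: cvg_cst|exact: cg].
- by move=> s sI; apply: is_derive_pair; exact: dg.
Qed.

Lemma fdom_idom : fdom = idom setT jfield.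
Proof.
apply/seteqP; split=> [[t z] [g ig]|[t z] [w [iw _]]].
  by exists (fun s => (t, g s)); split=> //; exact: jfield_icurve.
have Ew := icurve_jfield iw; have [w0 cw dw] := iw.
exists (fun s => (w s).2); split=> /=.
- by rewrite w0.
- by move=> s; exact: (continuous_comp (cw s) ((islin_snd R V).2 (w s))).
- move=> s sI; rewrite -(Ew s) ?oo_cc //.
  exact: (is_derive_lin (dw s sI) (islin_snd _ _)).
Qed.

Let lJ : locLip setT jfield.
Proof. exact: (CT1_locLip (findim_prod (@findim_R R) fV) (@openT _) (sm_jfield 1)). Qed.

Lemma open_fdom : open fdom.
Proof. rewrite fdom_idom; exact: (open_idom (findim_prod (@findim_R R) fV) lJ). Qed.

Lemma flow_icurve t z g : icurve (fun x => t *: X x) z g -> flow X t z = g 1.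
Proof.
by move=> ig; rewrite flow_fl; exact: (flE (CT1_locLip fV (@openT _) (sXc t)) ig).
Qed.

Lemma flow_jfield p : fdom p -> fl jfield p = (p.1, flow X p.1 p.2).
Proof.
case: p => t z [g ig]; rewrite (flow_icurve ig).
exact: (flE lJ (jfield_icurve ig)).
Qed.

Lemma sm_flow : sm fdom (fun p => flow X p.1 p.2).
Proof.
move=> k.
have h := fl_CT (findim_prod (@findim_R R) fV) (@openT _) (sm_jfield k.+1).
rewrite -fdom_idom in h.
apply: (@CT_loc _ _ _ _ _ (fun p => (fl jfield p).2) _ open_fdom).
  by move=> p /flow_jfield ->.
exact: (CT_post open_fdom (islin_snd R V) (CTS h)).
Qed.

Lemma fdom0 z : fdom (0, z).
Proof.
exists (cst z); split=> //=.
- by move=> s; exact: cvg_cst.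
- by move=> s _; rewrite scale0r; exact: is_derive_cst.
Qed.

Lemma flow0 z : flow X 0 z = z.
Proof.
have [g ig] := fdom0 z; rewrite (flow_icurve ig).
apply: (icurve0 (z := z) _ I01).
have -> // : (fun _ : V => 0 : V) = (fun x => (0 : R, z).1 *: X x).
by apply/funext => x; rewrite scale0r.
Qed.

Lemma flow_restrict t z s s' : fdom (t, z) -> 0 <= s <= 1 -> 0 <= s' <= 1 ->
  [/\ fdom (s * t, z), fdom ((s' - s) * t, flow X (s * t) z) &
   flow X ((s' - s) * t) (flow X (s * t) z) = flow X (s' * t) z].
Proof.
move=> [g ig] sI s'I.
have I0 : 0 <= (0 : R) <= 1 by rewrite lexx ler01.
have Es x : 0 <= x <= 1 -> fdom (x * t, z) /\ flow X (x * t) z = g x.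
  move=> xI; have := icurve_restrict ig I0 xI.
  have [g0 _ _] := ig; rewrite g0 subr0 /= => i; split; first by exists (fun t0 => g (0 + x * t0)).
  by rewrite (flow_icurve i) mulr1 add0r.
have [d1 e1] := Es s sI; have [_ e2] := Es s' s'I; rewrite e1 e2.
have i := icurve_restrict ig sI s'I.
split => //; first by exists (fun t => g (s + (s' - s) * t)).
by rewrite (flow_icurve i) mulr1 addrC subrK.
Qed.

Lemma flow_inv t z : fdom (t, z) -> fdom (- t, flow X t z) /\ flow X (- t) (flow X t z) = z.
Proof.
move=> d; have I0 : 0 <= (0 : R) <= 1 by rewrite lexx ler01.
have [_] := flow_restrict d I01 I0.
by rewrite sub0r mulN1r mul1r mul0r flow0.
Qed.

(* Both times are reached from the common starting point [flow X (- c) z]. *)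
Lemma flow_add z0 : exists2 d : R, 0 < d & forall z t s, ball z0 d z -> `|t| < d -> `|s| < d ->
  [/\ fdom (t, z), fdom (s, flow X t z) & flow X s (flow X t z) = flow X (t + s) z].
Proof.
have /nbhs_ballP[e /= e0 He] : \forall p \near ((0 : R), z0), fdom p.
  exact: open_nbhs_nbhs (conj open_fdom (fdom0 z0)).
have cf := CT_cont (sm_flow 0) (fdom0 z0).
have e20 : 0 < e / 2 by rewrite divr_gt0.
have /cvgrPdist_lt/(_ _ e20)/nbhs_ballP[e' /= e'0 He'] := cf.
pose c := Num.min (e / 4) (e' / 2).
have c0 : 0 < c by rewrite lt_min !divr_gt0.
have ce : c <= e / 4 by rewrite ge_min lexx.
have ce' : c <= e' / 2 by rewrite ge_min lexx orbT.
exists (Num.min (c / 2) (Num.min e' e)); first by rewrite !lt_min divr_gt0 //= e'0.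
move=> z t s bz; rewrite !lt_min => /andP[tc _] /andP[sc _].
have bz' : ball z0 e' z by apply: le_ball bz; rewrite !ge_min lexx !orbT.
have bze : ball z0 e z by apply: le_ball bz; rewrite !ge_min lexx !orbT.
have bc : ball (0 : R) e (- c).
  by rewrite -ball_normE /= opprK add0r gtr0_norm //; lra.
have dc : fdom (- c, z) by apply: He; split.
have [dw Ew] := flow_inv dc; set w := flow X (- c) z in dw Ew.
have bw : ball z0 (e / 2) w.
  rewrite -ball_normE /=; have := He' (- c, z); rewrite /= flow0; apply.
  by split => //=; rewrite -ball_normE /= opprK add0r gtr0_norm //; lra.
have dw2 : fdom (2 * c, w).
  apply: He; split => /=; last by apply: le_ball bw; lra.
  by rewrite -ball_normE /= sub0r normrN gtr0_norm ?mulr_gt0 //; lra.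
have P x : `|x| <= c -> 0 <= (c + x) / (2 * c) <= 1.
  rewrite ler_norml => /andP[h1 h2]; apply/andP; split.
    by rewrite divr_ge0 ?mulr_ge0 ?(ltW c0) //; lra.
  by rewrite ler_pdivrMr ?mulr_gt0 //; lra.
have E x : (c + x) / (2 * c) * (2 * c) = c + x by rewrite divfK // gt_eqF // mulr_gt0.
have E2 x y : ((c + x) / (2 * c) - (c + y) / (2 * c)) * (2 * c) = x - y.
  by rewrite mulrBl !E; ring.
have F x : `|x| <= c -> [/\ fdom (x, z), fdom (c + x, w) & flow X (c + x) w = flow X x z].
  move=> xc; have P0 : `|(0 : R)| <= c by rewrite normr0 ltW.
  have [d1 d2 e1] := flow_restrict dw2 (P 0 P0) (P x xc).
  have [d3 _ _] := flow_restrict dw2 (P x xc) (P x xc).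
  rewrite E2 E addr0 -(opprK c) Ew subr0 opprK in d2 e1; rewrite E in d3.
  by split => //; rewrite e1 E.
have tc' : `|t| <= c by lra.
have ts' : `|t + s| <= c by apply: le_trans (ler_normD _ _) _; lra.
have [d1 d2 e1] := F t tc'; have [d3 d4 e2] := F (t + s) ts'.
have [d5 d6 e3] := flow_restrict dw2 (P t tc') (P (t + s) ts').
rewrite E2 !E e1 e2 (_ : t + s - t = s) in d6 e3; last by ring.
by split.
Qed.

End Joint.

(** * Division of smooth maps by the parameter *)

Section Hadamard.
Context {R : realType} {V W : normedModType R}.
Hypotheses (fV : findim V) (fW : findim W).

(** The quotient is the mean over s in [0, 1] of the derivative of [E] in its first variable at (s
    e, z). It is obtained by solving a differential equation with parameters, so its smoothness is
    that of the flow. *)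
Lemma hadamard (O : set (R * V)%type) (E : (R * V)%type -> W) : open O -> sm O E ->
  (forall p s, O p -> 0 <= s <= 1 -> O (s * p.1, p.2)) ->
  (forall z, O (0, z) -> E (0, z) = 0) ->
  exists2 Q : (R * V)%type -> W, sm O Q & forall p, O p -> E p = p.1 *: Q p.
Proof.
move=> oO sE star E0.
pose T := (W * (R * (R * V)))%type.
pose m (p : T) : (R * V)%type := (p.2.1 * p.2.2.1, p.2.2.2).
pose D := 'D_((1 : R), (0 : V)) E.
have fRV := findim_prod (@findim_R R) fV.
have fT : findim T by apply: findim_prod fW _; apply: findim_prod (@findim_R R) _.
have l2 := @islin_snd R W (R * (R * V))%type.
have l22 : islin (fun p : T => p.2.2) by exact: (islin_comp l2 (islin_snd _ _)).
have sm_m k B : open B -> CT k B m.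
  move=> oB; apply: CT_pair => //.
    apply: (@CT_scale _ _ _ _ _ (fun p : T => p.2.1) (fun p : T => p.2.2.1)) => //.
      by apply: CT_lin; exact: (islin_comp l2 (islin_fst _ _)).
    by apply: CT_lin; exact: (islin_comp l22 (islin_fst _ _)).
  by apply: CT_lin; exact: (islin_comp l22 (islin_snd _ _)).
pose A : set T := m @^-1` O.
have oA : open A.
  apply: (open_comp _ oO) => p _; exact: (CT_cont (sm_m 0%N setT (@openT _)) I).
pose F (p : T) : T := (D (m p), ((1 : R), (0 : (R * V)%type))).
have sF k : CT k A F.
  apply: CT_pair => //; last exact: CT_cst.
  apply: (@CT_comp _ _ _ _ _ _ O m D) => //; first exact: sm_m.
  exact: CT_derive.
have lF : locLip A F by exact: CT1_locLip.
(* The solution in closed form, which shows that the flow exists up to time 1 and, at s = 1,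
   identifies its first component with E / e when e is nonzero. *)
pose Q0 (p : (R * V)%type) (s : R) : W := if p.1 == 0 then s *: D p else p.1^-1 *: E (s * p.1, p.2).
have curve p : O p -> icurve F (0, (0, p)) (fun s => (fun s => (Q0 p s, (s, p))) (clamp s)) /\
   forall t : R, 0 <= t <= 1 -> A (Q0 p (clamp t), (clamp t, p)).
  move=> Op; split; last by move=> t tI; rewrite /A /=; apply: star => //; exact: clampP.
  have cQ (t : R) : 0 <= t <= 1 -> is_derive t 1 (Q0 p) (D (t * p.1, p.2)).
    move=> tI; rewrite /Q0; case: p Op => e z Op /=; case: eqP => [e0|/eqP en].
      rewrite e0 mulr0; have := is_derive_lin (is_derive_id t (1 : R)) (islin_scalev (D (0, z))).
      by rewrite scale1r.
    have Ot := star _ t Op tI; rewrite /= in Ot.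
    have dE := CT_diff (sE 1%N) Ot.
    have dm : is_derive t 1 (fun s : R => (s * e, z)) (e, (0 : V)).
      apply: is_derive_pair.
      have := is_derive_lin (is_derive_id t (1 : R)) (@islin_scale R R R e _ (@islin_id R R)).
      rewrite [_ *: 1]mulr1; congr (is_derive _ _ _ _); apply/funext => s.
      by rewrite [_ *: _]mulrC.
    have := is_derive_lin (is_derive_comp dm dE) (@islin_scale R W W e^-1 _ (@islin_id R W)).
    have -> : (e, 0 : V) = e *: ((1 : R), (0 : V)).
      by rewrite -[RHS]/(e *: 1, e *: 0) scaler0 [e *: 1]mulr1.
    by rewrite (islinZ _ _ (diff_eps dE).1) scalerA mulVf // scale1r.
  apply: (@icurve_clamp R T F (0, (0, p)) (fun s => (Q0 p s, (s, p)))).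
  - rewrite /Q0 scale0r mul0r; case: ifP => // _; rewrite E0 ?scaler0 //.
    have I0 : 0 <= (0 : R) <= 1 by rewrite lexx ler01.
    by have := star p 0 Op I0; rewrite mul0r.
  - move=> t tI; apply: cont_pair; first exact: is_derive_continuous (cQ t tI).
    by apply: cont_pair; [exact: cvg_id|exact: cvg_cst].
  - move=> t tI; apply: is_derive_pair; first exact: cQ (oo_cc tI).
    by apply: is_derive_pair.
exists (fun p => (fl F (0, (0, p))).1).
  move=> k; apply: (CT_post oO (islin_fst W (R * (R * V))%type)).
  apply: (@CT_comp _ _ _ _ _ _ (idom A F) (fun p => (0, (0, p)))) => //.
  - move=> p Op; have [ic cA] := curve p Op.
    by exists (fun s => (Q0 p (clamp s), (clamp s, p))).
  - apply: CT_lin; apply: islin_pair; first exact: islin_cst0.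
    by apply: islin_pair; [exact: islin_cst0|exact: islin_id].
  - exact/CTS/(fl_CT fT oA (sF k.+1)).
move=> p Op; have [ic cA] := curve p Op.
rewrite (flE lF ic cA) /= clampE ?I01 // /Q0 scale1r mul1r.
case: p Op ic cA => e z Op _ _ /=; case: eqP => [e0|/eqP en].
  by rewrite e0 scale0r E0 // -e0.
by rewrite scalerA divff // scale1r.
Qed.
End Hadamard.

(** * Expansion of compositions of flows *)

Section BigO.
Context {R : realType}.
Implicit Types V W Z : normedModType R.

(** Both signs of e are included, as is needed for maps smooth through e = 0 and for rescalings of e
    by any real factor. *)
Definition bO V (k : nat) (F : R -> V) : Prop :=
  exists C : R, \forall e \near (0 : R), `|F e| <= C * `|e| ^+ k.

Lemma bO_pos V k (F : R -> V) : bO k F ->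
  exists2 C : R, 0 < C & \forall e \near (0 : R), `|F e| <= C * `|e| ^+ k.
Proof.
move=> [C HC]; exists (`|C| + 1); first by rewrite ltr_wpDl.
apply: filterS HC => e h; apply: le_trans h _; rewrite ler_wpM2r ?exprn_ge0 //.
by rewrite (le_trans (ler_norm C)) // lerDl.
Qed.

Lemma bO_ext V k (F G : R -> V) : (\forall e \near (0 : R), F e = G e) -> bO k F -> bO k G.
Proof.
move=> E [C HC]; exists C; near=> e; have <- : F e = G e by near: e.
by near: e.
Unshelve. all: by end_near. Qed.

Lemma bO_add V k (F G : R -> V) : bO k F -> bO k G -> bO k (fun e => F e + G e).
Proof.
move=> [C HC] [D HD]; exists (C + D); near=> e.
apply: le_trans (ler_normD _ _) _; rewrite mulrDl.
by apply: lerD; near: e.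
Unshelve. all: by end_near. Qed.

Lemma bO_opp V k (F : R -> V) : bO k F -> bO k (fun e => - F e).
Proof. by move=> [C HC]; exists C; apply: filterS HC => e; rewrite normrN. Qed.

Lemma bO_sub V k (F G : R -> V) : bO k F -> bO k G -> bO k (fun e => F e - G e).
Proof. by move=> h1 /bO_opp; exact: bO_add. Qed.

Lemma near0_lt (d : R) : 0 < d -> \forall e \near (0 : R), `|e| < d.
Proof.
move=> d0; apply: filterS (nbhsx_ballx (0 : R) _ d0) => e.
by rewrite -ball_normE /= sub0r normrN.
Qed.

Lemma bO_le V j k (F : R -> V) : (j <= k)%N -> bO k F -> bO j F.
Proof.
move=> jk /bO_pos[C C0 HC]; exists C; near=> e.
have e1 : `|e| < 1 by near: e; exact: near0_lt.
apply: le_trans (_ : C * `|e| ^+ k <= _); first by near: e.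
by rewrite ler_pM2l // ler_wiXn2l // ltW.
Unshelve. all: by end_near. Qed.

Lemma bO_mulX V j k (F : R -> V) : bO k F -> bO (j + k) (fun e => e ^+ j *: F e).
Proof.
move=> [C HC]; exists C; apply: filterS HC => e h.
by rewrite normrZ normrX exprD mulrCA ler_wpM2l ?exprn_ge0.
Qed.

Lemma bO_cst V (c : V) : bO 0 (fun=> c).
Proof. by exists `|c|; near=> e; rewrite expr0 mulr1. Unshelve. all: by end_near. Qed.

Lemma bO_small V (x : R -> V) z d : bO 1 (fun e => x e - z) -> 0 < d ->
  \forall e \near (0 : R), ball z d (x e).
Proof.
move=> /bO_pos[C C0 HC] d0; near=> e.
have h : `|x e - z| <= C * `|e| ^+ 1 by near: e.
rewrite -ball_normE /= distrC; apply: le_lt_trans h _; rewrite expr1 mulrC -ltr_pdivlMr //.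
by near: e; apply: near0_lt; rewrite divr_gt0.
Unshelve. all: by end_near. Qed.

Lemma bO_pow (c : R) (w : nat) : (0 < w)%N -> bO 1 (fun e : R => c * e ^+ w).
Proof.
move=> w0; apply: (@bO_le R _ w) => //; exists `|c|; near=> e.
by rewrite normrM normrX.
Unshelve. all: by end_near. Qed.

Lemma locLip_pos V W (A : set V) (f : V -> W) z : locLip A f -> A z -> exists d L : R,
  [/\ 0 < d, 0 < L & forall x y, ball z d x -> ball z d y -> A x /\ `|f x - f y| <= L * `|x - y|].
Proof.
move=> lf /lf[d [d0 [L HL]]]; exists d, (`|L| + 1); have L1 : 0 < `|L| + 1 by rewrite ltr_wpDl.
split=> //.
move=> x y bx by_; have [Ax h] := HL x y bx by_; split=> //; apply: le_trans h _.
by rewrite ler_wpM2r // (le_trans (ler_norm L)) // lerDl.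
Qed.

Lemma bO_taylor V (f : R -> V) (d : R) : 0 < d -> CT 2 (ball (0 : R) d) f ->
  bO 2 (fun e => f e - f 0 - e *: 'D_(1 : R) f 0).
Proof.
move=> d0 cf.
have B0 : ball (0 : R) d 0 by exact: ballxx.
have oB : open (ball (0 : R) d) by exact: ball_open.
have [d' [L [d'0 L0 HL]]] := locLip_pos (CT1_locLip (@findim_R R) oB (CT_derive (1 : R) oB cf)) B0.
exists L; near=> e.
have e1 : `|e| < d by near: e; exact: near0_lt.
have e2 : `|e| < d' by near: e; exact: near0_lt.
have -> : f e - f 0 - e *: 'D_(1 : R) f 0 = f e - f 0 - e *: 'D_1 f 0 by [].
apply: (@seg_mvi _ _ _ f (e *: 'D_(1 : R) f 0) e 0) => t tI.
rewrite subr0 add0r.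
have te : `|t *: e| <= `|e|.
  by rewrite normrZ; case/andP: tI => t0 t1; rewrite ger0_norm // ler_piMl.
have bt : ball (0 : R) d (t *: e) by rewrite -ball_normE /= sub0r normrN (le_lt_trans te).
have bt' : ball (0 : R) d' (t *: e) by rewrite -ball_normE /= sub0r normrN (le_lt_trans te).
have df := CT_diff cf bt; split => //.
have -> : 'D_e f (t *: e) = e *: 'D_(1 : R) f (t *: e).
  by rewrite -(islinZ _ _ (diff_eps df).1); congr ('D_ _ f _); rewrite [RHS]mulr1.
rewrite -scalerBr normrZ.
have [_ h] := HL _ _ bt' (ballxx _ d'0).
rewrite subr0 in h; rewrite expr2 mulrA (mulrC L) -mulrA ler_wpM2l //.
by apply: le_trans h _; rewrite ler_pM2l.
Unshelve. all: by end_near. Qed.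
End BigO.

Section LocalFlow.
Context {R : realType} {V : normedModType R}.
Hypothesis fV : findim V.
Variable X : V -> V.
Hypothesis sX : sm setT X.
Implicit Types (t s e : R) (z : V).

Lemma ball_pair (z0 : V) d p : ball ((0 : R), z0) d p <-> `|p.1| < d /\ ball z0 d p.2.
Proof.
split=> [[/=]|[h1 h2]]; first by rewrite -ball_normE /= sub0r normrN.
by split=> //=; rewrite -ball_normE /= sub0r normrN.
Qed.

(** Hadamard's lemma applied to the flow minus the identity. The short-time estimates of flows and
    commutators are read off the smooth factor [a]. *)
Lemma flow_first (z0 : V) : exists (d : R) (a : (R * V)%type -> V), [/\ 0 < d,
  forall p, ball ((0 : R), z0) d p -> fdom X p,
  sm (ball ((0 : R), z0) d) a,
  forall p, ball ((0 : R), z0) d p -> flow X p.1 p.2 = p.2 + p.1 *: a p &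
  forall z, ball z0 d z -> a (0, z) = X z].
Proof.
have oD := open_fdom fV sX.
have /nbhs_ballP[d /= d0 Hd] : \forall p \near ((0 : R), z0), fdom X p.
  exact: open_nbhs_nbhs (conj oD (fdom0 X z0)).
have oB : open (ball ((0 : R), z0) d) by exact: ball_open.
have lsnd k (B : set (R * V)%type) : CT k B (fun p => p.2) by exact: CT_lin (islin_snd R V).
have sE : sm (ball ((0 : R), z0) d) (fun p => flow X p.1 p.2 - p.2).
  by move=> k; apply: CT_sub2 => //; exact: CT_sub (sm_flow fV sX k).
have [||a sa Ea] := hadamard fV fV oB sE.
- move=> p s /ball_pair[h1 h2] /andP[s0 s1]; apply/ball_pair; split => //=.
  by apply: le_lt_trans h1; rewrite normrM ger0_norm // ler_piMl.
- by move=> z _ /=; rewrite flow0 // subrr.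
exists d, a; split=> //; first by move=> p /Ea <-; rewrite addrC subrK.
move=> z bz; apply/eqP; rewrite -subr_eq0 -normr_le0; apply/ler_addgt0Pr => eta eta0.
rewrite add0r.
have B0z : ball ((0 : R), z0) d (0, z) by apply/ball_pair; rewrite normr0.
have eta2 : 0 < eta / 2 by rewrite divr_gt0.
have cX := CT_cont (sX 0%N) (I : [set: V] z).
have /cvgrPdist_le/(_ _ eta2) := cX => /nbhs_ballP[r /= r0 Hr].
have cPhi := CT_cont (sm_flow fV sX 0%N) (fdom0 X z).
have /cvgrPdist_lt/(_ _ r0) := cPhi; rewrite /= flow0 // => /nbhs_ballP[r' /= r'0 Hr'].
have ca := CT_cont (sa 0%N) B0z.
have /cvgrPdist_le/(_ _ eta2)/nbhs_ballP[r2 /= r20 Hr2] := ca.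
pose c := Num.min (d / 2) (Num.min (r' / 2) (r2 / 2)).
have c0 : 0 < c by rewrite !lt_min !divr_gt0.
have [cd cr' cr2] : [/\ c < d, c < r' & c < r2].
  have h1 : c <= d / 2 by rewrite ge_min lexx.
  have h2 : c <= r' / 2 by rewrite !ge_min lexx orbT.
  have h3 : c <= r2 / 2 by rewrite !ge_min lexx !orbT.
  by split; lra.
have Bc : ball ((0 : R), z0) d (c, z) by apply/ball_pair; rewrite gtr0_norm.
have h1 : `|a (0, z) - a (c, z)| <= eta / 2.
  by apply: Hr2; split; [rewrite -ball_normE /= sub0r normrN gtr0_norm|exact: ballxx].
have Dc : fdom X (c, z) by exact: Hd.
have [g ig] := Dc; have [g0 cg dg] := ig.
have Eg s : 0 <= s <= 1 -> flow X (s * c) z = g s.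
  move=> sI; have I0 : 0 <= (0 : R) <= 1 by rewrite lexx ler01.
  have := icurve_restrict ig I0 sI; rewrite g0 subr0 /= => i.
  by rewrite (flow_icurve fV sX i) mulr1 add0r.
(* c a(c, z) is the displacement along the curve; the mean value inequality compares it with c X z,
   as [X] varies by at most eta / 2 on the way. *)
have h2 : `|a (c, z) - X z| <= eta / 2.
  rewrite -(ler_pM2l c0) -[X in X * `|_|](gtr0_norm c0) -normrZ scalerBr -(Ea _ Bc) /=.
  have -> : flow X c z - z = g 1 - g 0 by rewrite g0 -(Eg 1 I01) mul1r.
  have := @mvi R V (fun s => g s - s *: (c *: X z)) (fun s => c *: X (g s) - c *: X z)
    (fun s => c * (eta / 2) * s) (fun=> c * (eta / 2)).
  move=> /(_ _ _ _ _ _ 1 I01); rewrite scale1r scale0r subr0 mulr0 mulr1 subr0 addrAC.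
  have dl (t : R) : is_derive t 1 (fun s : R => c * (eta / 2) * s) (c * (eta / 2)).
    by have := is_derive_lin (is_derive_id t (1 : R)) (@islin_scale R _ _ (c * (eta / 2)) _ (@islin_id R R)); rewrite [_ *: 1]mulr1.
  have dv (t : R) : is_derive t 1 (fun s : R => s *: (c *: X z)) (c *: X z).
    by have := is_derive_lin (is_derive_id t (1 : R)) (islin_scalev (c *: X z)); rewrite scale1r.
  apply.
  - by move=> t _; apply: cvgB; [exact: cg|exact: is_derive_continuous (dv t)].
  - by move=> t _; exact: is_derive_continuous (dl t).
  - by move=> t tI; apply: is_deriveB; exact: dg.
  - move=> t tI; rewrite -scalerBr normrZ gtr0_norm // ler_pM2l // distrC.
    apply: Hr; rewrite -(Eg t (oo_cc tI)) -ball_normE /=.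
    apply: (Hr' (t * c, z)); split; last exact: ballxx.
    rewrite -ball_normE /= sub0r normrN gtr0_norm; case/andP: tI => t0 t1; last by rewrite mulr_gt0.
    by apply: lt_trans cr'; rewrite gtr_pMl.
rewrite -(subrK (a (c, z)) (a (0, z))) -addrA.
by apply: le_trans (ler_normD _ _) _; lra.
Qed.

Lemma flow_loc (z0 : V) : exists d C : R, [/\ 0 < d, 0 < C,
  forall t z, `|t| < d -> ball z0 d z -> [/\ fdom X (t, z), `|flow X t z - z| <= C * `|t| &
     `|flow X t z - z - t *: X z| <= C * `|t| ^+ 2] &
  forall t x y, `|t| < d -> ball z0 d x -> ball z0 d y ->
     `|flow X t x - flow X t y - (x - y)| <= C * `|t| * `|x - y|].
Proof.
have [d [a [d0 Hd sa Ea a0]]] := flow_first z0.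
have oB : open (ball ((0 : R), z0) d) by exact: ball_open.
have Bz : ball ((0 : R), z0) d (0, z0) by exact: ballxx.
have fRV := findim_prod (@findim_R R) fV.
have [r [L [r0 L0 HL]]] := locLip_pos (CT1_locLip fRV oB (sa 1%N)) Bz.
pose C := `|a (0, z0)| + L * r + L.
have C0 : 0 < C by rewrite ltr_wpDl // addr_ge0 // mulr_ge0 // ltW.
have nE (x : R) (y : V) : `|(x, y)| = Num.max `|x| `|y| by rewrite prod_normE.
exists (Num.min d r), C; split=> //; first by rewrite lt_min d0.
  move=> t z; rewrite lt_min => /andP[td tr] bz.
  have bzd : ball z0 d z by apply: le_ball bz; rewrite ge_min lexx.
  have bzr : ball z0 r z by apply: le_ball bz; rewrite ge_min lexx orbT.
  have B1 : ball ((0 : R), z0) d (t, z) by apply/ball_pair.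
  have R1 : ball ((0 : R), z0) r (t, z) by apply/ball_pair.
  have R2 : ball ((0 : R), z0) r (0, z) by apply/ball_pair; rewrite normr0.
  split; first exact: Hd.
    rewrite (Ea _ B1) /= addrAC subrr add0r normrZ mulrC ler_wpM2r //.
    have [_ h] := HL _ _ R1 (ballxx _ r0).
    rewrite -(subrK (a (0, z0)) (a (t, z))); apply: le_trans (ler_normD _ _) _.
    have : `|(t, z) - (0, z0)| <= r.
      rewrite -[(t, z) - _]/(t - 0, z - z0) nE ge_max subr0 (ltW tr) /=.
      by move: bzr; rewrite -ball_normE /= distrC => /ltW.
    rewrite -(ler_pM2l L0) => h2; rewrite /C addrC -addrA lerD2l.
    by apply: le_trans h _; apply: le_trans h2 _; rewrite lerDl ltW.
  rewrite (Ea _ B1) /= [z + _]addrC addrK -(a0 z bzd) -scalerBr normrZ expr2 mulrA.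
  rewrite [leRHS]mulrC ler_wpM2l //.
  have [_ h] := HL _ _ R1 R2; apply: le_trans h _.
  rewrite -[(t, z) - _]/(t - 0, z - z) nE subrr normr0 subr0 max_l // ler_wpM2r //.
  by rewrite /C lerDr addr_ge0 // mulr_ge0 // ltW.
move=> t x y; rewrite lt_min => /andP[td tr] bx by_.
have bxd : ball z0 d x by apply: le_ball bx; rewrite ge_min lexx.
have bxr : ball z0 r x by apply: le_ball bx; rewrite ge_min lexx orbT.
have byd : ball z0 d y by apply: le_ball by_; rewrite ge_min lexx.
have byr : ball z0 r y by apply: le_ball by_; rewrite ge_min lexx orbT.
have B1 : ball ((0 : R), z0) d (t, x) by apply/ball_pair.
have B2 : ball ((0 : R), z0) d (t, y) by apply/ball_pair.
have R1 : ball ((0 : R), z0) r (t, x) by apply/ball_pair.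
have R2 : ball ((0 : R), z0) r (t, y) by apply/ball_pair.
rewrite (Ea _ B1) (Ea _ B2) /=.
have -> : x + t *: a (t, x) - (y + t *: a (t, y)) - (x - y) = t *: (a (t, x) - a (t, y)) by lmod R.
rewrite normrZ (mulrC C) -mulrA ler_wpM2l //.
have [_ h] := HL _ _ R1 R2; apply: le_trans h _.
rewrite -[(t, x) - _]/(t - t, x - y) nE subrr normr0 max_r // ler_wpM2r //.
by rewrite /C lerDr addr_ge0 // mulr_ge0 // ltW.
Qed.

Lemma bO_flow_near (z0 : V) (tau : R -> R) (x : R -> V) :
  bO 1 tau -> bO 1 (fun e => x e - z0) ->
  (\forall e \near (0 : R), fdom X (tau e, x e)) /\ bO 1 (fun e => flow X (tau e) (x e) - z0).
Proof.
move=> bt bx; have [d [C [d0 C0 H1 _]]] := flow_loc z0.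
have nt : \forall e \near (0 : R), `|tau e| < d.
  have b' : bO 1 (fun e => tau e - 0) by apply: bO_ext bt; near=> e; rewrite subr0.
  by apply: filterS (bO_small b' d0) => e; rewrite -ball_normE /= sub0r normrN.
have nx := bO_small bx d0.
split.
  by near=> e; have [] := H1 (tau e) (x e) _ _; by [near: e|].
have [D D0 HD] := bO_pos bt.
have b1 : bO 1 (fun e => flow X (tau e) (x e) - x e).
  exists (C * D); near=> e.
  have [_ h _] : [/\ fdom X (tau e, x e), `|flow X (tau e) (x e) - x e| <= C * `|tau e| &
     `|flow X (tau e) (x e) - x e - tau e *: X (x e)| <= C * `|tau e| ^+ 2].
    by apply: H1; near: e.
  apply: le_trans h _; rewrite -mulrA ler_pM2l //; near: e; exact: HD.
by apply: bO_ext (bO_add b1 bx); near=> e; rewrite addrA subrK.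
Unshelve. all: by end_near. Qed.

(** The flow minus the identity has Lipschitz constant O(tau), so transporting two points by the
    same flow alters their difference only one order higher. This is what lets defects of successive
    factors simply add up. *)
Lemma bO_flow_diff (z0 : V) (tau : R -> R) (x y : R -> V) m :
  bO 1 tau -> bO 1 (fun e => x e - z0) -> bO 1 (fun e => y e - z0) -> bO m (fun e => x e - y e) ->
  bO m.+1 (fun e => flow X (tau e) (x e) - flow X (tau e) (y e) - (x e - y e)).
Proof.
move=> bt bx by_ /bO_pos[B B0 HB]; have [d [C [d0 C0 _ H2]]] := flow_loc z0.
have nt : \forall e \near (0 : R), `|tau e| < d.
  have b' : bO 1 (fun e => tau e - 0) by apply: bO_ext bt; near=> e; rewrite subr0.
  by apply: filterS (bO_small b' d0) => e; rewrite -ball_normE /= sub0r normrN.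
have nx := bO_small bx d0; have ny := bO_small by_ d0.
have [D D0 HD] := bO_pos bt.
exists (C * D * B); near=> e.
have h : `|flow X (tau e) (x e) - flow X (tau e) (y e) - (x e - y e)| <= C * `|tau e| * `|x e - y e|.
  by apply: H2; near: e.
have hD : `|tau e| <= D * `|e| ^+ 1 by near: e.
have hB : `|x e - y e| <= B * `|e| ^+ m by near: e.
rewrite expr1 in hD; apply: le_trans h _; rewrite exprS.
rewrite (_ : C * D * B * (`|e| * `|e| ^+ m) = C * (D * `|e|) * (B * `|e| ^+ m)); last by ring.
apply: ler_pM => //; first by rewrite mulr_ge0 // ltW.
by rewrite ler_pM2l.
Unshelve. all: by end_near. Qed.

Lemma flow_exp (z0 : V) (tau : R -> R) (x : R -> V) j : (0 < j)%N ->
  bO j tau -> bO 1 (fun e => x e - z0) ->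
  bO (j * 2) (fun e => flow X (tau e) (x e) - x e - tau e *: X (x e)).
Proof.
move=> j0 bt bx; have [d [C [d0 C0 H1 _]]] := flow_loc z0.
have nt : \forall e \near (0 : R), `|tau e| < d.
  have b' : bO 1 (fun e => tau e - 0) by apply: bO_ext (bO_le j0 bt); near=> e; rewrite subr0.
  by apply: filterS (bO_small b' d0) => e; rewrite -ball_normE /= sub0r normrN.
have nx := bO_small bx d0.
have [D D0 HD] := bO_pos bt.
exists (C * D ^+ 2); near=> e.
have [_ _ h] : [/\ fdom X (tau e, x e), `|flow X (tau e) (x e) - x e| <= C * `|tau e| &
     `|flow X (tau e) (x e) - x e - tau e *: X (x e)| <= C * `|tau e| ^+ 2].
  by apply: H1; near: e.
have hD : `|tau e| <= D * `|e| ^+ j by near: e.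
apply: le_trans h _; rewrite -mulrA ler_pM2l // exprM -exprMn.
by rewrite lerXn2r // nnegrE ?mulr_ge0 ?exprn_ge0 // ltW.
Unshelve. all: by end_near. Qed.

End LocalFlow.

(** * Words of flows and divisibility of their defect *)

Section Words.
Context {R : realType} {V : normedModType R}.
Hypothesis fV : findim V.
Implicit Types (e c : R) (z : V).

(* [(G, (c, n))] stands for the exact flow of [G] for the time [c * e ^ n]. *)
Definition wstep : Type := ((V -> V) * (R * nat))%type.
Implicit Types (w : seq wstep).

Definition stime (a : wstep) e : R := a.2.1 * e ^+ a.2.2.
Definition wmap w e z : V := foldl (fun z a => flow a.1 (stime a e) z) z w.
Fixpoint wdom w : set (R * V)%type := if w is a :: w' then
  [set p | fdom a.1 (stime a p.1, p.2) /\ wdom w' (p.1, flow a.1 (stime a p.1) p.2)] else setT.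
Definition wgood w : Prop := forall a, List.In a w -> sm setT a.1 /\ (0 < a.2.2)%N.

Lemma wgood_cons a w : wgood (a :: w) -> [/\ sm setT a.1, (0 < a.2.2)%N & wgood w].
Proof.
move=> H; have [h1 h2] := H a (or_introl erefl).
by split=> // b bw; apply: H; right.
Qed.

Lemma wgood_cat w1 w2 : wgood w1 -> wgood w2 -> wgood (w1 ++ w2).
Proof. by move=> h1 h2 a /List.in_app_iff[/h1|/h2]. Qed.

Lemma open_preim (V1 V2 : normedModType R) (D : set V1) (f : V1 -> V2) (B : set V2) : open D ->
  (forall y, D y -> {for y, continuous f}) -> open B -> open (D `&` f @^-1` B).
Proof.
move=> oD cf oB; rewrite openE => y [Dy By]; apply: filterI.
  exact: open_nbhs_nbhs (conj oD Dy).
by apply: (cf y Dy); exact: open_nbhs_nbhs (conj oB By).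
Qed.

Lemma sm_word w : wgood w -> open (wdom w) /\ sm (wdom w) (fun p => wmap w p.1 p.2).
Proof.
elim: w => [|a w IH].
  by move=> _; split; [exact: openT|move=> k; exact: CT_lin (islin_snd R V)].
move=> /wgood_cons[sa _ /IH[ow sw]].
pose m (p : (R * V)%type) : (R * V)%type := (stime a p.1, p.2).
have sm_m k : CT k setT m.
  apply: CT_pair; [exact: openT| |exact: CT_lin (islin_snd R V)].
  have : CT k setT (stime a); last first.
    by move=> h; exact: (CT_pre (@openT _) (islin_fst R V) (fun _ _ => I) h).
  have : CT k setT (fun e : R => e ^+ a.2.2).
    elim: (a.2.2) => [|n IHn]; first exact: CT_cst.
    have h := @CT_scale R k _ _ setT (fun e : R => e) (fun e : R => e ^+ n) (@openT _) (CT_lin _ _ (@islin_id R R)) IHn.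
    by apply: CT_loc h; [exact: openT|move=> e _; rewrite exprS].
  exact: CT_scalec (@openT _).
pose D1 := setT `&` m @^-1` (fdom a.1).
have oD1 : open D1.
  apply: open_preim; [exact: openT|by move=> p _; exact: (CT_cont (sm_m 0%N))|exact: open_fdom].
pose S (p : (R * V)%type) : (R * V)%type := (p.1, flow a.1 (stime a p.1) p.2).
have sS k : CT k D1 S.
  apply: CT_pair => //; first exact: CT_lin (islin_fst R V).
  apply: (@CT_comp _ _ _ _ _ _ (fdom a.1) m (fun p => flow a.1 p.1 p.2)) => //; [by move=> p []|exact: CT_sub (sm_m k)|].
  exact: (sm_flow fV sa).
have E : wdom (a :: w) = D1 `&` S @^-1` (wdom w).
  by apply/seteqP; split=> [p [h1 h2]|p [[_ h1] h2]]; split.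
have oW : open (wdom (a :: w)).
  by rewrite E; apply: open_preim => // p Dp; exact: (CT_cont (sS 0%N)).
split=> // k.
apply: (@CT_comp _ _ _ _ _ _ (wdom w) S (fun p => wmap w p.1 p.2)) => //; first by move=> p [].
by apply: CT_sub (sS k); rewrite E => p [].
Qed.

Lemma stime0 a : (0 < a.2.2)%N -> stime a 0 = 0.
Proof. by move=> h; rewrite /stime expr0n gtn_eqF // mulr0. Qed.

Lemma word0 w z : wgood w -> wdom w (0, z) /\ wmap w 0 z = z.
Proof.
elim: w z => [//|a w IH] z /wgood_cons[sa wa /IH H].
rewrite /= stime0 // flow0 //; have [h1 h2] := H z.
by split=> //; split=> //; exact: fdom0.
Qed.

Lemma bO_stime a : (0 < a.2.2)%N -> bO 1 (stime a).
Proof. exact: bO_pow. Qed.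

Lemma bO_word w z0 (x : R -> V) : wgood w -> bO 1 (fun e => x e - z0) ->
  (\forall e \near (0 : R), wdom w (e, x e)) /\ bO 1 (fun e => wmap w e (x e) - z0).
Proof.
elim: w x => [|a w IH] x.
  by move=> _ h; split => //; near=> e.
move=> /wgood_cons[sa wa gw] bx.
have [n1 b1] := bO_flow_near fV sa (bO_stime wa) bx.
have [n2 b2] := IH _ gw b1.
by split=> //; near=> e; split; near: e.
Unshelve. all: by end_near. Qed.

Lemma wmap_cat w1 w2 e z : wmap (w1 ++ w2) e z = wmap w2 e (wmap w1 e z).
Proof. by rewrite /wmap foldl_cat. Qed.

Lemma wdom_cat w1 w2 e z : wdom (w1 ++ w2) (e, z) <-> wdom w1 (e, z) /\ wdom w2 (e, wmap w1 e z).
Proof.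
elim: w1 z => [|a w IH] z /=; first by split=> [|[]].
split=> [[h /IH[h1 h2]]|[[h1 h2] h3]] //.
by split=> //; apply/IH.
Qed.

Definition sinv (a : wstep) : wstep := (a.1, (- a.2.1, a.2.2)).
Definition winv w := rev (map sinv w).

Lemma winvK w : winv (winv w) = w.
Proof.
rewrite /winv map_rev revK -map_comp map_id_in // => -[G [c n]] _.
by rewrite /= /sinv /= opprK.
Qed.

Lemma wgood_inv w : wgood w -> wgood (winv w).
Proof.
elim: w => [//|a w IH] /wgood_cons[sa wa /IH gw].
rewrite /winv /= rev_cons -cats1; apply: wgood_cat => // b [<-|[]] //=.
Qed.

Lemma winvP w e z : wgood w -> wdom w (e, z) ->
  wdom (winv w) (e, wmap w e z) /\ wmap (winv w) e (wmap w e z) = z.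
Proof.
elim: w z => [//|a w IH] z /wgood_cons[sa wa gw] /= [h1 h2].
have [d1 E1] := IH _ gw h2; have [d2 E2] := flow_inv fV sa h1.
have st : stime (sinv a) e = - stime a e by rewrite /stime /= mulNr.
rewrite /winv /= rev_cons -cats1; rewrite wmap_cat E1 /= st; split=> //.
by apply/wdom_cat; split=> //; rewrite E1 /= st.
Qed.

(** Since factor times are monomials in e, replacing e by a e changes only the coefficients, and the
    result is again a word. *)
Definition wscale (a : R) w : seq wstep := map (fun s : wstep => (s.1, (s.2.1 * a ^+ s.2.2, s.2.2))) w.

Lemma wmap_scale a w e z : wmap (wscale a w) e z = wmap w (a * e) z.
Proof.
elim: w z => [//|s w IH] z /=; rewrite -IH /wmap /=; congr (foldl _ (flow _ _ _) _).
by rewrite /stime /= exprMn mulrA.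
Qed.

Lemma wgood_scale a w : wgood w -> wgood (wscale a w).
Proof.
elim: w => [//|s w IH] /wgood_cons[sa wa /IH gw] b /= [<- //|]; exact: gw.
Qed.

End Words.

Section Divisible.
Context {R : realType} {V : normedModType R}.
Hypothesis fV : findim V.

(** The quotient is smooth jointly in (e, z); this is what later gives the same order for every
    derivative in z. *)
Definition Div (k : nat) (E : (R * V)%type -> V) : Prop := forall z0, exists (d : R) Q,
  [/\ 0 < d, sm (ball ((0 : R), z0) d) Q & forall p, ball ((0 : R), z0) d p -> E p = p.1 ^+ k *: Q p].

(** The order is assumed at each point with no uniformity. Each division is possible because the
    current quotient, being continuous and O(e) at the point, vanishes at e = 0. *)
Lemma had_iter (O : set (R * V)%type) E K : open O -> sm O E -> (forall z, O (0, z)) ->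
  (forall z, bO K (fun e => E (e, z))) -> Div K E.
Proof.
move=> oO sE O0 bE; suff H k : (k <= K)%N -> Div k E by exact: H (leqnn K).
elim: k => [|k IH] kK z0.
  have /nbhs_ballP[d /= d0 Hd] : \forall p \near ((0 : R), z0), O p.
    exact: open_nbhs_nbhs (conj oO (O0 z0)).
  by exists d, E; split=> // [k|p bp]; [exact: CT_sub (sE k)|rewrite expr0 scale1r].
have [d [Q [d0 sQ EQ]]] := IH (ltnW kK) z0.
have oB : open (ball ((0 : R), z0) d) by exact: ball_open.
have [||Q' sQ' EQ'] := hadamard fV fV oB sQ.
- move=> p s /ball_pair[h1 h2] /andP[s0 s1]; apply/ball_pair; split => //=.
  by apply: le_lt_trans h1; rewrite normrM ger0_norm // ler_piMl.
- move=> z /[dup] B0 /ball_pair[_ /= bz].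
  have cQ := CT_cont (sQ 0%N) B0.
  have [C C0 HC] := bO_pos (bE z).
  apply/eqP; rewrite -normr_le0; apply/ler_addgt0Pr => eta eta0; rewrite add0r.
  have eta2 : 0 < eta / 2 by rewrite divr_gt0.
  have /cvgrPdist_le/(_ _ eta2)/nbhs_ballP[r /= r0 Hr] := cQ.
  have : \forall e \near (0 : R)^'+, `|Q (0, z)| <= eta.
    have dC : 0 < eta / 2 / C by rewrite divr_gt0.
    near=> e.
    have e0 : 0 < e by [].
    have ed : e < d by near: e; exact: nbhs_right_lt.
    have er : e < r by near: e; exact: nbhs_right_lt.
    have e1 : e < 1 by near: e; exact: nbhs_right_lt.
    have eC : e < eta / 2 / C by near: e; exact: nbhs_right_lt.
    have Be : ball ((0 : R), z0) d (e, z) by apply/ball_pair; rewrite gtr0_norm.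
    have h1 : `|Q (0, z) - Q (e, z)| <= eta / 2.
      by apply: Hr; split; [rewrite -ball_normE /= sub0r normrN gtr0_norm|exact: ballxx].
    have h2 : `|E (e, z)| <= C * `|e| ^+ K by near: e; apply: cvg_within; exact: HC.
    rewrite (EQ _ Be) /= normrZ normrX gtr0_norm // -(subnK kK) -addSnnS addSn exprS exprD in h2.
    have h3 : `|Q (e, z)| <= eta / 2.
      have ek : 0 < e ^+ k by rewrite exprn_gt0.
      rewrite -(ler_pM2l ek); apply: le_trans h2 _.
      move: (e ^+ (K - k.+1)) (exprn_ge0 (K - k.+1) (ltW e0)) (exprn_ile1 (K - k.+1) (ltW e0) (ltW e1)) => x x0 x1.
      rewrite (_ : C * (e * (x * e ^+ k)) = e ^+ k * (C * e * x)); last by ring.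
      rewrite ler_pM2l //; apply: (@le_trans _ _ (C * e)).
        by rewrite ler_piMr // mulr_ge0 // ltW.
      by rewrite mulrC -ler_pdivlMr // ltW.
    rewrite -(subrK (Q (e, z)) (Q (0, z))).
    by apply: le_trans (ler_normD _ _) _; lra.
  by move=> /filter_ex[].
exists d, Q'; split=> // p bp; rewrite (EQ _ bp) (EQ' _ bp) scalerA exprSr //.
Unshelve. all: by end_near. Qed.

(** The leading coefficient is the quotient frozen at (0, z0). Moving the argument by O(e) or
    rescaling e changes it at the next order only, so one vector [Y] serves all factors of a
    composition. *)
Lemma Div_exp k E z0 : Div k E -> exists Y, forall c (x : R -> V), bO 1 (fun e => x e - z0) ->
  bO k.+1 (fun e => E (c * e, x e) - (c ^+ k * e ^+ k) *: Y).
Proof.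
move=> /(_ z0)[d [Q [d0 sQ EQ]]]; exists (Q (0, z0)) => c x bx.
have oB : open (ball ((0 : R), z0) d) by exact: ball_open.
have fRV := findim_prod (@findim_R R) fV.
have [r [L [r0 L0 HL]]] := locLip_pos (CT1_locLip fRV oB (sQ 1%N)) (ballxx _ d0).
have bce : bO 1 (fun e => c * e - 0).
  have := @bO_pow R c 1 isT; apply: bO_ext; near=> e; by rewrite expr1 subr0.
have [C C0 HC] := bO_pos bce; have [D D0 HD] := bO_pos bx.
have nd := bO_small bce d0; have nd' := bO_small bx d0.
have nr := bO_small bce r0; have nr' := bO_small bx r0.
exists (`|c| ^+ k * (L * (C + D))); near=> e.
have B1 : ball ((0 : R), z0) d (c * e, x e) by split; near: e.
have B2 : ball ((0 : R), z0) r (c * e, x e) by split; near: e.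
rewrite (EQ _ B1) /= exprMn -scalerBr normrZ normrM !normrX exprSr.
have [_ h] := HL _ _ B2 (ballxx _ r0).
rewrite [leRHS](_ : _ = (`|c| ^+ k * `|e| ^+ k) * (L * ((C + D) * `|e|))); last by ring.
apply: ler_wpM2l; first by rewrite mulr_ge0 // exprn_ge0.
apply: le_trans h _; rewrite ler_pM2l //.
rewrite -[(c * e, x e) - _]/(c * e - 0, x e - z0) prod_normE /= ge_max mulrDl.
have hC : `|c * e - 0| <= C * `|e| ^+ 1 by near: e.
have hD : `|x e - z0| <= D * `|e| ^+ 1 by near: e.
rewrite expr1 in hC hD.
apply/andP; split; [apply: le_trans hC _|apply: le_trans hD _]; rewrite ?lerDl ?lerDr mulr_ge0 // ltW.
Unshelve. all: by end_near. Qed.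
End Divisible.

(** * Raising the order of a composition *)

Section Order.
Context {R : realType} {V : normedModType R}.
Hypothesis fV : findim V.
Variable X : V -> V.
Hypothesis sX : sm setT X.
Implicit Types (w : seq (@wstep R V)).

Definition werr w (p : (R * V)%type) : V := wmap w p.1 p.2 - flow X (p.1 ^+ 2) p.2.

Lemma bO1_sq (c : R) : bO 1 (fun e : R => (c * e) ^+ 2).
Proof.
apply: (bO_ext _ (@bO_pow R (c ^+ 2) 2 isT)); near=> e.
by rewrite exprMn.
Unshelve. all: by end_near. Qed.

Lemma bO1_sqN (c : R) : bO 1 (fun e : R => - (c * e) ^+ 2).
Proof. exact/bO_opp/bO1_sq. Qed.

Lemma bO1_self (z0 : V) : bO 1 (fun e : R => z0 - z0).
Proof. by exists 0; near=> e; rewrite subrr normr0 mul0r. Unshelve. all: by end_near. Qed.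

Section Step.
Variables (w : seq (@wstep R V)) (k : nat) (z0 Y : V).
Hypothesis gw : wgood w.
Hypothesis HY : forall c (x : R -> V), bO 1 (fun e => x e - z0) ->
  bO k.+1 (fun e => werr w (c * e, x e) - (c ^+ k * e ^+ k) *: Y).

Lemma bO_lead (x y : R -> V) theta : bO k.+1 (fun e => y e - x e - (theta * e ^+ k) *: Y) ->
  bO k (fun e => y e - x e).
Proof.
move=> h; have h1 := bO_le (leqnSn k) h.
have h2 := @bO_mulX R V k 0 _ (bO_cst (theta *: Y)); rewrite addn0 in h2.
apply: bO_ext (bO_add h1 h2); near=> e.
by rewrite scalerA (mulrC theta) subrK.
Unshelve. all: by end_near. Qed.

Lemma step_forward (x y : R -> V) theta c : bO 1 (fun e => x e - z0) -> bO 1 (fun e => y e - z0) ->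
  bO k.+1 (fun e => y e - x e - (theta * e ^+ k) *: Y) ->
  bO k.+1 (fun e => wmap w (c * e) (y e) - flow X ((c * e) ^+ 2) (x e)
     - ((theta + c ^+ k) * e ^+ k) *: Y).
Proof.
move=> bx by_ h; have hk := bO_lead h.
have h1 := bO_flow_diff fV sX (bO1_sq c) by_ bx hk.
apply: bO_ext (bO_add (bO_add (HY c by_) h1) h); near=> e.
rewrite /werr /=; move: (c ^+ k) (e ^+ k) => a b; lmod R.
Unshelve. all: by end_near. Qed.

(** For an inverse word the new difference is known only implicitly, through the forward step that
    undoes it; solving for it changes the sign of the leading defect. *)
Lemma step_backward (x x' y y' : R -> V) theta c :
  bO 1 (fun e => x' e - z0) -> bO 1 (fun e => y' e - z0) ->
  (\forall e \near (0 : R), flow X ((c * e) ^+ 2) (x' e) = x e) ->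
  (\forall e \near (0 : R), wmap w (c * e) (y' e) = y e) ->
  bO k.+1 (fun e => y e - x e - (theta * e ^+ k) *: Y) ->
  bO k.+1 (fun e => y' e - x' e - ((theta - c ^+ k) * e ^+ k) *: Y).
Proof.
move=> bx by_ Ex Ey h; have hk := bO_lead h.
have hE := HY c by_.
have hEk : bO k (fun e => werr w (c * e, y' e)).
  have h2 := @bO_mulX R V k 0 _ (bO_cst (c ^+ k *: Y)); rewrite addn0 in h2.
  apply: bO_ext (bO_add (bO_le (leqnSn k) hE) h2); near=> e.
  by rewrite scalerA (mulrC (c ^+ k)) subrK.
have fd j : bO j (fun e => y' e - x' e) ->
   bO j.+1 (fun e => flow X ((c * e) ^+ 2) (y' e) - flow X ((c * e) ^+ 2) (x' e) - (y' e - x' e)).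
  exact: (bO_flow_diff fV sX (bO1_sq c) by_ bx).
have hid : \forall e \near (0 : R), y' e - x' e = (y e - x e) - werr w (c * e, y' e) -
   (flow X ((c * e) ^+ 2) (y' e) - flow X ((c * e) ^+ 2) (x' e) - (y' e - x' e)).
  near=> e.
  have e1 : flow X ((c * e) ^+ 2) (x' e) = x e by near: e.
  have e2 : wmap w (c * e) (y' e) = y e by near: e.
  by rewrite /werr /= e1 e2; lmod R.
(* The identity [hid] contains the unknown difference on both sides, but on the right it appears
   with one more power of e; each use therefore gains one order, up to k. *)
have hj j : (j <= k)%N -> bO j (fun e => y' e - x' e).
  elim: j => [|j IH] jk.
    apply: (@bO_le _ _ 0 1) => //; apply: bO_ext (bO_sub by_ bx); near=> e; lmod R.
  have := bO_sub (bO_sub (bO_le jk hk) (bO_le jk hEk)) (fd j (IH (ltnW jk))).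
  by apply: bO_ext; apply: filterS hid => e <-.
have := bO_sub (bO_sub h hE) (fd k (hj k (leqnn k))).
apply: bO_ext; apply: filterS hid => e H; rewrite [in RHS]H.
move: (c ^+ k) (e ^+ k) => a b; lmod R.
Unshelve. all: by end_near. Qed.
End Step.

(* The composition [w (a e) w (a e) w (b e)^-1] keeps the second-order term when
   2 a^2 - b^2 = 1 and cancels the term of order [k] when 2 a^k = b^k. *)
Definition wnext (a b : R) w := winv (wscale b w) ++ wscale a w ++ wscale a w.

Lemma wgood_next a b w : wgood w -> wgood (wnext a b w).
Proof.
move=> gw; apply: wgood_cat; first exact/wgood_inv/wgood_scale.
by apply: wgood_cat; exact: wgood_scale.
Qed.

Lemma werr_dom w : wgood w -> exists O : set (R * V)%type,
  [/\ open O, sm O (werr w) & forall z, O (0, z)].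
Proof.
move=> gw; have [ow sw] := sm_word fV gw.
pose m (p : (R * V)%type) : (R * V)%type := (p.1 ^+ 2, p.2).
have sm_m k : CT k setT m.
  apply: CT_pair; [exact: openT| |exact: CT_lin (islin_snd R V)].
  have h := CT_lin k setT (islin_fst R V).
  by apply: CT_loc (CT_scale (@openT _) h h); [exact: openT|move=> p _; rewrite expr2].
have oF := open_fdom fV sX.
have oD : open (setT `&` m @^-1` (fdom X)).
  by apply: open_preim => //; [exact: openT|move=> p _; exact: (CT_cont (sm_m 0%N))].
have oO := openI ow oD.
exists (wdom w `&` (setT `&` m @^-1` (fdom X))); split => //.
  move=> k; apply: CT_sub2 => //; first by apply: CT_sub (sw k) => p [].
  apply: (@CT_comp _ _ _ _ _ _ (fdom X) m (fun p => flow X p.1 p.2)) => //.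
  - by move=> p [_ []].
  - exact: CT_sub (sm_m k).
  - exact: (sm_flow fV sX).
move=> z; split; first by have [] := word0 fV z gw.
by split=> //=; rewrite /m /= expr0n /=; exact: fdom0.
Qed.

Lemma werr_Div w k : wgood w -> (forall z, bO k (fun e => werr w (e, z))) -> Div k (werr w).
Proof. by move=> /werr_dom[D [h1 h2 h3]]; exact: (had_iter fV h1 h2 h3). Qed.

(** The inverse factor contributes the defect -b^k and each forward factor a^k, all along the same
    vector [Y], so they cancel, while the times -b^2, a^2 and a^2 add up to 1. *)
Lemma next_order a b w k : wgood w -> Div k (werr w) ->
  2 * a ^+ 2 - b ^+ 2 = 1 -> 2 * a ^+ k = b ^+ k -> Div k.+1 (werr (wnext a b w)).
Proof.
move=> gw Dw ab2 abk; apply: werr_Div; first exact: wgood_next.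
move=> z0; have [Y HY] := Div_exp fV z0 Dw.
have gb : wgood (wscale b w) := wgood_scale gw.
have ga : wgood (wscale a w) := wgood_scale gw.
have gi := wgood_inv gb.
pose y0 e := wmap (winv (wscale b w)) e z0.
pose x0 e := flow X (- (b * e) ^+ 2) z0.
have bz := bO1_self z0.
have [nW bY0] := bO_word fV gi bz.
have [nx0 bX0] := bO_flow_near fV sX (bO1_sqN b) bz.
have Ex : \forall e \near (0 : R), flow X ((b * e) ^+ 2) (x0 e) = z0.
  near=> e; have d : fdom X (- (b * e) ^+ 2, z0) by near: e.
  by have [_] := flow_inv fV sX d; rewrite opprK.
have Ey : \forall e \near (0 : R), wmap w (b * e) (y0 e) = z0.
  near=> e; have d : wdom (winv (wscale b w)) (e, z0) by near: e.
  by have [_] := winvP fV gi d; rewrite winvK wmap_scale.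
have h0 : bO k.+1 (fun e => z0 - z0 - (0 * e ^+ k) *: Y).
  by exists 0; near=> e; rewrite mul0r scale0r subr0 subrr normr0 mul0r.
have s0 := step_backward HY bX0 bY0 Ex Ey h0.
pose x1 e := flow X ((a * e) ^+ 2) (x0 e).
pose y1 e := wmap w (a * e) (y0 e).
have s1 := step_forward HY a bX0 bY0 s0.
have [_ bX1] := bO_flow_near fV sX (bO1_sq a) bX0.
have bY1 : bO 1 (fun e => y1 e - z0).
  have [_] := bO_word fV ga bY0; apply: bO_ext; near=> e.
  by rewrite wmap_scale.
have s2 := step_forward HY a bX1 bY1 s1.
(* The exact flows of the three stages merge into the flow for time e^2 by the group law, which
   holds locally. *)
have [d d0 Hd] := flow_add fV sX z0.
have small (f : R -> R) : bO 1 f -> \forall e \near (0 : R), `|f e| < d.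
  move=> bf; have b' : bO 1 (fun e => f e - 0) by apply: bO_ext bf; near=> e; rewrite subr0.
  by apply: filterS (bO_small b' d0) => e; rewrite -ball_normE /= sub0r normrN.
have n1 := small _ (bO1_sqN b); have n2 := small _ (bO1_sq a).
have n3 := small _ (bO_add (bO1_sqN b) (bO1_sq a)).
apply: bO_ext s2; near=> e.
have -> : (0 - b ^+ k + a ^+ k + a ^+ k) * e ^+ k = 0 by rewrite -abk; ring.
rewrite scale0r subr0 /werr /wnext !wmap_cat !wmap_scale; congr (_ - _).
have [te1 te2 te3] : [/\ `|- (b * e) ^+ 2| < d, `|(a * e) ^+ 2| < d &
    `|- (b * e) ^+ 2 + (a * e) ^+ 2| < d] by split; near: e.
have [_ _ E1] := Hd z0 _ _ (ballxx _ d0) te1 te2.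
have [_ _ E2] := Hd z0 _ _ (ballxx _ d0) te3 te2.
rewrite /x1 /x0 E1 E2; congr (flow X _ z0); rewrite /=.
by rewrite -[RHS]mul1r -ab2 !exprMn; ring.
Unshelve. all: by end_near. Qed.

(** With b = rho a the second condition says that rho is the k-th root of 2, and the first fixes a
    provided rho^2 < 2. This holds for k > 2, which is why the ladder starts at 3. *)
Lemma scaling_exists k : (3 <= k)%N -> exists a b : R, 2 * a ^+ 2 - b ^+ 2 = 1 /\ 2 * a ^+ k = b ^+ k.
Proof.
move=> k3; have k0 : (0 : R) < k%:R by rewrite ltr0n (leq_trans _ k3).
pose rho : R := expR (ln 2 / k%:R).
have rk : rho ^+ k = 2.
  by rewrite /rho -expRM_natl mulrC divfK ?gt_eqF // lnK // posrE.
have r2 : rho ^+ 2 < 2.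
  rewrite -[ltRHS](@lnK R 2) ?posrE // /rho -expRM_natl ltr_expR.
  rewrite mulrCA gtr_pMr; last by rewrite ln_gt0 // ltr1n.
  by rewrite ltr_pdivrMr // mul1r ltr_nat.
have a0 : 0 < 2 - rho ^+ 2 by rewrite subr_gt0.
exists (Num.sqrt (2 - rho ^+ 2)^-1), (rho * Num.sqrt (2 - rho ^+ 2)^-1).
rewrite !exprMn rk; split=> //.
rewrite sqr_sqrtr; last by rewrite invr_ge0 ltW.
by rewrite -mulrBl divff // gt_eqF.
Qed.

Lemma order_ladder w k : wgood w -> (3 <= k)%N -> Div 3 (werr w) ->
  exists2 w', wgood w' & Div k (werr w') /\ forall a, List.In a w' -> exists c,
     List.In (a.1, (c, a.2.2)) w.
Proof.
move=> gw k3 D3; elim: k k3 => [//|k IH]; rewrite leq_eqVlt => /orP[/eqP <-|k3].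
  by exists w => //; split=> // -[G [c n]] h; exists c.
have [w' gw' [Dw' sub]] := IH k3.
have [a [b [ab2 abk]]] := scaling_exists k3.
exists (wnext a b w'); first exact: wgood_next.
split; first exact: next_order.
have sc c s : List.In s (wscale c w') -> exists c', List.In (s.1, (c', s.2.2)) w.
  move=> /List.in_map_iff[u [<- /sub[c' h]]] /=; by exists c'.
move=> s /List.in_app_iff[|/List.in_app_iff[|]]; [|exact: sc|exact: sc].
rewrite /winv => h.
have : List.In s (map (@sinv R V) (wscale b w')).
  elim: (map _ _) h => [//|x l IHl]; rewrite rev_cons -cats1 => /List.in_app_iff[/IHl ?|[->|[]]].
    by right.
  by left.
move=> /List.in_map_iff[u [<- /sc[c' h']]] /=; by exists c'.
Qed.
End Order.

(** * Second-order expansion of commutators of flows *)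

Section Commutator.
Context {R : realType} {V : normedModType R}.
Hypothesis fV : findim V.

Definition brk (S D : V -> V) (z : V) : V := 'D_(S z) D z - 'D_(D z) S z.

(** First-order Taylor expansion in e. The derivatives of the two terms with respect to the first
    argument cancel, and only the derivative in the direction of [a] survives. *)
Lemma comm_half (z0 : V) (d : R) (a b : (R * V)%type -> V) : 0 < d ->
  sm (ball ((0 : R), z0) d) a -> sm (ball ((0 : R), z0) d) b ->
  bO 2 (fun e => b (e, z0 + e *: a (e, z0)) - b (e, z0) - e *: 'D_((0 : R), a ((0 : R), z0)) b ((0 : R), z0)).
Proof.
move=> d0 sa sb.
have oB : open (ball ((0 : R), z0) d) by exact: ball_open.
have oR : open (ball (0 : R) d) by exact: ball_open.
have B0 : ball ((0 : R), z0) d (0, z0) by exact: ballxx.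
pose i (e : R) : (R * V)%type := (e, z0).
have iB e : ball (0 : R) d e -> ball ((0 : R), z0) d (i e) by move=> be; split => //=; exact: ballxx.
have si k : CT k (ball (0 : R) d) i.
  by apply: CT_pair => //; [exact: CT_lin (@islin_id R R)|exact: CT_cst].
pose c (e : R) : (R * V)%type := (e, z0 + e *: a (i e)).
have sc k : CT k (ball (0 : R) d) c.
  apply: CT_pair => //; first exact: CT_lin (@islin_id R R).
  apply: CT_add => //; first exact: CT_cst.
  apply: CT_scale => //; first exact: CT_lin (@islin_id R R).
  exact: (CT_comp oR iB (si k) (sa k)).
have oU : open (ball (0 : R) d `&` c @^-1` (ball ((0 : R), z0) d)).
  by apply: open_preim => // e be; exact: (CT_cont (sc 0%N)).
have /nbhs_ballP[r /= r0 Hr] : nbhs (0 : R) (ball (0 : R) d `&` c @^-1` (ball ((0 : R), z0) d)).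
  apply: open_nbhs_nbhs; split => //; split; first exact: ballxx.
  by rewrite /c /= scale0r addr0.
have oBr : open (ball (0 : R) r) by exact: ball_open.
pose f (e : R) := b (c e) - b (i e).
have cb : CT 2 (ball (0 : R) r) (b \o c).
  apply: (@CT_comp _ _ _ _ _ _ _ c b oBr _ _ (sb 2%N)); first by move=> e /Hr[].
  by apply: CT_sub (sc 2%N) => e /Hr[].
have cbi : CT 2 (ball (0 : R) r) (b \o i).
  apply: (@CT_comp _ _ _ _ _ _ _ i b oBr _ _ (sb 2%N)); first by move=> e /Hr[/iB].
  by apply: CT_sub (si 2%N) => e /Hr[].
have cf : CT 2 (ball (0 : R) r) f by exact: (CT_sub2 oBr cb cbi).
have := bO_taylor r0 cf.
have -> : f 0 = 0 by rewrite /f /c scale0r addr0 subrr.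
have B0r : ball (0 : R) r 0 by exact: ballxx.
have B0d : ball (0 : R) d 0 by exact: ballxx.
have db := CT_diff (sb 1%N) B0.
have dc : is_derive (0 : R) 1 c ((1 : R), a (0, z0)).
  apply: is_derive_pair.
  have da : differentiable (fun e : R => a (i e)) 0.
    exact: (CT_diff (CT_comp oR iB (si 1%N) (sa 1%N)) B0d).
  have [dm Em] := diff_scale_pair ((0 : R), a (i 0)).
  have dp : is_derive (0 : R) 1 (fun e : R => (e, a (i e))) ((1 : R), 'D_(1 : R) (fun e : R => a (i e)) 0).
    by apply: is_derive_pair; exact: diff_is_derive.
  have h := is_deriveD (is_derive_cst z0 (0 : R) 1) (is_derive_comp dp dm).
  by move: h; rewrite Em /= scale0r !add0r scale1r.
have di : is_derive (0 : R) 1 i ((1 : R), (0 : V)) by apply: is_derive_pair.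
have dbc : differentiable b (c 0) by rewrite /c scale0r addr0.
have h1 := is_derive_comp dc dbc.
have h2 := is_derive_comp di db.
have -> : 'D_(1 : R) f 0 = 'D_((0 : R), a (0, z0)) b (0, z0).
  have := is_deriveB h1 h2 => h; rewrite (@derive_val _ _ _ _ _ _ _ h).
  rewrite /c scale0r addr0 -(islinB _ _ (diff_eps db).1).
  by congr ('D_ _ b _); rewrite -[LHS]/(1 - 1, _ - 0) subrr subr0.
by apply: bO_ext; near=> e; rewrite subr0.
Unshelve. all: by end_near. Qed.

(** Flowing first along S and then along D, or in the other order, gives points that differ by e^2
    times the bracket up to O(e^3). Undoing S and then D brings the second point back to [z0] and
    alters the difference only by O(e^3). *)
Lemma comm_exp (S D : V -> V) (z0 : V) : sm setT S -> sm setT D ->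
  bO 3 (fun e => wmap [:: (S, (1, 1%N)); (D, (1, 1%N)); (S, (-1, 1%N)); (D, (-1, 1%N))] e z0
     - z0 - e ^+ 2 *: brk S D z0).
Proof.
move=> sS sD.
have [d1 [a [d10 Hd1 sa1 Ea1 a01]]] := flow_first fV sS z0.
have [d2 [b [d20 Hd2 sb2 Eb2 b02]]] := flow_first fV sD z0.
pose d := Num.min d1 d2.
have d0 : 0 < d by rewrite lt_min d10.
have sub1 p : ball ((0 : R), z0) d p -> ball ((0 : R), z0) d1 p by apply: le_ball; rewrite ge_min lexx.
have sub2 p : ball ((0 : R), z0) d p -> ball ((0 : R), z0) d2 p by apply: le_ball; rewrite ge_min lexx orbT.
have sa : sm (ball ((0 : R), z0) d) a by move=> k; exact: CT_sub (sa1 k).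
have sb : sm (ball ((0 : R), z0) d) b by move=> k; exact: CT_sub (sb2 k).
have bz := bO1_self z0.
have be : bO 1 (fun e : R => e).
  by have := @bO_pow R 1 1 isT; apply: bO_ext; near=> e; rewrite expr1 mul1r.
pose z1 e := flow S e z0; pose z2 e := flow D e (z1 e).
pose w1 e := flow D e z0; pose w2 e := flow S e (w1 e).
have [_ bz1] := bO_flow_near fV sS be bz.
have [_ bz2] := bO_flow_near fV sD be bz1.
have [nw1 bw1] := bO_flow_near fV sD be bz.
have [nw2 bw2] := bO_flow_near fV sS be bw1.
have hb := comm_half d0 sa sb; have ha := comm_half d0 sb sa.
have B0 : ball ((0 : R), z0) d (0, z0) by exact: ballxx.
have part (g : (R * V)%type -> V) (G : V -> V) (v : V) : sm (ball ((0 : R), z0) d) g -> sm setT G ->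
    (forall z, ball z0 d z -> g (0, z) = G z) -> 'D_((0 : R), v) g ((0 : R), z0) = 'D_v G z0.
  move=> sg sG Eg; have dg := CT_diff (sg 1%N) B0.
  have [dj Ej] : differentiable (fun z : V => ((0 : R), z)) z0 /\ forall v, 'D_v (fun z : V => ((0 : R), z)) z0 = ((0 : R), v).
    have l : islin (fun z : V => ((0 : R), z)) by apply: islin_pair; [exact: islin_cst0|exact: islin_id].
    by split=> [|u]; [exact: islin_diff|rewrite islin_derive].
  have := derive_compE v dj dg; rewrite Ej => <-.
  have E : \forall z \near z0, (g \o (fun z : V => ((0 : R), z))) z = G z.
    by apply: filterS (nbhsx_ballx z0 _ d0) => z bzz /=; exact: Eg.
  by have [_ ->] := near_eq_diff E (differentiable_comp dj dg).
have b0 z : ball z0 d z -> b (0, z) = D z.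
  by move=> h; apply: b02; apply: le_ball h; rewrite ge_min lexx orbT.
have a0 z : ball z0 d z -> a (0, z) = S z.
  by move=> h; apply: a01; apply: le_ball h; rewrite ge_min lexx.
rewrite (part b D _ sb sD b0) (a0 _ (ballxx _ d0)) in hb.
rewrite (part a S _ sa sS a0) (b0 _ (ballxx _ d0)) in ha.
have h12 : bO 3 (fun e => z2 e - w2 e - e ^+ 2 *: brk S D z0).
  apply: bO_ext (@bO_mulX R V 1 2 _ (bO_sub hb ha)); near=> e.
  have e0 : `|e| < d by near: e; exact: near0_lt.
  have Bz : ball ((0 : R), z0) d (e, z0) by apply/ball_pair; split => //; exact: ballxx.
  have Bz1 : ball ((0 : R), z0) d (e, z1 e) by apply/ball_pair; split => //=; near: e; exact: bO_small.
  have Bw1 : ball ((0 : R), z0) d (e, w1 e) by apply/ball_pair; split => //=; near: e; exact: bO_small.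
  rewrite /z2 /w2 (Eb2 _ (sub2 _ Bz1)) (Ea1 _ (sub1 _ Bw1)) /=.
  have E1 : z1 e = z0 + e *: a (e, z0) by rewrite /z1 (Ea1 _ (sub1 _ Bz)).
  have E2 : w1 e = z0 + e *: b (e, z0) by rewrite /w1 (Eb2 _ (sub2 _ Bz)).
  rewrite -E1 -E2 /brk expr1 expr2.
  move: (b (e, z1 e)) (a (e, w1 e)) => bz1' aw1'; rewrite E1 E2; lmod R.
have b2 : bO 2 (fun e => z2 e - w2 e).
  have h := @bO_mulX R V 2 0 _ (bO_cst (brk S D z0)).
  by apply: bO_ext (bO_add (bO_le (leqnSn 2) h12) h); near=> e; rewrite subrK.
have bne : bO 1 (fun e : R => - e) by exact: bO_opp.
have s1 := bO_flow_diff fV sS bne bz2 bw2 b2.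
pose z3 e := flow S (- e) (z2 e).
have [_ bz3] := bO_flow_near fV sS bne bz2.
have h3 : bO 3 (fun e => z3 e - w1 e - (z2 e - w2 e)).
  apply: bO_ext s1; near=> e; have h : fdom S (e, w1 e) by near: e.
  by have [_ ->] := flow_inv fV sS h.
have b3 : bO 2 (fun e => z3 e - w1 e).
  by apply: bO_ext (bO_add (bO_le (leqnSn 2) h3) b2); near=> e; rewrite subrK.
have s2 := bO_flow_diff fV sD bne bz3 bw1 b3.
have h4 : bO 3 (fun e => flow D (- e) (z3 e) - z0 - (z3 e - w1 e)).
  apply: bO_ext s2; near=> e; have h : fdom D (e, z0) by near: e.
  by have [_ ->] := flow_inv fV sD h.
apply: bO_ext (bO_add (bO_add h4 h3) h12); near=> e.
rewrite /wmap /= /stime /= !mul1r !mulN1r !expr1 -/(z1 e) -/(z2 e) -/(z3 e).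
set t := flow D (- e) (z3 e); lmod R.
Unshelve. all: by end_near. Qed.

(** Stated along curves that converge to [z0], not just at [z0]: in a concatenation the second word
    starts from a point that depends on e. *)
Definition expan (w : seq (@wstep R V)) (P : V -> V) : Prop := forall z0 (x : R -> V),
  bO 1 (fun e => x e - z0) -> bO 3 (fun e => wmap w e (x e) - x e - e ^+ 2 *: P (x e)).

(** Divisibility by e^3 with a smooth quotient carries the estimate from fixed points to moving
    ones. *)
Lemma expan_pointwise w P : wgood w -> sm setT P ->
  (forall z0, bO 3 (fun e => wmap w e z0 - z0 - e ^+ 2 *: P z0)) -> expan w P.
Proof.
move=> gw sP H z0 x bx; have [ow sw] := sm_word fV gw.
pose E (p : (R * V)%type) := wmap w p.1 p.2 - p.2 - p.1 ^+ 2 *: P p.2.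
have sE : sm (wdom w) E.
  move=> k; apply: CT_sub2 => //.
    by apply: CT_sub2 => //; exact: CT_lin (islin_snd R V).
  apply: CT_scale => //.
    have h := CT_lin k (wdom w) (islin_fst R V).
    by apply: CT_loc (CT_scale ow h h) => // p _; rewrite expr2.
  exact: (CT_pre ow (islin_snd R V) (fun _ _ => I) (sP k)).
have DE : Div 3 E by apply: (had_iter fV ow sE) => // z; have [] := word0 fV z gw.
have [Y HY] := Div_exp fV z0 DE.
have h := @bO_mulX R V 3 0 _ (bO_cst Y).
apply: bO_ext (bO_add (bO_le (leqnSn 3) (HY 1 x bx)) h); near=> e.
by rewrite /E /= expr1n !mul1r subrK.
Unshelve. all: by end_near. Qed.

Lemma expan_cat w1 w2 P1 P2 : wgood w1 -> expan w1 P1 -> expan w2 P2 -> sm setT P2 ->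
  expan (w1 ++ w2) (fun z => P1 z + P2 z).
Proof.
move=> g1 h1 h2 s2 z0 x bx.
have [_ bx1] := bO_word fV g1 bx.
have [d [L [d0 L0 HL]]] := locLip_pos (CT1_locLip fV (@openT _) (s2 1%N)) (I : [set: V] z0).
have h3 : bO 3 (fun e => e ^+ 2 *: (P2 (wmap w1 e (x e)) - P2 (x e))).
  apply: (@bO_mulX R V 2 1).
  have bd := bO_sub bx1 bx.
  have [C C0 HC] := bO_pos bd.
  have n1 := bO_small bx1 d0; have n2 := bO_small bx d0.
  exists (L * C); near=> e.
  have [_ h] : setT (wmap w1 e (x e)) /\ `|P2 (wmap w1 e (x e)) - P2 (x e)| <= L * `|wmap w1 e (x e) - x e|.
    by apply: HL; near: e.
  apply: le_trans h _; rewrite -mulrA ler_pM2l //.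
  have -> : wmap w1 e (x e) - x e = wmap w1 e (x e) - z0 - (x e - z0) by lmod R.
  by near: e.
apply: bO_ext (bO_add (bO_add (h1 z0 x bx) (h2 z0 _ bx1)) h3); near=> e.
by rewrite wmap_cat; lmod R.
Unshelve. all: by end_near. Qed.

Lemma expan_single (G : V -> V) : sm setT G -> expan [:: (G, (1, 2%N))] G.
Proof.
move=> sG z0 x bx.
have bt : bO 2 (fun e : R => e ^+ 2) by exists 1; near=> e; rewrite mul1r normrX.
apply: (@bO_le _ _ 3 4) => //; apply: bO_ext (flow_exp fV sG (isT : (0 < 2)%N) bt bx); near=> e.
by rewrite /wmap /= /stime /= mul1r.
Unshelve. all: by end_near. Qed.

Lemma sm_brk (S D : V -> V) : sm setT S -> sm setT D -> sm setT (brk S D).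
Proof.
move=> sS sD k; have oT := @openT V.
have H (A B : V -> V) : sm setT A -> sm setT B -> CT k setT (fun z => 'D_(A z) B z).
  move=> sA sB; have [_ h] := sB k.+1.
  have cp : CT k setT (fun z => (z, A z)) by apply: CT_pair => //; exact: CT_lin (@islin_id R V).
  exact: (CT_post oT (islin_snd V V) (CT_comp oT (fun _ _ => conj I I) cp h)).
by apply: CT_sub2 => //; exact: H.
Qed.

Definition wcomm (p : (V -> V) * (V -> V)) : seq (@wstep R V) :=
  [:: (p.1, (1, 1%N)); (p.2, (1, 1%N)); (p.1, (-1, 1%N)); (p.2, (-1, 1%N))].

Lemma base_expan (s0 d0 : V -> V) (I : Type) (r : seq I) (S D : I -> V -> V) :
  sm setT s0 -> sm setT d0 -> (forall i, sm setT (S i)) -> (forall i, sm setT (D i)) ->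
  exists w, [/\ wgood w, expan w (fun z => s0 z + d0 z + \sum_(i <- r) brk (S i) (D i) z) &
    forall a, List.In a w -> ((a.1 = s0 \/ a.1 = d0) \/ (exists i, a.1 = S i \/ a.1 = D i)) /\
      (a.2.2 = 1%N \/ a.2.2 = 2%N)].
Proof.
move=> ss0 sd0 sS sD; have oT := @openT V; elim: r => [|i r [w [gw ew inw]]].
  exists [:: (s0, (1, 2%N)); (d0, (1, 2%N))]; split.
  - by move=> a /= [<-|[<-|[]]].
  - have g0 : wgood [:: (s0, ((1 : R), 2%N))] by move=> a /= [<-|[]].
    have := expan_cat g0 (expan_single ss0) (expan_single sd0) sd0.
    by move=> h z0 x bx; apply: bO_ext (h z0 x bx); near=> e; rewrite big_nil addr0.
  - by move=> a /= [<-|[<-|[]]] /=; split; [left; left|right|left; right|right].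
have gc : wgood (wcomm (S i, D i)) by move=> a /= [<-|[<-|[<-|[<-|[]]]]] /=; split.
exists (wcomm (S i, D i) ++ w); split; first exact: wgood_cat.
  have ec : expan (wcomm (S i, D i)) (brk (S i) (D i)).
    apply: expan_pointwise => //; first exact: sm_brk.
    by move=> z0; exact: (comm_exp z0 (sS i) (sD i)).
  have sP : sm setT (fun z => s0 z + d0 z + \sum_(i <- r) brk (S i) (D i) z).
    move=> k; apply: CT_add => //; first exact: CT_add.
    by apply: CT_sum => // j; exact: sm_brk.
  have h := expan_cat gc ec ew sP.
  move=> z0 x bx; apply: bO_ext (h z0 x bx); near=> e; congr (_ - _ *: _).
  by rewrite big_cons addrCA.
move=> a aw; have [|/inw //] := (List.in_app_iff (wcomm (S i, D i)) w a).1 aw.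
by move=> /= [<-|[<-|[<-|[<-|[]]]]] /=; (split; last by left); right; exists i; [left|right|left|right].
Unshelve. all: by end_near. Qed.

Theorem order_word (X s0 d0 : V -> V) (I : Type) (r : seq I) (S D : I -> V -> V) k :
  sm setT s0 -> sm setT d0 -> (forall i, sm setT (S i)) -> (forall i, sm setT (D i)) ->
  sm setT X -> (forall z, X z = s0 z + d0 z + \sum_(i <- r) brk (S i) (D i) z) -> (3 <= k)%N ->
  exists w, [/\ wgood w, Div k (werr X w) &
    forall a, List.In a w -> ((a.1 = s0 \/ a.1 = d0) \/ (exists i, a.1 = S i \/ a.1 = D i)) /\
      (a.2.2 = 1%N \/ a.2.2 = 2%N)].
Proof.
move=> ss0 sd0 sS sD sX EX k3.
have [w [gw ew inw]] := base_expan r ss0 sd0 sS sD.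
have D3 : Div 3 (werr X w).
  apply: werr_Div => // z0; have bz := bO1_self z0.
  have h2 := expan_single sX bz; have h1 := ew z0 _ bz.
  apply: bO_ext (bO_sub h1 h2); near=> e.
  by rewrite /werr /= -EX /wmap /= /stime /= mul1r; lmod R.
have [w' gw' [Dw' sub]] := order_ladder fV sX gw k3 D3.
by exists w'; split=> // a /sub[c /inw].
Unshelve. all: by end_near. Qed.
End Commutator.

(** * Local and global error *)

Section LocalError.
Context {R : realType}.
Implicit Types V W : normedModType R.

(* Local error of size [h ^ q] in class C^k, locally uniformly on [A]. *)
Fixpoint LO (q k : nat) V W (A : set V) (f : R -> V -> W) : Prop :=
  if k is k'.+1 then @LO q k' (V * V)%type (W * W)%type (A `*` setT) (fun h => tgt (f h))
  else forall z0, A z0 -> exists d C : R, 0 < d /\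
    forall z h, ball z0 d z -> 0 < h < d -> `|f h z| <= C * h ^+ q.

Lemma LO_S q k V W (A : set V) (f : R -> V -> W) : LO q k.+1 A f -> LO q k A f.
Proof.
elim: k V W A f => [|k IH] V W A f; last by move=> h; exact: IH h.
move=> H z0 Az0; have [d [C [d0 HC]]] := H (z0, 0) (conj Az0 I).
exists d, C; split=> // z h bz hd.
have b2 : ball (z0, 0 : V) d (z, 0) by split => //=; exact: ballxx.
apply: le_trans (HC _ _ b2 hd); rewrite prod_normE /= le_max lexx //.
Qed.

Lemma LO_le q j k V W (A : set V) (f : R -> V -> W) : (j <= k)%N -> LO q k A f -> LO q j A f.
Proof. by move=> /subnK <-; elim: (k - j)%N => [//|i IH]; rewrite addSn => /LO_S. Qed.

Lemma near_eq_tgt V W (f g : V -> W) z v d : 0 < d -> (forall x, ball z d x -> f x = g x) ->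
  tgt f (z, v) = tgt g (z, v).
Proof.
move=> d0 E; rewrite /tgt /= (E z (ballxx _ d0)); congr (_, _).
by apply: near_eq_derive; apply: filterS (nbhsx_ballx z _ d0) => x /E.
Qed.

Lemma LO_ext q k V W (A : set V) (f g : R -> V -> W) :
  (forall z0, A z0 -> exists2 d : R, 0 < d & forall z h, ball z0 d z -> 0 < h < d -> f h z = g h z) ->
  LO q k A f -> LO q k A g.
Proof.
elim: k V W A f g => [|k IH] V W A f g E.
  move=> H z0 Az0; have [d [C [d0 HC]]] := H z0 Az0; have [d' d'0 Hd'] := E z0 Az0.
  exists (Num.min d d'), C; split; first by rewrite lt_min d0.
  move=> z h bz; rewrite lt_min => /andP[h0 /andP[hd hd']].
  rewrite -Hd' ?h0 //; last by apply: le_ball bz; rewrite ge_min lexx orbT.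
  by apply: HC; rewrite ?h0 //; apply: le_ball bz; rewrite ge_min lexx.
apply: IH => -[z0 v0] [/= Az0 _]; have [d d0 Hd] := E z0 Az0.
exists (d / 2); first by rewrite divr_gt0.
move=> [z v] h [/= bz _] /andP[h0 hd].
have d20 : 0 < d / 2 by rewrite divr_gt0.
apply: (@near_eq_tgt V W _ _ z v (d / 2)) => // x bx; apply: Hd; last by rewrite h0; lra.
by rewrite -[d](@subrK _ (d / 2)); apply: ball_triangle (le_ball _ bx); [apply: le_ball bz|]; lra.
Qed.

(** Differentiation in z leaves the factor e^q untouched and acts on the quotient alone, so the
    order is the same at each tangent level. *)
Lemma LO_div q k V W (A : set V) (E : R -> V -> W) :
  (forall z0, A z0 -> exists (d : R) (Q : (R * V)%type -> W), [/\ 0 < d,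
     CT k (ball ((0 : R), z0) d) Q & forall e z, ball ((0 : R), z0) d (e, z) -> E e z = e ^+ q *: Q (e, z)]) ->
  LO q k A E.
Proof.
elim: k V W A E => [|k IH] V W A E H.
  move=> z0 Az0; have [d [Q [d0 cQ EQ]]] := H z0 Az0.
  have /cvgrPdist_le/(_ _ ltr01)/nbhs_ballP[r /= r0 Hr] := cQ _ (ballxx _ d0).
  exists (Num.min d r), (`|Q (0, z0)| + 1); split; first by rewrite lt_min d0.
  move=> z h bz; rewrite lt_min => /andP[h0 /andP[hd hr]].
  have B1 : ball ((0 : R), z0) d (h, z).
    by apply/ball_pair; rewrite gtr0_norm //; split=> //; apply: le_ball bz; rewrite ge_min lexx.
  have B2 : ball ((0 : R), z0) r (h, z).
    by apply/ball_pair; rewrite gtr0_norm //; split=> //; apply: le_ball bz; rewrite ge_min lexx orbT.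
  rewrite (EQ _ _ B1) normrZ normrX gtr0_norm // mulrC ler_wpM2r //; first by rewrite exprn_ge0 // ltW.
  have -> : Q (h, z) = Q (0, z0) + (Q (h, z) - Q (0, z0)) by rewrite addrC subrK.
  apply: le_trans (ler_normD _ _) _.
  by rewrite lerD2l distrC; exact: Hr.
apply: IH => -[z0 v0] [/= Az0 _]; have [d [Q [d0 cQ EQ]]] := H z0 Az0.
have oB : open (ball ((0 : R), z0) d) by exact: ball_open.
pose L (p : (R * (V * V))%type) : ((R * V) * (R * V))%type := ((p.1, p.2.1), (0, p.2.2)).
have l2 := @islin_snd R R (V * V)%type.
have lL : islin L.
  apply: islin_pair; apply: islin_pair; [exact: islin_fst| |exact: islin_cst0|].
    exact: (islin_comp l2 (islin_fst _ _)).
  exact: (islin_comp l2 (islin_snd _ _)).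
exists d, (fun p => tgt Q (L p)); split => //.
  have sub (x : (R * (V * V))%type) : ball ((0 : R), (z0, v0)) d x -> (ball ((0 : R), z0) d `*` setT) (L x).
    by case: x => [e [z v]] [/= be [bz _]].
  have oB2 : open (ball ((0 : R), (z0, v0)) d) by exact: ball_open.
  have h := CT_pre oB2 lL sub cQ.2. exact: h.
move=> e z; case: z => z v [/= be [/= bz _]].
have Bez : ball ((0 : R), z0) d (e, z) by [].
have dQ := CT_diff cQ Bez.
have li : islin (fun x : V => ((0 : R), x)) by apply: islin_pair; [exact: islin_cst0|exact: islin_id].
have [di Ei] : differentiable (fun x : V => (e, x)) z /\ forall v, 'D_v (fun x : V => (e, x)) z = ((0 : R), v).
  apply: eps_diff => // eta eta0; near=> x.
  rewrite -[_ - _ - _]/(e - e - 0, x - z - (x - z)) !subrr.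
  by rewrite -[(0, 0)]/(0 : (R * V)%type) normr0 mulr_ge0 // ltW.
have [Ed Ev] : differentiable (fun x => e ^+ q *: Q (e, x)) z /\
   forall v, 'D_v (fun x => e ^+ q *: Q (e, x)) z = e ^+ q *: 'D_((0 : R), v) Q (e, z).
  have dc := differentiable_comp di dQ.
  have ls : islin (fun y : W => e ^+ q *: y) by exact/islin_scale/islin_id.
  split; first exact: (differentiable_comp dc (islin_diff _ ls)).
  move=> u; have := derive_compE u dc (islin_diff _ ls); rewrite (islin_derive _ _ ls) => ->.
  by rewrite (derive_compE u di dQ) Ei.
have nE : \forall x \near z, e ^+ q *: Q (e, x) = E e x.
  have ob : open (ball z0 d) by exact: ball_open.
  have := open_nbhs_nbhs (conj ob bz).
  by apply: filterS => x bx; apply/esym/EQ.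
have [_ ED] := near_eq_diff nE Ed.
by rewrite /tgt /= (EQ _ _ Bez) ED Ev.
Unshelve. all: by end_near. Qed.
End LocalError.

Section Gauge.
Context {R : realType} {I : Type} (F : set_system I) {FF : Filter F}.

(* [Bnd S] says that the families of reals [S i] obey the chosen gauge along [F]:
   a big-O of a fixed quantity, or a little-o of 1. *)
Variable Bnd : (I -> R -> Prop) -> Prop.
(** Upper bounds of sets of reals stand for suprema, so no set has to be shown bounded beforehand;
    sums and constant multiples are all the closure that is needed. *)
Definition gauge_axiom : Prop := forall (S S' T : I -> R -> Prop) (c : R), Bnd S -> Bnd S' ->
  (\forall i \near F, forall a b, 0 <= a -> 0 <= b -> (forall x, S i x -> x <= a) ->
     (forall x, S' i x -> x <= b) -> forall x, T i x -> x <= c * (a + b)) -> Bnd T.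

Definition bdQ (V W : normedModType R) (U : set V) (f : I -> V -> W) : Prop :=
  Bnd (fun i x => exists2 z, U z & x = `|f i z|).

Definition cball (V : normedModType R) (M : R) : set V := [set v | `|v| <= M].

(* The quality [Q] for the k-fold iterated tangent maps, on bounded sets of tangent vectors. *)
Fixpoint rec (Q : forall V W : normedModType R, set V -> (I -> V -> W) -> Prop) (k : nat)
    (V W : normedModType R) (U : set V) (f : I -> V -> W) : Prop :=
  if k is k'.+1 then forall M : R,
    @rec Q k' (V * V)%type (W * W)%type (U `*` cball M) (fun i => tgt (f i))
  else Q V W U f.

Definition Qext (Q : forall V W : normedModType R, set V -> (I -> V -> W) -> Prop) : Prop :=
  forall (V W : normedModType R) (U : set V) (f g : I -> V -> W),
   (\forall i \near F, forall z, U z -> f i z = g i z) -> Q V W U f -> Q V W U g.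

Lemma rec_ext Q k (V W : normedModType R) (U : set V) (f g : I -> V -> W) : Qext Q ->
  (\forall i \near F, exists O : set V, [/\ open O, U `<=` O & forall z, O z -> f i z = g i z]) ->
  rec Q k U f -> rec Q k U g.
Proof.
move=> HQ; elim: k V W U f g => [|k IH] V W U f g E.
  by apply: HQ; apply: filterS E => i [D [oD UD H]] z /UD /H.
move=> H M; apply: IH (H M); apply: filterS E => i [D [oD UD E]].
exists (D `*` setT); split; first exact: openXT.
  by move=> [z v] [/= /UD].
move=> [z v] [/= Dz _].
have /nbhs_ballP[d /= d0 Hd] := open_nbhs_nbhs (conj oD Dz).
by apply: (@near_eq_tgt R V W _ _ z v d) => // x /Hd /E.
Qed.

Hypothesis GA : gauge_axiom.

Lemma bdQ_ext : Qext bdQ.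
Proof.
move=> V W U f g E B; apply: (GA (c := 1) B B); apply: filterS E => i E a b a0 b0 Ha _ x [z Uz ->].
rewrite -(E z Uz) mul1r; apply: (@le_trans _ _ a); last by rewrite lerDl.
by apply: Ha; exists z.
Qed.
End Gauge.

(** * Accumulation of local errors *)

Section GlobalError.
Context {R : realType}.
Variables (T : R) (p : nat).
Hypotheses (T0 : 0 < T) (p0 : (0 < p)%N).

(** A statement along this filter holds for all small h, uniformly in the number of steps that fit
    into the time T. *)
Definition steps : set_system (R * nat)%type :=
  [set S | \forall h \near (0 : R)^'+, forall m : nat, m%:R * h <= T -> S (h, m)].

Lemma steps_filter : Filter steps.
Proof.
apply: Build_Filter.
- by rewrite /steps /=; near=> h.
- move=> P Q; rewrite /steps /=; apply: filterS2 => h hP hQ m mT.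
  by split; [exact: hP|exact: hQ].
- by move=> P Q PQ; rewrite /steps /=; apply: filterS => h H m /H /PQ.
Unshelve. all: by end_near. Qed.

Definition powB (S : (R * nat)%type -> R -> Prop) : Prop :=
  exists C : R, steps (fun i => forall x, S i x -> x <= C * i.1 ^+ p).

Lemma powB_gauge : gauge_axiom steps powB.
Proof.
move=> S S' W c [C HC] [C' HC'] H.
pose B := `|C| + `|C'|; exists (`|c| * B).
have FF := steps_filter.
rewrite /steps /=; near=> h => m mT x Wx.
have h0 : 0 < h by [].
have hp : 0 <= h ^+ p by rewrite exprn_ge0 // ltW.
have h1 : forall a b, 0 <= a -> 0 <= b -> (forall x, S (h, m) x -> x <= a) ->
     (forall x, S' (h, m) x -> x <= b) -> forall x, W (h, m) x -> x <= c * (a + b).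
  by move: m mT {Wx}; near: h.
have h2 : forall x, S (h, m) x -> x <= C * h ^+ p by move: m mT {Wx h1}; near: h.
have h3 : forall x, S' (h, m) x -> x <= C' * h ^+ p by move: m mT {Wx h1 h2}; near: h.
have := h1 (`|C| * h ^+ p) (`|C'| * h ^+ p); rewrite !mulr_ge0 // => /(_ isT isT) h4.
apply: le_trans (h4 _ _ _ Wx) _.
- by move=> y /h2 hy; apply: le_trans hy _; rewrite ler_wpM2r // ler_norm.
- by move=> y /h3 hy; apply: le_trans hy _; rewrite ler_wpM2r // ler_norm.
- rewrite -mulrDl -mulrA ler_wpM2r ?ler_norm // mulr_ge0 // addr_ge0 //.
Unshelve. all: by end_near. Qed.

(** The errors satisfy e_(m+1) <= (1 + C h) e_m + C h^(p+1), hence e_m <= C h^(p+1) m exp (C h m).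
    The constants hold only in a tube around the compact set [K], and the estimate itself shows that
    the iterates stay in it. *)
Lemma global_C0 (V : normedModType R) (X : V -> V) (A U K : set V) (Psi : R -> V -> V) :
  findim V -> sm setT X -> open A -> compact K -> K `<=` A ->
  (forall z, U z -> exists g, icurve (fun x => T *: X x) z g /\ forall t : R, 0 <= t <= 1 -> K (g t)) ->
  LO p.+1 0 A (fun h z => Psi h z - flow X h z) ->
  exists C : R, \forall h \near (0 : R)^'+, forall m : nat, m%:R * h <= T -> forall z, U z ->
    [/\ A (iter m (Psi h) z), fdom X (m%:R * h, z) &
        `|flow X (m%:R * h) z - iter m (Psi h) z| <= C * h ^+ p].
Proof.
move=> fV sX oA cK KA Hc lo.
have [d d0 Hd] : exists2 d : R, 0 < d & forall e z, 0 < e <= d -> K z ->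
   forall x h, ball z e x -> 0 < h < e -> [/\ A x, `|Psi h x - flow X h x| <= e^-1 * h ^+ p.+1 &
     `|flow X h x - flow X h z| <= (1 + e^-1 * h) * `|x - z|].
  apply: cpt_unif => // z0 Kz0.
  have [d1 [C1 [d10 H1]]] := lo z0 (KA _ Kz0).
  have [d2 [C2 [d20 C20 _ H2]]] := flow_loc fV sX z0.
  have /nbhs_ballP[d3 /= d30 H3] := open_nbhs_nbhs (conj oA (KA _ Kz0)).
  pose c := `|C1| + C2 + 1.
  have c0 : 0 < c by rewrite ltr_wpDl // addr_ge0 // ltW.
  pose d := Num.min (Num.min d1 d2) (Num.min d3 c^-1).
  have dd : 0 < d by rewrite !lt_min d10 d20 d30 invr_gt0.
  exists (d / 2); first by rewrite divr_gt0.
  move=> e z /andP[e0 ed] bz x h bx /andP[h0 he].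
  have bxd : ball z0 d x by rewrite -[d](@subrK _ (d / 2)); apply: ball_triangle (le_ball _ bx); [apply: le_ball bz|]; lra.
  have bzd : ball z0 d z by apply: le_ball bz; lra.
  have hd : h < d by lra.
  move: hd; rewrite !lt_min => /andP[/andP[hd1 hd2] /andP[hd3 hc]].
  have Dd1 : d <= d1 by rewrite !ge_min lexx.
  have Dd2 : d <= d2 by rewrite !ge_min lexx !orbT.
  have Dd3 : d <= d3 by rewrite !ge_min lexx !orbT.
  have cd : c <= e^-1.
    rewrite -[c]invrK lef_pV2 ?posrE ?invr_gt0 //.
    have : d <= c^-1 by rewrite !ge_min lexx !orbT.
    lra.
  split.
  - by apply: H3; exact: le_ball bxd.
  - apply: (@le_trans _ _ (C1 * h ^+ p.+1)).
      by apply: H1; rewrite ?h0 ?hd1 //; exact: le_ball bxd.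
    rewrite ler_wpM2r ?exprn_ge0 ?(ltW h0) //; apply: le_trans cd.
    by rewrite /c; have := ler_norm C1; lra.
  - have h2 : `|h| < d2 by rewrite gtr0_norm.
    have := H2 h x z h2 (le_ball Dd2 bxd) (le_ball Dd2 bzd); rewrite gtr0_norm // => h4.
    have -> : flow X h x - flow X h z = (flow X h x - flow X h z - (x - z)) + (x - z) by rewrite subrK.
    apply: le_trans (ler_normD _ _) _; rewrite mulrDl mul1r addrC lerD2l.
    apply: le_trans h4 _; rewrite ler_wpM2r // ler_wpM2r ?(ltW h0) //; apply: le_trans cd.
    by rewrite /c; have := normr_ge0 C1; lra.
pose C := d^-1; have C0 : 0 < C by rewrite invr_gt0.
have dd : 0 < d <= d by rewrite d0 lexx.
(* The value of C h m exp (C h m) at m h = T. *)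
pose B := C * T * expR (C * T).
have B0 : 0 < B by rewrite !mulr_gt0 // expR_gt0.
exists B.
have Bd : 0 < d / B by rewrite divr_gt0.
near=> h.
have h0 : 0 < h by [].
have hd : h < d by near: h; exact: nbhs_right_lt.
have h1 : h < 1 by near: h; exact: nbhs_right_lt.
have hB : B * h < d.
  by rewrite mulrC -ltr_pdivlMr //; near: h; exact: nbhs_right_lt.
(* Here a positive order matters: the accumulated error is at most B h, which is smaller than the
   radius of the tube. *)
have hp : h ^+ p <= h.
  by case: (p) p0 => [//|q] _; rewrite exprS ler_piMr ?(ltW h0) // exprn_ile1 // ltW.
have hh : 0 < h < d by rewrite h0.
have main m z : U z -> m%:R * h <= T -> [/\ K (flow X (m%:R * h) z), fdom X (m%:R * h, z) &
   `|iter m (Psi h) z - flow X (m%:R * h) z| <= C * h ^+ p.+1 * m%:R * expR (C * h * m%:R)].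
  move=> Uz; have [g [ig gK]] := Hc z Uz; have [g0 _ _] := ig.
  have fd : fdom X (T, z) by exists g.
  have sI (j : nat) : j%:R * h <= T -> 0 <= j%:R * h / T <= 1.
    move=> jT; rewrite divr_ge0 ?mulr_ge0 ?(ltW h0) ?(ltW T0) //=.
    by rewrite ler_pdivrMr // mul1r.
  have Eg s : 0 <= s <= 1 -> flow X (s * T) z = g s.
    move=> s01; have I0 : 0 <= (0 : R) <= 1 by rewrite lexx ler01.
    have := icurve_restrict ig I0 s01; rewrite g0 subr0 /= => i.
    by rewrite (flow_icurve fV sX i) mulr1 add0r.
  have ET (j : nat) : j%:R * h / T * T = j%:R * h by rewrite divfK // gt_eqF.
  elim: m => [|m IH] mT.
    rewrite mul0r flow0 // subrr normr0; split; last by rewrite mulr0 mul0r.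
      by rewrite -g0; apply: gK; rewrite lexx ler01.
    exact: fdom0.
  have mT' : m%:R * h <= T by apply: le_trans mT; rewrite ler_pM2r // ler_nat.
  have [Km fm em] := IH mT'.
  have [f1 f2 E] := flow_restrict fV sX fd (sI _ mT') (sI _ mT).
  rewrite -mulrBl !ET -mulrBl -natrB // subSnn mul1r divfK ?gt_eqF // in f1 f2 E.
  have [fS _ _] := flow_restrict fV sX fd (sI _ mT) (sI _ mT); rewrite ET in fS.
  split => //.
    by rewrite -ET Eg; [apply: gK|]; exact: sI.
  have bm : ball (flow X (m%:R * h) z) d (iter m (Psi h) z).
    rewrite -ball_normE /= distrC; apply: le_lt_trans em _; apply: le_lt_trans hB.
    have Em : C * h * m%:R = C * (m%:R * h) by ring.
  rewrite Em exprSr; move: (expR_gt0 (C * (m%:R * h))); set ex := expR _ => ex0.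
  rewrite (_ : C * (h ^+ p * h) * m%:R * ex = (C * (m%:R * h) * ex) * h ^+ p); last by ring.
    have exT : ex <= expR (C * T) by rewrite ler_expR ler_pM2l.
    have mh0 : 0 <= m%:R * h by rewrite mulr_ge0 // ltW.
    have Cm0 : 0 <= C * (m%:R * h) by rewrite mulr_ge0 // ltW.
    apply: ler_pM => //.
    + by rewrite mulr_ge0 // ltW.
    + by rewrite exprn_ge0 // ltW.
    + by apply: ler_pM => //; [exact: ltW|rewrite ler_pM2l].
  have [_ e1 e2] := Hd _ _ dd Km _ _ bm hh.
  rewrite iterS -E -/C in e1 e2 *.
  set y := iter m (Psi h) z in em e1 e2 bm *; set x := flow X (m%:R * h) z in em e2 bm *.
  have -> : Psi h y - flow X h x = (Psi h y - flow X h y) + (flow X h y - flow X h x) by lmod R.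
  apply: le_trans (ler_normD _ _) _; apply: le_trans (lerD e1 e2) _.
  set a := C * h ^+ p.+1 in em *.
  have a0 : 0 <= a by rewrite mulr_ge0 ?exprn_ge0 // ltW.
  have Ch : 0 <= C * h by rewrite mulr_ge0 // ltW.
  have q1 : 1 + C * h <= expR (C * h) by exact: expR_ge1Dx.
  have q2 : 1 <= expR (C * h * m.+1%:R) by rewrite -(@expR0 R) ler_expR mulr_ge0.
  have q3 : expR (C * h * m.+1%:R) = expR (C * h) * expR (C * h * m%:R).
    by rewrite -expRD -natr1 mulrDr mulr1 addrC.
  have q4 : (1 + C * h) * `|y - x| <= expR (C * h) * (a * m%:R * expR (C * h * m%:R)).
    by apply: ler_pM => //; rewrite addr_ge0.
  have q5 : a <= a * expR (C * h * m.+1%:R) by rewrite ler_peMr.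
  rewrite -natr1 mulrDr mulr1 mulrDl; rewrite -natr1 in q3 q5 *.
  have -> : a * m%:R * expR (C * h * (m%:R + 1)) = expR (C * h) * (a * m%:R * expR (C * h * m%:R)).
    by rewrite q3; ring.
  lra.
move=> m mT z Uz; have [Km fm em] := main m z Uz mT.
have em' : `|iter m (Psi h) z - flow X (m%:R * h) z| <= B * h ^+ p.
  apply: le_trans em _; have Em : C * h * m%:R = C * (m%:R * h) by ring.
  rewrite Em exprSr; move: (expR_gt0 (C * (m%:R * h))); set ex := expR _ => ex0.
  rewrite (_ : C * (h ^+ p * h) * m%:R * ex = (C * (m%:R * h) * ex) * h ^+ p); last by ring.
  have exT : ex <= expR (C * T) by rewrite ler_expR ler_pM2l.
  have mh0 : 0 <= m%:R * h by rewrite mulr_ge0 // ltW.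
  have Cm0 : 0 <= C * (m%:R * h) by rewrite mulr_ge0 // ltW.
  apply: ler_wpM2r; first by rewrite exprn_ge0 // ltW.
  by apply: ler_pM => //; [exact: ltW|rewrite ler_pM2l].
have bm : ball (flow X (m%:R * h) z) d (iter m (Psi h) z).
  rewrite -ball_normE /= distrC; apply: le_lt_trans em' _; apply: le_lt_trans hB.
  by rewrite ler_pM2l.
have [Am _ _] := Hd _ _ dd Km _ _ bm hh.
by split; rewrite // distrC.
Unshelve. all: by end_near. Qed.
End GlobalError.

Section FlowTgt.
Context {R : realType} {V : normedModType R}.
Hypothesis fV : findim V.
Variable X : V -> V.
Implicit Types (t s e c : R) (z v : V).

Lemma tgt_scale (A : set V) c z v : (forall z, A z -> differentiable X z) -> A z ->
  tgt (fun x => c *: X x) (z, v) = c *: tgt X (z, v).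
Proof.
move=> dX Az; rewrite /tgt /= -[RHS]/(c *: X z, c *: 'D_v X z); congr (_, _).
by apply: deriveZ; exact/diff_derivable/dX.
Qed.

Lemma idom_cpt_tgt (A K : set V) (Y : V -> V) (U : set V) M : open A -> CT 1 A Y -> compact K -> K `<=` A ->
  (forall z, U z -> exists g, icurve Y z g /\ forall t : R, 0 <= t <= 1 -> K (g t)) ->
  exists M', forall zv, (U `*` cball M) zv -> exists g, icurve (tgt Y) zv g /\
     forall t : R, 0 <= t <= 1 -> (K `*` cball M') (g t).
Proof.
move=> oA cY cK KA H; have [B B0 HB] := op_bound_cpt fV oA cY cK KA.
exists (M * expR (B + 1)) => -[z v] [/= /H[g [ig gK]] vM].
have [_ cg _] := ig.
have gA (t : R) : 0 <= t <= 1 -> A (g t) by move=> /gK /KA.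
have [y vy] := vcurve_ex fV oA cY v cg gA.
exists (fun t => (g t, y t)); split; first exact: icurve_tgt.
move=> t tI; split => /=; first exact: gK.
apply: le_trans (vcurve_bound (fun s sI => HB _ (gK s sI)) B0 vy tI) _.
apply: ler_pM; [by []|exact: expR_ge0|exact: vM|].
by rewrite ler_expR ler_piMr ?addr_ge0 ?(ltW B0) //; case/andP: tI.
Qed.

Hypothesis sX : sm setT X.
Let dX z : differentiable X z. Proof. exact: (CT_diff (sX 1%N)). Qed.

Lemma sm_tgt : sm setT (tgt X).
Proof. by move=> k; have [_ h] := sX k.+1; apply: CT_sub h => -[]. Qed.

Lemma tgt_scaleT c : tgt (fun x => c *: X x) = (fun zv => c *: tgt X zv).
Proof. by apply/funext => -[z v]; apply: (@tgt_scale setT). Qed.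

Lemma flow_tgt t z v : fdom X (t, z) -> flow (tgt X) t (z, v) = tgt (flow X t) (z, v).
Proof.
move=> [g /= ig]; rewrite flow_fl -tgt_scaleT.
have c1 : CT 1 setT (fun x => t *: X x) by apply: CT_scalec; [exact: openT|exact: sX].
rewrite (fl_tgt fV (@openT _) c1); last by exists g.
by congr (tgt _ _); apply/funext => x; rewrite flow_fl.
Qed.

Lemma flow_slice k t (D : set V) : open D -> (forall z, D z -> fdom X (t, z)) -> CT k D (flow X t).
Proof.
move=> oD H; apply: (@CT_comp _ _ _ _ _ _ (fdom X) (fun z => (t, z)) (fun p => flow X p.1 p.2)) => //.
  by apply: CT_pair => //; [exact: CT_cst|exact: CT_lin (@islin_id R V)].
exact: sm_flow.
Qed.

Lemma open_fslice t : open [set z | fdom X (t, z)].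
Proof.
have := @open_preim R V (R * V)%type setT (fun z => (t, z)) (fdom X) (@openT _) _ (open_fdom fV sX).
rewrite setTI; apply => y _; apply: cont_pair; [exact: cvg_cst|exact: cvg_id].
Qed.

Lemma flow_diff t z : fdom X (t, z) -> differentiable (flow X t) z.
Proof. by move=> h; exact: (CT_diff (flow_slice 1 (open_fslice t) (fun _ h => h)) h). Qed.
End FlowTgt.

Section Iterates.
Context {R : realType} {V : normedModType R}.
Implicit Types (A : set V) (f : V -> V).

Definition itdom A f (m : nat) : set V := [set z | forall j, (j < m)%N -> A (iter j f z)].

Lemma itdomS A f m : itdom A f m.+1 = itdom A f m `&` (iter m f) @^-1` A.
Proof.
apply/seteqP; split=> [z H|z [H1 H2] j].
  by split=> [j jm|]; apply: H => //; exact: ltnW.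
by rewrite ltnS leq_eqVlt => /orP[/eqP -> //|]; exact: H1.
Qed.

Lemma CT_iter k A f m : open A -> CT k A f -> open (itdom A f m) /\ CT k (itdom A f m) (iter m f).
Proof.
move=> oA cf; elim: m => [|m [oI cI]].
  split; last exact: CT_lin (@islin_id R V).
  by rewrite (_ : itdom _ _ _ = setT); [exact: openT|apply/seteqP; split].
have oS : open (itdom A f m.+1).
  by rewrite itdomS; apply: open_preim => // y; exact: CT_cont cI.
split=> //; apply: (@CT_comp _ _ _ _ _ _ A (iter m f) f) => //; first by move=> z H; exact: H.
by apply: CT_sub cI; rewrite itdomS => z [].
Qed.

Lemma tgt_iter A f m z v : open A -> CT 1 A f -> itdom A f m z ->
  iter m (tgt f) (z, v) = tgt (iter m f) (z, v).
Proof.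
move=> oA cf; elim: m => [|m IH].
  by move=> _; rewrite /tgt /= derive_id.
rewrite itdomS => -[Hm Hz]; rewrite iterS IH //.
have [oI cI] := CT_iter m oA cf.
by rewrite -(@tgt_comp _ _ _ _ (iter m f) f (z, v)) //; [exact: CT_diff cI Hm|exact: CT_diff cf Hz].
Qed.
End Iterates.

Section GlobalCk.
Context {R : realType}.
Variables (T : R) (p : nat).
Hypotheses (T0 : 0 < T) (p0 : (0 < p)%N).

Lemma near_steps (P : (R * nat)%type -> Prop) :
  (\forall h \near (0 : R)^'+, forall m : nat, m%:R * h <= T -> P (h, m)) ->
  \forall i \near steps T, P i.
Proof. by []. Qed.

Theorem global_Ck r (V : normedModType R) (X : V -> V) (A U K : set V) (Psi : R -> V -> V) :
  findim V -> sm setT X -> open A -> compact K -> K `<=` A ->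
  (forall z, U z -> exists g, icurve (fun x => T *: X x) z g /\ forall t : R, 0 <= t <= 1 -> K (g t)) ->
  (\forall h \near (0 : R)^'+, CT r A (Psi h)) ->
  LO p.+1 r A (fun h z => Psi h z - flow X h z) ->
  rec (bdQ (powB T p)) r U (fun i z => flow X (i.2%:R * i.1) z - iter i.2 (Psi i.1) z).
Proof.
elim: r V X A U K Psi => [|r IH] V X A U K Psi fV sX oA cK KA Hc cPsi lo.
  have [C HC] := global_C0 T0 p0 fV sX oA cK KA Hc lo.
  exists C; rewrite /steps /=; apply: filterS HC => h H m mT x [z Uz ->].
  by have [] := H m mT z Uz.
move=> M.
have fVV := findim_prod fV fV.
have c1 : CT 1 setT (fun x => T *: X x) by apply: CT_scalec; [exact: openT|exact: sX].
have [M' HM'] := idom_cpt_tgt fV M (@openT _) c1 cK (fun _ _ => I) Hc.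
rewrite (tgt_scaleT sX) in HM'.
have [C HC] := global_C0 T0 p0 fV sX oA cK KA Hc (LO_le (leq0n _) lo).
pose Psi' h := tgt (Psi h).
have cPsi' : \forall h \near (0 : R)^'+, CT r (A `*` setT) (Psi' h).
  by apply: filterS cPsi => h [].
have lo' : LO p.+1 r (A `*` setT) (fun h z => Psi' h z - flow (tgt X) h z).
  apply: (@LO_ext R p.+1 r _ _ _ (fun h => tgt (fun z => Psi h z - flow X h z))); last exact: lo.
  move=> -[z0 v0] [/= Az0 _].
  have /nbhs_ballP[d1 /= d10 H1] := open_nbhs_nbhs (conj oA Az0).
  have /nbhs_ballP[d2 /= d20 H2] := open_nbhs_nbhs (conj (open_fdom fV sX) (fdom0 X z0)).
  have [d3 /= d30 H3] := cPsi.
  exists (Num.min d1 (Num.min d2 d3)); first by rewrite !lt_min d10 d20.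
  move=> [z v] h [/= bz _] /andP[h0]; rewrite !lt_min => /andP[hd1 /andP[hd2 hd3]].
  have Az : A z by apply: H1; apply: le_ball bz; rewrite ge_min lexx.
  have fz : fdom X (h, z).
    by apply: H2; apply/ball_pair; rewrite gtr0_norm //; split=> //; apply: le_ball bz; rewrite !ge_min lexx orbT.
  have cP : CT r.+1 A (Psi h) by apply: H3 => //=; rewrite sub0r normrN gtr0_norm.
  rewrite /Psi' (flow_tgt fV sX v fz) /tgt /= -[RHS]/(_ - _, _ - _); congr (_, _).
  by apply: deriveB; apply: diff_derivable; [exact: CT_diff cP Az|exact: flow_diff].
have cK' : compact (K `*` @cball R V M') by apply: compact_setX => //; exact: compact_cball.
have KA' : (K `*` @cball R V M') `<=` (A `*` setT) by move=> [z v] [/= Kz _]; split => //=; exact: KA.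
have IHV := IH _ (tgt X) (A `*` setT) (U `*` @cball R V M) (K `*` @cball R V M') Psi' fVV.
have IHV2 := IHV (sm_tgt sX) (openXT oA) cK' KA' HM' cPsi' lo'.
have FF : Filter (steps T) := steps_filter T.
apply: (rec_ext (bdQ_ext (@powB_gauge R T p)) _ IHV2).
apply: near_steps; near=> h => m mT.
have cP : CT r.+1 A (Psi h) by near: h.
have cP1 : CT 1 A (Psi h) by exact: CT_le cP.
have Hh : forall m : nat, m%:R * h <= T -> forall z, U z ->
    [/\ A (iter m (Psi h) z), fdom X (m%:R * h, z) &
        `|flow X (m%:R * h) z - iter m (Psi h) z| <= C * h ^+ p] by near: h.
have [oI cI] := CT_iter m oA cP1.
have h0 : 0 < h by [].
exists (([set z | fdom X (m%:R * h, z)] `&` itdom A (Psi h) m) `*` setT); split.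
- by apply: openXT; apply: openI => //; exact: open_fslice.
- move=> [z v] [/= Uz _]; split=> //=; split; first by have [] := Hh m mT z Uz.
  move=> j jm; have jT : j%:R * h <= T by apply: le_trans mT; rewrite ler_pM2r // ler_nat ltnW.
  by have [] := Hh j jT z Uz.
- move=> [z v] [/= [fz Iz] _].
  rewrite (flow_tgt fV sX v fz) (tgt_iter v oA cP1 Iz) /tgt /= -[LHS]/(_ - _, _ - _); congr (_, _).
  by apply/esym/deriveB; apply: diff_derivable; [exact: flow_diff|exact: CT_diff cI Iz].
Unshelve. all: by end_near. Qed.
End GlobalCk.

(** * Contact geometry of the jet space *)

Section ContactField.
Context {R : realType} {n : nat}.
Implicit Types (H K : ham R n) (z v w : jet R n).

Lemma findim_jet : findim (jet R n).
Proof.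
have h := findim_prod (findim_prod (@findim_rV R n) (@findim_R R)) (@findim_rV R n).
exact: h.
Qed.

Lemma islin_x i : islin (fun z : jet R n => z.1.1 0 i).
Proof.
have h := islin_comp (islin_fst (base R n) 'rV[R]_n) (islin_comp (islin_fst 'rV[R]_n R) (islin_coord i)).
exact: h.
Qed.
Lemma islin_u : islin (fun z : jet R n => z.1.2).
Proof. have h := islin_comp (islin_fst (base R n) 'rV[R]_n) (islin_snd 'rV[R]_n R); exact: h. Qed.
Lemma islin_mom i : islin (fun z : jet R n => mom z i).
Proof. have h := islin_comp (islin_snd (base R n) 'rV[R]_n) (islin_coord i); exact: h. Qed.

Lemma CT_row (V : normedModType R) k (A : set V) (f : 'I_n -> V -> R) : open A ->
  (forall i, CT k A (f i)) -> CT k A (fun y => \row_i f i y).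
Proof.
move=> oA cf.
have h : CT k A (fun y => \sum_i f i y *: (delta_mx 0 i : 'rV[R]_n)).
  by apply: CT_sum => // i; apply: CT_scale => //; exact: CT_cst.
apply: CT_loc h => // z _; rewrite [RHS]row_sum_delta.
by apply: eq_bigr => i _; rewrite mxE.
Qed.

Lemma CT_contact_field k (A : set (jet R n)) H : open A -> CT k.+1 A H -> CT k A (contact_field H).
Proof.
move=> oA cH; have cD v : CT k A ('D_v H) by exact: CT_derive.
have cm i : CT k A (fun z => mom z i) by exact/CT_lin/islin_mom.
apply: CT_pair => //; first apply: CT_pair => //.
- apply: CT_row => // i; exact: (cD (e_p i)).
- apply: CT_sub2 => //; last exact: CTS.
  by apply: CT_sum => // i; exact: (CT_scale oA (cm i) (cD (e_p i))).
- apply: CT_row => // i; apply: CT_opp => //; apply: CT_add => //; first exact: (cD (e_x i)).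
  exact: (CT_scale oA (cm i) (cD e_u)).
Qed.

Lemma jet_decomp v : v = \sum_i v.1.1 0 i *: e_x i + v.1.2 *: e_u + \sum_i v.2 0 i *: e_p i.
Proof.
have E (v1 v2 : jet R n) : (forall i, v1.1.1 0 i = v2.1.1 0 i) -> v1.1.2 = v2.1.2 ->
    (forall i, v1.2 0 i = v2.2 0 i) -> v1 = v2.
  case: v1 => [[x1 u1] p1]; case: v2 => [[x2 u2] p2] /= h1 h2 h3.
  by congr (_, _, _) => //; apply/rowP.
have d (i j : 'I_n) : (delta_mx 0 j : 'rV[R]_n) 0 i = (j == i)%:R by rewrite mxE eqxx /= eq_sym.
have pick (f : 'I_n -> R) (i : 'I_n) : \sum_j f j *: ((j == i)%:R : R) = f i.
  rewrite (bigD1 i) //= eqxx big1 ?addr0 => [|j ne]; first exact: mulr1.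
  by rewrite (negbTE ne) scaler0.
have z0 (f : 'I_n -> R) : \sum_j f j *: (0 : R) = 0 by rewrite big1 // => j _; rewrite scaler0.
apply: E => [i||i].
- rewrite !(islinD _ _ (islin_x i)) !(islin_sum _ _ _ (islin_x i)) (islinZ _ _ (islin_x i)).
  under eq_bigr => j _ do rewrite (islinZ _ _ (islin_x i)) /= d.
  under [X in _ + X]eq_bigr => j _ do rewrite (islinZ _ _ (islin_x i)) /= mxE.
  by rewrite pick z0 /= mxE scaler0 !addr0.
- rewrite !(islinD _ _ islin_u) !(islin_sum _ _ _ islin_u) (islinZ _ _ islin_u).
  under eq_bigr => j _ do rewrite (islinZ _ _ islin_u) /=.
  under [X in _ + X]eq_bigr => j _ do rewrite (islinZ _ _ islin_u) /=.
  by rewrite !z0 /= [_ *: 1]mulr1 add0r addr0.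
- have lp := islin_mom i; rewrite /mom in lp.
  rewrite !(islinD _ _ lp) !(islin_sum _ _ _ lp) (islinZ _ _ lp).
  under eq_bigr => j _ do rewrite (islinZ _ _ lp) /= mxE.
  under [X in _ + X]eq_bigr => j _ do rewrite (islinZ _ _ lp) /= d.
  by rewrite pick z0 /= mxE scaler0 !add0r.
Qed.

Lemma derive_jet H z v : differentiable H z ->
  'D_v H z = \sum_i v.1.1 0 i * d_x i H z + v.1.2 * d_u H z + \sum_i v.2 0 i * d_p i H z.
Proof.
move=> dH; have [lD _] := diff_eps dH.
rewrite {1}(jet_decomp v) !(islinD _ _ lD) !(islin_sum _ _ _ lD) (islinZ _ _ lD).
by congr (_ + _ + _); apply: eq_bigr => i _; rewrite (islinZ _ _ lD).
Qed.

Lemma derive_post (V W Z : normedModType R) (F : V -> W) (l : W -> Z) (z v : V) : islin l ->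
  differentiable F z -> l ('D_v F z) = 'D_v (fun x => l (F x)) z.
Proof.
move=> ll dF; have := derive_compE v dF (islin_diff (F z) ll).
by rewrite (islin_derive _ _ ll) => <-.
Qed.

Lemma deriveMR (V : normedModType R) (f g : V -> R) (z v : V) : differentiable f z -> differentiable g z ->
  'D_v (fun x => f x * g x) z = 'D_v f z * g z + f z * 'D_v g z.
Proof.
move=> df dg; have := deriveM (diff_derivable (v := v) df) (diff_derivable (v := v) dg).
by move=> ->; rewrite addrC [_ *: _]mulrC.
Qed.

Lemma deriveDR (V : normedModType R) (f g : V -> R) (z v : V) : differentiable f z -> differentiable g z ->
  'D_v (fun x => f x + g x) z = 'D_v f z + 'D_v g z.
Proof. by move=> df dg; exact: deriveD (diff_derivable df) (diff_derivable dg). Qed.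

Lemma deriveSR (V : normedModType R) (f : 'I_n -> V -> R) (z v : V) : (forall i, differentiable (f i) z) ->
  'D_v (fun x => \sum_i f i x) z = \sum_i 'D_v (f i) z.
Proof.
move=> df; have := derive_sum (fun i => diff_derivable (v := v) (df i)).
by move=> <-; congr ('D_v _ z); apply/funext => x; rewrite fct_sumE.
Qed.

(** The derivative of [K] is evaluated along [X], so both its base point and its direction vary; in
    the first contribution the two derivatives are interchanged by symmetry. *)
Lemma derive_along (V : normedModType R) (K : V -> R) (X : V -> V) (z w : V) : findim V -> sm setT K ->
  differentiable X z ->
  'D_w (fun y => 'D_(X y) K y) z = 'D_(X z) ('D_w K) z + 'D_('D_w X z) K z.
Proof.
move=> fV sK dX; have oT := @openT V.
pose G (p : (V * V)%type) : R := (tgt K p).2.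
have dG : differentiable G (z, X z).
  have c2 : CT 1 (setT `*` setT) (tgt K) by case: (sK 2%N).
  have h := CT_post (openXT oT) (islin_snd R R) c2.
  exact: (CT_diff h (conj I I)).
have [did Eid] : differentiable (fun y : V => (y, X y)) z /\
    forall v : V, 'D_v (fun y : V => (y, X y)) z = (v, 'D_v X z).
  have l := islin_diff z (@islin_id R V).
  split; first exact: differentiable_pair.
  by move=> v; rewrite derive_pairE // (islin_derive _ _ (@islin_id R V)).
have E : 'D_w (fun y => 'D_(X y) K y) z = 'D_(w, 'D_w X z) G (z, X z).
  by rewrite -Eid -(derive_compE w did dG).
rewrite E.
have [lG _] := diff_eps dG.
have -> : 'D_(w, 'D_w X z) G (z, X z) = 'D_(w, 0) G (z, X z) + 'D_(0, 'D_w X z) G (z, X z).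
  have <- := islinD ((w, 0) : (V * V)%type) (0, 'D_w X z) lG.
  by congr ('D_ _ G _); rewrite -[RHS]/(w + 0, 0 + _) addr0 add0r.
have G1 : 'D_(w, 0) G (z, X z) = 'D_(X z) ('D_w K) z.
  have [d1 E1] : differentiable (fun y : V => (y, X z)) z /\ forall v : V, 'D_v (fun y : V => (y, X z)) z = (v, 0).
    have dc : differentiable (cst (X z) : V -> V) z := differentiable_cst (X z) z.
    have l := islin_diff z (@islin_id R V).
    split; first exact: (differentiable_pair l dc).
    by move=> v; rewrite (derive_pairE v l dc) (islin_derive _ _ (@islin_id R V)) derive_cst.
  rewrite -(E1 w) -(derive_compE w d1 dG).
  have h : 'D_w ('D_(X z) K) z = 'D_(X z) ('D_w K) z  := @schwarz R V R setT K z w (X z) fV oT (sK 2%N) I.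
  exact: h.
have G2 : 'D_(0, 'D_w X z) G (z, X z) = 'D_('D_w X z) K z.
  have [d2 E2] : differentiable (fun y : V => (z, y)) (X z) /\ forall v : V, 'D_v (fun y : V => (z, y)) (X z) = (0, v).
    have dc : differentiable (cst z : V -> V) (X z) := differentiable_cst z (X z).
    have l := islin_diff (X z) (@islin_id R V).
    split; first exact: (differentiable_pair dc l).
    by move=> v; rewrite (derive_pairE v dc l) (islin_derive _ _ (@islin_id R V)) derive_cst.
  rewrite -E2 -(derive_compE ('D_w X z) d2 dG).
  have lK := (diff_eps (CT_diff (sK 1%N) (I : setT z))).1.
  have h := islin_derive (X z) ('D_w X z) lK.
  exact: h.
by rewrite G1 G2.
Qed.
End ContactField.

(* The identities between derivatives are instances of identities between arbitrary families of reals. *)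
Section Algebra.
Context {R : realType} {n : nat}.
Implicit Types (m fp fx gp gx cx cp a b hp hx kp kx w fc gc af ag jp k lp : 'I_n -> R).

Lemma contact_alg1 m fp fx gp gx cx cp (fu gu F : R) :
  (forall i, cx i = fp i) -> (forall i, cp i = - (fx i + m i * fu)) ->
  \sum_i cx i * gx i + (\sum_i m i * fp i - F) * gu + \sum_i cp i * gp i =
  \sum_i fp i * gx i + (\sum_i m i * fp i - F) * gu
   - (\sum_i fx i * gp i + fu * \sum_i m i * gp i).
Proof.
move=> ex ep; under eq_bigr => i _ do rewrite ex.
under [X in _ + X = _]eq_bigr => i _ do rewrite ep.
rewrite (mulr_sumr _ _ _ fu) -big_split -sumrN /=.
by congr (_ + _); apply: eq_bigr => i _; ring.
Qed.

Lemma jacobi_alg m hp hx kp kx (hu ku H K : R) :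
  \sum_i (hp i * kx i - hx i * kp i) + hu * (K - \sum_i m i * kp i) - ku * (H - \sum_i m i * hp i) =
  \sum_i hp i * kx i + (\sum_i m i * hp i - H) * ku - (\sum_i hx i * kp i + hu * \sum_i m i * kp i)
  + hu * K.
Proof. rewrite sumrB; ring. Qed.

(* [a, b, c]: the derivatives of [d_p H, d_x H, d_u H] in a direction of momentum part [w]. *)
Lemma derive_jacobi_alg m hp kp kx w a b cx cp (hu ku c wH wK A K : R) :
  (forall i, cx i = a i) -> (forall i, cp i = - (b i + (w i * hu + m i * c))) ->
  A + (\sum_i cx i * kx i + (\sum_i (w i * hp i + m i * a i) - wH) * ku + \sum_i cp i * kp i)
   + (c * K + hu * wK) =
  A - (\sum_i kp i * b i + (\sum_i m i * kp i - K) * c - (\sum_i kx i * a i + ku * \sum_i m i * a i))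
  + ku * (\sum_i w i * hp i - wH) + hu * (wK - \sum_i w i * kp i).
Proof.
move=> ex ep; rewrite big_split /=.
have -> : \sum_i cx i * kx i = \sum_i kx i * a i by apply: eq_bigr => i _; rewrite ex mulrC.
have -> : \sum_i cp i * kp i =
   - (\sum_i kp i * b i + hu * (\sum_i w i * kp i) + c * \sum_i m i * kp i).
  by rewrite !mulr_sumr -!big_split -sumrN /=; apply: eq_bigr => i _; rewrite ep; ring.
ring.
Qed.

Lemma bracket_alg m fp fx gp gx fc gc af ag jp (fu gu F G : R) :
  (forall i, jp i = ag i - af i) ->
  (forall i, fc i = - (fx i + m i * fu)) -> (forall i, gc i = - (gx i + m i * gu)) ->
  \sum_i m i * jp i
   - (\sum_i fp i * gx i + (\sum_i m i * fp i - F) * gu - (\sum_i fx i * gp i + fu * \sum_i m i * gp i)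
      + fu * G) =
  \sum_i (fc i * gp i + m i * ag i)
   - (\sum_i fp i * gx i + (\sum_i m i * fp i - F) * gu - (\sum_i fx i * gp i + fu * \sum_i m i * gp i))
  - (\sum_i (gc i * fp i + m i * af i)
   - (\sum_i gp i * fx i + (\sum_i m i * gp i - G) * fu - (\sum_i gx i * fp i + gu * \sum_i m i * fp i))).
Proof.
move=> ej ef eg.
have -> : \sum_i m i * jp i = \sum_i m i * ag i - \sum_i m i * af i.
  by rewrite -sumrB; apply: eq_bigr => i _; rewrite ej mulrBr.
have C k kx lp kp ku : (forall i, k i = - (kx i + m i * ku)) ->
   \sum_i (k i * lp i + kp i) = - (\sum_i kx i * lp i + ku * \sum_i m i * lp i) + \sum_i kp i.
  move=> ek; rewrite big_split; congr (_ + _).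
  rewrite mulr_sumr -big_split -sumrN /=.
  by apply: eq_bigr => i _; rewrite ek; ring.
rewrite (C _ _ _ _ _ ef) (C _ _ _ _ _ eg).
have -> : \sum_i gp i * fx i = \sum_i fx i * gp i by apply: eq_bigr => i _; rewrite mulrC.
have -> : \sum_i gx i * fp i = \sum_i fp i * gx i by apply: eq_bigr => i _; rewrite mulrC.
ring.
Qed.
End Algebra.

Section Bracket.
Context {R : realType} {n : nat}.
Variables (H K : ham R n).
Hypotheses (sH : sm setT H) (sK : sm setT K).
Implicit Types (z v w : jet R n).
Let fJ := @findim_jet R n.
Let oT : open [set: jet R n] := @openT _.

Let sD (F : ham R n) v : sm setT F -> sm setT ('D_v F).
Proof. by move=> sF k; exact: CT_derive. Qed.
Let dif (F : ham R n) z : sm setT F -> differentiable F z.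
Proof. by move=> sF; exact: (CT_diff (sF 1%N) (I : setT z)). Qed.

Lemma sm_contact_field (F : ham R n) : sm setT F -> sm setT (contact_field F).
Proof. by move=> sF k; exact: CT_contact_field. Qed.

Let swap (F : ham R n) z v w : sm setT F -> 'D_v ('D_w F) z = 'D_w ('D_v F) z.
Proof. by move=> sF; apply: (schwarz (A := setT)) => //; exact: sF. Qed.

Let dmom i z : differentiable (fun y : jet R n => mom y i) z.
Proof. exact: islin_diff (islin_mom i). Qed.

Let Dmom i z v : 'D_v (fun y : jet R n => mom y i) z = v.2 0 i.
Proof. exact: islin_derive (islin_mom i). Qed.

Lemma contact_x (F : ham R n) z i : (contact_field F z).1.1 0 i = d_p i F z.
Proof. by rewrite /= mxE. Qed.
Lemma contact_p (F : ham R n) z i : (contact_field F z).2 0 i = - (d_x i F z + mom z i * d_u F z).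
Proof. by rewrite /= mxE. Qed.

Lemma derive_contact_x (F : ham R n) z v i : sm setT F ->
  ('D_v (contact_field F) z).1.1 0 i = 'D_v (d_p i F) z.
Proof.
move=> sF; have dX := CT_diff (sm_contact_field sF 1%N) (I : setT z).
rewrite (derive_post v (islin_x i) dX); congr ('D_v _ z).
by apply/funext => y; exact: contact_x.
Qed.

Lemma derive_contact_u (F : ham R n) z v : sm setT F ->
  ('D_v (contact_field F) z).1.2 =
   \sum_i (v.2 0 i * d_p i F z + mom z i * 'D_v (d_p i F) z) - 'D_v F z.
Proof.
move=> sF; have dX := CT_diff (sm_contact_field sF 1%N) (I : setT z).
rewrite (derive_post v islin_u dX) /=.
have dF := dif z sF.
have dp i : differentiable (d_p i F) z by exact: dif (sD _ sF).
have dmp i : differentiable (fun y => mom y i * d_p i F y) z by exact: differentiableM.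
have dS : differentiable (fun y => \sum_i mom y i * d_p i F y) z.
  have := differentiable_sum dmp; congr (differentiable _ z).
  by apply/funext => y; rewrite fct_sumE.
rewrite (deriveB (diff_derivable dS) (diff_derivable dF)); congr (_ - _).
rewrite deriveSR //; apply: eq_bigr => i _.
by rewrite deriveMR // Dmom.
Qed.

Lemma derive_contact_p (F : ham R n) z v i : sm setT F ->
  ('D_v (contact_field F) z).2 0 i =
   - ('D_v (d_x i F) z + (v.2 0 i * d_u F z + mom z i * 'D_v (d_u F) z)).
Proof.
move=> sF; have dX := CT_diff (sm_contact_field sF 1%N) (I : setT z).
have -> : ('D_v (contact_field F) z).2 0 i = mom ('D_v (contact_field F) z) i by [].
rewrite (derive_post v (islin_mom i) dX).
have -> : (fun y => mom (contact_field F y) i) = (fun y => - (d_x i F y + mom y i * d_u F y)).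
  by apply/funext => y; rewrite /mom contact_p.
have dx : differentiable (d_x i F) z by exact: dif (sD _ sF).
have du : differentiable (d_u F) z by exact: dif (sD _ sF).
have dm : differentiable (fun y => mom y i * d_u F y) z by exact: differentiableM.
have dS : differentiable (fun y => d_x i F y + mom y i * d_u F y) z := differentiableD dx dm.
rewrite (deriveN (diff_derivable dS)) deriveDR // deriveMR // Dmom //.
Qed.

Lemma derive_contact (F G : ham R n) z : sm setT G ->
  'D_(contact_field F z) G z = \sum_i d_p i F z * d_x i G z
   + (\sum_i mom z i * d_p i F z - F z) * d_u G z
   - (\sum_i d_x i F z * d_p i G z + d_u F z * \sum_i mom z i * d_p i G z).
Proof.
move=> sG; rewrite derive_jet; last exact: dif.
have h := contact_alg1 (fun i => d_p i G z) (fun i => d_x i G z) (d_u G z) (F z) (contact_x F z) (contact_p F z).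
exact: h.
Qed.

Lemma derive_contactE (F G : ham R n) z gx gp gu : sm setT G ->
  (forall i, d_x i G z = gx i) -> d_u G z = gu -> (forall i, d_p i G z = gp i) ->
  'D_(contact_field F z) G z = \sum_i d_p i F z * gx i
   + (\sum_i mom z i * d_p i F z - F z) * gu
   - (\sum_i d_x i F z * gp i + d_u F z * \sum_i mom z i * gp i).
Proof.
move=> sG /funext <- <- /funext <-; exact: derive_contact.
Qed.

Lemma jacobi_derive z : jacobi H K z = 'D_(contact_field H z) K z + d_u H z * K z.
Proof.
rewrite derive_contact //; exact: jacobi_alg.
Qed.

(** The last two terms measure how far [w] is from a pure momentum direction: they vanish for [e_p],
    cancel for [e_u] and remain only for [e_x]. With the three specialisations, the components of
    the bracket of fields can be compared. *)
Lemma derive_jacobi z w : 'D_w (jacobi H K) z =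
  'D_(contact_field H z) ('D_w K) z - 'D_(contact_field K z) ('D_w H) z
  + d_u K z * (\sum_i w.2 0 i * d_p i H z - 'D_w H z)
  + d_u H z * ('D_w K z - \sum_i w.2 0 i * d_p i K z).
Proof.
have -> : jacobi H K = fun y => 'D_(contact_field H y) K y + d_u H y * K y.
  by apply/funext => y; exact: jacobi_derive.
have dX := CT_diff (sm_contact_field sH 1%N) (I : setT z).
have dK := dif z sK; have du : differentiable (d_u H) z by exact: dif (sD _ sH).
have dG : differentiable (fun y => 'D_(contact_field H y) K y) z.
  have c2 : CT 1 (setT `*` setT) (tgt K) by case: (sK 2%N).
  have h := CT_diff (CT_post (openXT oT) (islin_snd R R) c2) (conj I I : (setT `*` setT) (z, contact_field H z)).
  have dp : differentiable (fun y => (y, contact_field H y)) z.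
    by apply: differentiable_pair => //; exact: islin_diff (@islin_id R _).
  exact: (differentiable_comp dp h).
have dM : differentiable (fun y => d_u H y * K y) z by exact: differentiableM.
rewrite deriveDR // deriveMR // (derive_along w fJ sK dX).
rewrite (derive_jet ('D_w (contact_field H) z) dK).
rewrite derive_contact_u //.
have Ex i : d_x i ('D_w H) z = 'D_w (d_x i H) z by exact: swap.
have Eu : d_u ('D_w H) z = 'D_w (d_u H) z by exact: swap.
have Ep i : d_p i ('D_w H) z = 'D_w (d_p i H) z by exact: swap.
have Pw : 'D_(contact_field K z) ('D_w H) z = \sum_i d_p i K z * 'D_w (d_x i H) z
    + (\sum_i mom z i * d_p i K z - K z) * 'D_w (d_u H) z
    - (\sum_i d_x i K z * 'D_w (d_p i H) z + d_u K z * \sum_i mom z i * 'D_w (d_p i H) z).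
  exact: (derive_contactE K (sD w sH) Ex Eu Ep).
rewrite Pw.
have h := derive_jacobi_alg (fun i => d_p i H z) (fun i => d_p i K z) (fun i => d_x i K z) (d_u K z)
  ('D_w H z) ('D_w K z) ('D_(contact_field H z) ('D_w K) z) (K z) (fun i => derive_contact_x z w i sH) (fun i => derive_contact_p z w i sH).
exact: h.
Qed.

Theorem contact_field_jacobi z :
  contact_field (jacobi H K) z = brk (contact_field H) (contact_field K) z.
Proof.
have sp (F : ham R n) i : sm setT F -> sm setT (d_p i F) by move=> sF; exact: sD.
have su (F : ham R n) : sm setT F -> sm setT (d_u F) by move=> sF; exact: sD.
have sx (F : ham R n) i : sm setT F -> sm setT (d_x i F) by move=> sF; exact: sD.
have epi (F : ham R n) (i : 'I_n) : \sum_j (e_p i : jet R n).2 0 j * d_p j F z = d_p i F z.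
  rewrite (bigD1 i) //= mxE !eqxx mul1r big1 ?addr0 // => j ne.
  by rewrite mxE eqxx (negbTE ne) mul0r.
have e0 (F : ham R n) (v : jet R n) : v.2 = 0 -> \sum_j v.2 0 j * d_p j F z = 0.
  by move=> ->; rewrite big1 // => j _; rewrite mxE mul0r.
have c0 (a b x y u t : R) : a - b + x * (y - y) + u * (t - t) = a - b by ring.
have c1 (a b x y u t : R) : a - b + x * (0 - y) + u * (t - 0) = a - b - x * y + u * t by ring.
have c2 (a b x y : R) : a - b + x * (0 - y) + y * (x - 0) = a - b by ring.
pose DH (F : ham R n) : R := 'D_(contact_field H z) F z; pose DK (F : ham R n) : R := 'D_(contact_field K z) F z.
have Dp i : d_p i (jacobi H K) z = DH (d_p i K) - DK (d_p i H).
  have h := derive_jacobi z (e_p i); rewrite !epi in h.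
  exact: (etrans h (c0 (DH (d_p i K)) (DK (d_p i H)) (d_u K z) (d_p i H z) (d_u H z) (d_p i K z))).
have Dx i : d_x i (jacobi H K) z = DH (d_x i K) - DK (d_x i H) - d_u K z * d_x i H z + d_u H z * d_x i K z.
  have h := derive_jacobi z (e_x i); rewrite !(e0 _ (e_x i)) // in h.
  exact: (etrans h (c1 (DH (d_x i K)) (DK (d_x i H)) (d_u K z) (d_x i H z) (d_u H z) (d_x i K z))).
have Du : d_u (jacobi H K) z = DH (d_u K) - DK (d_u H).
  have h := derive_jacobi z e_u; rewrite !(e0 _ e_u) // in h.
  exact: (etrans h (c2 (DH (d_u K)) (DK (d_u H)) (d_u K z) (d_u H z))).
have E (v1 v2 : jet R n) : (forall i, v1.1.1 0 i = v2.1.1 0 i) -> v1.1.2 = v2.1.2 ->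
    (forall i, v1.2 0 i = v2.2 0 i) -> v1 = v2.
  case: v1 => [[x1 u1] p1]; case: v2 => [[x2 u2] p2] /= h1 h2 h3.
  by congr (_, _, _) => //; apply/rowP.
pose A := 'D_(contact_field H z) (contact_field K) z.
pose B := 'D_(contact_field K z) (contact_field H) z.
rewrite -[brk _ _ z]/(A - B); apply: E => [i||i].
- have hA : A.1.1 0 i = DH (d_p i K) := derive_contact_x z (contact_field H z) i sK.
  have hB : B.1.1 0 i = DK (d_p i H) := derive_contact_x z (contact_field K z) i sH.
  have hl : (A - B).1.1 0 i = A.1.1 0 i - B.1.1 0 i := islinB A B (islin_x i).
  exact: (etrans (etrans (contact_x (jacobi H K) z i) (Dp i)) (esym (etrans hl (f_equal2 (fun x y => x - y) hA hB)))).
- have hA := derive_contact_u z (contact_field H z) sK; rewrite -/A in hA.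
  have hB := derive_contact_u z (contact_field K z) sH; rewrite -/B in hB.
  rewrite (derive_contact H z sK) in hA; rewrite (derive_contact K z sH) in hB.
  have hl : (A - B).1.2 = A.1.2 - B.1.2 := islinB A B islin_u.
  have h := bracket_alg (fun i => d_p i H z) (fun i => d_p i K z) (H z) (K z) Dp (contact_p H z) (contact_p K z).
  have hJ := etrans (jacobi_derive z) (f_equal (fun x => x + d_u H z * K z) (derive_contact H z sK)).
  exact: (etrans (etrans (f_equal (fun x => \sum_i mom z i * d_p i (jacobi H K) z - x) hJ) h)
    (esym (etrans hl (f_equal2 (fun x y => x - y) hA hB)))).
- have hA : A.2 0 i = - (DH (d_x i K) + ((contact_field H z).2 0 i * d_u K z + mom z i * DH (d_u K))) :=
    derive_contact_p z (contact_field H z) i sK.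
  have hB : B.2 0 i = - (DK (d_x i H) + ((contact_field K z).2 0 i * d_u H z + mom z i * DK (d_u H))) :=
    derive_contact_p z (contact_field K z) i sH.
  rewrite -/A -/(DH _) -/(DH _) in hA; rewrite -/B -/(DK _) -/(DK _) in hB.
  have hl : (A - B).2 0 i = A.2 0 i - B.2 0 i := islinB A B (islin_mom i).
  have g (a b hx kx hu ku c d m vp wp jx ju : R) :
      jx = a - b - ku * hx + hu * kx -> ju = c - d -> vp = - (hx + m * hu) -> wp = - (kx + m * ku) ->
      - (jx + m * ju) = - (a + (vp * ku + m * c)) - - (b + (wp * hu + m * d)).
    by move=> -> -> -> ->; ring.
  exact: (etrans (etrans (contact_p (jacobi H K) z i) (g _ _ _ _ _ _ _ _ _ _ _ _ _ (Dx i) Du (contact_p H z i) (contact_p K z i)))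
    (esym (etrans hl (f_equal2 (fun x y => x - y) hA hB)))).
Qed.
End Bracket.

(** * Flows of contact fields as contactomorphisms *)

Section Contactomorphism.
Context {R : realType} {n : nat}.
Implicit Types (z v y : jet R n) (w : seq (@wstep R (jet R n))).
Let fJ := @findim_jet R n.
Let J := jet R n.

Lemma contact_alpha_alg (m hp hx vx vp xp dx : 'I_n -> R) (hu vu du A : R) :
  (forall i, xp i = - (hx i + m i * hu)) ->
  du = \sum_i (vp i * hp i + m i * dx i) - A ->
  A = \sum_i vx i * hx i + vu * hu + \sum_i vp i * hp i ->
  du - \sum_i (m i * dx i + vx i * xp i) = - hu * (vu - \sum_i m i * vx i).
Proof.
move=> ex -> ->.
have -> : \sum_i (m i * dx i + vx i * xp i) =
    \sum_i m i * dx i - \sum_i vx i * hx i - hu * \sum_i m i * vx i.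
  by rewrite mulr_sumr -!sumrB; apply: eq_bigr => i _; rewrite ex; ring.
rewrite big_split /=; ring.
Qed.

(* The Lie derivative of [alpha] along a contact Hamiltonian field is [- d_u G * alpha]. *)
Lemma contact_alpha (G : ham R n) z v : sm setT G ->
  ('D_v (contact_field G) z).1.2
   - \sum_i (mom z i * ('D_v (contact_field G) z).1.1 0 i + v.1.1 0 i * (contact_field G z).2 0 i)
  = - d_u G z * alpha z v.
Proof.
move=> sG; have dG := CT_diff (sG 1%N) (I : setT z).
have h := contact_alpha_alg (contact_p G z) (derive_contact_u z v sG) (derive_jet v dG).
apply: etrans h; congr (_ - _); apply: eq_bigr => i _; congr (_ * _ + _).
exact: derive_contact_x.
Qed.

Lemma derive_alpha_curve (g y : R -> J) (s : R) (dg dy : J) :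
  is_derive s 1 g dg -> is_derive s 1 y dy ->
  is_derive s 1 (fun t => alpha (g t) (y t))
    (dy.1.2 - \sum_i (mom (g s) i * dy.1.1 0 i + (y s).1.1 0 i * dg.2 0 i)).
Proof.
move=> hg hy.
have h1 := is_derive_lin hy (@islin_u R n).
have h2 i : is_derive s 1 (fun t => mom (g t) i * (y t).1.1 0 i)
    (mom (g s) i * dy.1.1 0 i + (y s).1.1 0 i * dg.2 0 i).
  have ha := is_derive_lin hg (@islin_mom R n i).
  have hb := is_derive_lin hy (@islin_x R n i).
  exact: (is_deriveM ha hb).
have h3 := is_derive_sum h2; have h := is_deriveB h1 h3.
rewrite (_ : (fun t => _) = (fun t => (y t).1.2) - \sum_i (fun t => mom (g t) i * (y t).1.1 0 i)) //.
by apply/funext => t; rewrite /= -[RHS]/(_ - _) fct_sumE.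
Qed.

(** Along a curve and a variational solution, [alpha] solves a scalar linear equation with
    coefficient -t d_u G. The coefficient depends on the base curve alone, so the integrating
    factor, and with it the exponent [L 1], is the same for all tangent vectors. *)
Lemma flow_contact (G : ham R n) (t : R) z : sm setT G -> fdom (contact_field G) (t, z) ->
  exists l : R, forall v, alpha (flow (contact_field G) t z) ('D_v (flow (contact_field G) t) z) =
    expR l * alpha z v.
Proof.
move=> sG [g cg]; rewrite /= in cg.
pose X := contact_field G; pose Y (x : J) := t *: X x.
have sX : sm setT X := sm_contact_field sG.
have oT := @openT J.
have cY : CT 1 setT Y := CT_scalec t oT (sX 1%N).
have [g0 gc gd] := cg.
have su : CT 0 setT (d_u G) := CT_derive e_u oT (sG 1%N).
have cf : continuous (fun s => - t * d_u G (g s)).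
  move=> s; apply: cvgM; first exact: cvg_cst.
  have hg := gc s; have hu := su (g s) I; exact: (continuous_comp hg hu).
have [L [Lc L0 Ld]] := primitiveR cf.
exists (L 1) => v.
have [y vy] := vcurve_ex fJ oT cY v gc (fun _ _ => I).
have [_ D] := fl_diff fJ oT cY cg (fun _ _ => I) vy.
have Ef : flow X t = fl Y by apply/funext => x; exact: flow_fl.
have lY := CT1_locLip fJ oT cY.
rewrite -/X Ef D (flE lY cg (fun _ _ => I)).
have [y0 yc yd] := vy.
pose u s : R := expR (- L s) * alpha (g s) (y s).
have du (s : R) : 0 < s < 1 -> is_derive s 1 u 0.
  move=> s01.
  have da := derive_alpha_curve (gd s s01) (yd s s01).
  have DY : 'D_(y s) Y (g s) = t *: 'D_(y s) X (g s).
    have := deriveZ t (diff_derivable (v := y s) (CT_diff (sX 1%N) (I : setT (g s)))); exact.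
  have E : ('D_(y s) Y (g s)).1.2 - \sum_i (mom (g s) i * ('D_(y s) Y (g s)).1.1 0 i + (y s).1.1 0 i * (Y (g s)).2 0 i)
      = - t * d_u G (g s) * alpha (g s) (y s).
    have h := f_equal (fun x => t * x) (contact_alpha (g s) (y s) sG).
    apply: etrans (etrans h _); last by ring.
    rewrite DY mulrBr; congr (_ - _); rewrite mulr_sumr; apply: eq_bigr => i _.
    have e1 : (t *: 'D_(y s) X (g s)).1.1 0 i = t * ('D_(y s) X (g s)).1.1 0 i := islinZ t _ (islin_x i).
    have e2 : (Y (g s)).2 0 i = t * (X (g s)).2 0 i := islinZ t _ (islin_mom i).
    by rewrite e1 e2; ring.
  rewrite E in da.
  have dL : is_derive s 1 (fun x => - L x) (- (- t * d_u G (g s))).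
    have hL := Ld s s01; exact: is_deriveN.
  have de : is_derive s 1 (fun x => expR (- L x)) (- (- t * d_u G (g s)) * expR (- L s)).
    have dE : differentiable (@expR R) (- L s) by apply/derivable1_diffP.
    have h := is_derive_comp dL dE.
    have [_ hE] := is_derive_diff (is_derive_expR (- L s)).
    by rewrite hE in h.
  have h := is_deriveM de da.
  suff -> : (0 : R) = expR (- L s) * (- t * d_u G (g s) * alpha (g s) (y s)) +
     alpha (g s) (y s) * (- (- t * d_u G (g s)) * expR (- L s)) by exact: h.
  ring.
have ca s : {for s, continuous (fun x => alpha (g x) (y x))}.
  apply: cvgB.
    have h1 := yc s; have h2 := (@islin_u R n).2 (y s); exact: (continuous_comp h1 h2).
  apply: cvg_finsum => i; apply: cvgM.
    have h1 := gc s; have h2 := (@islin_mom R n i).2 (g s); exact: (continuous_comp h1 h2).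
  have h1 := yc s; have h2 := (@islin_x R n i).2 (y s); exact: (continuous_comp h1 h2).
have uc (s : R) : 0 <= s <= 1 -> {for s, continuous u}.
  move=> _; apply: cvgM; last exact: ca.
  have h1 : {for s, continuous (fun x => - L x)} by apply: cvgN; exact: Lc.
  have h2 := @continuous_expR R (- L s); exact: (continuous_comp h1 h2).
have u1 : u 1 = u 0.
  apply/eqP; rewrite -subr_eq0 -normr_le0.
  have := @mvi R R u (fun=> 0) (fun=> 0) (fun=> 0) uc _ du _ _ 1 I01.
  rewrite subrr; apply.
  - by move=> s _; exact: cvg_cst.
  - by move=> s _; rewrite normr0.
move: u1; rewrite /u L0 oppr0 expR0 mul1r g0 y0 => <-.
by rewrite mulrA -expRD subrr expR0 mul1r.
Qed.

Lemma word_slice w (e : R) : wgood w -> open [set z | wdom w (e, z)] /\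
  sm [set z | wdom w (e, z)] (wmap w e).
Proof.
move=> gw; have [ow sw] := sm_word fJ gw; have oT := @openT J.
have ci k (D : set J) : open D -> CT k D (fun z : J => (e, z)).
  by move=> oD; apply: CT_pair => //; [exact: CT_cst|exact: (CT_lin k D (@islin_id R J))].
have oD : open [set z | wdom w (e, z)].
  have h := open_preim oT (fun z tz => CT_cont (ci 0%N _ oT) tz) ow.
  by rewrite setTI in h.
split=> // k; exact: (CT_comp oD (fun z (h : wdom w (e, z)) => h) (ci k _ oD) (sw k)).
Qed.

Lemma word_contact w (e : R) z : wgood w -> wdom w (e, z) ->
  (forall a, List.In a w -> exists2 G, sm setT G & a.1 = contact_field G) ->
  exists l : R, forall v, alpha (wmap w e z) ('D_v (wmap w e) z) = expR l * alpha z v.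
Proof.
elim: w z => [|a w IH] z gw dw hw.
  exists 0 => v; rewrite expR0 mul1r.
  have -> : wmap [::] e = @id J by [].
  by rewrite (islin_derive z v (@islin_id R J)).
have [sa _ gw'] := wgood_cons gw.
have [G sG Ea] := hw a (or_introl erefl).
have [d1 d2] := dw; rewrite /= in d1 d2.
have [l2 h2] := IH _ gw' d2 (fun b hb => hw b (or_intror hb)).
have d1' := d1; rewrite Ea in d1'.
have [l1 h1] := flow_contact sG d1'; rewrite -Ea in h1.
exists (l1 + l2) => v.
have df : differentiable (flow a.1 (stime a e)) z := flow_diff fJ sa d1.
have dg : differentiable (wmap w e) (flow a.1 (stime a e) z).
  exact: (CT_diff ((word_slice e gw').2 1%N) d2).
have h := derive_compE v df dg.
have -> : 'D_v (wmap (a :: w) e) z = 'D_('D_v (flow a.1 (stime a e)) z) (wmap w e) (flow a.1 (stime a e) z) := h.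
have -> : wmap (a :: w) e z = wmap w e (flow a.1 (stime a e) z) by [].
by rewrite h2 h1 expRD mulrA (mulrC (expR l2)).
Qed.

Lemma word_uniform w (K : set J) : wgood w -> compact K ->
  exists (A : set J) (d : R), [/\ open A, K `<=` A, 0 < d &
    forall z e, A z -> `|e| < d -> wdom w (e, z)].
Proof.
move=> gw cK; have [ow sw] := sm_word fJ gw.
have [d d0 H] : exists2 d : R, 0 < d & forall e x, 0 < e <= d -> K x ->
    forall e' x', `|e'| < e -> ball x e x' -> wdom w (e', x').
  apply: (@cpt_unif R J K (fun e x => forall e' x', `|e'| < e -> ball x e x' -> wdom w (e', x'))) => // z Kz.
  have [w0 _] := word0 fJ z gw.
  have := open_nbhs_nbhs (conj ow w0); rewrite -nbhs_ballE => -[d /= d0 hd].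
  exists (d / 2); first by rewrite divr_gt0.
  move=> e x /andP[e0 ed] zx e' x' le' xx'; apply: hd; apply/ball_pair; split=> /=.
    by lra.
  rewrite (splitr d); apply: ball_triangle zx _; exact: le_ball xx'.
exists (\bigcup_(x in K) ball x d), d; split=> //.
- by apply: bigcup_open => x _; exact: ball_open.
- by move=> x Kx; exists x => //; exact: ballxx.
- by move=> z e [x Kx xz] le; apply: (H d x _ Kx) => //; rewrite d0 lexx.
Qed.

Lemma word_contactomorphism w (A : set J) (e : R) : wgood w -> open A ->
  (forall z, A z -> wdom w (e, z)) ->
  (forall a, List.In a w -> exists2 G, sm setT G & a.1 = contact_field G) ->
  contactomorphism_on A (wmap w e).
Proof.
move=> gw oA AD hw; have gi := wgood_inv gw.
have [oD sD] := word_slice e gw; have [oI sI] := word_slice e gi.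
(* The image is the preimage of [A] under the inverse word, hence open. *)
have img : wmap w e @` A = [set y | wdom (winv w) (e, y)] `&` (wmap (winv w) e) @^-1` A.
  apply/seteqP; split=> [y [x Ax <-]|y [dy Ay]].
    by have [h1 h2] := winvP fJ gw (AD x Ax); split; rewrite //= h2.
  have [h1 h2] := winvP fJ gi dy; rewrite winvK in h1 h2.
  by exists (wmap (winv w) e y).
have oimg : open (wmap w e @` A).
  by rewrite img; exact: (open_preim oI (fun y Dy => CT_cont (sI 0%N) Dy) oA).
split=> //.
- by move=> k; apply: (CT_class_C oA); exact: CT_sub AD (sD k).
- exists (wmap (winv w) e) => [k|z Az]; last by have [] := winvP fJ gw (AD z Az).
  apply: (CT_class_C oimg); apply: CT_sub (sI k).
  by rewrite img => y [].
- pose P z l := forall v, alpha (wmap w e z) ('D_v (wmap w e) z) = expR l * alpha z v.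
  exists (fun z => xget 0 (P z)) => z Az v.
  have dz : differentiable (wmap w e) z := CT_diff (sD 1%N) (AD z Az).
  rewrite -deriveE //.
  have h : P z (xget 0 (P z)).
    apply: xgetPex; exact: word_contact (AD z Az) hw.
  exact: h.
Qed.
End Contactomorphism.

(** * Families of maps and the norm of C^r *)

Section RecClosure.
Context {R : realType} {T : Type} (F : set_system T) {FF : Filter F}.
Implicit Types V W Z : normedModType R.

(** The open neighborhood may depend on the index, since the domains of flows and of iterates do. *)
Definition reg (k : nat) V W (U : set V) (f : T -> V -> W) : Prop :=
  \forall i \near F, exists O : set V, [/\ open O, U `<=` O & CT k O (f i)].

Lemma reg_near k V W (U : set V) (f : T -> V -> W) (A : set V) : open A -> U `<=` A ->
  (\forall i \near F, CT k A (f i)) -> reg k U f.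
Proof. by move=> oA UA; apply: filterS => i ci; exists A. Qed.

Lemma reg_le j k V W (U : set V) (f : T -> V -> W) : (j <= k)%N -> reg k U f -> reg j U f.
Proof. by move=> jk; apply: filterS => i [A [oA UA cA]]; exists A; split=> //; exact: CT_le jk cA. Qed.

Lemma reg_tgt k V W (U : set V) (M : R) (f : T -> V -> W) : reg k.+1 U f ->
  reg k (U `*` @cball R V M) (fun i => tgt (f i)).
Proof.
apply: filterS => i [A [oA UA [_ cA]]]; exists (A `*` setT); split=> //; first exact: openXT.
by move=> [z v] [/= /UA].
Qed.

Lemma reg_add k V W (U : set V) (f g : T -> V -> W) : reg k U f -> reg k U g ->
  reg k U (fun i z => f i z + g i z).
Proof.
apply: filterS2 => i [A [oA UA cA]] [B [oB UB cB]]; exists (A `&` B); split; first exact: openI.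
  by move=> z Uz; split; [exact: UA|exact: UB].
have oAB := openI oA oB.
apply: CT_add => //; [exact: CT_sub (@subIsetl _ A B) cA|exact: CT_sub (@subIsetr _ A B) cB].
Qed.

Lemma reg_post k V W Z (U : set V) (f : T -> V -> W) (L : W -> Z) : islin L -> reg k U f ->
  reg k U (fun i z => L (f i z)).
Proof. by move=> lL; apply: filterS => i [A [oA UA cA]]; exists A; split=> //; exact: CT_post. Qed.

Lemma CT_affine k V W (A : set V) (L : V -> W) c : open A -> islin L -> CT k A (fun z => L z + c).
Proof. by move=> oA lL; apply: CT_add => //; [exact: CT_lin|exact: CT_cst]. Qed.

Lemma reg_pre k V W Z (U : set V) (U' : set W) (f : T -> W -> Z) (L : V -> W) c : islin L ->
  (forall z, U z -> U' (L z + c)) -> reg k U' f -> reg k U (fun i z => f i (L z + c)).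
Proof.
move=> lL UU'; apply: filterS => i [A [oA UA cA]].
have cL := CT_affine k c (@openT V) lL.
have oP := open_preim (@openT V) (fun z tz => CT_cont cL tz) oA.
exists ([set: V] `&` (fun z => L z + c) @^-1` A); split=> //.
- by move=> z /UU' /UA.
- apply: CT_comp cA => //; last exact: CT_sub cL.
  by move=> z [].
Qed.

Lemma reg_scale k V W (U : set V) (a : V -> R) (f : T -> V -> W) : sm setT a -> reg k U f ->
  reg k U (fun i z => a z *: f i z).
Proof.
move=> sa; apply: filterS => i [A [oA UA cA]]; exists A; split=> //.
by apply: CT_scale => //; exact: CT_sub (sa k).
Qed.

Lemma tgt_add V W (f g : V -> W) zv : differentiable f zv.1 -> differentiable g zv.1 ->
  tgt (fun z => f z + g z) zv = tgt f zv + tgt g zv.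
Proof.
move=> df dg; rewrite /tgt -[RHS]/(_ + _, _ + _); congr (_, _).
exact: deriveD (diff_derivable df) (diff_derivable dg).
Qed.

Lemma tgt_post V W Z (f : V -> W) (L : W -> Z) zv : islin L -> differentiable f zv.1 ->
  tgt (fun z => L (f z)) zv = (L (tgt f zv).1, L (tgt f zv).2).
Proof.
move=> lL df; rewrite /tgt; congr (_, _).
have h := derive_compE zv.2 df (islin_diff (f zv.1) lL).
by rewrite (islin_derive _ _ lL) in h.
Qed.

Lemma derive_affine V W (L : V -> W) c z : islin L ->
  differentiable (fun z => L z + c) z /\ forall v, 'D_v (fun z => L z + c) z = L v.
Proof.
move=> lL; apply: eps_diff => // e e0; near=> x.
by rewrite opprD addrACA subrr addr0 -(islinB _ _ lL) subrr normr0 mulr_ge0 // ltW.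
Unshelve. all: by end_near. Qed.

Lemma tgt_pre V W Z (f : W -> Z) (L : V -> W) c zv : islin L -> differentiable f (L zv.1 + c) ->
  tgt (fun z => f (L z + c)) zv = tgt f (L zv.1 + c, L zv.2).
Proof.
move=> lL df; have [dL EL] := derive_affine c zv.1 lL; rewrite /tgt; congr (_, _).
have h := derive_compE zv.2 dL df.
by rewrite EL in h.
Qed.

Lemma derive_scale V W (a : V -> R) (f : V -> W) z v : differentiable a z -> differentiable f z ->
  'D_v (fun x => a x *: f x) z = a z *: 'D_v f z + 'D_v a z *: f z.
Proof.
move=> da df; have [dm Em] := diff_scale_pair (a z, f z).
have dp : differentiable (fun x => (a x, f x)) z by exact: differentiable_pair.
have h := derive_compE v dp dm; rewrite derive_pairE // Em /= in h; exact: h.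
Qed.

Lemma tgt_scale_fun V W (a : V -> R) (f : V -> W) zv : differentiable a zv.1 -> differentiable f zv.1 ->
  tgt (fun z => a z *: f z) zv = (tgt a zv).1 *: tgt f zv + (tgt a zv).2 *: (0, (tgt f zv).1).
Proof.
move=> da df; rewrite /tgt -[RHS]/(_ + _ *: _, _ + _); rewrite scaler0 addr0; congr (_, _).
exact: derive_scale.
Qed.

Variable Q : forall V W : normedModType R, set V -> (T -> V -> W) -> Prop.

(** Four closure properties of a quality of families. Once known for the maps themselves, they pass
    by induction to all iterated tangent maps; they are proved for boundedness in a gauge and for
    equicontinuity. *)
Definition Qadd := forall V W (U : set V) (f g : T -> V -> W), Q U f -> Q U g ->
  Q U (fun i z => f i z + g i z).
Definition Qpost := forall V W Z (U : set V) (f : T -> V -> W) (L : W -> Z), islin L -> Q U f ->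
  Q U (fun i z => L (f i z)).
Definition Qpre := forall V W Z (U : set V) (U' : set W) (f : T -> W -> Z) (L : V -> W) c, islin L ->
  (forall z, U z -> U' (L z + c)) -> Q U' f -> Q U (fun i z => f i (L z + c)).
Definition Qscale := forall V W (U : set V) (a : V -> R) (f : T -> V -> W), findim V -> compact U ->
  sm setT a -> Q U f -> Q U (fun i z => a z *: f i z).
Hypotheses (Qe : Qext F Q) (Qa : Qadd) (Qp : Qpost) (Qr : Qpre) (Qs : Qscale).

Lemma rec_add k V W (U : set V) (f g : T -> V -> W) : reg k U f -> reg k U g ->
  rec Q k U f -> rec Q k U g -> rec Q k U (fun i z => f i z + g i z).
Proof.
elim: k V W U f g => [|k IH] V W U f g rf rg; first exact: Qa.
move=> qf qg M; have h := IH _ _ _ _ _ (reg_tgt M rf) (reg_tgt M rg) (qf M) (qg M).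
apply: rec_ext Qe _ h; move: rf rg; apply: filterS2 => i [A [oA UA cA]] [B [oB UB cB]].
exists ((A `&` B) `*` setT); split; first by apply: openXT; exact: openI.
  by move=> [z v] [/= Uz _]; split=> //; split; [exact: UA|exact: UB].
move=> [z v] [/= [Az Bz] _]; rewrite tgt_add //; [exact: (CT_diff cA Az)|exact: (CT_diff cB Bz)].
Qed.

Lemma rec_post k V W Z (U : set V) (f : T -> V -> W) (L : W -> Z) : islin L -> reg k U f ->
  rec Q k U f -> rec Q k U (fun i z => L (f i z)).
Proof.
elim: k V W Z U f L => [|k IH] V W Z U f L lL rf; first exact: Qp.
move=> qf M.
have l2 : islin (fun p : (W * W)%type => (L p.1, L p.2)).
  by apply: islin_pair; apply: islin_comp => //; [exact: islin_fst|exact: islin_snd].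
have h := IH _ _ _ _ _ _ l2 (reg_tgt M rf) (qf M).
apply: rec_ext Qe _ h; move: rf; apply: filterS => i [A [oA UA cA]].
exists (A `*` setT); split; [exact: openXT|by move=> [z v] [/= /UA]|].
by move=> [z v] [/= Az _]; rewrite tgt_post //; exact: (CT_diff cA Az).
Qed.

Lemma rec_pre k V W Z (U : set V) (U' : set W) (f : T -> W -> Z) (L : V -> W) c : islin L ->
  (forall z, U z -> U' (L z + c)) -> reg k U' f -> rec Q k U' f -> rec Q k U (fun i z => f i (L z + c)).
Proof.
elim: k V W Z U U' f L c => [|k IH] V W Z U U' f L c lL UU' rf; first exact: Qr.
move=> qf M; have [C C0 HC] := islin_bound lL.
have l2 : islin (fun p : (V * V)%type => (L p.1, L p.2)).
  by apply: islin_pair; apply: islin_comp => //; [exact: islin_fst|exact: islin_snd].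
have U2 p : (U `*` @cball R V M) p -> (U' `*` @cball R W (C * M)) ((L p.1, L p.2) + (c, 0)).
  case: p => z v [/= Uz vM]; split=> /=; first exact: UU'.
  by rewrite /cball /= addr0; apply: le_trans (HC v) _; rewrite ler_pM2l.
have h := IH _ _ _ _ _ _ _ _ l2 U2 (reg_tgt (C * M) rf) (qf (C * M)).
apply: rec_ext Qe _ h; move: rf; apply: filterS => i [A [oA UA cA]].
have cL := CT_affine 0 c (@openT V) lL.
have oP := open_preim (@openT V) (fun z tz => CT_cont cL tz) oA.
exists (([set: V] `&` (fun z => L z + c) @^-1` A) `*` setT); split; first exact: openXT.
- by move=> [z v] [/= /UU' /UA].
- move=> [z v] [/= [_ Az] _].
  rewrite (tgt_pre (zv := (z, v)) lL) /=; last exact: (CT_diff cA Az).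
  by rewrite -[(_, _) + _]/(L z + c, L v + 0) addr0.
Qed.

Lemma rec_scale k V W (U : set V) (a : V -> R) (f : T -> V -> W) : findim V -> compact U ->
  sm setT a -> reg k U f -> rec Q k U f -> rec Q k U (fun i z => a z *: f i z).
Proof.
elim: k V W U a f => [|k IH] V W U a f fV cU sa rf; first exact: Qs.
move=> qf M.
have fVV := findim_prod fV fV.
have cU' : compact (U `*` @cball R V M) by apply: compact_setX => //; exact: compact_cball.
have oT := @openT V.
have st : sm setT (tgt a).
  move=> j; have [_ h] := sa j.+1; rewrite (_ : setT = [set: V] `*` [set: V]) //.
  by apply/seteqP; split=> // -[].
have oT2 := @openT (V * V)%type.
have s1 : sm setT (fun zv => (tgt a zv).1) by move=> j; exact: CT_post oT2 (islin_fst _ _) (st j).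
have s2 : sm setT (fun zv => (tgt a zv).2) by move=> j; exact: CT_post oT2 (islin_snd _ _) (st j).
have lN : islin (fun p : (W * W)%type => (0 : W, p.1)).
  by apply: islin_pair; [exact: islin_cst0|exact: islin_fst].
have rt := reg_tgt M rf.
have h1 := IH _ _ _ _ _ fVV cU' s1 rt (qf M).
have h2 := IH _ _ _ _ _ fVV cU' s2 (reg_post lN rt) (rec_post lN rt (qf M)).
have h := rec_add (reg_scale s1 rt) (reg_scale s2 (reg_post lN rt)) h1 h2.
apply: rec_ext Qe _ h; move: rf; apply: filterS => i [A [oA UA cA]].
exists (A `*` setT); split; [exact: openXT|by move=> [z v] [/= /UA]|].
move=> [z v] [/= Az _]; have dz : differentiable a z := CT_diff (sa 1%N) (I : setT z).
by have -> := tgt_scale_fun (zv := (z, v)) dz (CT_diff cA Az).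
Qed.

Lemma rec_le j k V W (U : set V) (f : T -> V -> W) : (j <= k)%N -> reg k U f ->
  rec Q k U f -> rec Q j U f.
Proof.
move=> jk; rewrite -(subnK jk); elim: (k - j)%N => [//|m IH] rf qf.
apply: IH; first exact: reg_le rf.
move: rf qf; rewrite addSn; move: (m + j)%N => {jk}q rf qf.
elim: q V W U f rf qf => [|q IHq] V W U f rf qf; last first.
  by move=> M; apply: IHq; [exact: reg_tgt|exact: qf].
(* The bounded set of tangent vectors may be reduced to 0; there the first component of the tangent
   map is the map itself. *)
have h0 := qf 0.
have lL : islin (fun z : V => (z, 0 : V)) by apply: islin_pair; [exact: islin_id|exact: islin_cst0].
have UU z : U z -> (U `*` @cball R V 0) ((z, 0) + 0).
  by rewrite addr0 => Uz; split=> //=; rewrite /cball /= normr0.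
have h1 := Qp (islin_fst W W) (Qr lL UU h0).
by apply: Qe h1; apply: nearW => i z _; rewrite addr0.
Qed.
End RecClosure.

Local Notation iterD := Pilot.Defs.iterD.
Section RecMore.
Context {R : realType} {T : Type} (F : set_system T) {FF : Filter F}.
Implicit Types V W Z : normedModType R.
Variable Q : forall V W : normedModType R, set V -> (T -> V -> W) -> Prop.
Hypotheses (Qe : Qext F Q) (Qa : Qadd Q) (Qp : Qpost Q) (Qr : Qpre Q) (Qs : Qscale Q).

Lemma reg_addsum k V W (U : set V) (J : Type) (s : seq J) (g0 : T -> V -> W) (g : J -> T -> V -> W) :
  reg F k U g0 -> (forall j, reg F k U (g j)) -> reg F k U (fun i z => g0 i z + \sum_(j <- s) g j i z).
Proof.
move=> r0 rg; elim: s => [|j s IH].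
  by rewrite (_ : (fun _ _ => _) = g0) //; apply/funext => i; apply/funext => z; rewrite big_nil addr0.
rewrite (_ : (fun _ _ => _) = (fun i z => g j i z + (g0 i z + \sum_(j <- s) g j i z))).
  exact: reg_add.
by apply/funext => i; apply/funext => z; rewrite big_cons addrCA.
Qed.

Lemma rec_addsum k V W (U : set V) (J : Type) (s : seq J) (g0 : T -> V -> W) (g : J -> T -> V -> W) :
  reg F k U g0 -> (forall j, reg F k U (g j)) -> rec Q k U g0 -> (forall j, rec Q k U (g j)) ->
  rec Q k U (fun i z => g0 i z + \sum_(j <- s) g j i z).
Proof.
move=> r0 rg q0 qg; elim: s => [|j s IH].
  by rewrite (_ : (fun _ _ => _) = g0) //; apply/funext => i; apply/funext => z; rewrite big_nil addr0.
rewrite (_ : (fun _ _ => _) = (fun i z => g j i z + (g0 i z + \sum_(j <- s) g j i z))).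
  by apply: (rec_add Qe Qa) => //; exact: reg_addsum.
by apply/funext => i; apply/funext => z; rewrite big_cons addrCA.
Qed.

Lemma reg_derive k V W (U : set V) (f : T -> V -> W) v : reg F k.+1 U f ->
  reg F k U (fun i => 'D_v (f i)).
Proof. by apply: filterS => i [A [oA UA cA]]; exists A; split=> //; exact: CT_derive. Qed.

Lemma rec_derive k V W (U : set V) (f : T -> V -> W) v : reg F k.+1 U f -> rec Q k.+1 U f ->
  rec Q k U (fun i => 'D_v (f i)).
Proof.
move=> rf qf; have rt := reg_tgt (FF:=FF) `|v| rf.
have lL : islin (fun z : V => (z, 0 : V)) by apply: islin_pair; [exact: islin_id|exact: islin_cst0].
have UU z : U z -> (U `*` @cball R V `|v|) ((z, 0) + (0, v)).
  by move=> Uz; split; rewrite /cball /= ?addr0 ?add0r.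
have h := rec_pre (FF:=FF) Qe Qr lL UU rt (qf `|v|).
have h2 := rec_post (FF:=FF) Qe Qp (islin_snd W W) (reg_pre (FF:=FF) lL UU rt) h.
rewrite (_ : (fun i => 'D_v (f i)) = (fun i z => (tgt (f i) ((z, 0) + (0, v))).2)) //.
apply/funext => i; apply/funext => z.
by rewrite -[(z, 0) + _]/(z + 0, 0 + v) /tgt /= addr0 add0r.
Qed.

Lemma reg_preL k V W Z (U : set V) (U' : set W) (f : T -> W -> Z) (L : V -> W) : islin L ->
  (forall z, U z -> U' (L z)) -> reg F k U' f -> reg F k U (fun i z => f i (L z)).
Proof.
move=> lL UU rf; have UU0 z : U z -> U' (L z + 0) by rewrite addr0; exact: UU.
have h := reg_pre (FF:=FF) lL UU0 rf.
by rewrite (_ : (fun _ _ => _) = (fun i z => f i (L z + 0))) //; apply/funext => i; apply/funext => z; rewrite addr0.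
Qed.

Lemma rec_preL k V W Z (U : set V) (U' : set W) (f : T -> W -> Z) (L : V -> W) : islin L ->
  (forall z, U z -> U' (L z)) -> reg F k U' f -> rec Q k U' f -> rec Q k U (fun i z => f i (L z)).
Proof.
move=> lL UU rf qf; have UU0 z : U z -> U' (L z + 0) by rewrite addr0; exact: UU.
have h := rec_pre (FF:=FF) Qe Qr lL UU0 rf qf.
by rewrite (_ : (fun _ _ => _) = (fun i z => f i (L z + 0))) //; apply/funext => i; apply/funext => z; rewrite addr0.
Qed.

(** The generating vectors are shrunk into the unit ball because the norm of C^r tests derivatives
    on such vectors only. *)
Lemma findim_unit V : findim V -> exists (m : nat) (e : 'I_m -> V) (c : 'I_m -> V -> R),
  [/\ forall i, islin (c i), forall i, `|e i| <= 1 & forall v, v = \sum_i c i v *: e i].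
Proof.
move=> [m [e [c [lc ev]]]].
exists m, (fun i => (1 + `|e i|)^-1 *: e i), (fun i v => (1 + `|e i|) *: c i v).
have p i : 0 < 1 + `|e i| by rewrite ltr_pwDl.
split=> [i|i|v]; first exact: islin_scale.
  by rewrite normrZ normfV gtr0_norm // mulrC ler_pdivrMr // mul1r lerDr.
rewrite {1}(ev v); apply: eq_bigr => i _; rewrite scalerA; congr (_ *: _).
by rewrite -[RHS]/((1 + `|e i|) * c i v / (1 + `|e i|)) mulrAC mulfV ?mul1r // gt_eqF.
Qed.

Lemma iterD_rcons V W (vs : seq V) v (f : V -> W) : iterD (rcons vs v) f = iterD vs ('D_v f).
Proof. by rewrite /iterD -cats1 foldr_cat. Qed.

Lemma sm_lin V W (L : V -> W) : islin L -> sm setT L.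
Proof. by move=> lL k; exact: CT_lin. Qed.

(** The tangent map is a sum of derivatives along unit vectors with coefficients linear in the
    tangent vector, hence smooth and bounded on bounded sets; the closure properties do the rest. *)
Lemma rec_of_iterD k V W (U : set V) (f : T -> V -> W) : findim V -> compact U -> reg F k U f ->
  (forall vs : seq V, (size vs <= k)%N -> (forall v, v \in vs -> `|v| <= 1) ->
     Q U (fun i => iterD vs (f i))) -> rec Q k U f.
Proof.
elim: k V W U f => [|k IH] V W U f fV cU rf H; first exact: (H [::]).
move=> M; have [m [e [c [lc le ev]]]] := findim_unit fV.
have fVV := findim_prod fV fV.
have cU' : compact (U `*` @cball R V M) by apply: compact_setX => //; exact: compact_cball.
have UU z : (U `*` @cball R V M) z -> U z.1 by case.
have rD j : reg F k U (fun i => 'D_(e j) (f i)) := reg_derive (e j) rf.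
have qD j : rec Q k U (fun i => 'D_(e j) (f i)).
  apply: IH => // vs svs uvs.
  rewrite (_ : (fun i => _) = (fun i => iterD (rcons vs (e j)) (f i))).
    apply: H; first by rewrite size_rcons.
    by move=> v; rewrite mem_rcons inE => /orP[/eqP ->|/uvs].
  by apply/funext => i; rewrite iterD_rcons.
have rf' := reg_le (FF:=FF) (leqnSn k) rf.
have qf : rec Q k U f by apply: IH => // vs svs; apply: H; exact: leqW.
have l1 : islin (fun x : W => (x, 0 : W)) by apply: islin_pair; [exact: islin_id|exact: islin_cst0].
have l2 : islin (fun x : W => (0 : W, x)) by apply: islin_pair; [exact: islin_cst0|exact: islin_id].
have lf := islin_fst V V.
have sc j : sm setT (fun zv : (V * V)%type => c j zv.2).
  by apply: sm_lin; exact: islin_comp (islin_snd V V) (lc j).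
have r1 := reg_post (FF:=FF) l1 (reg_preL lf UU rf').
have q1 := rec_post (FF:=FF) Qe Qp l1 (reg_preL lf UU rf') (rec_preL lf UU rf' qf).
have r2 j := reg_post (FF:=FF) l2 (reg_preL lf UU (rD j)).
have q2 j := rec_post (FF:=FF) Qe Qp l2 (reg_preL lf UU (rD j)) (rec_preL lf UU (rD j) (qD j)).
have q3 j := rec_scale (FF:=FF) Qe Qa Qp Qs fVV cU' (sc j) (r2 j) (q2 j).
have r3 j := reg_scale (FF:=FF) (sc j) (r2 j).
have h := rec_addsum (index_enum 'I_m) r1 r3 q1 q3.
apply: rec_ext Qe _ h; move: rf; apply: filterS => i [A [oA UA cA]].
exists (A `*` setT); split; [exact: openXT|by move=> [z v] [/= /UA]|].
move=> [z v] [/= Az _]; rewrite /tgt /=.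
have [lD _] := diff_eps (CT_diff cA Az).
rewrite {2}(ev v) (islin_sum _ _ _ lD).
have -> : (f i z, \sum_j 'D_(c j v *: e j) (f i) z) =
   (f i z, 0) + (0, \sum_j c j v *: 'D_(e j) (f i) z).
  rewrite -[RHS]/(f i z + 0, 0 + _) addr0 add0r; congr (_, _).
  by apply: eq_bigr => j _; rewrite (islinZ _ _ lD).
congr (_ + _).
have h2 := islin_sum (index_enum 'I_m) xpredT (fun j => c j v *: 'D_(e j) (f i) z) l2.
apply: (etrans _ (esym h2)); apply: eq_bigr => j _; apply: esym.
exact: (islinZ (c j v) ('D_(e j) (f i) z) l2).
Qed.
End RecMore.

Lemma cpt_bound (R : realType) (V W : normedModType R) (A K : set V) (f : V -> W) :
  CT 0 A f -> compact K -> K `<=` A -> exists2 C : R, 0 < C & forall z, K z -> `|f z| <= C.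
Proof.
move=> cf cK KA.
have cfK : compact (f @` K).
  apply: continuous_compact cK; apply: continuous_in_subspaceT => z; rewrite inE => /KA; exact: cf.
have /ex_strict_bound_gt0[C C0 HC] := compact_bounded cfK.
by exists C => // z Kz; apply/ltW/HC; exists z.
Qed.

(** * Boundedness and equicontinuity in a gauge *)

Section Qualities.
Context {R : realType} {T : Type} (F : set_system T) {FF : Filter F}.
Implicit Types V W Z : normedModType R.

Definition bndB (S : T -> R -> Prop) : Prop := exists C : R, \forall i \near F, forall x, S i x -> x <= C.

Lemma bndB_pos (S : T -> R -> Prop) : bndB S -> exists2 C : R, 0 <= C & \forall i \near F, forall x, S i x -> x <= C.
Proof.
move=> [C HC]; exists (Num.max 0 C); first by rewrite le_max lexx.
by apply: filterS HC => i H x /H h; rewrite le_max h orbT.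
Qed.

Lemma bndB_gauge : gauge_axiom F bndB.
Proof.
move=> S S' S2 c /bndB_pos[C C0 HC] /bndB_pos[C' C'0 HC'] H.
exists (c * (C + C')); move: HC HC' H; apply: filterS3 => i h h' H x.
exact: H.
Qed.

Variable Bnd : (T -> R -> Prop) -> Prop.
Hypothesis GA : gauge_axiom F Bnd.

Lemma gauge_sub (S S' : T -> R -> Prop) : Bnd S ->
  (\forall i \near F, forall x, S' i x -> exists2 y, S i y & x <= y) -> Bnd S'.
Proof.
move=> B H; apply: (GA (c := 1) B B); apply: filterS H => i H a b a0 b0 Ha _ x Sx.
have [y Sy xy] := H x Sx; rewrite mul1r; apply: le_trans xy _; apply: le_trans (Ha y Sy) _.
by rewrite lerDl.
Qed.

Lemma bdQ_add : Qadd (bdQ Bnd).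
Proof.
move=> V W U f g bf bg; apply: (GA (c := 1) bf bg); apply: nearW => i a b a0 b0 Ha Hb x [z Uz ->].
by rewrite mul1r; apply: le_trans (ler_normD _ _) _; apply: lerD; [apply: Ha|apply: Hb]; exists z.
Qed.

Lemma bdQ_post : Qpost (bdQ Bnd).
Proof.
move=> V W Z U f L lL bf; have [C C0 HC] := islin_bound lL.
apply: (GA (c := C) bf bf); apply: nearW => i a b a0 b0 Ha Hb x [z Uz ->].
apply: le_trans (HC _) _; rewrite ler_pM2l //; apply: le_trans (_ : _ <= a) _; last by rewrite lerDl.
by apply: Ha; exists z.
Qed.

Lemma bdQ_pre : Qpre (bdQ Bnd).
Proof.
move=> V W Z U U' f L c lL UU bf; apply: gauge_sub bf _; apply: nearW => i x [z Uz ->].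
by eexists; last exact: lexx; exists (L z + c) => //; exact: UU.
Qed.

Lemma bdQ_scale : Qscale (bdQ Bnd).
Proof.
move=> V W U a f fV cU sa bf.
have [C C0 HC] := cpt_bound (sa 0%N) cU (@subsetT _ U).
apply: (GA (c := C) bf bf); apply: nearW => i x b x0 b0 Hx Hb y [z Uz ->].
rewrite normrZ; apply: ler_pM => //; first exact: HC.
by apply: le_trans (_ : _ <= x) _; [apply: Hx; exists z|rewrite lerDl].
Qed.

(* Equicontinuity of a family, measured in the gauge, together with a uniform bound. *)
Definition EC V W (U : set V) (f : T -> V -> W) : Prop := forall S, Bnd S ->
  Bnd (fun i d => exists x y, [/\ U x, U y, S i `|x - y| & d = `|f i x - f i y|]).
Definition ECB V W (U : set V) (f : T -> V -> W) : Prop := EC U f /\ bdQ bndB U f.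

Lemma ECB_ext : Qext F ECB.
Proof.
move=> V W U f g E [ef bf]; split; last exact: bdQ_ext bndB_gauge _ _ _ _ _ E bf.
move=> S BS; apply: gauge_sub (ef S BS) _; apply: filterS E => i E d [x [y [Ux Uy Sxy ->]]].
by exists `|f i x - f i y|; [exists x, y; split|rewrite !E ?lexx].
Qed.
End Qualities.

Section Qualities2.
Context {R : realType} {T : Type} (F : set_system T) {FF : Filter F}.
Implicit Types V W Z : normedModType R.
Variable Bnd : (T -> R -> Prop) -> Prop.
Hypothesis GA : gauge_axiom F Bnd.
Notation ECB := (ECB F Bnd).
Let GB : gauge_axiom F (bndB F) := @bndB_gauge R T F FF.

Lemma ECB_add : Qadd ECB.
Proof.
move=> V W U f g [ef bf] [eg bg]; split; last exact: (bdQ_add GB bf bg).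
move=> S BS; apply: (GA (c := 1) (ef S BS) (eg S BS)).
apply: nearW => i a b a0 b0 Ha Hb d [x [y [Ux Uy Sxy ->]]].
rewrite mul1r opprD addrACA; apply: le_trans (ler_normD _ _) _.
by apply: lerD; [apply: Ha|apply: Hb]; exists x, y.
Qed.

Lemma ECB_post : Qpost ECB.
Proof.
move=> V W Z U f L lL [ef bf]; split; last exact: (bdQ_post GB lL bf).
have [C C0 HC] := islin_bound lL.
move=> S BS; apply: (GA (c := C) (ef S BS) (ef S BS)).
apply: nearW => i a b a0 b0 Ha Hb d [x [y [Ux Uy Sxy ->]]].
rewrite -(islinB _ _ lL); apply: le_trans (HC _) _; rewrite ler_pM2l //.
by apply: le_trans (_ : _ <= a) _; [apply: Ha; exists x, y|rewrite lerDl].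
Qed.

Lemma ECB_pre : Qpre ECB.
Proof.
move=> V W Z U U' f L c lL UU [ef bf]; split; last exact: (bdQ_pre GB lL UU bf).
have [C C0 HC] := islin_bound lL.
move=> S BS; pose S2 (i : T) d := exists x y, [/\ U x, U y, S i `|x - y| & d = `|L x - L y|].
have BS2 : Bnd S2.
  apply: (GA (c := C) BS BS); apply: nearW => i a b a0 b0 Ha Hb d [x [y [Ux Uy Sxy ->]]].
  rewrite -(islinB _ _ lL); apply: le_trans (HC _) _; rewrite ler_pM2l //.
  by apply: le_trans (_ : _ <= a) _; [exact: Ha|rewrite lerDl].
apply: (gauge_sub GA (ef S2 BS2)); apply: nearW => i d [x [y [Ux Uy Sxy ->]]].
eexists; last exact: lexx; exists (L x + c), (L y + c); split=> //; try exact: UU.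
by exists x, y; split=> //; rewrite opprD addrACA subrr addr0.
Qed.

Lemma ECB_scale : Qscale ECB.
Proof.
move=> V W U a f fV cU sa [ef bf]; split; last exact: (bdQ_scale GB fV cU sa bf).
have [C C0 HC] := cpt_bound (sa 0%N) cU (@subsetT _ U).
have [L L0 HL] := locLip_on_cpt (CT1_locLip fV (@openT V) (sa 1%N)) cU (@subsetT _ U).
have [B B0 HB] := bndB_pos bf.
move=> S BS; apply: (GA (c := C + L * B) (ef S BS) BS).
apply: filterS HB => i HB b s b0 s0 Hb Hs d [x [y [Ux Uy Sxy ->]]].
have -> : a x *: f i x - a y *: f i y = a x *: (f i x - f i y) + (a x - a y) *: f i y.
  by rewrite scalerBr scalerBl addrA subrK.
apply: le_trans (ler_normD _ _) _; rewrite !normrZ.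
have h1 : `|f i x - f i y| <= b by apply: Hb; exists x, y.
have h2 : `|f i y| <= B by apply: HB; exists y.
have h3 : `|a x - a y| <= L * s by apply: le_trans (HL x y Ux Uy) _; rewrite ler_pM2l //; exact: Hs.
have h4 := HC x Ux.
apply: le_trans (lerD (ler_pM _ _ h4 h1) (ler_pM _ _ h3 h2)) _ => //.
rewrite -subr_ge0 (_ : _ - _ = C * s + L * B * b); last by ring.
by apply: addr_ge0; rewrite !mulr_ge0 // ltW.
Qed.

Lemma tgt_slice V W (g : (V * V)%type -> W) z v w : 'D_(w, 0) g (z, v) = 'D_w (fun x => g (x, v)) z.
Proof.
rewrite /derive; apply: (congr1 (fun F : R -> W => lim (F @ (0 : R)^'))); apply/funext => h /=.
by rewrite -[h *: (w, 0) + _]/(h *: w + z, h *: 0 + v) scaler0 add0r.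
Qed.

Lemma iterD_slice V W (g : (V * V)%type -> W) (ws : seq V) v :
  (fun z => iterD [seq (w, 0 : V) | w <- ws] g (z, v)) = iterD ws (fun z => g (z, v)).
Proof.
elim: ws => [//|w ws IH] /=; rewrite -IH; apply/funext => z.
exact: tgt_slice.
Qed.

(** The innermost direction is frozen in the tangent component; the remaining derivatives are taken
    in directions (w, 0), which move the base point only. *)
Lemma rec_iterD k V W (U : set V) (f : T -> V -> W) : reg F k U f -> rec (bdQ Bnd) k U f ->
  Bnd (fun i x => exists (vs : seq V) z,
    [/\ size vs = k, (forall v, v \in vs -> `|v| <= 1), U z & x = `|iterD vs (f i) z|]).
Proof.
elim: k V W U f => [|k IH] V W U f rf qf.
  apply: (gauge_sub GA qf); apply: nearW => i x [vs [z [sv _ Uz ->]]].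
  by case: vs sv => [|//] _; exists `|f i z|; [exists z|].
have rt := reg_tgt (FF:=FF) 1 rf; have ls := islin_snd W W.
have h := IH _ _ _ _ (reg_post (FF:=FF) ls rt) (rec_post (FF:=FF) (bdQ_ext (FF:=FF) GA) (bdQ_post (FF:=FF) GA) ls rt (qf 1)).
apply: (gauge_sub GA h); apply: nearW => i x [vs [z [sv uv Uz ->]]].
case/lastP: vs sv uv => [//|ws v]; rewrite size_rcons => -[sw] uv.
eexists; last exact: lexx.
exists [seq (w, 0 : V) | w <- ws], (z, v); split.
- by rewrite size_map.
- move=> _ /mapP[w wi ->]; rewrite prod_normE /= normr0 ge_max ler01 andbT.
  by apply: uv; rewrite mem_rcons inE wi orbT.
- by split=> //=; apply: uv; rewrite mem_rcons inE eqxx.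
- rewrite iterD_rcons; congr `|_|; apply: esym.
  exact: (f_equal (fun h => h z) (iterD_slice (fun zv => (tgt (f i) zv).2) ws v)).
Qed.

Lemma CT_rec_bnd k V W (A U : set V) (f : V -> W) : findim V -> open A -> U `<=` A -> compact U ->
  CT k A f -> rec (bdQ (bndB F)) k U (fun=> f).
Proof.
elim: k V W A U f => [|k IH] V W A U f fV oA UA cU cf.
  have [C C0 HC] := cpt_bound cf cU UA.
  by exists C; apply: nearW => i x [z Uz ->]; exact: HC.
move=> M; have [_ ct] := cf.
apply: (IH _ _ (A `*` setT)) => //; [exact: findim_prod|exact: openXT|by move=> [z v] [/= /UA]|].
by apply: compact_setX => //; exact: compact_cball.
Qed.
End Qualities2.

(** * The norm of C^r in terms of iterated derivatives *)

Section Norms.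
Context {R : realType}.
Implicit Types V W Z : normedModType R.

Lemma iterD_loc V W (A : set V) (vs : seq V) (f g : V -> W) : open A -> (forall z, A z -> f z = g z) ->
  forall z, A z -> iterD vs f z = iterD vs g z.
Proof.
move=> oA E; elim: vs => [//|v vs IH] z Az /=.
apply: near_eq_derive; have := open_nbhs_nbhs (conj oA Az).
by apply: filterS => x /IH.
Qed.

Lemma iterD_add V W (A : set V) k (vs : seq V) (f g : V -> W) z : open A -> CT k A f -> CT k A g ->
  (size vs <= k)%N -> A z -> iterD vs (fun x => f x + g x) z = iterD vs f z + iterD vs g z.
Proof.
move=> oA; elim/last_ind: vs k f g z => [//|vs v IH] [|k] f g z cf cg; rewrite size_rcons // => sk Az.
rewrite !iterD_rcons -(IH k) //; try exact: CT_derive.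
apply: (iterD_loc vs oA) => // x Ax.
exact: deriveD (diff_derivable (CT_diff cf Ax)) (diff_derivable (CT_diff cg Ax)).
Qed.

Lemma sup_le0 (A : set R) (B : R) : 0 <= B -> (forall x, A x -> x <= B) -> sup A <= B.
Proof.
move=> B0 H; have [->|/set0P A0] := eqVneq A set0; first by rewrite sup0.
exact: ge_sup.
Qed.

Lemma C_norm_le V W r (U : set V) (f : V -> W) B : 0 <= B ->
  (forall vs z, (size vs <= r)%N -> (forall v, v \in vs -> `|v| <= 1) -> U z -> `|iterD vs f z| <= B) ->
  C_norm r U f <= B.
Proof.
move=> B0 H; apply: bigmax_le => // k _; apply: sup_le0 => // _ [z Uz <-].
apply: sup_le0 => // _ [vs uvs <-]; apply: H => //; first by rewrite size_tuple -ltnS.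
by move=> v /tnthP[i ->]; exact: uvs.
Qed.

Lemma class_C_near_CT V W k (U : set V) (f : V -> W) : findim V -> class_C_near k U f ->
  exists A, [/\ open A, U `<=` A & CT k A f].
Proof. by move=> fV [A [oA UA cA]]; exists A; split=> //; exact: class_C_CT. Qed.

Lemma CT_class_C_near V W k (U A : set V) (f : V -> W) : open A -> U `<=` A -> CT k A f ->
  class_C_near k U f.
Proof. by move=> oA UA cA; exists A; split=> //; exact: CT_class_C. Qed.

Lemma iterD_bounded V W r (U : set V) (f : V -> W) : findim V -> compact U -> class_C_near r U f ->
  exists2 C, 0 <= C & forall k (vs : seq V) z, (k <= r)%N -> size vs = k ->
    (forall v, v \in vs -> `|v| <= 1) -> U z -> `|iterD vs f z| <= C.
Proof.
move=> fV cU /(class_C_near_CT fV)[A [oA UA cA]].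
elim: r cA => [|r IH] cA.
  have [C C0 HC] := cpt_bound cA cU UA.
  exists C => [|k vs z]; first exact: ltW.
  by rewrite leqn0 => /eqP -> /size0nil -> _; exact: HC.
have [C C0 HC] := IH (CTS cA).
(* A single map is treated as a constant family, along an arbitrary filter whose sets are nonempty,
   so that the bound can be extracted. *)
pose FF : Filter (nbhs (0 : R)) := nbhs_filter (0 : R).
have h := CT_rec_bnd (FF := FF) fV oA UA cU cA.
have rf : reg (nbhs (0 : R)) r.+1 U (fun=> f) by apply: nearW => _; exists A.
have [C' C'0 HC'] := bndB_pos (rec_iterD (FF := FF) (@bndB_gauge R R (nbhs (0 : R)) FF) rf h).
exists (C + C') => [|k vs z]; first exact: addr_ge0.
rewrite leq_eqVlt => /orP[/eqP -> svs uvs Uz|kr svs uvs Uz].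
  apply: le_trans (_ : _ <= C') _; last by rewrite lerDr.
  by apply: (nbhs_singleton HC'); exists vs, z.
by apply: le_trans (HC k vs z kr svs uvs Uz) _; rewrite lerDl.
Qed.

Lemma iterD_C_norm V W r (U : set V) (f : V -> W) (vs : seq V) z : findim V -> compact U ->
  class_C_near r U f -> (size vs <= r)%N -> (forall v, v \in vs -> `|v| <= 1) -> U z ->
  `|iterD vs f z| <= C_norm r U f.
Proof.
move=> fV cU cf svs uvs Uz; have [C C0 HC] := iterD_bounded fV cU cf.
pose k := Ordinal (svs : (size vs < r.+1)%N).
have ut (t : (size vs).-tuple V) : (forall i, `|tnth t i| <= 1) -> forall v, v \in tval t -> `|v| <= 1.
  by move=> h v /tnthP[i ->].
have Db y : U y -> has_ubound [set `|iterD vs0 f y| | vs0 in [set vs0 : (size vs).-tuple V | forall i, `|tnth vs0 i| <= 1]].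
  move=> Uy; exists C => _ [t tu <-]; apply: (HC (size vs)) => //; [by rewrite size_tuple|exact: ut].
apply: (le_trans _ (le_bigmax _ _ k)); rewrite /=.
apply: le_trans (_ : _ <= Dnorm (size vs) f z) _.
  apply: ub_le_sup; first exact: Db.
  by exists (in_tuple vs) => //= i; apply: uvs; rewrite (tnth_nth 0) mem_nth //= ltn_ord.
apply: ub_le_sup; last by exists z.
exists C => _ [y Uy <-]; apply: sup_le0 => // _ [t tu <-].
by apply: (HC (size vs)) => //; [by rewrite size_tuple|exact: ut].
Qed.

Lemma C_norm_ge0 V W r (U : set V) (f : V -> W) : 0 <= C_norm r U f.
Proof. exact: bigmax_ge_id. Qed.

Lemma C_norm_add V W r (U : set V) (f g : V -> W) : findim V -> compact U ->
  class_C_near r U f -> class_C_near r U g ->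
  C_norm r U (fun z => f z + g z) <= C_norm r U f + C_norm r U g.
Proof.
move=> fV cU cf cg; apply: C_norm_le => [|vs z svs uvs Uz]; first by rewrite addr_ge0 // C_norm_ge0.
have [A [oA UA cA]] := class_C_near_CT fV cf; have [B [oB UB cB]] := class_C_near_CT fV cg.
rewrite (@iterD_add _ _ (A `&` B) r) //; last by split; [exact: UA|exact: UB].
- by apply: le_trans (ler_normD _ _) _; apply: lerD; exact: iterD_C_norm.
- exact: openI.
- exact: CT_sub (@subIsetl _ A B) cA.
- exact: CT_sub (@subIsetr _ A B) cB.
Qed.
End Norms.

Section NormRec.
Context {R : realType} {T : Type} (F : set_system T) {FF : Filter F}.
Implicit Types V W Z : normedModType R.
Variable Bnd : (T -> R -> Prop) -> Prop.
Hypothesis GA : gauge_axiom F Bnd.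

Lemma rec_iterD_le k V W (U : set V) (f : T -> V -> W) : reg F k U f -> rec (bdQ Bnd) k U f ->
  Bnd (fun i x => exists (vs : seq V) z,
    [/\ (size vs <= k)%N, (forall v, v \in vs -> `|v| <= 1), U z & x = `|iterD vs (f i) z|]).
Proof.
elim: k => [|k IH] rf qf; have h := rec_iterD (FF:=FF) GA rf qf.
  apply: (gauge_sub GA h); apply: nearW => i x [vs [z [sv uv Uz ->]]].
  by eexists; last exact: lexx; exists vs, z; split=> //; apply/eqP; rewrite -leqn0.
have rf' := reg_le (FF:=FF) (leqnSn k) rf.
have qf' := rec_le (FF:=FF) (bdQ_ext (FF:=FF) GA) (bdQ_post (FF:=FF) GA) (bdQ_pre (FF:=FF) GA) (leqnSn k) rf qf.
have h' := IH rf' qf'.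
apply: (GA (c := 1) h h'); apply: nearW => i a b a0 b0 Ha Hb x [vs [z [sv uv Uz ->]]].
rewrite mul1r; move: sv; rewrite leq_eqVlt => /orP[/eqP sv|sv].
  by apply: le_trans (_ : _ <= a) _; [apply: Ha; exists vs, z|rewrite lerDl].
by apply: le_trans (_ : _ <= b) _; [apply: Hb; exists vs, z|rewrite lerDr].
Qed.

Lemma bd_C_norm k V W (U : set V) (f : T -> V -> W) : reg F k U f -> rec (bdQ Bnd) k U f ->
  Bnd (fun i x => x = C_norm k U (f i)).
Proof.
move=> rf qf; have h := rec_iterD_le rf qf.
apply: (GA (c := 1) h h); apply: nearW => i a b a0 b0 Ha Hb x ->.
rewrite mul1r; apply: le_trans (_ : _ <= a) _; last by rewrite lerDl.
by apply: C_norm_le => // vs z sv uv Uz; apply: Ha; exists vs, z.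
Qed.

Lemma class_C_near_reg k V W (U : set V) (f : T -> V -> W) : findim V ->
  (\forall i \near F, class_C_near k U (f i)) -> reg F k U f.
Proof. by move=> fV; apply: filterS => i /(class_C_near_CT fV). Qed.

Lemma C_norm_bd k V W (U : set V) (f : T -> V -> W) : findim V -> compact U ->
  (\forall i \near F, class_C_near k U (f i)) ->
  Bnd (fun i x => x = C_norm k U (f i)) -> rec (bdQ Bnd) k U f.
Proof.
move=> fV cU cf B; have rf := class_C_near_reg fV cf.
apply: (rec_of_iterD (bdQ_ext GA) (bdQ_add GA) (bdQ_post GA) (bdQ_pre GA) (bdQ_scale GA) fV cU rf).
move=> vs svs uvs; apply: (gauge_sub GA B); apply: filterS cf => i ci x [z Uz ->].
by exists (C_norm k U (f i)) => //; exact: iterD_C_norm.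
Qed.
End NormRec.

Section ContactRec.
Context {R : realType} {n : nat} {T : Type} (F : set_system T) {FF : Filter F}.
Variable Q : forall V W : normedModType R, set V -> (T -> V -> W) -> Prop.
Hypotheses (Qe : Qext F Q) (Qa : Qadd Q) (Qp : Qpost Q) (Qr : Qpre Q) (Qs : Qscale Q).
Let J := jet R n.

(** The contact field is built from [K] and its first derivatives with fixed vectors and momentum
    coordinates as coefficients. In this shape the closure properties carry estimates from
    Hamiltonians to fields, at the cost of one derivative. *)
Lemma contact_field_sum (K : ham R n) (z : J) : contact_field K z =
  (- K z) *: e_u + \sum_(i < n) (d_p i K z *: e_x i + mom z i *: (d_p i K z *: e_u)
      + ((- d_x i K z) *: e_p i + mom z i *: ((- d_u K z) *: e_p i))).
Proof.
have E (v1 v2 : jet R n) : (forall i, v1.1.1 0 i = v2.1.1 0 i) -> v1.1.2 = v2.1.2 ->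
    (forall i, v1.2 0 i = v2.2 0 i) -> v1 = v2.
  case: v1 => [[x1 u1] p1]; case: v2 => [[x2 u2] p2] /= h1 h2 h3.
  by congr (_, _, _) => //; apply/rowP.
have pick (f : 'I_n -> R) (i : 'I_n) : \sum_j f j * ((j == i)%:R : R) = f i.
  rewrite (bigD1 i) //= eqxx mulr1 big1 ?addr0 // => j ne.
  by rewrite (negbTE ne) mulr0.
have lc (L : J -> R) : islin L -> forall (a : R) (b c : 'I_n -> R) (f g h k : 'I_n -> J) (u : J),
    L (a *: u + \sum_i (b i *: f i + mom z i *: (b i *: g i) + ((- c i) *: h i + mom z i *: ((- d_u K z) *: k i)))) =
    a * L u + \sum_i (b i * L (f i) + mom z i * (b i * L (g i)) - (c i * L (h i) + mom z i * d_u K z * L (k i))).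
  move=> lL a b c f g h k u; rewrite (islinD _ _ lL) (islinZ _ _ lL) (islin_sum _ _ _ lL); congr (_ + _).
  apply: eq_bigr => i _; rewrite !(islinD _ _ lL) !(islinZ _ _ lL).
  rewrite -[(- c i) *: _]/(- c i * _) -[(- d_u K z) *: _]/(- d_u K z * _).
  rewrite -[b i *: L (f i)]/(b i * _) -[b i *: L (g i)]/(b i * _).
  rewrite -[mom z i *: (b i * _)]/(mom z i * _) -[mom z i *: (_ * L (k i))]/(mom z i * _); ring.
have h := fun L lL => lc L lL (- K z) (fun i => d_p i K z) (fun i => d_x i K z) e_x (fun=> e_u) e_p e_p e_u.
have d (i j : 'I_n) : (delta_mx 0 j : 'rV[R]_n) 0 i = (j == i)%:R by rewrite mxE eqxx /= eq_sym.
have d0 (i : 'I_n) : (0 : 'rV[R]_n) 0 i = 0 by rewrite mxE.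
apply: E => [i||i].
- apply: etrans (contact_x K z i) _; apply: esym; apply: etrans (h _ (islin_x i)) _.
  rewrite /= d0 mulr0 add0r -[RHS](pick (fun j => d_p j K z) i).
  apply: eq_bigr => j _; rewrite d ?d0.
  by move: (d_p j K z) (d_x j K z) (d_u K z) (mom z j) => a b c m; ring.
- apply: esym; apply: etrans (h _ islin_u) _; rewrite /= mulr1 addrC; congr (_ - _).
  apply: eq_bigr => j _.
  by move: (d_p j K z) (d_x j K z) (d_u K z) (mom z j) => a b c m; ring.
- apply: etrans (contact_p K z i) _; apply: esym; apply: etrans (h _ (islin_mom i)) _.
  rewrite /mom /= d0 mulr0 add0r -[RHS](pick (fun j => - (d_x j K z + z.2 0 j * d_u K z)) i).
  apply: eq_bigr => j _; rewrite d ?d0.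
  by move: (d_p j K z) (d_x j K z) (d_u K z) (z.2 0 j) => a b c m; ring.
Qed.

Lemma rec_contact_field k (U : set J) (K : T -> ham R n) : compact U -> reg F k.+1 U K ->
  rec Q k.+1 U K -> rec Q k U (fun i => contact_field (K i)).
Proof.
move=> cU rK qK; have fJ := @findim_jet R n.
have rK' := reg_le (FF:=FF) (leqnSn k) rK.
have qK' := rec_le (FF:=FF) Qe Qp Qr (leqnSn k) rK qK.
have lv (v : J) : islin (fun a : R => a *: v) := islin_scalev v.
have lvN (v : J) : islin (fun a : R => (- a) *: v).
  have h := islin_scale (-1) (lv v).
  by rewrite (_ : (fun _ => _) = (fun a : R => -1 *: (a *: v))) //; apply/funext => a; rewrite scaleN1r scaleNr.
have sm_mom i : sm setT (fun z : J => mom z i) := sm_lin (islin_mom i).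
have rD v := reg_derive (FF:=FF) v rK; have qD v := rec_derive (FF:=FF) Qe Qp Qr v rK qK.
have r0 := reg_post (FF:=FF) (lvN e_u) rK'; have q0 := rec_post (FF:=FF) Qe Qp (lvN e_u) rK' qK'.
have r1 i := reg_post (FF:=FF) (lv (e_x i)) (rD (e_p i)).
have q1 i := rec_post (FF:=FF) Qe Qp (lv (e_x i)) (rD (e_p i)) (qD (e_p i)).
have r2 i := reg_post (FF:=FF) (lv e_u) (rD (e_p i)).
have q2 i := rec_post (FF:=FF) Qe Qp (lv e_u) (rD (e_p i)) (qD (e_p i)).
have r3 i := reg_post (FF:=FF) (lvN (e_p i)) (rD (e_x i)).
have q3 i := rec_post (FF:=FF) Qe Qp (lvN (e_p i)) (rD (e_x i)) (qD (e_x i)).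
have r4 i := reg_post (FF:=FF) (lvN (e_p i)) (rD e_u).
have q4 i := rec_post (FF:=FF) Qe Qp (lvN (e_p i)) (rD e_u) (qD e_u).
have s2 i := reg_scale (FF:=FF) (sm_mom i) (r2 i).
have t2 i := rec_scale (FF:=FF) Qe Qa Qp Qs fJ cU (sm_mom i) (r2 i) (q2 i).
have s4 i := reg_scale (FF:=FF) (sm_mom i) (r4 i).
have t4 i := rec_scale (FF:=FF) Qe Qa Qp Qs fJ cU (sm_mom i) (r4 i) (q4 i).
have rg i := reg_add (FF:=FF) (reg_add (FF:=FF) (r1 i) (s2 i)) (reg_add (FF:=FF) (r3 i) (s4 i)).
have qg i := rec_add (FF:=FF) Qe Qa (reg_add (FF:=FF) (r1 i) (s2 i)) (reg_add (FF:=FF) (r3 i) (s4 i))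
  (rec_add (FF:=FF) Qe Qa (r1 i) (s2 i) (q1 i) (t2 i)) (rec_add (FF:=FF) Qe Qa (r3 i) (s4 i) (q3 i) (t4 i)).
have h := rec_addsum (FF:=FF) Qe Qa (index_enum 'I_n) r0 rg q0 qg.
rewrite (_ : (fun i => contact_field (K i)) = (fun i z => - K i z *: e_u +
   \sum_(j <- index_enum 'I_n) (d_p j (K i) z *: e_x j + mom z j *: (d_p j (K i) z *: e_u)
      + ((- d_x j (K i) z) *: e_p j + mom z j *: ((- d_u (K i) z) *: e_p j))))); first exact: h.
by apply/funext => i; apply/funext => z; exact: contact_field_sum.
Qed.

End ContactRec.

(** * Convergence of flows with converging fields *)

Section Curves.
Context {R : realType}.
Implicit Types V : normedModType R.

Definition cin V (X : V -> V) (K : set V) z (g : R -> V) : Prop :=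
  icurve X z g /\ forall t : R, 0 <= t <= 1 -> K (g t).

Lemma scale_bound (c Tm B x y : R) : `|c| <= Tm -> 0 <= B -> x <= B * y -> 0 <= y -> `|c| * x <= Tm * B * y.
Proof.
move=> cT B0 xB y0; apply: le_trans (_ : _ <= `|c| * (B * y)) _; first exact: ler_wpM2l.
by rewrite mulrA; apply: ler_wpM2r => //; exact: ler_wpM2r.
Qed.

Lemma tgt_cin V (A K : set V) (X : V -> V) (c Tm B M : R) z v g : findim V -> open A -> CT 1 A X -> K `<=` A ->
  `|c| <= Tm -> 0 < B -> (forall x, K x -> forall w, `|'D_w X x| <= B * `|w|) -> `|v| <= M ->
  cin (fun x => c *: X x) K z g -> exists y,
    [/\ vcurve (fun x => c *: X x) g v y, icurve (fun w => c *: tgt X w) (z, v) (fun t => (g t, y t)) &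
     forall t : R, 0 <= t <= 1 -> cball (M * expR (Tm * B + 2)) (y t)].
Proof.
move=> fV oA cX KA cT B0 HB vM [ig gK].
have cY : CT 1 A (fun x => c *: X x) by exact: CT_scalec.
have [_ cg _] := ig.
have gA (t : R) : 0 <= t <= 1 -> A (g t) by move=> /gK /KA.
have [y vy] := vcurve_ex fV oA cY v cg gA.
have T0 : 0 <= Tm := le_trans (normr_ge0 _) cT.
have dX x : A x -> differentiable X x by move=> Ax; exact: (CT_diff cX Ax).
exists y; split=> //.
- have [h0 h1 h2] := icurve_tgt ig vy; split=> // t t01.
  have h := h2 t t01; rewrite (tgt_scale c (y t) dX (gA t (oo_cc t01))) in h; exact: h.
(* One unit is added because [Tm] may vanish while the variational bound asks for a positive
   constant, which adds a further unit: hence the 2 in the exponent. *)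
- have TB : 0 < Tm * B + 1 by rewrite ltr_wpDl // mulr_ge0 // ltW.
  have HB' (t : R) : 0 <= t <= 1 -> forall w, `|'D_w (fun x => c *: X x) (g t)| <= (Tm * B + 1) * `|w|.
    move=> tI w.
    have -> : 'D_w (fun x => c *: X x) (g t) = c *: 'D_w X (g t).
      have := deriveZ c (diff_derivable (v := w) (dX _ (gA t tI))); exact.
    rewrite normrZ mulrDl mul1r; apply: le_trans (_ : _ <= Tm * B * `|w|) _; last by rewrite lerDl.
    apply: scale_bound => //; first exact: ltW.
    exact: HB (gK t tI) w.
  move=> t tI; rewrite /cball /=; apply: le_trans (vcurve_bound HB' TB vy tI) _.
  apply: ler_pM; rewrite ?expR_ge0 //.
  have -> : Tm * B + 2 = Tm * B + 1 + 1 by ring.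
  rewrite ler_expR ler_piMr ?addr_ge0 ?(ltW TB) //; first exact: mulr_ge0 T0 (ltW B0).
  by case/andP: tI.
Qed.

Lemma gronwall0 V (u du : R -> V) (c eta : R) :
  (forall t : R, 0 <= t <= 1 -> {for t, continuous u}) ->
  (forall t : R, 0 < t < 1 -> is_derive t 1 u (du t)) ->
  u 0 = 0 -> 0 <= c -> 0 <= eta ->
  (forall t : R, 0 < t < 1 -> `|du t| <= c * `|u t| + eta) ->
  forall t : R, 0 <= t <= 1 -> `|u t| <= eta * expR (c + 1).
Proof.
move=> uc ud u0 c0 e0 H t tI.
have h := @gronwall R V u du eta c (c + 1) eta (eta * expR (c + 1) + 1) uc ud.
apply: le_trans (h _ _ _ _ _ _ t tI) _ => //.
- by rewrite u0 normr0.
- by rewrite ltrDl.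
- by rewrite addrAC subrr add0r mul1r.
- by rewrite ltrDl.
- by move=> s sI _; exact: H.
- apply: ler_wpM2l => //; rewrite ler_expR ler_piMr ?addr_ge0 //; by case/andP: tI.
Qed.
End Curves.

Section Conv.
Context {R : realType} {T : Type} (F : set_system T) {FF : Filter F}.
Implicit Types V : normedModType R.
Variable Bnd : (T -> R -> Prop) -> Prop.
Hypothesis GA : gauge_axiom F Bnd.
Variables (tm : T -> R) (Tm : R).
Hypothesis tmT : forall i, `|tm i| <= Tm.

Lemma gauge_union (S S' : T -> R -> Prop) : Bnd S -> Bnd S' -> Bnd (fun i x => S i x \/ S' i x).
Proof.
move=> B B'; apply: (GA (c := 1) B B'); apply: nearW => i a b a0 b0 Ha Hb x [/Ha h|/Hb h].
  by rewrite mul1r; apply: le_trans h _; rewrite lerDl.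
by rewrite mul1r; apply: le_trans h _; rewrite lerDr.
Qed.

Definition cgap V (U K : set V) (X : V -> V) (Y : T -> V -> V) (i : T) (d : R) : Prop :=
  exists z g g' (t : R), [/\ U z, cin (fun x => tm i *: X x) K z g, cin (fun x => tm i *: Y i x) K z g',
    0 <= t <= 1 & d = `|g t - g' t|].

(** Both curves are known to stay in [K], so the Lipschitz bound of [X] on pairs of points of [K]
    applies at all times. *)
Lemma conv0 V (U K : set V) (X : V -> V) (Y : T -> V -> V) L : 0 <= L ->
  (forall x y, K x -> K y -> `|X x - X y| <= L * `|x - y|) ->
  bdQ Bnd K (fun i z => X z - Y i z) -> Bnd (cgap U K X Y).
Proof.
move=> L0 HL B; apply: (GA (c := Tm * expR (Tm * L + 1)) B B).
apply: nearW => i a b a0 b0 Ha _ d [z [g [g' [t [Uz [[g0 gc gd] gK] [[g'0 g'c g'd] g'K] tI ->]]]]].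
have T0 : 0 <= Tm := le_trans (normr_ge0 _) (tmT i).
apply: (@le_trans _ _ (Tm * a * expR (Tm * L + 1))); last first.
  rewrite mulrAC; apply: ler_wpM2l; last by rewrite lerDl.
  by rewrite mulr_ge0 // expR_ge0.
apply: (@gronwall0 R V (fun s => g s - g' s) (fun s => tm i *: X (g s) - tm i *: Y i (g' s))) => //.
- by move=> s _; apply: cvgB; [exact: gc|exact: g'c].
- by move=> s sI; have h1 := gd s sI; have h2 := g'd s sI; exact: is_deriveB.
- by rewrite g0 g'0 subrr.
- exact: mulr_ge0.
- exact: mulr_ge0.
- move=> s /oo_cc sI.
  have -> : tm i *: X (g s) - tm i *: Y i (g' s) =
      tm i *: (X (g s) - X (g' s)) + tm i *: (X (g' s) - Y i (g' s)).
    by rewrite -scalerDr addrA subrK scalerBr.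
  apply: le_trans (ler_normD _ _) _; rewrite !normrZ; apply: lerD.
    by apply: scale_bound => //; apply: HL; [exact: gK|exact: g'K].
  by apply: ler_pM => //; apply: Ha; exists (g' s) => //; exact: g'K.
Qed.

(** The difference of the two variational equations has three parts. One is linear in the unknown
    difference, one is the derivative of X - Y, and one is the change of the derivative of [Y]
    between the two base curves. For the last, equicontinuity is used at a displacement that obeys
    the gauge by [conv0]. *)
Lemma conv1 V (U K A : set V) (X : V -> V) (Y : T -> V -> V) M M' : findim V -> open A -> CT 1 A X ->
  compact K -> K `<=` A -> (forall i, CT 1 setT (Y i)) ->
  bdQ Bnd K (fun i z => X z - Y i z) ->
  bdQ Bnd (K `*` @cball R V M') (fun i => tgt (fun z => X z - Y i z)) ->
  EC Bnd (K `*` @cball R V M') (fun i => tgt (Y i)) ->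
  Bnd (cgap (U `*` @cball R V M) (K `*` @cball R V M') (tgt X) (fun i => tgt (Y i))).
Proof.
move=> fV oA cX cK KA cY B0 B1 E1.
have [L L0 HL] := locLip_on_cpt (CT1_locLip fV oA cX) cK KA.
have [B Bp HB] := op_bound_cpt fV oA cX cK KA.
have G0 : Bnd (cgap U K X Y) := conv0 U (ltW L0) HL B0.
have E := E1 _ G0.
have B2 := gauge_union B1 E.
pose C := Tm * expR (Tm * B + 1).
apply: (GA (c := 1 + C + C) G0 B2); apply: nearW => i a b a0 b0 Ha Hb d.
move=> [[z v] [w [w' [t [[/= Uz vM] [iw wK] [iw' w'K] tI ->]]]]].
have T0 : 0 <= Tm := le_trans (normr_ge0 _) (tmT i).
have C0 : 0 <= C by rewrite mulr_ge0 // expR_ge0.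
have [w0 wc wd] := iw; have [w'0 w'c w'd] := iw'.
have fst_curve (f : (V * V)%type -> (V * V)%type) (X1 : V -> V) u : (forall p, (f p).1 = X1 p.1) ->
    cin (fun p => tm i *: f p) (K `*` @cball R V M') (z, v) u -> cin (fun x => tm i *: X1 x) K z (fun s => (u s).1).
  move=> Ef [[u0 uc ud] uK]; split; last by move=> s /uK [].
  split; [by rewrite u0| |].
    by move=> s; have h1 := uc s; have h2 := (islin_fst V V).2 (u s); exact: (continuous_comp h1 h2).
  move=> s sI; have h := is_derive_lin (ud s sI) (islin_fst V V).
  by rewrite /= Ef in h.
have c1 : cin (fun x => tm i *: X x) K z (fun s => (w s).1) by apply: (fst_curve (tgt X)).
have c1' : cin (fun x => tm i *: Y i x) K z (fun s => (w' s).1) by apply: (fst_curve (tgt (Y i))).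
have gap (s : R) : 0 <= s <= 1 -> `|(w s).1 - (w' s).1| <= a.
  by move=> sI; apply: Ha; exists z, (fun s => (w s).1), (fun s => (w' s).1), s.
have vgap : `|(w t).2 - (w' t).2| <= Tm * (b + b) * expR (Tm * B + 1).
  have sc (u : R -> (V * V)%type) : continuous u -> forall s : R, {for s, continuous (fun s => (u s).2)}.
    by move=> uc s; have h1 := uc s; have h2 := (islin_snd V V).2 (u s); exact: (continuous_comp h1 h2).
  apply: (@gronwall0 R V (fun s => (w s).2 - (w' s).2)
    (fun s => tm i *: 'D_((w s).2) X (w s).1 - tm i *: 'D_((w' s).2) (Y i) (w' s).1)) => //.
  - by move=> s _; apply: cvgB; exact: sc.
  - move=> s sI; have h1 := is_derive_lin (wd s sI) (islin_snd V V).
    have h2 := is_derive_lin (w'd s sI) (islin_snd V V); exact: (is_deriveB h1 h2).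
  - by rewrite w0 w'0 subrr.
  - by rewrite mulr_ge0 // ltW.
  - by rewrite mulr_ge0 // addr_ge0.
  - move=> s /oo_cc sI; have [/= K1 M1] := wK s sI; have [/= K1' M1'] := w'K s sI.
    have dX := CT_diff cX (KA _ K1); have dY x := CT_diff (cY i) (I : setT x).
    have [lD _] := diff_eps dX.
    have -> : tm i *: 'D_((w s).2) X (w s).1 - tm i *: 'D_((w' s).2) (Y i) (w' s).1 =
       tm i *: 'D_((w s).2 - (w' s).2) X (w s).1 +
       (tm i *: 'D_((w' s).2) (fun z => X z - Y i z) (w s).1 +
        tm i *: ('D_((w' s).2) (Y i) (w s).1 - 'D_((w' s).2) (Y i) (w' s).1)).
      have -> : 'D_((w' s).2) (fun z => X z - Y i z) (w s).1 = 'D_((w' s).2) X (w s).1 - 'D_((w' s).2) (Y i) (w s).1.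
        by have := deriveB (diff_derivable (v := (w' s).2) dX) (diff_derivable (dY (w s).1)); exact.
      by rewrite (islinB _ _ lD) -!scalerDr -scalerBr; congr (_ *: _); rewrite !addrA !subrK.
    apply: le_trans (ler_normD _ _) _; rewrite normrZ; apply: lerD.
      by apply: scale_bound => //; [exact: ltW|exact: HB].
    apply: le_trans (ler_normD _ _) _; rewrite !normrZ mulrDr; apply: lerD; apply: ler_pM => //.
      apply: le_trans (_ : _ <= `|tgt (fun z => X z - Y i z) ((w s).1, (w' s).2)|) _.
        by rewrite prod_normE le_max lexx orbT.
      by apply: Hb; left; exists ((w s).1, (w' s).2).
    apply: le_trans (_ : _ <= `|tgt (Y i) ((w s).1, (w' s).2) - tgt (Y i) ((w' s).1, (w' s).2)|) _.
      by rewrite prod_normE le_max lexx orbT.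
    apply: Hb; right; exists ((w s).1, (w' s).2), ((w' s).1, (w' s).2); split=> //.
    rewrite prod_normE /= subrr normr0 max_l //.
    by exists z, (fun s => (w s).1), (fun s => (w' s).1), s.
rewrite prod_normE ge_max; apply/andP; split.
  apply: le_trans (gap t tI) _; rewrite mulrDl mulrDl mul1r -addrA.
  have : 0 <= C * (a + b) by rewrite mulr_ge0 // addr_ge0.
  by move: (C * (a + b)) => x x0; lra.
apply: le_trans vgap _; rewrite -mulrA (mulrC (b + b)) mulrA -/C.
have : 0 <= C * a by rewrite mulr_ge0.
have : 0 <= C * b by rewrite mulr_ge0.
rewrite !mulrDl !mulrDr mul1r; move: (C * a) (C * b) => x y; lra.
Qed.
End Conv.

Section ConvCk.
Context {R : realType} {T : Type} (F : set_system T) {FF : Filter F}.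
Implicit Types V W : normedModType R.
Variable Bnd : (T -> R -> Prop) -> Prop.
Hypothesis GA : gauge_axiom F Bnd.
Variables (tm : T -> R) (Tm : R).
Hypothesis tmT : forall i, `|tm i| <= Tm.

Lemma op_bound_unit V W (L : V -> W) (C : R) : islin L -> (forall v, `|v| <= 1 -> `|L v| <= C) ->
  forall w, `|L w| <= C * `|w|.
Proof.
move=> lL H w; have [->|w0] := eqVneq w 0; first by rewrite (islin0 lL) !normr0 mulr0.
have nw : 0 < `|w| by rewrite normr_gt0.
have h := H (`|w|^-1 *: w); rewrite (islinZ _ _ lL) !normrZ !normfV !normr_id in h.
have {}h := h _; rewrite mulVf ?gt_eqF // in h; have {}h := h (lexx _).
by rewrite mulrC -ler_pdivrMl.
Qed.

Lemma tgt_sub V W (f g : V -> W) zv : differentiable f zv.1 -> differentiable g zv.1 ->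
  tgt (fun z => f z - g z) zv = tgt f zv - tgt g zv.
Proof.
move=> df dg; rewrite /tgt -[RHS]/(_ - _, _ - _); congr (_, _).
exact: deriveB (diff_derivable df) (diff_derivable dg).
Qed.

Lemma tgt_fl_curve V (A : set V) (X : V -> V) z v g y : findim V -> open A -> CT 1 A X ->
  icurve X z g -> (forall t : R, 0 <= t <= 1 -> A (g t)) -> vcurve X g v y ->
  differentiable (fl X) z /\ tgt (fl X) (z, v) = (g 1, y 1).
Proof.
move=> fV oA cX ig gA vy; have [d D] := fl_diff fV oA cX ig gA vy.
by split=> //; rewrite /tgt /= D (flE (CT1_locLip fV oA cX) ig gA).
Qed.

Lemma tgt_fl_scale V (A : set V) (X : V -> V) c z v : findim V -> open A -> CT 2 A X ->
  idom A (fun x => c *: X x) z ->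
  tgt (fl (fun x => c *: X x)) (z, v) = fl (fun w => c *: tgt X w) (z, v).
Proof.
move=> fV oA cX [g [ig gA]]; have cY : CT 1 A (fun x => c *: X x) by apply: CT_scalec => //; exact: CTS.
have [_ cg _] := ig; have [y vy] := vcurve_ex fV oA cY v cg gA.
have [_ ->] := tgt_fl_curve fV oA cY ig gA vy.
have oA2 := openXT (W := V) oA; have ctX : CT 1 (A `*` setT) (tgt X) by case: cX.
have lX := CT1_locLip (findim_prod fV fV) oA2 (CT_scalec c oA2 ctX).
have icw : icurve (fun w => c *: tgt X w) (z, v) (fun t => (g t, y t)).
  have [h0 h1 h2] := icurve_tgt ig vy; split=> // t t01.
  have dX x : A x -> differentiable X x by move=> Ax; exact: (CT_diff cX Ax).
  have h := h2 t t01; rewrite (tgt_scale c (y t) dX (gA t (oo_cc t01))) in h; exact: h.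
by rewrite (flE lX icw) // => t tI; split=> //; exact: gA.
Qed.

Definition tcin V (X : V -> V) (K : set V) (c M' : R) (zv : (V * V)%type) (g y : R -> V) : Prop :=
  [/\ cin (fun x => c *: X x) K zv.1 g, vcurve (fun x => c *: X x) g zv.2 y &
      cin (fun w => c *: tgt X w) (K `*` @cball R V M') zv (fun t => (g t, y t))].

Lemma tgt_curves V (A K U : set V) (X : V -> V) (Y : T -> V -> V) M : findim V -> open A ->
  CT 1 A X -> compact K -> K `<=` A -> (forall i, CT 1 setT (Y i)) ->
  bdQ (bndB F) (K `*` @cball R V 1) (fun i => tgt (Y i)) ->
  (\forall i \near F, forall z, U z -> (exists g, cin (fun x => tm i *: X x) K z g) /\
      exists g, cin (fun x => tm i *: Y i x) K z g) ->
  exists M', \forall i \near F, forall zv, (U `*` @cball R V M) zv ->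
    (exists g y, tcin X K (tm i) M' zv g y) /\ exists g y, tcin (Y i) K (tm i) M' zv g y.
Proof.
move=> fV oA cX cK KA cY bY Hc.
have [B B0 HB] := op_bound_cpt fV oA cX cK KA.
have [C C0 HC] := bndB_pos bY.
pose D := B + C; have D0 : 0 < D by rewrite ltr_wpDr.
exists (M * expR (Tm * D + 2)); move: HC Hc; apply: filterS2 => i HC Hc [z v] [/= Uz vM].
have [[g cg] [g' cg']] := Hc z Uz.
have HX x : K x -> forall w, `|'D_w X x| <= D * `|w|.
  by move=> Kx w; apply: le_trans (HB x Kx w) _; apply: ler_wpM2r => //; rewrite lerDl.
have HY x : K x -> forall w, `|'D_w (Y i) x| <= D * `|w|.
  move=> Kx w; have [lD _] := diff_eps (CT_diff (cY i) (I : setT x)).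
  apply: op_bound_unit lD _ w => w w1; apply: le_trans (_ : _ <= C) _; last by rewrite lerDr ltW.
  apply: le_trans (_ : _ <= `|tgt (Y i) (x, w)|) _; first by rewrite prod_normE le_max lexx orbT.
  by apply: HC; exists (x, w).
split.
  have [y [vy iy yM]] := tgt_cin fV oA cX KA (tmT i) D0 HX vM cg.
  exists g, y; split=> //; split=> // t tI; split=> /=; [exact: cg.2|exact: yM].
have [y [vy iy yM]] := tgt_cin fV (@openT V) (cY i) (@subsetT _ K) (tmT i) D0 HY vM cg'.
exists g', y; split=> //; split=> // t tI; split=> /=; [exact: cg'.2|exact: yM].
Qed.

(** The induction bottoms out at class C^1, not C^0: the last tangent field is only continuous, so
    [conv0] does not apply to it and [conv1] takes its place. *)
Theorem conv_Ck k V (A K U : set V) (X : V -> V) (Y : T -> V -> V) : findim V -> open A ->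
  CT k.+1 A X -> compact K -> K `<=` A -> (forall i, sm setT (Y i)) ->
  rec (bdQ Bnd) k.+1 K (fun i z => X z - Y i z) -> rec (ECB F Bnd) k.+1 K Y ->
  (\forall i \near F, forall z, U z -> (exists g, cin (fun x => tm i *: X x) K z g) /\
      exists g, cin (fun x => tm i *: Y i x) K z g) ->
  rec (bdQ Bnd) k.+1 U (fun i z => fl (fun x => tm i *: X x) z - fl (fun x => tm i *: Y i x) z).
Proof.
elim: k V A K U X Y => [|k IH] V A K U X Y fV oA cX cK KA sY qXY qY Hc M;
  have oT := @openT V; have cX1 : CT 1 A X := CT_le (ltn0Sn _) cX;
  have cY1 i : CT 1 setT (Y i) := sY i 1%N;
  have cZ i : CT 1 A (fun x => tm i *: X x) := CT_scalec (tm i) oA cX1;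
  have cZ' i : CT 1 setT (fun x => tm i *: Y i x) := CT_scalec (tm i) oT (cY1 i).
- have [_ bY] := qY 1.
  have [M' HM'] := tgt_curves M fV oA cX1 cK KA cY1 bY Hc.
  have rXY : reg F 1 K (fun i z => X z - Y i z).
    apply: (reg_near oA KA); apply: nearW => i; apply: CT_sub2 => //; exact: CT_sub (cY1 i).
  have B0 := rec_le (FF:=FF) (bdQ_ext (FF:=FF) GA) (bdQ_post (FF:=FF) GA) (bdQ_pre (FF:=FF) GA) (leq0n 1) rXY qXY.
  have [EY _] := qY M'.
  have G := conv1 (FF:=FF) GA tmT U M fV oA cX1 cK KA cY1 B0 (qXY M') EY.
  apply: (gauge_sub GA G); apply: filterS HM' => i H x [[z v] Uzv ->].
  have [[g [y [[ig gK] vy cw]]] [g' [y' [[ig' g'K] vy' cw']]]] := H _ Uzv.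
  have gA (t : R) : 0 <= t <= 1 -> A (g t) by move=> /gK /KA.
  have [d E] := tgt_fl_curve fV oA (cZ i) ig gA vy.
  have [d' E'] := tgt_fl_curve fV oT (cZ' i) ig' (fun _ _ => I) vy'.
  exists `|(g 1, y 1) - (g' 1, y' 1)|; last by rewrite tgt_sub //= E E'.
  by exists (z, v), (fun t => (g t, y t)), (fun t => (g' t, y' t)), 1; split=> //; exact: I01.
- have [M' HM'] : exists M', \forall i \near F, forall zv, (U `*` @cball R V M) zv ->
    (exists g y, tcin X K (tm i) M' zv g y) /\ exists g y, tcin (Y i) K (tm i) M' zv g y.
    have rY : reg F k.+1 (K `*` @cball R V 1) (fun i => tgt (Y i)).
      apply: (reg_near (openXT oT) (A := [set: V] `*` [set: V])) => //.
      by apply: nearW => i; have [] := sY i k.+2.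
    have [_ bY] := rec_le (FF:=FF) (ECB_ext GA) (ECB_post GA) (ECB_pre GA) (leq0n k.+1) rY (qY 1).
    exact: (tgt_curves M fV oA cX1 cK KA cY1 bY Hc).
  have fVV := findim_prod fV fV; have oA2 := openXT (W := V) oA.
  have cK2 : compact (K `*` @cball R V M') by apply: compact_setX => //; exact: compact_cball.
  have KA2 : K `*` @cball R V M' `<=` A `*` setT by move=> [z v] [/= /KA].
  have [dX ctX] := cX.
  have sY2 i : sm setT (tgt (Y i)) := sm_tgt (sY i).
  have q1 : rec (bdQ Bnd) k.+1 (K `*` @cball R V M') (fun i z => tgt X z - tgt (Y i) z).
    have q0 : rec (bdQ Bnd) k.+1 (K `*` @cball R V M') (fun i => tgt (fun z => X z - Y i z)) := qXY M'.
    apply: (rec_ext (bdQ_ext GA) _ q0); apply: nearW => i; exists (A `*` setT); split=> //.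
    move=> [z v] [/= Az _]; apply: tgt_sub => //=; [exact: dX|exact: (CT_diff (cY1 i) (I : setT z))].
  have Hc2 : \forall i \near F, forall zv, (U `*` @cball R V M) zv ->
     (exists w, cin (fun x => tm i *: tgt X x) (K `*` @cball R V M') zv w) /\
     exists w, cin (fun x => tm i *: tgt (Y i) x) (K `*` @cball R V M') zv w.
    apply: filterS HM' => i H zv Uzv; have [[g [y [_ _ c1]]] [g' [y' [_ _ c2]]]] := H zv Uzv.
    by split; [exists (fun t => (g t, y t))|exists (fun t => (g' t, y' t))].
  have h := IH _ _ _ _ _ _ fVV oA2 ctX cK2 KA2 sY2 q1 (qY M') Hc2.
  apply: (rec_ext (bdQ_ext GA) _ h); apply: filterS Hc => i Hc.
  have lZ := CT1_locLip fV oA (cZ i); have lZ' := CT1_locLip fV oT (cZ' i).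
  have oD := openI (open_idom fV lZ) (open_idom fV lZ').
  exists ((idom A (fun x => tm i *: X x) `&` idom setT (fun x => tm i *: Y i x)) `*` setT); split.
  + exact: openXT.
  + move=> [z v] [/= Uz _]; split=> //; have [[g [ig gK]] [g' [ig' _]]] := Hc z Uz.
    by split; [exists g; split=> // t /gK /KA|exists g'].
  + move=> [z v] [/= [D D'] _].
    have c2 : CT 2 A X by apply: CT_le cX.
    rewrite tgt_sub; last 2 first.
    * exact: (CT_diff (fl_CT fV oA (cZ i)) D).
    * exact: (CT_diff (fl_CT fV oT (cZ' i)) D').
    by rewrite (tgt_fl_scale v fV oA c2 D) (tgt_fl_scale v fV oT (sY i 2%N) D').
Qed.
End ConvCk.

(** * The splitting method and the proof of the theorem *)

Section Generators.
Context {R : realType} {n : nat}.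
Implicit Types (H K : ham R n) (z v : jet R n).
Let fJ := @findim_jet R n.
Let oT : open [set: jet R n] := @openT _.

Lemma smooth_sm H : smooth H -> sm setT H.
Proof. by move=> sH k; apply: class_C_CT => //; exact: sH. Qed.

Lemma CT_mul k (A : set (jet R n)) H K : open A -> CT k A H -> CT k A K -> CT k A (fun z => H z * K z).
Proof. by move=> oA cH cK; exact: (CT_scale oA cH cK). Qed.

Lemma pdiff_sm H : pdiff H -> sm setT H.
Proof.
move=> [f [g [sf sg E]]] k.
have fB : findim (base R n) := findim_prod (@findim_rV R n) (@findim_R R).
have pre (a : base R n -> R) : smooth a -> CT k setT (fun z : jet R n => a z.1).
  move=> sa; apply: (CT_pre oT (islin_fst (base R n) 'rV[R]_n) (B := setT)) => //.
  by apply: class_C_CT => //; exact: openT.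
have h : CT k setT (fun z : jet R n => f z.1 + \sum_(i < n) g i z.1 * mom z i).
  apply: CT_add => //; first exact: pre.
  by apply: CT_sum => // i; apply: CT_mul => //; [exact: pre|exact/CT_lin/islin_mom].
by apply: CT_loc h.
Qed.

Lemma sm_jacobi H K : sm setT H -> sm setT K -> sm setT (jacobi H K).
Proof.
move=> sH sK k.
have D (G : ham R n) v : sm setT G -> CT k setT ('D_v G) by move=> sG; exact: CT_derive.
have m i : CT k setT (fun z : jet R n => mom z i) by exact/CT_lin/islin_mom.
have c (G : ham R n) : sm setT G -> CT k setT (fun z => G z - \sum_(i < n) mom z i * d_p i G z).
  move=> sG; apply: CT_sub2 => //; apply: CT_sum => // i; have h := CT_mul oT (m i) (D G (e_p i) sG); exact: h.
apply: CT_sub2 => //; last by apply: CT_mul => //; [exact: D|exact: c].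
apply: CT_add => //; last by apply: CT_mul => //; [exact: D|exact: c].
apply: CT_sum => // i; apply: CT_sub2 => //; apply: CT_mul => //; exact: D.
Qed.

Lemma contact_field_add H K z : differentiable H z -> differentiable K z ->
  contact_field (fun y => H y + K y) z = contact_field H z + contact_field K z.
Proof.
move=> dH dK.
have D v : 'D_v (fun y => H y + K y) z = 'D_v H z + 'D_v K z by exact: deriveDR.
have Dx i : d_x i (fun y => H y + K y) z = d_x i H z + d_x i K z := D _.
have Dp i : d_p i (fun y => H y + K y) z = d_p i H z + d_p i K z := D _.
have Du : d_u (fun y => H y + K y) z = d_u H z + d_u K z := D _.
rewrite /contact_field -[RHS]/(_ + _, _ + _, _ + _); congr (_, _, _).
- by apply/rowP => i; rewrite !mxE Dp.
- rewrite (_ : \sum_(i < n) _ = \sum_(i < n) mom z i * d_p i H z + \sum_(i < n) mom z i * d_p i K z).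
    by rewrite opprD addrACA.
  by rewrite -big_split; apply: eq_bigr => i _; rewrite Dp mulrDr.
- apply/rowP => i; rewrite !mxE Dx Du.
  by move: (d_x i H z) (d_x i K z) (d_u H z) (d_u K z) (mom z i) => a b c d e; ring.
Qed.

Lemma contact_field_addsum (Ix : Type) (s : seq Ix) (G : ham R n) (J : Ix -> ham R n) : sm setT G ->
  (forall i, sm setT (J i)) -> sm setT (fun z => G z + \sum_(i <- s) J i z) /\
  forall z, contact_field (fun z => G z + \sum_(i <- s) J i z) z =
    contact_field G z + \sum_(i <- s) contact_field (J i) z.
Proof.
move=> sG sJ; elim: s => [|i s [IH1 IH2]].
  have -> : (fun z => G z + \sum_(i <- [::]) J i z) = G by apply/funext => z; rewrite big_nil addr0.
  by split=> // z; rewrite big_nil addr0.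
have -> : (fun z => G z + \sum_(i <- i :: s) J i z) = (fun z => J i z + (G z + \sum_(i <- s) J i z)).
  by apply/funext => z; rewrite big_cons addrCA.
split=> [k|z]; first exact: (CT_add oT (sJ i k) (IH1 k)).
rewrite contact_field_add; first by rewrite IH2 big_cons addrCA.
  exact: (CT_diff (sJ i 1%N) (I : setT z)).
exact: (CT_diff (IH1 1%N) (I : setT z)).
Qed.

Lemma represents_field (S : splitting R n) H : represents S H ->
  [/\ sm setT H, (forall g, generators S g -> sm setT g) &
   forall z, contact_field H z = contact_field (sp_s0 S) z + contact_field (sp_d0 S) z +
     \sum_(i <- index_enum (spI S)) brk (contact_field (sp_s i)) (contact_field (sp_d i)) z].
Proof.
move=> [[c0 p0] cs pd E].
have s0 : sm setT (sp_s0 S) by apply: smooth_sm; case: c0.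
have d0 : sm setT (sp_d0 S) := pdiff_sm p0.
have si (i : spI S) : sm setT (sp_s i) by apply: smooth_sm; have [] := cs i.
have di (i : spI S) : sm setT (sp_d i) := pdiff_sm (pd i).
have sG : sm setT (fun z => sp_s0 S z + sp_d0 S z) by move=> k; exact: CT_add.
have [h1 h2] := contact_field_addsum (index_enum (spI S)) sG (fun i => sm_jacobi (si i) (di i)).
have EH : H = (fun z => sp_s0 S z + sp_d0 S z + \sum_(i <- index_enum (spI S)) jacobi (sp_s i) (sp_d i) z).
  by apply/funext => z; exact: E.
split.
- by rewrite EH.
- by move=> g [[[->|->]|[i _ <-]]|[i _ <-]].
- move=> z; rewrite EH h2 contact_field_add.
  + by congr (_ + _); apply: eq_bigr => i _; exact: contact_field_jacobi.
  + exact: (CT_diff (s0 1%N) (I : setT z)).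
  + exact: (CT_diff (d0 1%N) (I : setT z)).
Qed.

(** The words use e = sqrt h, so exponents 1 and 2 of e become the powers 1/2 and 1 of h: commutator
    factors run for times of order sqrt h. *)
Lemma word_factors (S : splitting R n) (w : seq (@wstep R (jet R n))) :
  (forall a, List.In a w -> (exists2 g, generators S g & a.1 = contact_field g) /\
     (a.2.2 = 1%N \/ a.2.2 = 2%N)) ->
  exists2 fs : seq (Pilot.Defs.factor R n), admissible_word S fs &
    forall h, 0 <= h -> word_map fs h = wmap w (Num.sqrt h).
Proof.
elim: w => [|a w IH] H; first by exists [::].
have [fs afs Efs] := IH (fun b hb => H b (or_intror hb)).
have [[g Gg Ea] en] := H a (or_introl erefl).
exists (Factor g a.2.1 (a.2.2%:R / 2) :: fs).
  move=> b [<-|]; last exact: afs.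
  by split=> //=; rewrite divr_gt0 // ltr0n; case: en => ->.
move=> h h0; apply/funext => z.
have -> : word_map (Factor g a.2.1 (a.2.2%:R / 2) :: fs) h z =
  word_map fs h (factor_flow h (Factor g a.2.1 (a.2.2%:R / 2)) z) by [].
rewrite Efs // /factor_flow /= -Ea; congr (wmap _ _ (flow _ (_ * _) _)).
case: en => ->; first by rewrite mul1r powR12_sqrt.
by rewrite divff // powRr1 // sqr_sqrtr.
Qed.
End Generators.

Section Confined.
Context {R : realType} {V : normedModType R}.

Lemma confined_sub (X : V -> V) (T : R) (U U' : set V) : 0 <= T -> flow_confined X T U U' -> U `<=` U'.
Proof. by move=> T0 H z /H[g [[<- _ _]]]; apply; rewrite lexx T0. Qed.

Lemma confined_cin (X : V -> V) (T t : R) (U U' : set V) z : 0 < T -> 0 <= t <= T -> flow_confined X T U U' ->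
  U z -> exists g, cin (fun x => t *: X x) U' z g.
Proof.
move=> T0 /andP[t0 tT] H /H[g [ig gU]].
have h := integral_icurve ig.
pose s := t / T.
have sI : 0 <= s <= 1 by rewrite divr_ge0 ?(ltW T0) //= ler_pdivrMr // mul1r.
have h2 := icurve_restrict h (_ : 0 <= 0 <= 1) sI.
have {}h2 := h2 _; rewrite lexx ler01 in h2; have {}h2 := h2 isT.
have Es : (s - 0) * T = t by rewrite subr0 /s mulfVK // gt_eqF.
rewrite Es in h2; have [g0 _ _] := h; rewrite g0 in h2.
exists (fun u => g (T * clamp (0 + (s - 0) * u))); split=> // u uI.
have /andP[c0 c1] := clampP (0 + (s - 0) * u).
by apply: gU; rewrite mulr_ge0 ?(ltW T0) //= ler_piMr // ltW.
Qed.
End Confined.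

Lemma near0_rightP (R : realType) (P : R -> Prop) : (\forall h \near (0 : R)^'+, P h) <->
  exists2 h0 : R, 0 < h0 & forall h, 0 < h < h0 -> P h.
Proof.
split=> [[d /= d0 H]|[d d0 H]].
  by exists d => // h /andP[h0 hd]; apply: H => //=; rewrite sub0r normrN gtr0_norm.
exists d => //= h; rewrite /= sub0r normrN => hd h0; apply: H.
by rewrite h0 -(gtr0_norm h0).
Qed.

Section LocalReparam.
Context {R : realType}.

Lemma LO_sqrt q k (V W : normedModType R) (A : set V) (f : R -> V -> W) :
  LO (2 * q) k A f -> LO q k A (fun h => f (Num.sqrt h)).
Proof.
elim: k V W A f => [|k IH] V W A f; last exact: (IH _ _ _ (fun h => tgt (f h))).
move=> H z0 Az0; have [d [C [d0 HC]]] := H z0 Az0.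
exists (Num.min d (d ^+ 2)), C; split; first by rewrite lt_min d0 exprn_gt0.
move=> z h bz /andP[h0]; rewrite lt_min => /andP[hd hd2].
have sh : Num.sqrt h < d by rewrite -[d]gtr0_norm // -sqrtr_sqr ltr_sqrt // exprn_gt0.
have bz' : ball z0 d z by apply: le_ball bz; rewrite ge_min lexx.
have := HC z (Num.sqrt h) bz'; rewrite sqrtr_gt0 h0 sh exprM sqr_sqrtr ?(ltW h0) //; exact.
Qed.
End LocalReparam.

Section PartOne.
Context {R : realType} {n : nat}.
Variables (T : R) (U U' : set (jet R n)) (r p N : nat) (HN : ham R n) (S : splitting R n).
Hypotheses (T_gt0 : 0 < T) (cptU : compact U) (cptU' : compact U') (p_gt0 : (0 < p)%N).
Hypothesis adm : admissible_approx U U' T N HN S.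
Let fJ := @findim_jet R n.
Let X := contact_field HN.

Let sX : sm setT X.
Proof. by have [_ _ rep _] := adm; have [sH _ _] := represents_field rep; exact: sm_contact_field. Qed.

Let UU' : U `<=` U'.
Proof. by have [_ conf _ _] := adm; exact: confined_sub (ltW T_gt0) conf. Qed.

(** The defect e^(2 (p + 1)) is h^(p + 1) in terms of the step; one power of h is lost when about T
    / h local errors accumulate. *)
Lemma method_word : exists w : seq (@wstep R (jet R n)), [/\ wgood w, Div (2 * p.+1) (werr X w),
  (forall a, List.In a w -> exists2 G, sm setT G & a.1 = contact_field G) &
  exists2 fs, admissible_word S fs & forall h, 0 <= h -> word_map fs h = wmap w (Num.sqrt h)].
Proof.
have [_ _ rep _] := adm; have [sH sG E] := represents_field rep.
have sg g : generators S g -> sm setT (contact_field g) by move=> /sG; exact: sm_contact_field.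
have g0 : generators S (sp_s0 S) by left; left; left.
have g1 : generators S (sp_d0 S) by left; left; right.
have g2 (i : spI S) : generators S (sp_s i) by left; right; exists i.
have g3 (i : spI S) : generators S (sp_d i) by right; exists i.
have k3 : (3 <= 2 * p.+1)%N by rewrite (leq_trans (_ : 3 <= 2 * 2)%N) // leq_mul2l.
have [w [gw Dw lw]] := order_word fJ (sg _ g0) (sg _ g1) (fun i : spI S => sg _ (g2 i)) (fun i : spI S => sg _ (g3 i)) sX E k3.
have lw' a : List.In a w -> (exists2 g, generators S g & a.1 = contact_field g) /\ (a.2.2 = 1%N \/ a.2.2 = 2%N).
  move=> /lw[ha en]; split=> //; case: ha => [[->|->]|[i [->|->]]].
  - by exists (sp_s0 S).
  - by exists (sp_d0 S).
  - by exists (sp_s i).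
  - by exists (sp_d i).
exists w; split=> //; last exact: word_factors.
by move=> a /lw'[[g Gg ->] _]; exists g => //; exact: sG.
Qed.

Lemma part_one : exists Psi C, splitting_method U U' T r p HN S Psi C.
Proof.
have [w [gw Dw lw [fs afs Efs]]] := method_word.
have [A [d [oA UA d0 HA]]] := word_uniform gw cptU'.
pose Psi := word_map fs.
have d20 : 0 < d ^+ 2 by rewrite exprn_gt0.
have wd h z : 0 < h < d ^+ 2 -> A z -> wdom w (Num.sqrt h, z).
  move=> /andP[h0 hd] Az; apply: HA => //.
  by rewrite ger0_norm ?sqrtr_ge0 // -[d]gtr0_norm // -sqrtr_sqr ltr_sqrt.
have one : contact_one_step U' Psi.
  exists A => //; exists (d ^+ 2) => // h hI; have h0 : 0 <= h by apply: ltW; case/andP: hI.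
  rewrite /Psi Efs //; apply: word_contactomorphism => // z; exact: wd.
have cPsi k : \forall h \near (0 : R)^'+, CT k A (Psi h).
  apply/near0_rightP; exists (d ^+ 2) => // h hI; have h0 : 0 <= h by apply: ltW; case/andP: hI.
  rewrite /Psi Efs //; apply: CT_sub ((word_slice (Num.sqrt h) gw).2 k) => z; exact: wd.
have lo k : LO p.+1 k A (fun h z => Psi h z - flow X h z).
  have h1 : LO (2 * p.+1) k A (fun e z => werr X w (e, z)).
    apply: LO_div => z0 _; have [e [Q [e0 sQ EQ]]] := Dw z0.
    by exists e, Q; split=> // e' z h; exact: EQ.
  have h2 := LO_sqrt h1.
  apply: (@LO_ext R p.+1 k _ _ A (fun h z => werr X w (Num.sqrt h, z))) h2.
  move=> z0 _; exists 1; first exact: ltr01.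
  move=> z h _ /andP[h0 _].
  by rewrite /werr /= /Psi Efs ?sqr_sqrtr // ltW.
have cur z : U z -> exists g, icurve (fun x => T *: X x) z g /\ forall t : R, 0 <= t <= 1 -> U' (g t).
  have [_ conf _ _] := adm; have TT : 0 <= T <= T by rewrite lexx (ltW T_gt0).
  exact: confined_cin T_gt0 TT conf.
have rc := global_Ck T_gt0 p_gt0 fJ sX oA cptU' UA cur (cPsi r) (lo r).
have [C0 HC0] := global_C0 T_gt0 p_gt0 fJ sX oA cptU' UA cur (lo 0%N).
pose FF : Filter (steps T) := steps_filter T.
have rg : reg (steps T) r U (fun i z => flow X (i.2%:R * i.1) z - iter i.2 (Psi i.1) z).
  apply: near_steps; have cP := cPsi r; near=> h => m mT.
  have cPh : CT r A (Psi h) by near: h.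
  have Hh : forall m : nat, m%:R * h <= T -> forall z, U z ->
    [/\ A (iter m (Psi h) z), fdom X (m%:R * h, z) &
        `|flow X (m%:R * h) z - iter m (Psi h) z| <= C0 * h ^+ p] by near: h.
  have [oI cI] := CT_iter m oA cPh.
  have oF := open_fslice fJ sX (m%:R * h).
  have h0 : 0 < h by [].
  exists ([set z | fdom X (m%:R * h, z)] `&` itdom A (Psi h) m); split.
  - exact: openI.
  - move=> z Uz; split; first by have [] := Hh m mT z Uz.
    move=> j jm; have jT : j%:R * h <= T by apply: le_trans mT; rewrite ler_pM2r // ler_nat ltnW.
    by have [] := Hh j jT z Uz.
  - apply: CT_sub2; first exact: openI.
      apply: CT_sub (@subIsetl _ _ _) _; apply: (flow_slice fJ sX r oF) => z; exact.
    exact: CT_sub (@subIsetr _ _ _) cI.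
have [C HC] := bd_C_norm (@powB_gauge R T p) rg rc.
(* The extracted constant may fail to be positive, as the conclusion requires. *)
pose D := Num.max C 1.
exists Psi, D; split=> //; first by exists fs.
  by rewrite lt_max ltr01 orbT.
have h1 : \forall h \near (0 : R)^'+, forall m : nat, m%:R * h <= T ->
    exists O, [/\ open O, U `<=` O & CT r O (flow_error HN Psi m h)] := rg.
have h2 : \forall h \near (0 : R)^'+, forall m : nat, m%:R * h <= T ->
    forall x, x = C_norm r U (flow_error HN Psi m h) -> x <= C * h ^+ p := HC.
have both : \forall h \near (0 : R)^'+, forall m : nat, m%:R * h <= T ->
    class_C_near r U (flow_error HN Psi m h) /\ C_norm r U (flow_error HN Psi m h) <= D * h ^+ p.
  have h3 : \forall h \near (0 : R)^'+, 0 < h by exact: nbhs_right_gt.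
  move: h1 h2 h3; apply: filterS3 => h H1 H2 h0 m mT; split.
    have [D1 [q1 q2 q3]] := H1 m mT; exact: CT_class_C_near q1 q2 q3.
  apply: le_trans (H2 m mT _ erefl) _; rewrite ler_wpM2r //; first by rewrite exprn_ge0 // ltW.
  by rewrite le_max lexx.
by case/near0_rightP: both => h0 h00 H; exists h0.
Unshelve. all: by end_near. Qed.
End PartOne.

(** * Lipschitz fields and families that tend to zero *)

Section Lipschitz.
Context {R : realType}.
Implicit Types V W : normedModType R.

Lemma klipschitzP V W (L : R) (U : set V) (f : V -> W) : L.-lipschitz_U f ->
  forall x y, U x -> U y -> `|f x - f y| <= L * `|x - y|.
Proof. by move=> H x y Ux Uy; exact: (H (x, y)). Qed.

Lemma lipschitz_ex V W (U : set V) (f : V -> W) : [lipschitz f z | z in U] ->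
  exists2 L : R, 0 <= L & forall x y, U x -> U y -> `|f x - f y| <= L * `|x - y|.
Proof.
move=> [M [_ HM]]; exists (`|M| + 1) => [|x y Ux Uy]; first by rewrite addr_ge0.
have h : M < `|M| + 1 by rewrite (le_lt_trans (ler_norm M)) // ltrDl.
exact: (HM _ h (x, y)).
Qed.

Lemma lip_locLip V W (A : set V) (f : V -> W) (L : R) : open A ->
  (forall x y, A x -> A y -> `|f x - f y| <= L * `|x - y|) -> locLip A f.
Proof.
move=> oA H z Az; have /nbhs_ballP[d /= d0 Hd] := open_nbhs_nbhs (conj oA Az).
by exists d; split=> //; exists L => x y bx bY; split; [exact: Hd|apply: H; exact: Hd].
Qed.

Lemma locLip_scale V W (A : set V) (f : V -> W) (c : R) : locLip A f -> locLip A (fun x => c *: f x).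
Proof.
move=> H z Az; have [d [L [d0 L0 HL]]] := locLip_pos H Az.
exists d; split=> //; exists (`|c| * L) => x y bx bY; have [Ax h] := HL x y bx bY; split=> //.
by rewrite -scalerBr normrZ -mulrA; exact: ler_wpM2l.
Qed.
End Lipschitz.

Section LittleO.
Context {R : realType} {T : Type} (F : set_system T) {FF : Filter F}.
Implicit Types V W : normedModType R.

Definition oB (S : T -> R -> Prop) : Prop := forall e : R, 0 < e -> \forall i \near F, forall x, S i x -> x <= e.

Lemma oB_gauge : gauge_axiom F oB.
Proof.
move=> S S' S2 c B B' H e e0; pose d := e / (2 * (`|c| + 1)).
have c1 : 0 < `|c| + 1 by rewrite ltr_wpDl.
have d0 : 0 < d by rewrite divr_gt0 // mulr_gt0.
move: (B d d0) (B' d d0) H; apply: filterS3 => i h h' H x Tx.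
apply: le_trans (H d d (ltW d0) (ltW d0) h h' x Tx) _.
apply: (@le_trans _ _ ((`|c| + 1) * (d + d))).
  apply: ler_wpM2r; first by rewrite addr_ge0 // ltW.
  by apply: le_trans (ler_norm c) _; rewrite lerDl.
rewrite (_ : (`|c| + 1) * (d + d) = e) // /d; field.
by rewrite gt_eqF.
Qed.

Lemma rec_mono (Q Q' : forall V W : normedModType R, set V -> (T -> V -> W) -> Prop) k V W
    (U : set V) (f : T -> V -> W) :
  (forall V W (U : set V) (f : T -> V -> W), Q V W U f -> Q' V W U f) -> rec Q k U f -> rec Q' k U f.
Proof.
by move=> QQ; elim: k V W U f => [|k IH] V W U f; [exact: QQ|move=> H M; exact/IH/H].
Qed.

(** A family that tends uniformly to zero has differences of values that tend to zero, whatever the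
    distance between the points. *)
Lemma bdQ_oB_ECB V W (U : set V) (f : T -> V -> W) : bdQ oB U f -> ECB F oB U f.
Proof.
move=> B; split.
  move=> S _; apply: (oB_gauge (c := 2) B B); apply: nearW => i a b a0 b0 Ha Hb d [x [y [Ux Uy _ ->]]].
  apply: le_trans (ler_normB _ _) _.
  have h1 : `|f i x| <= a by apply: Ha; exists x.
  have h2 : `|f i y| <= a by apply: Ha; exists y.
  lra.
by exists 1; exact: B.
Qed.

(** A fixed continuous map is uniformly continuous on a compact set, so vanishing displacements give
    vanishing increments. *)
Lemma CT_rec_ECB k V W (A U : set V) (f : V -> W) : findim V -> open A -> U `<=` A -> compact U ->
  CT k A f -> rec (ECB F oB) k U (fun=> f).
Proof.
elim: k V W A U f => [|k IH] V W A U f fV oA UA cU cf.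
  split; last by have [C C0 HC] := cpt_bound cf cU UA; exists C; apply: nearW => i x [z Uz ->]; exact: HC.
  move=> S BS e e0.
  have [d d0 Hd] : exists2 d : R, 0 < d & forall e' x, 0 < e' <= d -> U x ->
      forall y, ball x e' y -> `|f x - f y| <= e.
    apply: (@cpt_unif R V U (fun e' x => forall y, ball x e' y -> `|f x - f y| <= e)) => // z Uz.
    have /cvgrPdist_lt/(_ (e / 2)) := cf z (UA z Uz); rewrite divr_gt0 // => /(_ isT).
    rewrite -nbhs_ballE => -[d /= d0 Hd]; exists (d / 2); first by rewrite divr_gt0.
    move=> e' x /andP[e'0 e'd] zx y xy.
    have h1 : `|f z - f x| < e / 2 by apply: Hd; apply: le_ball zx; lra.
    have h2 : `|f z - f y| < e / 2.
      by apply: Hd; rewrite (splitr d); apply: ball_triangle zx _; exact: le_ball xy.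
    have -> : f x - f y = (f z - f y) - (f z - f x) by rewrite opprB [RHS]addrC addrA subrK.
    by apply: le_trans (ler_normB _ _) _; lra.
  have d20 : 0 < d / 2 by rewrite divr_gt0.
  apply: filterS (BS _ d20) => i H x [y [z [Uy Uz Syz ->]]].
  apply: (Hd d) => //; first by rewrite d0 lexx.
  by rewrite -ball_normE /ball_ /=; have := H _ Syz; lra.
move=> M; have [_ ct] := cf.
apply: (IH _ _ (A `*` setT)) => //; [exact: findim_prod|exact: openXT|by move=> [z v] [/= /UA]|].
by apply: compact_setX => //; exact: compact_cball.
Qed.
End LittleO.

Section Compare.
Context {R : realType} {n : nat} {T : Type} (F : set_system T) {FF : Filter F}.
Variable Bnd : (T -> R -> Prop) -> Prop.
Hypothesis GA : gauge_axiom F Bnd.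
Variables (tm : T -> R) (Tm : R) (HN : T -> ham R n) (H : ham R n) (U A : set (jet R n)) (r : nat) (L : R).
Let X := contact_field H.
Let Y i := contact_field (HN i).
Hypotheses (tmT : forall i, `|tm i| <= Tm) (sHN : forall i, sm setT (HN i)) (cptU : compact U)
  (oA : open A) (UA : U `<=` A) (cH : CT r.+1 A H) (lX : locLip A X) (L0 : 0 <= L)
  (HL : forall x y, U x -> U y -> `|X x - X y| <= L * `|x - y|)
  (Hc : forall i z, U z -> (exists g, cin (fun x => tm i *: X x) U z g) /\
      exists g, cin (fun x => tm i *: Y i x) U z g)
  (BN : Bnd (fun i x => x = C_norm r.+1 U (fun z => H z - HN i z))).
Let fJ := @findim_jet R n.
Let cN i : CT r.+1 A (HN i).
Proof. exact: CT_sub (@subsetT _ A) (sHN i r.+1). Qed.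
Let cD i : CT r.+1 A (fun z => H z - HN i z).
Proof. by apply: CT_sub2. Qed.

Lemma field_difference : rec (bdQ Bnd) r U (fun i z => X z - Y i z).
Proof.
have ccn : \forall i \near F, class_C_near r.+1 U (fun z => H z - HN i z).
  by apply: nearW => i; exact: CT_class_C_near oA UA (cD i).
have q := C_norm_bd (FF:=FF) GA fJ cptU ccn BN.
have rg : reg F r.+1 U (fun i z => H z - HN i z) by apply: (reg_near oA UA); exact: nearW.
have h := rec_contact_field (FF:=FF) (bdQ_ext (FF:=FF) GA) (bdQ_add (FF:=FF) GA) (bdQ_post (FF:=FF) GA)
  (bdQ_pre (FF:=FF) GA) (bdQ_scale (FF:=FF) GA) cptU rg q.
apply: (rec_ext (bdQ_ext GA) _ h); apply: nearW => i; exists A; split=> // z Az.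
have E : H = (fun y => (H y - HN i y) + HN i y) by apply/funext => y; rewrite subrK.
have := contact_field_add (CT_diff (cD i) Az) (CT_diff (cN i) Az); rewrite -E.
by rewrite /X /Y => ->; rewrite addrK.
Qed.

(** For r = 0 the Lipschitz bound of the reference field suffices; for r > 0 the top derivative has
    no such bound and the equicontinuity of the approximating fields replaces it. *)
Lemma flow_difference : (r = 0%N \/ rec (ECB F Bnd) r U Y) ->
  rec (bdQ Bnd) r U (fun i z => flow X (tm i) z - flow (Y i) (tm i) z).
Proof.
move=> EY.
have E : (fun (i : T) z => flow X (tm i) z - flow (Y i) (tm i) z) =
    (fun i z => fl (fun x => tm i *: X x) z - fl (fun x => tm i *: Y i x) z).
  by apply/funext => i; apply/funext => z; rewrite !flow_fl.
rewrite E; have q := field_difference.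
have sY i : sm setT (Y i) := sm_contact_field (sHN i).
have cX : CT r A X := CT_contact_field oA cH.
move: EY q cX; case: r => [|k] EY q cX; last first.
  case: EY => [E0|EY]; first discriminate E0.
  have hc : \forall i \near F, forall z, U z -> (exists g, cin (fun x => tm i *: X x) U z g) /\
      exists g, cin (fun x => tm i *: Y i x) U z g by apply: nearW => i z; exact: Hc.
  exact: (conv_Ck (FF:=FF) GA tmT fJ oA cX cptU UA sY q EY hc).
have G := conv0 (FF:=FF) GA tmT U L0 HL q.
apply: (gauge_sub GA G); apply: nearW => i x [z Uz ->].
have [[g cg] [g' cg']] := Hc i Uz.
have -> : fl (fun x => tm i *: X x) z = g 1.
  by apply: (flE (locLip_scale (tm i) lX) cg.1) => t /cg.2 /UA.
have -> : fl (fun x => tm i *: Y i x) z = g' 1.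
  exact: (flE (locLip_scale (tm i) (CT1_locLip fJ (@openT _) (sY i 1%N))) cg'.1).
by exists `|g 1 - g' 1|; [exists z, g, g', 1; split=> //; exact: I01|].
Qed.

Lemma flow_class i : class_C_near r U (flow X (tm i)) /\ class_C_near r U (flow (Y i) (tm i)).
Proof.
have EX (Z : jet R n -> jet R n) : flow Z (tm i) = fl (fun x => tm i *: Z x).
  by apply/funext => z; rewrite flow_fl.
have cX : CT r A X := CT_contact_field oA cH.
have sY : sm setT (Y i) := sm_contact_field (sHN i).
have oT := @openT (jet R n).
split; rewrite EX.
  have lZ := locLip_scale (tm i) lX.
  apply: (CT_class_C_near (A := idom A (fun x => tm i *: X x))).
  - exact: open_idom.
  - by move=> z Uz; have [[g [ig gU]] _] := Hc i Uz; exists g; split=> // t /gU /UA.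
  - move: cX; case: r => [|k] cX; first exact: fl_continuous.
    exact: (fl_CT fJ oA (CT_scalec (tm i) oA cX)).
have cZ k : CT k setT (fun x => tm i *: Y i x) := CT_scalec (tm i) oT (sY k).
apply: (CT_class_C_near (A := idom setT (fun x => tm i *: Y i x))).
- exact: open_idom fJ (CT1_locLip fJ oT (cZ 1%N)).
- by move=> z Uz; have [_ [g [ig gU]]] := Hc i Uz; exists g.
- exact: CT_le (leqnSn r) (fl_CT fJ oT (cZ r.+1)).
Qed.

Lemma flow_C_norm : (r = 0%N \/ rec (ECB F Bnd) r U Y) ->
  Bnd (fun i x => x = C_norm r U (fun z => flow X (tm i) z - flow (Y i) (tm i) z)).
Proof.
move=> EY; apply: (bd_C_norm GA _ (flow_difference EY)).
apply: nearW => i; have [c1 c2] := flow_class i.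
have [A1 [q1 U1 k1]] := class_C_near_CT fJ c1; have [A2 [q2 U2 k2]] := class_C_near_CT fJ c2.
exists (A1 `&` A2); split; first exact: openI.
  by move=> z Uz; split; [exact: U1|exact: U2].
apply: CT_sub2; first exact: openI.
  exact: CT_sub (@subIsetl _ A1 A2) k1.
exact: CT_sub (@subIsetr _ A1 A2) k2.
Qed.
End Compare.

(** * Comparison with the reference flow, uniformly and in the limit *)

Section Assembly.
Context {R : realType} {n : nat}.
Variables (r : nat) (T : R) (U U' : set (jet R n)) (H : ham R n).
Hypotheses (T_gt0 : 0 < T) (cptU : compact U) (subU' : U' `<=` U) (H_reg : class_C_near r.+1 U H)
  (H_lip : r = 0%N -> exists A, [/\ open A, U `<=` A & [lipschitz (contact_field H) z | z in A]])
  (H_conf : flow_confined (contact_field H) T U U').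
Let fJ := @findim_jet R n.
Let X := contact_field H.

(** For r = 0 the Hamiltonian is only C^1 and its field only continuous, so the Lipschitz constant
    must come from [H_lip]; for r > 0 the field is C^1 and compactness of [U] provides one. *)
Lemma reference_field : exists A L, [/\ open A, U `<=` A, CT r.+1 A H, locLip A X &
  0 <= L /\ forall x y, U x -> U y -> `|X x - X y| <= L * `|x - y|].
Proof.
have [A [oA UA cA]] := class_C_near_CT fJ H_reg.
move: H_lip cA; case: r => [|k] lip cA.
  have [B [oB UB lB]] := lip erefl; have [L L0 HL] := lipschitz_ex lB.
  have lL : locLip (A `&` B) X.
    apply: (@lip_locLip _ _ _ _ _ L) => [|x y [_ Bx] [_ By]]; [exact: openI|exact: HL].
  exists (A `&` B), L; split=> //; first exact: openI.
  - by move=> z Uz; split; [exact: UA|exact: UB].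
  - exact: CT_sub (@subIsetl _ A B) cA.
  - by split=> // x y Ux Uy; apply: HL; exact: UB.
have c1 : CT 1 A X by apply: CT_le (CT_contact_field oA cA).
have lX := CT1_locLip fJ oA c1.
have [L L0 HL] := locLip_on_cpt lX cptU UA.
by exists A, L; split=> //; split=> //; exact: ltW.
Qed.

Lemma confined_both HN N (S : splitting R n) t z : admissible_approx U U' T N HN S -> 0 <= t <= T -> U z ->
  (exists g, cin (fun x => t *: X x) U z g) /\ exists g, cin (fun x => t *: contact_field HN x) U z g.
Proof.
move=> [_ conf _ _] tI Uz; split.
  have [g [ig gU]] := confined_cin T_gt0 tI H_conf Uz.
  by exists g; split=> // s /gU /subU'.
have [g [ig gU]] := confined_cin T_gt0 tI conf Uz.
by exists g; split=> // s /gU /subU'.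
Qed.

Lemma admissible_sm HN N (S : splitting R n) : admissible_approx U U' T N HN S -> sm setT HN.
Proof. by move=> [_ _ rep _]; have [] := represents_field rep. Qed.

Section UniformBound.
Variable Lb : R.
Let P (x : (ham R n * R)%type) : Prop :=
  [/\ exists N (S : splitting R n), admissible_approx U U' T N x.1 S,
      field_bounds r U Lb (contact_field x.1) & 0 <= x.2 <= T].
Let I := {x : (ham R n * R)%type | P x}.
(** All admissible pairs of an approximant and a time form one index type, and only its full set
    belongs to the filter. The family estimates then hold for every index with a single constant,
    which is the required uniformity. *)
Let F : set_system I := [set S | forall i, S i].
Let FF : Filter F.
Proof. by split=> [i //|A B hA hB i|A B AB hA i]; [split; [exact: hA|exact: hB]|exact/AB/hA]. Qed.
Let HNi (i : I) := (sval i).1.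
Let tmi (i : I) := (sval i).2.
Let eps (i : I) := C_norm r.+1 U (fun z => H z - HNi i z).
Let Bnd (S : I -> R -> Prop) := exists C : R, forall i x, S i x -> x <= C * eps i.

Let GA : gauge_axiom F Bnd.
Proof.
move=> S S' S2 c [C HC] [C' HC'] H2; exists (c * (`|C| + `|C'|)) => i x Sx.
have e0 : 0 <= eps i := C_norm_ge0 _ _ _.
have le (D : R) y : y <= D * eps i -> y <= `|D| * eps i.
  by move=> h; apply: le_trans h _; apply: ler_wpM2r => //; exact: ler_norm.
rewrite -mulrA mulrDl; apply: (H2 i) Sx; rewrite ?mulr_ge0 // => y Sy; apply: le; [exact: HC|exact: HC'].
Qed.

Lemma uniform_bound : exists2 C : R, 0 < C & forall HN, (exists N (S : splitting R n), admissible_approx U U' T N HN S) ->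
  field_bounds r U Lb (contact_field HN) -> forall t, 0 <= t <= T ->
  [/\ class_C_near r U (flow X t), class_C_near r U (flow (contact_field HN) t) &
    C_norm r U (fun z => flow X t z - flow (contact_field HN) t z) <= C * C_norm r.+1 U (fun z => H z - HN z)].
Proof.
have [A [L [oA UA cH lX [L0 HL]]]] := reference_field.
have tmT i : `|tmi i| <= T.
  by have [_ _ /andP[h0 h1]] := svalP i; rewrite ger0_norm.
have sHN i : sm setT (HNi i).
  by have [[N [S ad]] _ _] := svalP i; exact: admissible_sm ad.
have Hc i z : U z -> (exists g, cin (fun x => tmi i *: X x) U z g) /\
    exists g, cin (fun x => tmi i *: contact_field (HNi i) x) U z g.
  by move=> Uz; have [[N [S ad]] _ tI] := svalP i; exact: confined_both ad tI Uz.
have BN : Bnd (fun i x => x = C_norm r.+1 U (fun z => H z - HNi i z)).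
  by exists 1 => i x ->; rewrite mul1r.
have fb i : field_bounds r U Lb (contact_field (HNi i)).
  by have [_ fb _] := svalP i.
have sY i : sm setT (contact_field (HNi i)) := sm_contact_field (sHN i).
have oT := @openT (jet R n).
have EY : rec (ECB F Bnd) r U (fun i => contact_field (HNi i)).
  have rg : reg F r U (fun i => contact_field (HNi i)).
    have hn : \forall i \near F, CT r setT (contact_field (HNi i)) by move=> i; exact: sY.
    exact: (reg_near (FF:=FF) oT (@subsetT _ U) hn).
  have hI := rec_of_iterD (FF:=FF) (ECB_ext (FF:=FF) GA) (ECB_add (FF:=FF) GA) (ECB_post (FF:=FF) GA)
    (ECB_pre (FF:=FF) GA) (ECB_scale (FF:=FF) GA) fJ cptU rg.
  apply: hI.
  move=> vs svs uvs; split.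
    (* The uniform Lipschitz bounds in [field_bounds] turn displacements of order eps into
       increments of order eps. *)
    move=> S [C HC]; exists (`|Lb| * `|C|) => i d [x [y [Ux Uy Sxy ->]]].
    have [_ lip] := fb i.
    have ut j : `|tnth (in_tuple vs) j| <= 1 by apply: uvs; rewrite (tnth_nth 0) mem_nth //= ltn_ord.
    apply: le_trans (klipschitzP (lip _ (in_tuple vs) svs ut) Ux Uy) _.
    have h := HC i _ Sxy; rewrite -mulrA.
    apply: (@le_trans _ _ (`|Lb| * `|x - y|)); first by apply: ler_wpM2r => //; exact: ler_norm.
    apply: ler_wpM2l => //; apply: le_trans h _; apply: ler_wpM2r; last exact: ler_norm.
    exact: C_norm_ge0.
  exists Lb => i x [z Uz ->]; have [cn _] := fb i; apply: le_trans cn.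
  by apply: iterD_C_norm => //; exact: CT_class_C_near oT (@subsetT _ U) (sY i r).
have [C HC] := flow_C_norm (FF:=FF) GA tmT sHN cptU oA UA cH lX L0 HL Hc BN (or_intror EY).
exists (`|C| + 1); first by rewrite ltr_wpDl.
move=> HN ad fbN t tI.
have Px : P (HN, t) by split.
have [c1 c2] := flow_class sHN oA UA cH lX Hc (exist _ (HN, t) Px).
split=> //; apply: le_trans (HC (exist _ (HN, t) Px) _ erefl) _.
apply: ler_wpM2r; first exact: C_norm_ge0.
by apply: le_trans (ler_norm C) _; rewrite lerDl.
Qed.
End UniformBound.

Section Limit.
Variables (HN : nat -> ham R n) (S : nat -> splitting R n).
Hypothesis ad : forall N, admissible_approx U U' T N (HN N) (S N).
Hypothesis cvg_HN : (fun N => C_norm r.+1 U (fun z => H z - HN N z)) @ \oo --> (0 : R).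
Let I : Type := (nat * {t : R | 0 <= t <= T})%type.
(** Large N, uniformly in the time: the little-o estimate then covers all times of [0, T] with the
    same N. *)
Let F : set_system I := [set Q | \forall N \near \oo, forall t, Q (N, t)].
Let FF : Filter F.
Proof.
rewrite /F; split=> [|A B|A B AB] /=; first by apply: nearW.
  by apply: filterS2 => N hA hB t; split; [exact: hA|exact: hB].
by apply: filterS => N hA t; exact/AB/hA.
Qed.
Let HNi (i : I) := HN i.1.
Let tmi (i : I) := sval i.2.

Lemma limit_bound (e : R) : 0 < e -> \forall N \near \oo, forall t, 0 <= t <= T ->
  [/\ class_C_near r U (flow X t), class_C_near r U (flow (contact_field (HN N)) t) &
    C_norm r U (fun z => flow X t z - flow (contact_field (HN N)) t z) <= e].
Proof.
move=> e0; have [A [L [oA UA cH lX [L0 HL]]]] := reference_field.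
have GA := @oB_gauge R I F FF.
have tmT i : `|tmi i| <= T.
  by have /andP[h0 h1] := svalP i.2; rewrite ger0_norm.
have sHN i : sm setT (HNi i) := admissible_sm (ad i.1).
have Hc i z : U z -> (exists g, cin (fun x => tmi i *: X x) U z g) /\
    exists g, cin (fun x => tmi i *: contact_field (HNi i) x) U z g.
  by move=> Uz; exact: confined_both (ad i.1) (svalP i.2) Uz.
have BN : oB F (fun i x => x = C_norm r.+1 U (fun z => H z - HNi i z)).
  move=> d d0; have /cvgrPdist_lt/(_ d d0) := cvg_HN.
  apply: filterS => N h t x ->; rewrite sub0r normrN in h; apply: le_trans (ltW h).
  exact: ler_norm.
have sY i : sm setT (contact_field (HNi i)) := sm_contact_field (sHN i).
have oT := @openT (jet R n).
have cX : CT r A X := CT_contact_field oA cH.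
have EY : rec (ECB F (oB F)) r U (fun i => contact_field (HNi i)).
  have q := field_difference (FF:=FF) GA sHN cptU oA UA cH BN.
  have q2 := rec_mono (@bdQ_oB_ECB R I F FF) q.
  have rX : reg F r U (fun=> X).
    have hn : F [set i | CT r A X] by rewrite /F /=; apply: nearW => N t.
    exact: (reg_near (FF:=FF) oA UA hn).
  have rD : reg F r U (fun i z => X z - contact_field (HNi i) z).
    have hn : F [set i | CT r A (fun z => X z - contact_field (HNi i) z)].
      rewrite /F /=; apply: nearW => N t; exact: (CT_sub2 oA cX (CT_sub (@subsetT _ A) (sY (N, t) r))).
    exact: (reg_near (FF:=FF) oA UA hn).
  have lN : islin (fun x : jet R n => -1 *: x) := islin_scale (-1) (@islin_id R (jet R n)).
  have qX := CT_rec_ECB (FF:=FF) fJ oA UA cptU cX.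
  have qN := rec_post (FF:=FF) (ECB_ext (FF:=FF) GA) (ECB_post (FF:=FF) GA) lN rD q2.
  have h := rec_add (FF:=FF) (ECB_ext (FF:=FF) GA) (ECB_add (FF:=FF) GA) rX (reg_post (FF:=FF) lN rD) qX qN.
  (* Without uniform bounds, equicontinuity comes from convergence: each approximating field is the
     fixed field minus a difference that tends to zero. *)
  rewrite (_ : (fun i => contact_field (HNi i)) = (fun i z => X z + -1 *: (X z - contact_field (HNi i) z))) //.
  by apply/funext => i; apply/funext => z; rewrite scaleN1r opprB addrC subrK.
have HC := flow_C_norm (FF:=FF) GA tmT sHN cptU oA UA cH lX L0 HL Hc BN (or_intror EY).
have HCe : \forall N \near \oo, forall t : {t : R | 0 <= t <= T}, forall x,
  x = C_norm r U (fun z => flow X (sval t) z - flow (contact_field (HN N)) (sval t) z) -> x <= e := HC e e0.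
move: HCe; apply: filterS => N h t tI.
have [c1 c2] := flow_class sHN oA UA cH lX Hc (N, exist _ t tI).
by split=> //; exact: (h (exist _ t tI) _ erefl).
Qed.
End Limit.

Lemma error_triangle HN Psi (B C : R) p :
  (forall t, 0 <= t <= T ->
    [/\ class_C_near r U (flow X t), class_C_near r U (flow (contact_field HN) t) &
    C_norm r U (fun z => flow X t z - flow (contact_field HN) t z) <= B]) ->
  error_bound U T r HN Psi (fun h => C * h ^+ p) ->
  error_bound U T r H Psi (fun h => B + C * h ^+ p).
Proof.
move=> HB [h0 h00 He]; exists h0 => // h hI m mT.
have tI : 0 <= m%:R * h <= T by rewrite mT mulr_ge0 // ltW //; case/andP: hI.
have [cX cY cB] := HB _ tI; have [ce be] := He h hI m mT.
have cD : class_C_near r U (fun z => flow X (m%:R * h) z - flow (contact_field HN) (m%:R * h) z).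
  have [A1 [q1 U1 k1]] := class_C_near_CT fJ cX; have [A2 [q2 U2 k2]] := class_C_near_CT fJ cY.
  have q12 := openI q1 q2; apply: (CT_class_C_near q12); first by move=> z Uz; split; [exact: U1|exact: U2].
  exact: (CT_sub2 q12 (CT_sub (@subIsetl _ A1 A2) k1) (CT_sub (@subIsetr _ A1 A2) k2)).
have E : flow_error H Psi m h = (fun z => (flow X (m%:R * h) z - flow (contact_field HN) (m%:R * h) z) +
    flow_error HN Psi m h z) by apply/funext => z; rewrite /flow_error addrA subrK.
split; last by rewrite E; apply: le_trans (C_norm_add fJ cptU cD ce) _; exact: lerD.
have [A1 [q1 U1 k1]] := class_C_near_CT fJ cD; have [A2 [q2 U2 k2]] := class_C_near_CT fJ ce.
have q12 := openI q1 q2; apply: (CT_class_C_near q12); first by move=> z Uz; split; [exact: U1|exact: U2].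
by rewrite E; exact: (CT_add q12 (CT_sub (@subIsetl _ A1 A2) k1) (CT_sub (@subIsetr _ A1 A2) k2)).
Qed.
End Assembly.

Lemma small_power (R : realType) (C e : R) p : (0 < p)%N -> 0 < e ->
  exists2 h0 : R, 0 < h0 & forall h, 0 < h < h0 -> C * h ^+ p < e.
Proof.
move=> p0 e0; have c1 : 0 < `|C| + 1 by rewrite ltr_wpDl.
exists (Num.min 1 (e / (`|C| + 1))); first by rewrite lt_min ltr01 divr_gt0.
move=> h /andP[h0]; rewrite lt_min => /andP[h1 he].
have hp : h ^+ p <= h by rewrite -(prednK p0) exprS ler_piMr ?(ltW h0) // exprn_ile1 // ltW.
apply: (@le_lt_trans _ _ ((`|C| + 1) * h)); last by rewrite mulrC -ltr_pdivlMr.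
apply: (@le_trans _ _ ((`|C| + 1) * h ^+ p)); last by rewrite ler_pM2l.
by apply: ler_wpM2r; [rewrite exprn_ge0 // ltW|apply: le_trans (ler_norm C) _; rewrite lerDl].
Qed.

Theorem theorem4p4 (R : realType) (n r : nat) (T : R) (T_gt0 : 0 < T)
  (U U' : set (jet R n)) (cptU : compact U) (cptU' : compact U')
  (subU' : U' `<=` U)
  (H : ham R n) (H_reg : class_C_near r.+1 U H)
  (* needed for the flow of H to be well defined; automatic when 0 < r *)
  (H_lip : r = 0%N -> exists A, [/\ open A, U `<=` A &
             [lipschitz (contact_field H) z | z in A]])
  (H_conf : flow_confined (contact_field H) T U U') :
  (forall (N : nat) (HN : ham R n) (S : splitting R n),
     admissible_approx U U' T N HN S ->
     forall p : nat, (0 < p)%N ->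
     exists Psi Csplit, splitting_method U U' T r p HN S Psi Csplit)
  /\
  (forall L : R, exists2 Capprox : R, 0 < Capprox &
     (forall (N : nat) (HN : ham R n) (S : splitting R n),
        admissible_approx U U' T N HN S ->
        field_bounds r U L (contact_field HN) ->
        forall (p : nat) Psi Csplit, (0 < p)%N ->
        splitting_method U U' T r p HN S Psi Csplit ->
        error_bound U T r H Psi (fun h =>
          Capprox * C_norm r.+1 U (fun z => H z - HN z) + Csplit * h ^+ p))
     /\
     (forall (HN : nat -> ham R n) (S : nat -> splitting R n),
        (forall N, admissible_approx U U' T N (HN N) (S N)) ->
        (forall N, field_bounds r U L (contact_field (HN N))) ->
        (fun N => C_norm r.+1 U (fun z => H z - HN N z)) @ \oo --> (0 : R) ->
        forall (p : nat) (Psi : nat -> R -> jet R n -> jet R n)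
          (Csplit : nat -> R), (0 < p)%N ->
        (forall N, splitting_method U U' T r p (HN N) (S N) (Psi N) (Csplit N)) ->
        forall eps : R, 0 < eps ->
        exists2 N : nat,
          Capprox * C_norm r.+1 U (fun z => H z - HN N z) < eps / 2 &
        exists2 h0 : R, 0 < h0 & forall h, 0 < h < h0 ->
          Csplit N * h ^+ p < eps / 2 /\
          forall m : nat, m%:R * h <= T ->
            class_C_near r U (flow_error H (Psi N) m h) /\
            C_norm r U (flow_error H (Psi N) m h) < eps))
  /\
  (forall (HN : nat -> ham R n) (S : nat -> splitting R n),
     (forall N, admissible_approx U U' T N (HN N) (S N)) ->
     (fun N => C_norm r.+1 U (fun z => H z - HN N z)) @ \oo --> (0 : R) ->
     forall (p : nat) (Psi : nat -> R -> jet R n -> jet R n)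
       (Csplit : nat -> R), (0 < p)%N ->
     (forall N, splitting_method U U' T r p (HN N) (S N) (Psi N) (Csplit N)) ->
     forall eps : R, 0 < eps ->
     exists N : nat, exists2 h0 : R, 0 < h0 & forall h, 0 < h < h0 ->
       forall m : nat, m%:R * h <= T ->
         class_C_near r U (flow_error H (Psi N) m h) /\
         C_norm r U (flow_error H (Psi N) m h) < eps).
Proof.
have bound_of L := uniform_bound T_gt0 cptU subU' H_reg H_lip H_conf L.
split; last split.
- by move=> N HN S ad p p_gt0; exact: (part_one r T_gt0 cptU' p_gt0 ad).
- move=> L; have [C C0 HC] := bound_of L; exists C => //.
  have main N HN S p Psi Csplit : admissible_approx U U' T N HN S ->
      field_bounds r U L (contact_field HN) -> splitting_method U U' T r p HN S Psi Csplit ->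
      error_bound U T r H Psi (fun h =>
          C * C_norm r.+1 U (fun z => H z - HN z) + Csplit * h ^+ p).
    move=> ad fb [_ _ _ eb]; apply: (error_triangle cptU _ eb) => t tI.
    by apply: HC => //; exists N, S.
  split; first by move=> N HN S ad fb p Psi Csplit _ sm; exact: (main N HN S).
  move=> HN S ad fb cv p Psi Csplit p_gt0 sm eps eps_gt0.
  have e2 : 0 < eps / 2 by rewrite divr_gt0.
  have eC : 0 < eps / 2 / C by rewrite divr_gt0.
  have [N _ HN_small] : \forall N \near \oo, C_norm r.+1 U (fun z => H z - HN N z) < eps / 2 / C.
    have /cvgrPdist_lt/(_ _ eC) := cv; apply: filterS => N; rewrite sub0r normrN.
    exact/le_lt_trans/ler_norm.
  have small : C * C_norm r.+1 U (fun z => H z - HN N z) < eps / 2.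
    by rewrite mulrC -ltr_pdivlMr //; apply: HN_small => /=.
  exists N => //.
  have [h1 h1_gt0 Hsplit] := small_power (Csplit N) p_gt0 e2.
  have [h2 h2_gt0 Herr] := main N _ _ _ _ _ (ad N) (fb N) (sm N).
  exists (Num.min h1 h2); first by rewrite lt_min h1_gt0.
  move=> h /andP[h_gt0]; rewrite lt_min => /andP[hh1 hh2].
  have hs : Csplit N * h ^+ p < eps / 2 by apply: Hsplit; rewrite h_gt0.
  split=> // m mT; have [|cl le] := Herr h _ m mT; first by rewrite h_gt0.
  by split=> //; apply: le_lt_trans le _; rewrite (splitr eps) ltrD.
(* No uniform bound on the fields is assumed in this clause, so there is no constant to multiply
   eps_N; the limit form bounds the distance of the flows by eps / 2 directly. *)
- move=> HN S ad cv p Psi Csplit p_gt0 sm eps eps_gt0.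
  have e2 : 0 < eps / 2 by rewrite divr_gt0.
  have [N _ HN_small] := limit_bound T_gt0 cptU subU' H_reg H_lip H_conf ad cv e2; exists N.
  have [_ _ _ eb] := sm N.
  have [h1 h1_gt0 Hsplit] := small_power (Csplit N) p_gt0 e2.
  have [h2 h2_gt0 Herr] := error_triangle cptU (HN_small N (leqnn N)) eb.
  exists (Num.min h1 h2); first by rewrite lt_min h1_gt0.
  move=> h /andP[h_gt0]; rewrite lt_min => /andP[hh1 hh2] m mT.
  have [|cl le] := Herr h _ m mT; first by rewrite h_gt0.
  split=> //; apply: le_lt_trans le _; rewrite [ltRHS](splitr eps) ler_ltD //.
  by apply: Hsplit; rewrite h_gt0.
Qed.
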